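(* Let $M>0$ and $X,\bar X\in\mathcal{F}_{i,0}^{\alpha,M}$. Then for all $t\ge0$, $$d_M(t,X,\bar X)\le\hat C_{M,\alpha}(t)\,d_M(0,X,\bar X),$$ where $\hat C_{M,\alpha}(t)=e^{\frac12t}\tilde C_{M,\alpha}(t)e^{t\bar C_{M,\alpha}(t)}$ with $\tilde C_{M,\alpha}(t)=3+\frac32t+\frac12t^2+\frac3{16}t^3+\sqrt M(1+\frac14t+\frac14t^2+\frac1{16}t^3)+\|\alpha'\|_\infty\sqrt M(5+2t+t^2+\frac38t^3)+\|\alpha'\|_\infty M(3+\frac54t+\frac12t^2+\frac18t^3)$ and $\bar C_{M,\alpha}(t)=2+\|\alpha'\|_\infty\sqrt M+\sqrt M(\frac12+\frac18t+\frac1{16}t^2)+\|\alpha'\|_\infty M(1+\frac14t+\frac18t^2)$.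
   Context: Fix $\alpha\in W^{1,\infty}(\mathbb{R})$ with either $0\le\alpha(x)<1$ for all $x$, or $\alpha\equiv1$. $E_1=\{f\in L^\infty(\mathbb{R}): f'\in L^2,\ \lim_{x\to-\infty}f=0\}$, $E_2=\{f\in L^\infty: f'\in L^2\}$, norms $\|f\|_\infty+\|f'\|_2$; $B=E_2\times E_2\times E_1\times L^2(\mathbb{R})\times E_1$. $\mathcal{F}^\alpha$ is the set of $X=(y,U,H,r,V)$ with $(y-\mathrm{id},U,H,r,V)\in B$ and: (i) $y-\mathrm{id},U,H,V\in W^{1,\infty}$, $r\in L^\infty$; (ii) $y_\xi\ge0$, $H_\xi\ge0$, $y_\xi+H_\xi>c$ a.e. for some $c>0$; (iii) $y_\xi V_\xi=U_\xi^2+r^2$ a.e.; (iv) $0\le V_\xi\le H_\xi$ a.e.; (v) if $0\le\alpha<1$, there is $\kappa:\mathbb{R}\to(0,1]$ with $V_\xi=\kappa(y)H_\xi$ a.e. and $\kappa(y(\xi))=1$ whenever $U_\xi(\xi)<0$ or $r(\xi)\neq0$; (vi) if $\alpha\equiv1$, a.e. $y_\xi=0\Rightarrow V_\xi=0$ and $y_\xi>0\Rightarrow V_\xi=H_\xi$. $\mathcal{F}_i^\alpha=\{X\in\mathcal{F}^\alpha:V=H\}$, $\mathcal{F}_0^\alpha=\{X\in\mathcal{F}^\alpha: y+H=\mathrm{id}\}$, $\mathcal{F}^{\alpha,M}=\{X\in\mathcal{F}^\alpha:\|H\|_\infty\le M\}$, $\mathcal{F}_{i,0}^{\alpha,M}=\mathcal{F}_i^\alpha\cap\mathcal{F}_0^\alpha\cap\mathcal{F}^{\alpha,M}$.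 Flow: for $X_0=(y_0,U_0,H_0,r_0,V_0)\in\mathcal{F}_i^\alpha$, $\tau(\xi)=0$ if $y_{0,\xi}(\xi)=0$, $\tau(\xi)=-2U_{0,\xi}(\xi)/H_{0,\xi}(\xi)$ if $r_0(\xi)=0$ and $U_{0,\xi}(\xi)<0$, $\tau(\xi)=\infty$ otherwise. $S_t(X_0)$ is the value at time $t$ of the unique solution $X(t)=(y,U,H,r,V)(t)$, $X(0)=X_0$, of $y_t=U$, $U_t=\frac12V-\frac14\lim_{\xi\to\infty}V$, $H_t=0$, $r_t=0$, with $V(\xi,t)=\int_{-\infty}^\xi H_{0,\xi}(\eta)(1-\mathbf{1}_{\{t\ge\tau(\eta)\}}\alpha(y(\eta,\tau(\eta))))d\eta$. $G$ is the group of homeomorphisms $f$ of $\mathbb{R}$ with $f-\mathrm{id},f^{-1}-\mathrm{id}\in W^{1,\infty}$ and $f_\xi-1\in L^2$; $X\bullet f=(y\circ f,U\circ f,H\circ f,(r\circ f)f_\xi,V\circ f)$; $\Pi X=X\bullet(y+H)^{-1}$. For $X\in\mathcal{F}^\alpha$: $\Omega_c(X)=\{\xi:U_\xi\ge0\text{ or }r\ne0\}$, $\Omega_d(X)=\{\xi:U_\xi<0,\ r=0\}$, $H_\infty=\lim_{\xi\to\infty}H$; $g(X)=y_\xi+H_\xi-\alpha(y)H_\xi$ on $\Omega_d(X)$, $y_\xi+V_\xi$ on $\Omega_c(X)$; $g_2(X)=\|\alpha'\|_\infty H_\infty U_\xi$ on $\Omega_d(X)$, $0$ on $\Omega_c(X)$;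 $g_3(X)=\|\alpha'\|_\infty UU_\xi$ on $\Omega_d(X)$, $0$ on $\Omega_c(X)$. With $Z=(y_\xi,U_\xi,H_\xi,r)$, $\tilde d(X,\bar X)=\|y-\bar y\|_\infty+\|U-\bar U\|_\infty+\|\alpha'\|_\infty\|UH_\xi-\bar U\bar H_\xi\|_2+\|H_\xi-\bar H_\xi\|_1+\|Z-\bar Z\|_2+\|g(X)-g(\bar X)\|_2+\|g_2(X)-g_2(\bar X)\|_2+\|g_3(X)-g_3(\bar X)\|_2$. $J(X,\bar X)=\inf_{f,g\in G}(\tilde d(X\bullet f,\bar X)+\tilde d(X,\bar X\bullet g))$. For $X,\bar X\in\mathcal{F}_{i,0}^{\alpha,M}$, $d_M(t,X,\bar X)=\inf\sum_{n=1}^NJ(\Pi S_t(X_{n-1}),\Pi S_t(X_n))$, the infimum over finite sequences $X_0=X,\dots,X_N=\bar X$ in $\mathcal{F}_{i,0}^{\alpha,M}$. *)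

(* Defs.v *)
From HB Require Import structures.
From mathcomp Require Import all_boot all_order all_algebra.
From mathcomp Require Import all_classical all_reals all_analysis.
From mathcomp Require Import Rstruct Rstruct_topology.
From Stdlib Require Import ClassicalEpsilon.
Set Implicit Arguments. Unset Strict Implicit. Unset Printing Implicit Defensive.
Import Order.TTheory GRing.Theory Num.Theory numFieldNormedType.Exports.
Local Open Scope classical_set_scope.
Local Open Scope ring_scope.

Notation RR := Rdefinitions.R.
Notation leb := (@lebesgue_measure RR).

Definition Linf_norm (f : RR -> RR) : \bar RR := Lnorm leb +oo%E (EFin \o f).
Definition Lp_norm (p : RR) (f : RR -> RR) : \bar RR := Lnorm leb p%:E (EFin \o f).

Definition mfun (f : RR -> RR) : Prop :=
  measurable_fun (T := measurableTypeR RR) (U := measurableTypeR RR) setT f.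

Definition in_Linf (f : RR -> RR) : Prop :=
  mfun f /\ (Linf_norm f < +oo)%E.
Definition in_L2 (f : RR -> RR) : Prop :=
  mfun f /\ (Lp_norm 2%R f < +oo)%E.

(** Weak (= a.e., absolutely continuous) derivative on R:
    g is locally integrable and f(b) - f(a) = int_a^b g for all a <= b. *)
Definition is_wderiv (f g : RR -> RR) : Prop :=
  forall a b : RR, a <= b ->
    leb.-integrable `[a, b] (EFin \o g) /\
    (\int[leb]_(x in `[a, b]) (g x)%:E = (f b - f a)%:E)%E.

(* A chosen representative of the weak derivative f_xi (0 if none exists);
   it is determined almost everywhere. *)
Definition wderiv (f : RR -> RR) : RR -> RR :=
  epsilon (inhabits (fun _ => 0)) (is_wderiv f).

Definition in_E2 (f : RR -> RR) : Prop :=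
  in_Linf f /\ exists g, is_wderiv f g /\ in_L2 g.
Definition in_E1 (f : RR -> RR) : Prop :=
  in_E2 f /\ f x @[x --> -oo] --> (0 : RR).
Definition in_W1inf (f : RR -> RR) : Prop :=
  in_Linf f /\ exists g, is_wderiv f g /\ in_Linf g.

Record state := mkState {
  st_y : RR -> RR; st_U : RR -> RR; st_H : RR -> RR; st_r : RR -> RR; st_V : RR -> RR }.

Definition ae (P : RR -> Prop) : Prop := {ae leb, forall x, P x}.

Definition in_B (X : state) : Prop :=
  in_E2 (fun x => st_y X x - x) /\ in_E2 (st_U X) /\ in_E1 (st_H X) /\
  in_L2 (st_r X) /\ in_E1 (st_V X).

Definition in_F (alpha : RR -> RR) (X : state) : Prop :=
  let y := st_y X in let U := st_U X in let H := st_H X in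
  let r := st_r X in let V := st_V X in
  let yx := wderiv y in let Ux := wderiv U in let Hx := wderiv H in
  let Vx := wderiv V in
  in_B X /\
  in_W1inf (fun x => y x - x) /\ in_W1inf U /\ in_W1inf H /\ in_W1inf V /\
  in_Linf r /\
  (exists c : RR, 0 < c /\ ae (fun x => 0 <= yx x /\ 0 <= Hx x /\ c < yx x + Hx x)) /\
  ae (fun x => yx x * Vx x = Ux x ^+ 2 + r x ^+ 2) /\
  ae (fun x => 0 <= Vx x <= Hx x) /\
  ((forall x, 0 <= alpha x < 1) ->
     exists kappa : RR -> RR, (forall z, 0 < kappa z <= 1) /\
       ae (fun x => Vx x = kappa (y x) * Hx x) /\
       ae (fun x => (Ux x < 0 \/ r x <> 0) -> kappa (y x) = 1)) /\
  ((forall x, alpha x = 1) ->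
     ae (fun x => yx x = 0 -> Vx x = 0) /\ ae (fun x => 0 < yx x -> Vx x = Hx x)).

Definition in_Fi alpha X := in_F alpha X /\ st_V X = st_H X.
Definition in_F0 alpha X := in_F alpha X /\ forall x, st_y X x + st_H X x = x.
Definition in_FM alpha (M : RR) X := in_F alpha X /\ (Linf_norm (st_H X) <= M%:E)%E.
Definition in_Fi0M alpha M X := in_Fi alpha X /\ in_F0 alpha X /\ in_FM alpha M X.

Definition tau (X0 : state) (xi : RR) : \bar RR :=
  if wderiv (st_y X0) xi == 0 then 0%E
  else if (st_r X0 xi == 0) && (wderiv (st_U X0) xi < 0)
       then (- 2 * wderiv (st_U X0) xi / wderiv (st_H X0) xi)%:E
       else +oo%E.

Definition V_integrand (alpha : RR -> RR) (X0 : state) (Y : RR -> RR -> RR)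
  (t : RR) (eta : RR) : RR :=
  wderiv (st_H X0) eta *
  (1 - (if (t%:E >= tau X0 eta)%E then alpha (Y eta (fine (tau X0 eta))) else 0)).

Definition Vflow alpha X0 Y (xi t : RR) : RR :=
  (\int[leb]_(eta in `]-oo, xi]) V_integrand alpha X0 Y t eta)%R.
Definition Vflow_inf alpha X0 Y (t : RR) : RR :=
  (\int[leb]_(eta in setT) V_integrand alpha X0 Y t eta)%R.

(* (Y,Uf) is a solution for t >= 0 (integral form, Y(xi,t) = y(xi,t), Uf(xi,t) = U(xi,t)) of
   y_t = U, U_t = V/2 - V_oo/4, H_t = 0, r_t = 0, with X(0) = X0. *)
Definition is_flow (alpha : RR -> RR) (X0 : state) (Y Uf : RR -> RR -> RR) : Prop :=
  (forall t, 0 <= t -> mfun (V_integrand alpha X0 Y t)) /\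
  (forall xi t, 0 <= t ->
     Y xi t = st_y X0 xi + (\int[leb]_(s in `[0, t]) Uf xi s)%R /\
     Uf xi t = st_U X0 xi +
       (\int[leb]_(s in `[0, t]) (Vflow alpha X0 Y xi s / 2 - Vflow_inf alpha X0 Y s / 4))%R) /\
  (forall xi, {within `[0, +oo[, continuous (Y xi)} /\
              {within `[0, +oo[, continuous (Uf xi)}).

Definition flow_sol (alpha : RR -> RR) (X0 : state) : (RR -> RR -> RR) * (RR -> RR -> RR) :=
  epsilon (inhabits (fun _ _ => 0, fun _ _ => 0)) (fun p => is_flow alpha X0 p.1 p.2).

Definition S_t (alpha : RR -> RR) (t : RR) (X0 : state) : state :=
  let p := flow_sol alpha X0 in
  mkState (fun xi => p.1 xi t) (fun xi => p.2 xi t) (st_H X0) (st_r X0)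
          (fun xi => Vflow alpha X0 p.1 xi t).

Definition in_G (f : RR -> RR) : Prop :=
  exists g : RR -> RR, cancel f g /\ cancel g f /\ continuous f /\ continuous g /\
    in_W1inf (fun x => f x - x) /\ in_W1inf (fun x => g x - x) /\
    in_L2 (fun x => wderiv f x - 1).

Definition act (X : state) (f : RR -> RR) : state :=
  mkState (st_y X \o f) (st_U X \o f) (st_H X \o f)
          (fun x => st_r X (f x) * wderiv f x) (st_V X \o f).

Definition inverse_fun (f : RR -> RR) : RR -> RR :=
  fun x => epsilon (inhabits 0) (fun z => f z = x).

Definition Pi (X : state) : state := act X (inverse_fun (fun x => st_y X x + st_H X x)).

Definition alpha'_norm (alpha : RR -> RR) : RR := fine (Linf_norm (wderiv alpha)).

Definition Hinf (X : state) : RR := lim (st_H X x @[x --> +oo]).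

Definition in_Omega_d (X : state) (x : RR) : bool :=
  (wderiv (st_U X) x < 0) && (st_r X x == 0).

Definition g1 (alpha : RR -> RR) (X : state) (x : RR) : RR :=
  if in_Omega_d X x
  then wderiv (st_y X) x + wderiv (st_H X) x - alpha (st_y X x) * wderiv (st_H X) x
  else wderiv (st_y X) x + wderiv (st_V X) x.
Definition g2 (alpha : RR -> RR) (X : state) (x : RR) : RR :=
  if in_Omega_d X x then alpha'_norm alpha * Hinf X * wderiv (st_U X) x else 0.
Definition g3 (alpha : RR -> RR) (X : state) (x : RR) : RR :=
  if in_Omega_d X x then alpha'_norm alpha * st_U X x * wderiv (st_U X) x else 0.

Definition Zdiff (X Xb : state) (x : RR) : RR :=
  Num.sqrt ((wderiv (st_y X) x - wderiv (st_y Xb) x) ^+ 2 +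
            (wderiv (st_U X) x - wderiv (st_U Xb) x) ^+ 2 +
            (wderiv (st_H X) x - wderiv (st_H Xb) x) ^+ 2 +
            (st_r X x - st_r Xb x) ^+ 2).

Definition dtilde (alpha : RR -> RR) (X Xb : state) : \bar RR :=
  let n1 := Linf_norm (fun x => st_y X x - st_y Xb x) in
  let n2 := Linf_norm (fun x => st_U X x - st_U Xb x) in
  let n3 := Lp_norm 2 (fun x => st_U X x * wderiv (st_H X) x - st_U Xb x * wderiv (st_H Xb) x) in
  let n4 := Lp_norm 1 (fun x => wderiv (st_H X) x - wderiv (st_H Xb) x) in
  let n5 := Lp_norm 2 (Zdiff X Xb) in
  let n6 := Lp_norm 2 (fun x => g1 alpha X x - g1 alpha Xb x) in
  let n7 := Lp_norm 2 (fun x => g2 alpha X x - g2 alpha Xb x) in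
  let n8 := Lp_norm 2 (fun x => g3 alpha X x - g3 alpha Xb x) in
  (n1 + n2 + (alpha'_norm alpha)%:E * n3 + n4 + n5 + n6 + n7 + n8)%E.

Definition Jdist (alpha : RR -> RR) (X Xb : state) : \bar RR :=
  ereal_inf [set e | exists f g, in_G f /\ in_G g /\
                       e = (dtilde alpha (act X f) Xb + dtilde alpha X (act Xb g))%E].

Fixpoint chain_sum (alpha : RR -> RR) (t : RR) (X : state) (s : seq state) : \bar RR :=
  match s with
  | [::] => 0%E
  | Y :: s' => (Jdist alpha (Pi (S_t alpha t X)) (Pi (S_t alpha t Y)) +
                chain_sum alpha t Y s')%E
  end.

Definition d_M (alpha : RR -> RR) (M t : RR) (X Xb : state) : \bar RR :=
  ereal_inf [set e | exists s : seq state,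
     (forall Z, List.In Z s -> in_Fi0M alpha M Z) /\ last X s = Xb /\
     e = chain_sum alpha t X s].

Definition Ctilde (alpha : RR -> RR) (M t : RR) : RR :=
  let a := alpha'_norm alpha in
  3 + 3/2 * t + 1/2 * t^+2 + 3/16 * t^+3
  + Num.sqrt M * (1 + 1/4 * t + 1/4 * t^+2 + 1/16 * t^+3)
  + a * Num.sqrt M * (5 + 2 * t + t^+2 + 3/8 * t^+3)
  + a * M * (3 + 5/4 * t + 1/2 * t^+2 + 1/8 * t^+3).

Definition Cbar (alpha : RR -> RR) (M t : RR) : RR :=
  let a := alpha'_norm alpha in
  2 + a * Num.sqrt M + Num.sqrt M * (1/2 + 1/8 * t + 1/16 * t^+2)
  + a * M * (1 + 1/4 * t + 1/8 * t^+2).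

Definition Chat (alpha : RR -> RR) (M t : RR) : RR :=
  expR (t / 2) * Ctilde alpha M t * expR (t * Cbar alpha M t).

(* Main.v *)
Require Import Defs.
From HB Require Import structures.
From mathcomp Require Import all_boot all_order all_algebra.
From mathcomp Require Import all_classical all_reals all_analysis.
From mathcomp Require Import Rstruct Rstruct_topology.
From mathcomp Require Import measurable_realfun ess_sup_inf.
From mathcomp Require Import ring lra.
From Stdlib Require Import ClassicalEpsilon.
Set Implicit Arguments. Unset Strict Implicit. Unset Printing Implicit Defensive.
Import Order.TTheory GRing.Theory Num.Theory numFieldNormedType.Exports.
Local Open Scope classical_set_scope.
Local Open Scope ring_scope.

(** In a label shared by two solutions, the derivatives of [y] and [U] at time [t] and the
energy that survives are explicit functions of their initial values, of the breaking
time [tau] and of the single number [alpha (y tau)]. A breaking characteristic satisfies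
[H_xi * tau = - 2 * U_xi] and [y_xi * H_xi = U_xi ^ 2], so the terms in which the energy
jumps are controlled by the differences of [g], [g2] and [g3] at time 0. Distinct labels
interact only through [y], [U] and the total energy: since the second state satisfies
[y_xi + H_xi = 1], pointwise bounds turn into integrable ones, and Gronwall's inequality
closes the estimate for the supremum of [y - yb].

Both states reach a common label because the flow commutes with relabelling. If [k] and
[kb] are [y + H] for the two solutions at time [t], then [f] in the infimum at time 0 is
replaced by [k \o f \o kb^-1], which is again in [G]; the derivative of [kb^-1] is at most
[(1 + t / 2) ^ 2], so this relabelling costs a factor [1 + t / 2 <= expR (t / 2)] in
every term. The infimum over chains of states is then compared link by link. *)

(** * Pointwise comparison along characteristics *)

(** [flow_sol] and [wderiv] are choices by [epsilon], and this shapes the proof. A weak derivative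
    is known only almost everywhere, while the flow equations hold at every label, so pointwise
    estimates are stated under [aeL] and null sets are carried through every change of variables.
    Existence of the flow has to be proved. Once the density of lost energy is known the equations
    integrate explicitly, so this density is the only unknown; it is the fixed point of a map that
    contracts in a norm with an exponential weight in the breaking time. Every solution has the same
    explicit form, so the estimates apply to whichever one was chosen. The comparison is not
    symmetric: [y_xi + H_xi = 1] is asked of the second state only, which leaves the first one free
    to be relabelled by any [f]. The other half of the infimum follows by exchanging the states. In
    the constant, Gronwall's inequality contributes [exp (a * M * t ^ 2 / 8)]; the rest is
    polynomial and is absorbed through [(1 + x / 3) ^ 3 <= exp x] by comparing coefficients. *)

Ltac nneg := repeat first [assumption | exact: normr_ge0 | exact: sqr_ge0 | exact: ler0n
  | exact: ler01 | apply: addr_ge0 | apply: mulr_ge0 | apply: exprn_ge0 | rewrite invr_ge0 | by lra].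

Section pointwise.
Context {R : realFieldType}.
Implicit Types (x y z t a M U Ub H Hb : R).

Lemma norm_le x y : x <= y -> - x <= y -> `|x| <= y.
Proof. by move=> h1 h2; rewrite ler_norml lerNl h2. Qed.

Lemma norm_ge x : x <= `|x| /\ - x <= `|x|.
Proof. by rewrite ler_norm -normrN ler_norm. Qed.

Definition negp x : R := Num.min x 0.
Definition posp x : R := Num.max x 0.

Lemma negp_lip x y : `|negp x - negp y| <= `|x - y|.
Proof.
have [h1 h2] := norm_ge (x - y); have h3 := normr_ge0 (x - y).
by rewrite /negp /Order.min; apply: norm_le; case: ltP => ?; case: ltP => ?; lra.
Qed.

Lemma negp_bound x y : x <= 0 -> x <= y -> `|negp y| <= `|x|.
Proof.
have [h1 h2] := norm_ge x => x0 xy.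
by rewrite /negp /Order.min; apply: norm_le; case: ltP => ?; lra.
Qed.

Lemma posp_ge0 x : 0 <= posp x.
Proof. by rewrite /posp le_max lexx orbT. Qed.

Lemma posp_le x y : x <= y -> 0 <= y -> posp x <= y.
Proof. by move=> h1 h2; rewrite /posp ge_max h1. Qed.

(** [x - A * posp x] has slope [1] on the left of 0 and [1 - A] on the right, so it is 1-Lipschitz:
    a partial loss with a common coefficient never increases the distance between two slopes. *)
Lemma damped_mono A x y : 0 <= A <= 1 -> `|(x - A * posp x) - (y - A * posp y)| <= `|x - y|.
Proof.
move=> /andP[A0 A1]; have [h1 h2] := norm_ge (x - y); have h3 := normr_ge0 (x - y).
by rewrite /posp /Order.max; apply: norm_le; case: ltP => ?; case: ltP => ?; nra.
Qed.

Lemma mul_posp_lip A x y : 0 <= A <= 1 -> `|A * posp x - A * posp y| <= `|x - y|.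
Proof.
move=> /andP[A0 A1]; have [h1 h2] := norm_ge (x - y); have h3 := normr_ge0 (x - y).
by rewrite /posp /Order.max; apply: norm_le; case: ltP => ?; case: ltP => ?; nra.
Qed.

(* Both sides of a breaking time satisfy [H * tau = - 2 * U]; comparing truncated breaking times
   therefore only costs the differences of [U] and [H]. *)
Lemma cap_diff t H Hb U Ub tau taub :
  0 <= t -> 0 <= H -> 0 <= Hb -> 0 <= tau -> 0 <= taub ->
  H * tau = - 2 * U -> Hb * taub = - 2 * Ub ->
  Hb * `|Num.min t tau - Num.min t taub| <= 2 * `|U - Ub| + t * `|H - Hb|.
Proof.
move=> t0 H0 Hb0 tau0 taub0 e eb.
have [u1 u2] := norm_ge (U - Ub); have u3 := normr_ge0 (U - Ub).
have [h1 h2] := norm_ge (H - Hb); have h3 := normr_ge0 (H - Hb).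
rewrite -[X in X * _ <= _](ger0_norm Hb0) -normrM.
have k s : 0 <= s -> s <= t -> s * (H - Hb) <= t * `|H - Hb| /\ s * (Hb - H) <= t * `|H - Hb|.
  by move=> s0 st; split; nra.
rewrite /Order.min; case: ltP => c1; case: ltP => c2.
- by rewrite subrr mulr0 normr0; nra.
- have [k1 k2] := k t t0 (lexx t); have := ler_wpM2l H0 (ltW c1) => ?.
  have : Hb * taub <= Hb * t by exact: ler_wpM2l.
  by move=> ?; apply: norm_le; lra.
- have [k1 k2] := k tau tau0 c1; have := ler_wpM2l Hb0 (ltW c2) => ?.
  have : Hb * tau <= Hb * t by exact: ler_wpM2l.
  by move=> ?; apply: norm_le; lra.
- have [k1 k2] := k tau tau0 c1; have [k3 k4] := k taub taub0 c2.
  by apply: norm_le; lra.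
Qed.

(** This is [cap_diff] with [H] and [U] multiplied by [a * |U0|], which preserves the breaking
    relation. As [U <= 0 <= H], the weighted quantities are, up to sign, the absolute values of
    [a * U0 * U] and [a * U0 * H], and the reverse triangle inequality compares them. *)
Lemma cap_diff_weighted t a U0 Ub0 H Hb U Ub tau taub :
  0 <= t -> 0 <= a -> 0 <= H -> 0 <= Hb -> 0 <= tau -> 0 <= taub ->
  H * tau = - 2 * U -> Hb * taub = - 2 * Ub ->
  a * `|Ub0| * Hb * `|Num.min t tau - Num.min t taub| <=
  2 * `|a * U0 * U - a * Ub0 * Ub| + t * `|a * (U0 * H - Ub0 * Hb)|.
Proof.
move=> t0 a0 H0 Hb0 tau0 taub0 e eb.
have U0' : U <= 0 by nra.
have Ub0' : Ub <= 0 by nra.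
have := @cap_diff t (a * `|U0| * H) (a * `|Ub0| * Hb) (a * `|U0| * U) (a * `|Ub0| * Ub) tau taub t0.
move=> /(_ _ _ tau0 taub0 _ _)/le_trans; apply.
- by rewrite !mulr_ge0.
- by rewrite !mulr_ge0.
- by rewrite -mulrA e; ring.
- by rewrite -mulrA eb; ring.
have E x y : x <= 0 -> a * `|y| * x = - `|a * y * x|.
  by move=> x0; rewrite !normrM (ger0_norm a0) (ler0_norm x0); ring.
have E2 x y : 0 <= x -> a * `|y| * x = `|a * (y * x)|.
  by move=> x0; rewrite !normrM (ger0_norm a0) (ger0_norm x0); ring.
rewrite (E _ _ U0') (E _ _ Ub0') (E2 _ _ H0) (E2 _ _ Hb0); apply: lerD.
  by apply: ler_wpM2l => //; rewrite -opprD normrN; exact: ler_dist_dist.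
apply: ler_wpM2l => //; apply: le_trans (ler_dist_dist _ _) _.
by rewrite -mulrBr.
Qed.


(* The data of a solution along one characteristic: [lyx], [lUx], [lHx] are the
   derivatives at time 0, [lp s] is the position at time [s], [lD] tells whether
   the characteristic breaks, and [ltau] is the breaking time. *)
Record lag := Lag { lyx : R; lUx : R; lHx : R; lU0 : R; lHinf : R; ltau : R;
  lD : bool; lp : R -> R }.

Implicit Types (X Xb : lag) (alpha : R -> R) (s : R).

(** On a breaking characteristic this is [alpha] at the current position before breaking and at the
    breaking position afterwards. In this way [lag_v] covers both the term [(1 - alpha(y)) * H_xi]
    of [g] before breaking and the true [V_xi] after it. *)
Definition loss alpha X s : R := if lD X then alpha (lp X (Num.min s (ltau X))) else 0.
Definition free_slope X s : R := lUx X + s / 2 * lHx X.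
(** The free slope of a breaking characteristic vanishes at [tau], so it equals
    [H_xi * (s - tau) / 2], and the loss suffered after breaking is [alpha] times its positive
    part. *)
Definition slope alpha X s : R := free_slope X s - loss alpha X s * posp (free_slope X s).
(** The integral of [V_xi] over the times [[0, s]], with [H_xi * (s - tau)] again written as twice
    the free slope. *)
Definition energy_gain alpha X s : R := s * lHx X - 2 * (loss alpha X s * posp (free_slope X s)).
Definition lag_v alpha X s : R := (1 - loss alpha X s) * lHx X.
(** A breaking characteristic has negative slope only until it breaks, so the negative part of the
    free slope encodes both branches of [g2], and below of [g3], at time [s]. *)
Definition lag_g2 a X s : R := if lD X then a * lHinf X * negp (free_slope X s) else 0.
Definition lag_g3 a X s (u : R) : R := if lD X then a * u * negp (free_slope X s) else 0.

(** Two bounds on the motion are kept. From time 0 the velocity is [U0] up to [s * Hinf / 4], which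
    integrates to [s ^ 2 * Hinf / 8]; between two arbitrary times the cruder rate [|U0| + t * M / 4]
    is enough. *)
Definition lag_ok M t X : Prop :=
  [/\ 0 <= lyx X, 0 <= lHx X, 0 <= lHinf X <= M, 0 <= ltau X &
   [/\ (lD X -> lHx X * ltau X = - 2 * lUx X), (lD X -> lyx X = lHx X * ltau X ^+ 2 / 4),
    (forall s, 0 <= s <= t ->
       `|lp X s - lp X 0| <= s * `|lU0 X| + s ^+ 2 * lHinf X / 8) &
    (forall s s', 0 <= s <= t -> 0 <= s' <= t ->
       `|lp X s - lp X s'| <= `|s - s'| * (`|lU0 X| + t * M / 4))]].

Lemma loss_itv alpha X s : (forall z, 0 <= alpha z <= 1) -> 0 <= loss alpha X s <= 1.
Proof. by move=> h; rewrite /loss; case: ifP => // _; rewrite lexx ler01. Qed.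

Lemma lag_Ux_le0 M t X : lag_ok M t X -> lD X -> lUx X <= 0.
Proof. by move=> [_ H0 _ t0 [+ _ _ _]] D => /(_ D) e; nra. Qed.

Section two_lags.
Variables (alpha : R -> R) (a M t Ay W n4 : R) (X Xb : lag) (u ub : R).
Hypotheses (t0 : 0 <= t) (a0 : 0 <= a) (M0 : 0 <= M) (Ay0 : 0 <= Ay).
Hypothesis alpha01 : forall z, 0 <= alpha z <= 1.
Hypothesis alphaL : forall z z', `|alpha z - alpha z'| <= a * `|z - z'|.
Hypotheses (okX : lag_ok M t X) (okXb : lag_ok M t Xb).
Hypothesis close : forall s, 0 <= s <= t -> `|lp X s - lp Xb s| <= Ay.

Local Notation yx := (lyx X). Local Notation ybx := (lyx Xb).
Local Notation Ux := (lUx X). Local Notation Ubx := (lUx Xb).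
Local Notation H := (lHx X). Local Notation Hb := (lHx Xb).
Local Notation dy := (`|yx - ybx|).
Local Notation dU := (`|Ux - Ubx|).
Local Notation dH := (`|H - Hb|).
Local Notation d1 := (`|(yx + lag_v alpha X 0) - (ybx + lag_v alpha Xb 0)|).
Local Notation d2 := (`|lag_g2 a X 0 - lag_g2 a Xb 0|).
Local Notation d3 := (`|lag_g3 a X 0 (lU0 X) - lag_g3 a Xb 0 (lU0 Xb)|).
Local Notation k := (`|a * (lU0 X * H - lU0 Xb * Hb)|).
Local Notation sg := (2 * dU + t * dH).

(** [mixed_err] serves when exactly one characteristic breaks, [both_err] when both or neither do,
    and [err'] bounds both. The term [a * Hb * Ay], proportional to the distance of the positions,
    is kept apart because Gronwall's inequality has to absorb it. *)
Definition mixed_err : R := d1 + (2 * d3 + t / 4 * d2).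
Definition both_err : R := (2 * d3 + t * k) + a * t * M / 4 * sg.
Definition err' : R := d1 + t / 4 * d2 + 2 * d3 + t * k + a * t * M / 4 * sg.
Definition err : R := a * Hb * Ay + err'.

Lemma free0 Y : free_slope Y 0 = lUx Y.
Proof. by rewrite /free_slope mul0r mul0r addr0. Qed.

Lemma g2_at0 Y : lag_ok M t Y -> lag_g2 a Y 0 = if lD Y then a * lHinf Y * lUx Y else 0.
Proof.
move=> ok; rewrite /lag_g2 free0; case: ifP => // D.
by rewrite /negp; congr (_ * _); apply/min_idPl; exact: lag_Ux_le0 ok D.
Qed.

Lemma g3_at0 Y v : lag_ok M t Y -> lag_g3 a Y 0 v = if lD Y then a * v * lUx Y else 0.
Proof.
move=> ok; rewrite /lag_g3 free0; case: ifP => // D.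
by rewrite /negp; congr (_ * _); apply/min_idPl; exact: lag_Ux_le0 ok D.
Qed.

Lemma capt (s : R) : 0 <= s -> 0 <= Num.min t s <= t.
Proof. by move=> s0; rewrite le_min t0 s0/= ge_min lexx. Qed.

(** The two values of [alpha] are taken at different positions and different times. Passing through
    the second characteristic at the first time splits the difference into [Ay] and a displacement
    over the gap between the truncated breaking times; the factor [Hb] turns this gap into
    differences at time 0. *)
Lemma loss_diff_both : lD X -> lD Xb ->
  Hb * `|loss alpha X t - loss alpha Xb t| <= a * Hb * Ay + both_err.
Proof.
move=> D Db; have [_ H0 _ ta0 [/(_ D) e _ _ _]] := okX.
have [_ Hb0 _ tb0 [/(_ Db) eb _ _ pb]] := okXb.
rewrite /loss D Db.
set m := Num.min t (ltau X); set mb := Num.min t (ltau Xb).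
have mt : 0 <= m <= t by exact: capt.
have mbt : 0 <= mb <= t by exact: capt.
have h1 : `|lp X m - lp Xb mb| <= Ay + `|m - mb| * (`|lU0 Xb| + t * M / 4).
  rewrite (_ : _ - _ = (lp X m - lp Xb m) + (lp Xb m - lp Xb mb)); last by ring.
  by apply: le_trans (ler_normD _ _) _; apply: lerD; [exact: close|exact: pb].
have h2 := cap_diff t0 H0 Hb0 ta0 tb0 e eb; rewrite -/m -/mb in h2.
have h3 := cap_diff_weighted (lU0 X) (lU0 Xb) t0 a0 H0 Hb0 ta0 tb0 e eb; rewrite -/m -/mb in h3.
apply: (@le_trans _ _ (Hb * (a * (Ay + `|m - mb| * (`|lU0 Xb| + t * M / 4))))).
  by apply: ler_wpM2l => //; apply: le_trans (alphaL _ _) _; exact: ler_wpM2l.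
rewrite (_ : Hb * _ = a * Hb * Ay + a * `|lU0 Xb| * Hb * `|m - mb| + a * t * M / 4 * (Hb * `|m - mb|)); last by ring.
rewrite /both_err (g3_at0 _ okX) (g3_at0 _ okXb) D Db addrA; apply: lerD; first by rewrite lerD2l.
by apply: ler_wpM2l; [nneg|].
Qed.

(** Until it breaks, the characteristic moves by at most [m * |U0| + m ^ 2 * Hinf / 8], and
    [H * m <= - 2 * U] trades the time [m] for the slope. The resulting products [U0 * U] and
    [Hinf * U] are those of [g3] and [g2], which is why these two terms belong to the distance. *)
Lemma loss_change Y : lag_ok M t Y -> lD Y ->
  lHx Y * `|loss alpha Y 0 - loss alpha Y t| <=
  2 * `|lag_g3 a Y 0 (lU0 Y)| + t / 4 * `|lag_g2 a Y 0|.
Proof.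
move=> ok D; have [_ H0 /andP[Hi0 HiM] ta0 [/(_ D) e _ p0 _]] := ok.
rewrite (g3_at0 _ ok) (g2_at0 ok) /loss D (_ : Num.min 0 (ltau Y) = 0); last by apply/min_idPl.
set m := Num.min t (ltau Y).
have /andP[m0 mt] : 0 <= m <= t by exact: capt.
have mta : m <= ltau Y by rewrite /m ge_min lexx orbT.
have U0' := lag_Ux_le0 ok D.
apply: (@le_trans _ _ (lHx Y * (a * (m * `|lU0 Y| + m ^+ 2 * lHinf Y / 8)))).
  apply: ler_wpM2l => //; apply: le_trans (alphaL _ _) _; apply: ler_wpM2l => //.
  by rewrite distrC; apply: p0; rewrite m0.
have Hm : lHx Y * m <= - 2 * lUx Y by rewrite -e; exact: ler_wpM2l.
rewrite !normrM (ger0_norm a0) (ger0_norm Hi0) (ler0_norm U0').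
rewrite (_ : lHx Y * _ = (lHx Y * m) * (a * `|lU0 Y| + a * lHinf Y * m / 8)); last by ring.
apply: (@le_trans _ _ ((- 2 * lUx Y) * (a * `|lU0 Y| + a * lHinf Y * t / 8))); last by lra.
apply: ler_pM => //; [nneg|nneg|].
by rewrite lerD2l ler_pM2r ?invr_gt0// ler_wpM2l//; nneg.
Qed.

Lemma err'_ge0 : 0 <= err'.
Proof. by rewrite /err'; nneg. Qed.

Lemma errAy : 0 <= a * Hb * Ay.
Proof. by have [_ Hb0 _ _ _] := okXb; nneg. Qed.

Lemma both_err_le : both_err <= err'.
Proof. have h1 : 0 <= t / 4 * d2 by nneg.
by rewrite /err' /both_err; have := normr_ge0 (yx + lag_v alpha X 0 - (ybx + lag_v alpha Xb 0)); lra. Qed.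

(** On the side that does not break [g2] and [g3] vanish, so their differences control the full
    values on the other side. *)
Lemma g23_one Y Yb : lag_ok M t Y -> lag_ok M t Yb -> lD Y -> lD Yb = false ->
  2 * `|lag_g3 a Y 0 (lU0 Y)| + t / 4 * `|lag_g2 a Y 0| =
  2 * `|lag_g3 a Y 0 (lU0 Y) - lag_g3 a Yb 0 (lU0 Yb)| + t / 4 * `|lag_g2 a Y 0 - lag_g2 a Yb 0|.
Proof.
by move=> ok okb D Db; rewrite (g3_at0 _ okb) (g2_at0 okb) Db !subr0.
Qed.

Lemma loss_nD Y s : lD Y = false -> loss alpha Y s = 0.
Proof. by rewrite /loss => ->. Qed.

(** When only one of the two breaks, the comparison goes back to time 0, where [g] already contains
    [(1 - alpha(y)) * H_xi]. What remains is the variation of [alpha] along the breaking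
    characteristic. *)
Lemma v_mixed : lD X != lD Xb -> `|lag_v alpha X t - lag_v alpha Xb t| <= mixed_err + dy.
Proof.
move=> DD; have [_ H0 _ _ _] := okX; have [_ Hb0 _ _ _] := okXb.
have h : `|lag_v alpha X 0 - lag_v alpha Xb 0| <= d1 + dy.
  apply: le_trans (ler_normB _ _).
  by rewrite le_eqVlt; apply/orP; left; apply/eqP; congr `|_|; ring.
have [D|D] := boolP (lD X); move: DD; rewrite ?D ?(negbTE D) /= => Db.
- have {}Db : lD Xb = false by case: (lD Xb) Db.
  have := loss_change okX D; rewrite (g23_one okX okXb D Db) => c.
  rewrite (_ : _ - _ = (lag_v alpha X 0 - lag_v alpha Xb 0) +
     H * (loss alpha X 0 - loss alpha X t)); last by rewrite /lag_v !(loss_nD _ Db); ring.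
  apply: le_trans (ler_normD _ _) _; rewrite normrM (ger0_norm H0).
  by rewrite /mixed_err; lra.
- have {}Db : lD Xb by case: (lD Xb) Db.
  have Dx := negbTE D.
  have := loss_change okXb Db; rewrite (g23_one okXb okX Db Dx) => c.
  rewrite distrC (_ : _ - _ = (lag_v alpha Xb 0 - lag_v alpha X 0) +
     Hb * (loss alpha Xb 0 - loss alpha Xb t)); last by rewrite /lag_v !(loss_nD _ Dx); ring.
  apply: le_trans (ler_normD _ _) _; rewrite normrM (ger0_norm Hb0).
  move: h c; rewrite [`|lag_v alpha X 0 - _|]distrC [`|lag_g3 a Xb 0 _ - _|]distrC.
  rewrite [`|lag_g2 a Xb 0 - _|]distrC.
  by rewrite /mixed_err; lra.
Qed.

Lemma v_both : lD X = lD Xb -> `|lag_v alpha X t - lag_v alpha Xb t| <= dH + (a * Hb * Ay + both_err).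
Proof.
move=> DD; have [_ Hb0 _ _ _] := okXb; have /andP[l0 l1] := loss_itv X t alpha01.
rewrite (_ : _ - _ = (1 - loss alpha X t) * (H - Hb) - Hb * (loss alpha X t - loss alpha Xb t)); last first.
  by rewrite /lag_v; ring.
apply: le_trans (ler_normB _ _) _; rewrite !normrM (ger0_norm Hb0); apply: lerD.
  by rewrite ler_piMl// ger0_norm; lra.
have [D|D] := boolP (lD X); first by apply: loss_diff_both => //; rewrite -DD.
rewrite (loss_nD _ (negbTE D)) loss_nD -?DD ?(negbTE D)// subrr normr0 mulr0.
by rewrite addr_ge0 ?errAy// /both_err; nneg.
Qed.

Lemma free_diff : `|free_slope X t - free_slope Xb t| <= dU + t / 2 * dH.
Proof.
rewrite (_ : _ - _ = (Ux - Ubx) + t / 2 * (H - Hb)); last by rewrite /free_slope; ring.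
by apply: le_trans (ler_normD _ _) _; rewrite lerD2l normrM ger0_norm//; nneg.
Qed.

(* [t - e] is the time before breaking, capped at [t], and [e] the time elapsed since. *)
Lemma posp_free Y : lag_ok M t Y -> lD Y ->
  exists e, [/\ 0 <= e <= t, e * lHx Y = 2 * posp (free_slope Y t) & (t < ltau Y -> e = 0)].
Proof.
move=> [_ H0 _ ta0 [he _ _ _]] D; have e := he D.
have [tt|tt] := ltP t (ltau Y).
  exists 0; split=> //; first by rewrite lexx.
  rewrite mul0r /posp /Order.max /free_slope; case: ltP => // h; first by rewrite mulr0.
  by nra.
exists (t - ltau Y); split; [lra| |lra].
rewrite /posp /Order.max /free_slope; case: ltP => h; last by lra.
by nra.
Qed.

(** With [e] the time elapsed since breaking, the gain of the breaking side is
    [(t - e) * H + e * lag_v], while the other side gains at the constant rate [lag_v = H]. The two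
    stretches of time are compared separately. *)
Lemma energy_mixed : lD X != lD Xb ->
  `|energy_gain alpha X t - energy_gain alpha Xb t| <= t * dH + t * (mixed_err + dy).
Proof.
move=> DD; have vm := v_mixed DD.
have me0 : 0 <= mixed_err + dy by apply: le_trans vm.
have [D|D] := boolP (lD X); move: DD; rewrite ?D ?(negbTE D) /= => Db.
- have {}Db : lD Xb = false by case: (lD Xb) Db.
  have [e [/andP[e0 et] eE _]] := posp_free okX D.
  rewrite (_ : _ - _ = (t - e) * (H - Hb) + e * (lag_v alpha X t - lag_v alpha Xb t)); last first.
    rewrite /energy_gain /lag_v (loss_nD _ Db).
    rewrite (_ : 2 * (loss alpha X t * posp (free_slope X t)) =
       loss alpha X t * (2 * posp (free_slope X t))); last by ring.
    by rewrite -eE; ring.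
  apply: le_trans (ler_normD _ _) _; rewrite !normrM (ger0_norm e0) (ger0_norm (_ : 0 <= t - e)); last lra.
  by apply: lerD; apply: ler_pM => //; lra.
- have {}Db : lD Xb by case: (lD Xb) Db.
  have [e [/andP[e0 et] eE _]] := posp_free okXb Db.
  rewrite (_ : _ - _ = (t - e) * (H - Hb) + e * (lag_v alpha X t - lag_v alpha Xb t)); last first.
    rewrite /energy_gain /lag_v (loss_nD _ (negbTE D)).
    rewrite (_ : 2 * (loss alpha Xb t * posp (free_slope Xb t)) =
       loss alpha Xb t * (2 * posp (free_slope Xb t))); last by ring.
    by rewrite -eE; ring.
  apply: le_trans (ler_normD _ _) _; rewrite !normrM (ger0_norm e0) (ger0_norm (_ : 0 <= t - e)); last lra.
  by apply: lerD; apply: ler_pM => //; lra.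
Qed.

Lemma slope_energy Y : slope alpha Y t = lUx Y + energy_gain alpha Y t / 2.
Proof. by rewrite /slope /energy_gain /free_slope; field. Qed.

Lemma pfree_le Y : lag_ok M t Y -> lD Y -> 0 <= posp (free_slope Y t) <= t / 2 * lHx Y.
Proof.
move=> ok D; rewrite posp_ge0/=; have [_ H0 _ _ _] := ok.
apply: posp_le; last by nneg.
by rewrite /free_slope; have := lag_Ux_le0 ok D; lra.
Qed.

(** The loss coefficients are first made equal, where [damped_mono] applies. The change of
    coefficient multiplies a positive part of at most [t / 2 * Hb], which supplies the factor [Hb]
    that [loss_diff_both] needs. *)
Lemma slope_both : lD X = lD Xb ->
  `|slope alpha X t - slope alpha Xb t| <= dU + t / 2 * dH + t / 2 * (a * Hb * Ay + both_err).
Proof.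
move=> DD; rewrite /slope.
rewrite (_ : _ - _ = (free_slope X t - loss alpha X t * posp (free_slope X t) -
  (free_slope Xb t - loss alpha X t * posp (free_slope Xb t))) -
  (loss alpha X t - loss alpha Xb t) * posp (free_slope Xb t)); last by ring.
apply: le_trans (ler_normB _ _) _; apply: lerD.
  by apply: le_trans (damped_mono _ _ (loss_itv _ _ alpha01)) _; exact: free_diff.
have [D|D] := boolP (lD X); last first.
  rewrite (loss_nD _ (negbTE D)) loss_nD -?DD ?(negbTE D)// subrr mul0r normr0.
  by rewrite mulr_ge0// ?addr_ge0 ?errAy// /both_err; nneg.
have Db : lD Xb by rewrite -DD.
have /andP[p0 p1] := pfree_le okXb Db.
rewrite normrM (ger0_norm p0).
apply: (@le_trans _ _ (`|loss alpha X t - loss alpha Xb t| * (t / 2 * Hb))); first exact: ler_wpM2l.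
rewrite mulrCA [X in _ * X <= _]mulrC.
by apply: ler_wpM2l; [nneg|exact: loss_diff_both].
Qed.

Lemma slope_diff :
  `|slope alpha X t - slope alpha Xb t| <= dU + t / 2 * dH + t / 2 * (err + dy).
Proof.
have h0 : 0 <= t / 2 by nneg.
have [DD|DD] := eqVneq (lD X) (lD Xb).
  apply: le_trans (slope_both DD) _; rewrite lerD2l; apply: ler_wpM2l => //.
  by rewrite /err; have := both_err_le; have := normr_ge0 (yx - ybx); lra.
rewrite !slope_energy (_ : _ - _ = (Ux - Ubx) + (energy_gain alpha X t - energy_gain alpha Xb t) / 2); last by field.
apply: le_trans (ler_normD _ _) _; rewrite -[X in _ <= X]addrA lerD2l normrM [`|2^-1|]ger0_norm; last lra.
have := energy_mixed DD.
have : mixed_err + dy <= err + dy.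
  rewrite lerD2r /err /err' /mixed_err; have := errAy.
  have : 0 <= t * k by nneg.
  have : 0 <= a * t * M / 4 * sg by nneg.
  lra.
by nra.
Qed.

(** [yt] and [ybt] stand for [y_xi] at time [t] and are left arbitrary: only the difference of their
    increments enters. *)
Lemma g1_diff yt ybt : 
  `|(yt + lag_v alpha X t) - (ybt + lag_v alpha Xb t)| <=
  dy + dH + `|(yt - yx) - (ybt - ybx)| + err.
Proof.
set D0 := `|yt - yx - _|; have D00 : 0 <= D0 by exact: normr_ge0.
have [DD|DD] := eqVneq (lD X) (lD Xb).
  rewrite (_ : _ - _ = (yx - ybx) + ((yt - yx) - (ybt - ybx)) + (lag_v alpha X t - lag_v alpha Xb t)); last by ring.
  apply: le_trans (ler_normD _ _) _.
  have := ler_normD (yx - ybx) ((yt - yx) - (ybt - ybx)); rewrite -/D0.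
  by have := v_both DD; have := both_err_le; rewrite /err; lra.
have dy0 := normr_ge0 (yx - ybx); have dH0 := normr_ge0 (H - Hb); have e1 := err'_ge0; have e2 := errAy.
have k0 : 0 <= t * k by nneg.
have sg0 : 0 <= a * t * M / 4 * sg by nneg.
have [_ H0 _ _ _] := okX; have [_ Hb0 _ _ _] := okXb.
have [D|D] := boolP (lD X); move: DD; rewrite ?D ?(negbTE D) /= => Db.
- have {}Db : lD Xb = false by case: (lD Xb) Db.
  have := loss_change okX D; rewrite (g23_one okX okXb D Db) => c.
  rewrite (_ : _ - _ = ((yx + lag_v alpha X 0) - (ybx + lag_v alpha Xb 0)) +
    ((yt - yx) - (ybt - ybx)) + H * (loss alpha X 0 - loss alpha X t)); last first.
    by rewrite /lag_v !(loss_nD _ Db); ring.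
  have h1 := ler_normD (yx + lag_v alpha X 0 - (ybx + lag_v alpha Xb 0)) ((yt - yx) - (ybt - ybx)).
  rewrite -/D0 in h1.
  apply: le_trans (ler_normD _ _) _; rewrite normrM (ger0_norm H0).
  by rewrite /err /err'; lra.
- have {}Db : lD Xb by case: (lD Xb) Db.
  have Dx := negbTE D.
  have := loss_change okXb Db; rewrite (g23_one okXb okX Db Dx) => c.
  rewrite [`|lag_g3 a Xb 0 _ - _|]distrC [`|lag_g2 a Xb 0 - _|]distrC in c.
  rewrite (_ : _ - _ = ((yx + lag_v alpha X 0) - (ybx + lag_v alpha Xb 0)) +
    ((yt - yx) - (ybt - ybx)) - Hb * (loss alpha Xb 0 - loss alpha Xb t)); last first.
    by rewrite /lag_v !(loss_nD _ Dx); ring.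
  have h1 := ler_normD (yx + lag_v alpha X 0 - (ybx + lag_v alpha Xb 0)) ((yt - yx) - (ybt - ybx)).
  rewrite -/D0 in h1.
  apply: le_trans (ler_normB _ _) _; rewrite normrM (ger0_norm Hb0).
  by rewrite /err /err'; lra.
Qed.

Lemma g2_diff : `|lHinf X - lHinf Xb| <= n4 ->
  `|lag_g2 a X t - lag_g2 a Xb t| <= d2 + t / 2 * a * M * dH + t / 2 * a * Hb * n4.
Proof.
move=> h4; have [_ H0 /andP[Hi0 HiM] _ _] := okX; have [_ Hb0 /andP[Hbi0 HbiM] _ _] := okXb.
have n40 : 0 <= n4 by apply: le_trans h4.
have r0 : 0 <= t / 2 * a * M * dH + t / 2 * a * Hb * n4 by nneg.
have one Y : lag_ok M t Y -> lD Y -> `|lag_g2 a Y t| <= `|lag_g2 a Y 0|.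
  move=> ok D; rewrite (g2_at0 ok) /lag_g2 D !normrM; apply: ler_wpM2l; first by nneg.
  apply: negp_bound; first exact: lag_Ux_le0 ok D.
  by have [_ h _ _ _] := ok; rewrite /free_slope lerDl; nneg.
have [D|D] := boolP (lD X); have [Db|Db] := boolP (lD Xb).
- rewrite (g2_at0 okX) (g2_at0 okXb) /lag_g2 D Db.
  have sc (c x : R) : 0 <= c -> c * negp x = negp (c * x).
    by move=> c0; rewrite /negp minr_pMr// mulr0.
  rewrite !sc ?mulr_ge0//; apply: le_trans (negp_lip _ _) _.
  rewrite (_ : _ - _ = (a * lHinf X * Ux - a * lHinf Xb * Ubx) +
    t / 2 * a * (lHinf X * (H - Hb) + Hb * (lHinf X - lHinf Xb))); last by rewrite /free_slope; ring.
  apply: le_trans (ler_normD _ _) _; rewrite -addrA lerD2l normrM (ger0_norm (_ : 0 <= t / 2 * a)); last by nneg.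
  rewrite -!mulrA -!mulrDr; apply: ler_wpM2l; first by nneg.
  apply: ler_wpM2l; first by nneg.
  apply: ler_wpM2l; first by nneg.
  apply: le_trans (ler_normD _ _) _; rewrite !normrM (ger0_norm Hi0) (ger0_norm Hb0).
  by apply: lerD; [apply: ler_wpM2r|apply: ler_wpM2l].
- have := one X okX D; rewrite /lag_g2 (negbTE Db) !subr0; lra.
- have := one Xb okXb Db; rewrite /lag_g2 (negbTE D) !sub0r !normrN; lra.
- by rewrite /lag_g2 (negbTE D) (negbTE Db) subrr normr0; lra.
Qed.

(** If [U0] and [Ub0] have the same sign, they can be absorbed into [negp], which is positively
    homogeneous and 1-Lipschitz. If the signs differ, the two terms have opposite signs and both
    shrink towards 0 as the slopes grow, so the distance at time 0 bounds the later one. *)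
Lemma g3_main (U0 Ub0 : R) : Ux <= 0 -> Ubx <= 0 -> 0 <= H -> 0 <= Hb ->
  `|a * U0 * negp (free_slope X t) - a * Ub0 * negp (free_slope Xb t)| <=
  `|a * U0 * Ux - a * Ub0 * Ubx| + t / 2 * `|a * (U0 * H - Ub0 * Hb)|.
Proof.
move=> Ux0 Ubx0 H0 Hb0.
have nb Y : lUx Y <= 0 -> 0 <= lHx Y -> lUx Y <= negp (free_slope Y t) <= 0.
  by move=> h1 h2; rewrite /negp ge_min lexx orbT andbT le_min h1 andbT /free_slope lerDl; nneg.
have /andP[b1 b2] := nb X Ux0 H0; have /andP[b3 b4] := nb Xb Ubx0 Hb0.
have n0 : 0 <= t / 2 * `|a * (U0 * H - Ub0 * Hb)| by nneg.
have opp (V Vb : R) : 0 <= V -> Vb <= 0 ->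
  `|a * V * negp (free_slope X t) - a * Vb * negp (free_slope Xb t)| <= `|a * V * Ux - a * Vb * Ubx|.
  move=> V0 Vb0; have aV : 0 <= a * V by nneg.
  have aVb : a * Vb <= 0 by rewrite mulr_ge0_le0.
  rewrite !ler0_norm; [|nra|nra]; nra.
have same (V Vb : R) : 0 <= V -> 0 <= Vb ->
  `|a * V * negp (free_slope X t) - a * Vb * negp (free_slope Xb t)| <=
  `|a * V * Ux - a * Vb * Ubx| + t / 2 * `|a * (V * H - Vb * Hb)|.
  move=> V0 Vb0.
  have sc (c x : R) : 0 <= c -> c * negp x = negp (c * x).
    by move=> c0; rewrite /negp minr_pMr// mulr0.
  rewrite !sc ?mulr_ge0//; apply: le_trans (negp_lip _ _) _.
  rewrite (_ : _ - _ = (a * V * Ux - a * Vb * Ubx) + t / 2 * (a * (V * H - Vb * Hb))); last first.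
    by rewrite /free_slope; ring.
  by apply: le_trans (ler_normD _ _) _; rewrite lerD2l normrM ger0_norm//; nneg.
have [h|h] := leP 0 U0; have [hb|hb] := leP 0 Ub0.
- exact: same.
- by apply: le_trans (opp _ _ h (ltW hb)) _; rewrite lerDl.
- have := opp (- U0) (- Ub0); rewrite !oppr_ge0 !oppr_le0 => /(_ (ltW h) hb).
  rewrite !mulrN !mulNr -!opprD !normrN => /le_trans; apply.
  by rewrite lerDl.
- have := same (- U0) (- Ub0); rewrite !oppr_ge0 => /(_ (ltW h) (ltW hb)).
  by rewrite !mulrN !mulNr -!opprD !mulrN !normrN.
Qed.

Lemma g3_diff : `|u - lU0 X| <= t * lHinf X / 4 -> `|ub - lU0 Xb| <= t * lHinf Xb / 4 ->
  `|(u - lU0 X) - (ub - lU0 Xb)| <= W ->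
  `|lag_g3 a X t u - lag_g3 a Xb t ub| <=
  d3 + t / 2 * k + t / 4 * d2 + a * W * `|Ubx| + a * t * M / 8 * sg.
Proof.
move=> hw hwb hW; have [_ H0 /andP[Hi0 HiM] _ _] := okX; have [_ Hb0 /andP[Hbi0 HbiM] _ _] := okXb.
have W0 : 0 <= W by apply: le_trans hW.
have k0 : 0 <= t / 2 * k by nneg.
have d20 : 0 <= t / 4 * d2 by nneg.
have Wk : 0 <= a * W * `|Ubx| by nneg.
have s0 : 0 <= a * t * M / 8 * sg by nneg.
have one Y v : lag_ok M t Y -> lD Y -> `|v - lU0 Y| <= t * lHinf Y / 4 ->
    `|lag_g3 a Y t v| <= `|lag_g3 a Y 0 (lU0 Y)| + t / 4 * `|lag_g2 a Y 0|.
  move=> ok D hv; have [_ h0 /andP[i0 _] _ _] := ok.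
  rewrite (g3_at0 _ ok) (g2_at0 ok) /lag_g3 D.
  have hn : `|negp (free_slope Y t)| <= `|lUx Y|.
    apply: negp_bound; first exact: lag_Ux_le0 ok D.
    by rewrite /free_slope lerDl; nneg.
  have hv2 : `|v| <= `|lU0 Y| + t * lHinf Y / 4.
    rewrite (_ : v = lU0 Y + (v - lU0 Y)); last by ring.
    by apply: le_trans (ler_normD _ _) _; rewrite lerD2l.
  rewrite !normrM (ger0_norm a0) (ger0_norm i0).
  apply: (@le_trans _ _ (a * (`|lU0 Y| + t * lHinf Y / 4) * `|lUx Y|)); last by lra.
  apply: ler_pM => //; first by nneg.
  exact: ler_wpM2l.
have [D|D] := boolP (lD X); have [Db|Db] := boolP (lD Xb).
- rewrite (g3_at0 _ okX) (g3_at0 _ okXb) /lag_g3 D Db.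
  have Ux0 := lag_Ux_le0 okX D; have Ubx0 := lag_Ux_le0 okXb Db.
  have h1 := g3_main (lU0 X) (lU0 Xb) Ux0 Ubx0 H0 Hb0.
  (* Each velocity is its initial value plus its change. The first change is at most [t * M / 4],
     and the two changes differ by at most [W]. *)
  rewrite (_ : _ - _ = (a * lU0 X * negp (free_slope X t) - a * lU0 Xb * negp (free_slope Xb t)) +
    (a * (u - lU0 X) * (negp (free_slope X t) - negp (free_slope Xb t)) +
     a * ((u - lU0 X) - (ub - lU0 Xb)) * negp (free_slope Xb t))); last by ring.
  apply: le_trans (ler_normD _ _) _.
  have h2 : `|a * (u - lU0 X) * (negp (free_slope X t) - negp (free_slope Xb t))| <= a * t * M / 8 * sg.
    rewrite !normrM (ger0_norm a0).
    apply: (@le_trans _ _ (a * (t * M / 4) * (dU + t / 2 * dH))); last by lra.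
    apply: ler_pM => //; first by nneg.
      apply: ler_wpM2l => //; apply: le_trans hw _.
      by apply: ler_wpM2r; [lra|exact: ler_wpM2l].
    exact: le_trans (negp_lip _ _) free_diff.
  have h3 : `|a * ((u - lU0 X) - (ub - lU0 Xb)) * negp (free_slope Xb t)| <= a * W * `|Ubx|.
    rewrite !normrM (ger0_norm a0); apply: ler_pM => //; first by nneg.
      exact: ler_wpM2l.
    by apply: negp_bound => //; rewrite /free_slope lerDl; nneg.
  by have := ler_normD (a * (u - lU0 X) * (negp (free_slope X t) - negp (free_slope Xb t)))
    (a * ((u - lU0 X) - (ub - lU0 Xb)) * negp (free_slope Xb t)); lra.
- by have := one X u okX D hw; rewrite /lag_g2 /lag_g3 (negbTE Db) !subr0; lra.
- by have := one Xb ub okXb Db hwb; rewrite /lag_g2 /lag_g3 (negbTE D) !sub0r !normrN; lra.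
- by rewrite {1 2}/lag_g3 (negbTE D) (negbTE Db) subrr normr0; have := normr_ge0 (lag_g3 a X 0 (lU0 X) - lag_g3 a Xb 0 (lU0 Xb)); lra.
Qed.

Lemma n3_diff : `|u - lU0 X| <= t * lHinf X / 4 -> `|(u - lU0 X) - (ub - lU0 Xb)| <= W ->
  `|a * (u * H - ub * Hb)| <= k + a * W * Hb + a * t * M / 4 * dH.
Proof.
move=> hw hW; have [_ H0 /andP[Hi0 HiM] _ _] := okX; have [_ Hb0 _ _ _] := okXb.
rewrite (_ : _ * _ = a * (lU0 X * H - lU0 Xb * Hb) + (a * ((u - lU0 X) - (ub - lU0 Xb)) * Hb +
  a * (u - lU0 X) * (H - Hb))); last by ring.
apply: le_trans (ler_normD _ _) _; rewrite -[X in _ <= X]addrA lerD2l; apply: le_trans (ler_normD _ _) _.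
rewrite !normrM (ger0_norm a0) (ger0_norm Hb0); apply: lerD.
  by apply: ler_wpM2r => //; exact: ler_wpM2l.
apply: ler_wpM2r => //; rewrite -!mulrA; apply: ler_wpM2l => //; apply: le_trans hw _.
by rewrite -mulrA; apply: ler_wpM2l => //; rewrite ler_wpM2r//; lra.
Qed.

(* The weight [1 = lyx Xb + lHx Xb] turns pointwise bounds into bounds carrying a factor
   [Hb], which is square integrable: before breaking there is nothing to weigh, and at a
   breaking characteristic [lyx] is controlled by [lHx]. *)
Lemma energy_diff : lyx Xb + lHx Xb = 1 ->
  `|energy_gain alpha X t - energy_gain alpha Xb t| / 2 <=
  (t + t ^+ 3 / 8) * dH + t / 2 * (a * Hb * Ay) + t / 2 * Hb * dy +
  (1 + t ^+ 2 / 4) * Hb * (dU + t / 2 * (err' + dy)).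
Proof.
move=> one; have [y0 H0 _ ta0 [hH hy _ _]] := okX; have [yb0 Hb0 _ tab0 [hHb hyb _ _]] := okXb.
have e0 := err'_ge0.
set E := `|energy_gain _ _ _ - _|; have E0 : 0 <= E by exact: normr_ge0.
have lam0 := errAy; set lam := a * Hb * Ay; rewrite -/lam in lam0.
pose G := dU + t / 2 * (err' + dy).
have dy0 : 0 <= dy by []. have dH0 : 0 <= dH by []. have dU0 : 0 <= dU by [].
have G0 : 0 <= G by rewrite /G; nneg.
have tl0 : 0 <= t / 2 * lam by nneg.
have tH0 : 0 <= t * dH by nneg.
have EG : E / 2 <= t * dH + t / 2 * lam + G.
  have [DD|DD] := eqVneq (lD X) (lD Xb); last first.
    have := energy_mixed DD; rewrite -/E.
    have : mixed_err + dy <= err' + dy.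
      rewrite lerD2r /err' /mixed_err.
      have : 0 <= t * k by nneg.
      have : 0 <= a * t * M / 4 * sg by nneg.
      lra.
    by move=> /(ler_wpM2l (t0 : 0 <= t)) ? ?; rewrite /G; lra.
  have be := both_err_le.
  rewrite -[X in E / X](ger0_norm (ler0n _ 2)) -normf_div.
  rewrite (_ : _ / 2 = t / 2 * (H - Hb) - ((loss alpha X t * posp (free_slope X t) -
     loss alpha X t * posp (free_slope Xb t)) +
     (loss alpha X t - loss alpha Xb t) * posp (free_slope Xb t))); last first.
    by rewrite /energy_gain; field.
  apply: le_trans (ler_normB _ _) _.
  rewrite normrM (ger0_norm (_ : 0 <= t / 2)); last by nneg.
  have h1 := le_trans (mul_posp_lip (free_slope X t) (free_slope Xb t) (loss_itv X t alpha01)) free_diff.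
  have h2 : `|(loss alpha X t - loss alpha Xb t) * posp (free_slope Xb t)| <= t / 2 * (lam + both_err).
    have be0 : 0 <= both_err by rewrite /both_err; nneg.
    have [D|D] := boolP (lD X); last first.
      rewrite (loss_nD _ (negbTE D)) loss_nD -?DD ?(negbTE D)// subrr mul0r normr0.
      by nneg.
    have Db : lD Xb by rewrite -DD.
    have /andP[p0 p1] := pfree_le okXb Db.
    rewrite normrM (ger0_norm p0); apply: le_trans (ler_wpM2l _ p1) _ => //.
    rewrite mulrCA [X in _ * X <= _]mulrC.
    by apply: ler_wpM2l; [nneg|exact: loss_diff_both].
  have h3 : t / 2 * (lam + both_err) <= t / 2 * lam + t / 2 * (err' + dy).
    by rewrite -mulrDr; apply: ler_wpM2l; [nneg|lra].
  by apply: le_trans (lerD (lexx _) (ler_normD _ _)) _; rewrite /G; lra.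
have EH : E / 2 <= t / 2 * (dH + Hb).
  have en Y : lag_ok M t Y -> 0 <= energy_gain alpha Y t <= t * lHx Y.
    move=> ok; have [_ h0 _ _ _] := ok; have /andP[l0 l1] := loss_itv Y t alpha01.
    have [D|D] := boolP (lD Y); last first.
      by rewrite /energy_gain (loss_nD _ (negbTE D)) mul0r mulr0 subr0 lexx andbT; nneg.
    have /andP[p0 p1] := pfree_le ok D; rewrite /energy_gain; apply/andP; split; nra.
  have /andP[a1 a2] := en X okX; have /andP[b1 b2] := en Xb okXb.
  have [h1 h2] := norm_ge (H - Hb).
  have h3 : t * H <= t * (dH + Hb) by apply: ler_wpM2l => //; lra.
  have : E <= t * (dH + Hb) by apply: norm_le; lra.
  lra.
have [small|big] := leP (E / 2) (t * dH + t / 2 * lam).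
  apply: le_trans small _.
  have : 0 <= t ^+ 3 / 8 * dH by nneg.
  have : 0 <= t / 2 * Hb * dy by nneg.
  have : 0 <= (1 + t ^+ 2 / 4) * Hb * G by nneg.
  by rewrite /G; lra.
(* [rho] is the part of the bound that still lacks a factor [Hb]. By [EG] it is at most [G], and by
   [EH] at most [t / 2 * Hb]. The weight 1 is dominated by multiples of [Hb], [dy] and [dH]; the
   first bound is used on the multiple of [Hb], the second on the other two. *)
pose rho := E / 2 - (t * dH + t / 2 * lam).
have rho0 : 0 <= rho by rewrite /rho; lra.
have rhoG : rho <= G by rewrite /rho; lra.
have rhoH : rho <= t / 2 * Hb by rewrite /rho; lra.
have Hb1 : Hb <= 1 by lra.
suff : rho <= t ^+ 3 / 8 * dH + t / 2 * Hb * dy + (1 + t ^+ 2 / 4) * Hb * G.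
  by rewrite /rho /G; lra.
have GHb : rho * ((1 + t ^+ 2 / 4) * Hb) <= (1 + t ^+ 2 / 4) * Hb * G.
  by rewrite mulrC; apply: ler_wpM2l => //; nneg.
have sq (s : R) : 0 <= s -> s <= t -> s ^+ 2 / 4 <= t ^+ 2 / 4.
  by move=> s0 st; apply: ler_wpM2r; [lra|rewrite lerXn2r// nnegrE].
have [/andP[Db tb]|nb] := boolP (lD Xb && (ltau Xb <= t)).
  have : lyx Xb <= t ^+ 2 / 4 * Hb.
    by rewrite hyb// -mulrA mulrC; apply: ler_wpM2r => //; exact: sq.
  move=> yb1.
  have : rho <= rho * ((1 + t ^+ 2 / 4) * Hb) by rewrite ler_peMr//; lra.
  have : 0 <= t ^+ 3 / 8 * dH by nneg.
  have : 0 <= t / 2 * Hb * dy by nneg.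
  by lra.
have [/andP[D ta]|na] := boolP (lD X && (ltau X <= t)).
  have y1 : lyx X <= t ^+ 2 / 4 * H.
    by rewrite hy// -mulrA mulrC; apply: ler_wpM2r => //; exact: sq.
  have [h1 h2] := norm_ge (H - Hb); have [h3 h4] := norm_ge (yx - ybx).
  have t20 : 0 <= t ^+ 2 / 4 by nneg.
  have w1 : 1 <= dy + t ^+ 2 / 4 * dH + (1 + t ^+ 2 / 4) * Hb.
    have : t ^+ 2 / 4 * H <= t ^+ 2 / 4 * (dH + Hb) by apply: ler_wpM2l => //; lra.
    by lra.
  have : rho <= rho * (dy + t ^+ 2 / 4 * dH + (1 + t ^+ 2 / 4) * Hb) by rewrite ler_peMr.
  have r1 : rho * dy <= t / 2 * Hb * dy by exact: ler_wpM2r.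
  have r2 : rho * (t ^+ 2 / 4 * dH) <= t / 2 * Hb * (t ^+ 2 / 4 * dH) by apply: ler_wpM2r => //; nneg.
  have r3 : t / 2 * Hb * (t ^+ 2 / 4 * dH) <= t ^+ 3 / 8 * dH.
    rewrite (_ : _ * _ = Hb * (t ^+ 3 / 8 * dH)); last by field.
    by rewrite ler_piMl//; nneg.
  by lra.
(* Neither characteristic has broken by time [t], so the gains are [t * H] and [t * Hb], and [E / 2]
   cannot exceed the threshold in [big]. *)
exfalso.
have en Y : lag_ok M t Y -> ~~ (lD Y && (ltau Y <= t)) -> energy_gain alpha Y t = t * lHx Y.
  move=> ok; have [D|D _] := boolP (lD Y); last first.
    by rewrite /energy_gain (loss_nD _ (negbTE D)) mul0r mulr0 subr0.
  rewrite /= -ltNge => tt; have [e [_ eE /(_ tt) e00]] := posp_free ok D.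
  rewrite /energy_gain mulrCA -eE e00; ring.
move: big; rewrite /E (en X)// (en Xb)// -mulrBr normrM (ger0_norm t0); lra.
Qed.

End two_lags.
End pointwise.

(** * Polynomial inequalities for the growth constant *)

Ltac syntactic_nneg := lazymatch goal with
  | |- is_true (_ <= GRing.add _ _) => apply: addr_ge0; syntactic_nneg
  | |- is_true (_ <= GRing.mul _ _) => apply: mulr_ge0; syntactic_nneg
  | |- is_true (_ <= GRing.exp _ _) => apply: exprn_ge0; syntactic_nneg
  | |- is_true (_ <= GRing.inv _) => rewrite invr_ge0; syntactic_nneg
  | |- _ => first [assumption | exact: ler0n | exact: ler01]
  end.
Section growth_polynomial.
Context {R : realFieldType}.
Variables (u a m : R).
Hypotheses (u0 : 0 <= u) (a0 : 0 <= a) (m0 : 0 <= m).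

(** With [u = T / 2] and [m = sqrt M], a selection of the monomials of [Ctilde] that is large enough
    for [envelope_le]. *)
Definition cpoly_part : R := 3 + 2 * u ^+ 2 + 3 / 2 * u ^+ 3 + m * (1 + u ^+ 2) +
  a * m * (5 + 3 * u ^+ 3) + 3 * a * m ^+ 2.

(** A part of [T * Cbar] at [T = 2 * u]. In the term with [a * m ^ 2], the coefficient [u / 4]
    instead of [u / 2] leaves out exactly [a * M * T ^ 2 / 8], the exponent of the Gronwall factor
    [expo]. *)
Definition xpoly_part : R := 2 * u * (2 + a * m ^+ 2 * (1 + u / 4 + u ^+ 2 / 2)).

(** A common majorant, monomial by monomial, of the eight coefficients that [n1], ..., [n8] receive
    in [envelope_sum]. *)
Definition envelope : R :=
  3 + 1 / 2 * m + a * m + a * m ^+ 2 + u * (6 + 2 * m + 3 * a * m + 6 * a * m ^+ 2 + a ^+ 2 * m ^+ 3) +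
  u ^+ 2 * (8 + 5 / 2 * m + 4 * a * m + 13 / 2 * a * m ^+ 2 + a * m ^+ 3 + 2 * a ^+ 2 * m ^+ 3 +
  2 * a ^+ 2 * m ^+ 4) + u ^+ 3 * (8 + 2 * m + 8 * a * m + 13 * a * m ^+ 2 + 5 / 2 * a * m ^+ 3 +
  2 * a ^+ 2 * m ^+ 3 + 4 * a ^+ 2 * m ^+ 4) + u ^+ 4 * (1 + 2 * m + 9 * a * m + 14 * a * m ^+ 2 +
  2 * a * m ^+ 3 + 4 * a ^+ 2 * m ^+ 4 + 1 / 2 * a ^+ 2 * m ^+ 5 + a ^+ 3 * m ^+ 6) + u ^+ 5 * (2 * m +
  a * m + 10 * a * m ^+ 2 + 2 * a * m ^+ 3 + a ^+ 2 * m ^+ 3 + 8 * a ^+ 2 * m ^+ 4 +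
  1 / 2 * a ^+ 2 * m ^+ 5 + a ^+ 3 * m ^+ 6) + u ^+ 6 * (4 * a * m + 8 * a * m ^+ 2 + a * m ^+ 3 +
  6 * a ^+ 2 * m ^+ 4 + 1 / 2 * a ^+ 2 * m ^+ 5 + a ^+ 3 * m ^+ 6) + u ^+ 7 * (8 * a * m ^+ 2 +
  5 * a ^+ 2 * m ^+ 4 + 1 / 2 * a ^+ 2 * m ^+ 5 + a ^+ 3 * m ^+ 6) + u ^+ 8 * (4 * a ^+ 2 * m ^+ 4).

(** The difference expands into a polynomial with nonnegative coefficients. The cube is the lower
    bound for the exponential given by [expR_ge_cube]. *)
Lemma envelope_le : envelope <= cpoly_part * (1 + xpoly_part / 3) ^+ 3.
Proof.
rewrite -subr_ge0 (_ : _ - _ =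
  1 / 2 * m + 4 * a * m + 2 * a * m ^+ 2 + u * (6 + 2 * m + 17 * a * m + 12 * a * m ^+ 2 +
  2 * a * m ^+ 3 + 9 * a ^+ 2 * m ^+ 3 + 6 * a ^+ 2 * m ^+ 4) + u ^+ 2 * (10 + 23 / 6 * m +
  68 / 3 * a * m + 27 * a * m ^+ 2 + 29 / 6 * a * m ^+ 3 + 163 / 6 * a ^+ 2 * m ^+ 3 +
  39 / 2 * a ^+ 2 * m ^+ 4 + 4 / 3 * a ^+ 2 * m ^+ 5 + 20 / 3 * a ^+ 3 * m ^+ 5 +
  4 * a ^+ 3 * m ^+ 6) + u ^+ 3 * (155 / 18 + 118 / 27 * m + 185 / 27 * a * m + 142 / 9 * a * m ^+ 2 +
  97 / 18 * a * m ^+ 3 + 247 / 9 * a ^+ 2 * m ^+ 3 + 21 * a ^+ 2 * m ^+ 4 + 22 / 9 * a ^+ 2 * m ^+ 5 +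
  110 / 9 * a ^+ 3 * m ^+ 5 + 74 / 9 * a ^+ 3 * m ^+ 6 + 8 / 27 * a ^+ 3 * m ^+ 7 +
  40 / 27 * a ^+ 4 * m ^+ 7 + 8 / 9 * a ^+ 4 * m ^+ 8) + u ^+ 4 * (47 / 3 + 10 / 3 * m + 3 * a * m +
  34 / 3 * a * m ^+ 2 + 133 / 18 * a * m ^+ 3 + 214 / 9 * a ^+ 2 * m ^+ 3 + 65 / 4 * a ^+ 2 * m ^+ 4 +
  113 / 36 * a ^+ 2 * m ^+ 5 + 415 / 36 * a ^+ 3 * m ^+ 5 + 79 / 12 * a ^+ 3 * m ^+ 6 +
  2 / 9 * a ^+ 3 * m ^+ 7 + 10 / 9 * a ^+ 4 * m ^+ 7 + 2 / 3 * a ^+ 4 * m ^+ 8) + u ^+ 5 * (344 / 27 +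
  10 / 27 * m + 15 * a * m + 571 / 36 * a * m ^+ 2 + 17 / 3 * a * m ^+ 3 + 457 / 18 * a ^+ 2 * m ^+ 3 +
  98 / 9 * a ^+ 2 * m ^+ 4 + 25 / 6 * a ^+ 2 * m ^+ 5 + 136 / 9 * a ^+ 3 * m ^+ 5 +
  419 / 54 * a ^+ 3 * m ^+ 6 + 43 / 54 * a ^+ 3 * m ^+ 7 + 5 / 2 * a ^+ 4 * m ^+ 7 +
  3 / 2 * a ^+ 4 * m ^+ 8) + u ^+ 6 * (32 / 9 + 28 / 9 * a * m + 143 / 18 * a * m ^+ 2 +
  23 / 9 * a * m ^+ 3 + 53 / 3 * a ^+ 2 * m ^+ 3 + 83 / 18 * a ^+ 2 * m ^+ 4 +
  31 / 12 * a ^+ 2 * m ^+ 5 + 101 / 9 * a ^+ 3 * m ^+ 5 + 209 / 72 * a ^+ 3 * m ^+ 6 +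
  97 / 216 * a ^+ 3 * m ^+ 7 + 437 / 216 * a ^+ 4 * m ^+ 7 + 49 / 72 * a ^+ 4 * m ^+ 8) +
  u ^+ 7 * (8 / 9 * a * m ^+ 2 + 16 / 9 * a * m ^+ 3 + 32 / 3 * a ^+ 2 * m ^+ 3 +
  305 / 72 * a ^+ 2 * m ^+ 4 + 13 / 6 * a ^+ 2 * m ^+ 5 + 329 / 36 * a ^+ 3 * m ^+ 5 +
  29 / 12 * a ^+ 3 * m ^+ 6 + 3 / 4 * a ^+ 3 * m ^+ 7 + 23 / 12 * a ^+ 4 * m ^+ 7 +
  3 / 4 * a ^+ 4 * m ^+ 8) + u ^+ 8 * (8 / 3 * a * m ^+ 2 + 16 / 3 * a ^+ 2 * m ^+ 3 +
  8 / 9 * a ^+ 2 * m ^+ 4 + 7 / 9 * a ^+ 2 * m ^+ 5 + 20 / 3 * a ^+ 3 * m ^+ 5 +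
  37 / 27 * a ^+ 3 * m ^+ 6 + 61 / 216 * a ^+ 3 * m ^+ 7 + 16 / 9 * a ^+ 4 * m ^+ 7 +
  1 / 6 * a ^+ 4 * m ^+ 8) + u ^+ 9 * (37 / 18 * a ^+ 2 * m ^+ 4 + 4 / 9 * a ^+ 2 * m ^+ 5 +
  7 / 3 * a ^+ 3 * m ^+ 5 + 137 / 144 * a ^+ 3 * m ^+ 6 + 31 / 108 * a ^+ 3 * m ^+ 7 +
  187 / 216 * a ^+ 4 * m ^+ 7 + 1 / 9 * a ^+ 4 * m ^+ 8) + u ^+ 10 * (2 / 3 * a ^+ 2 * m ^+ 4 +
  4 / 3 * a ^+ 3 * m ^+ 5 + 35 / 72 * a ^+ 3 * m ^+ 6 + 1 / 18 * a ^+ 3 * m ^+ 7 +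
  3 / 4 * a ^+ 4 * m ^+ 7) + u ^+ 11 * (17 / 108 * a ^+ 3 * m ^+ 6 + 1 / 27 * a ^+ 3 * m ^+ 7 +
  1 / 6 * a ^+ 4 * m ^+ 7) + u ^+ 12 * (1 / 18 * a ^+ 3 * m ^+ 6 + 1 / 9 * a ^+ 4 * m ^+ 7)); last first.
  by rewrite /envelope /cpoly_part /xpoly_part; field.
by syntactic_nneg.
Qed.

Variables (n1 n2 n3 n4 n5 n6 n7 n8 : R).
Hypotheses (n10 : 0 <= n1) (n20 : 0 <= n2) (n30 : 0 <= n3) (n40 : 0 <= n4)
  (n50 : 0 <= n5) (n60 : 0 <= n6) (n70 : 0 <= n7) (n80 : 0 <= n8).

Local Notation T := (2 * u).
Local Notation M := (m ^+ 2).
Local Notation r := (n6 + (T / 4 * n7 + (2 * n8 + (T * n3 + (a * T * M / 4 * (2 + T) + 1) * n5)))).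
Local Notation w := (2^-1 * ((T + T ^+ 3 / 8) * n4 + T / 2 * (m * n5) +
  (1 + T ^+ 2 / 4) * (m * (n5 + T / 2 * r)))).

(** The left side is the sum of the eight bounds at time [T] with the Gronwall factor replaced by 1.
    The abbreviations [r] and [w] are [rho'] and [w0], and the last product is [c0] times the total
    coefficient of the bound for [y]. *)
Lemma envelope_sum :
  n2 + w + (n3 + a * w * m + a * T * M / 4 * n5) + n4 +
  ((1 + (T + T ^+ 2 / 2) + T / 2) * n5 + (T ^+ 2 / 2 + T / 2) * r) +
  ((3 / 2 + (T + T ^+ 2 / 2) + a * T * M / 4 * (2 + T)) * n5 + T ^+ 2 / 2 * r +
   (n6 + T / 4 * n7 + 2 * n8 + T * n3)) +
  (n7 + T / 2 * a * M * n5 + T / 2 * a * n4 * m) +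
  (n8 + T / 2 * n3 + T / 4 * n7 + a * w * m + a * T * M / 8 * (2 + T) * n5) +
  (n1 + T * (n2 + w)) * (1 + (1 + 2 * a * m) * (T / 4 * (a * M)) +
    (T ^+ 2 + T / 2 + 1) * (a * m)) <=
  envelope * (n1 + n2 + n3 + n4 + n5 + n6 + n7 + n8).
Proof.
rewrite -subr_ge0 (_ : _ - _ =
  (2 + 1 / 2 * m + a * m ^+ 2 + u * (6 + 2 * m + 2 * a * m + 11 / 2 * a * m ^+ 2) + u ^+ 2 * (8 +
   5 / 2 * m + 13 / 2 * a * m ^+ 2 + a * m ^+ 3 + 2 * a ^+ 2 * m ^+ 3 + 2 * a ^+ 2 * m ^+ 4) +
   u ^+ 3 * (8 + 2 * m + 8 * a * m + 13 * a * m ^+ 2 + 5 / 2 * a * m ^+ 3 + 2 * a ^+ 2 * m ^+ 3 +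
   4 * a ^+ 2 * m ^+ 4) + u ^+ 4 * (1 + 2 * m + 9 * a * m + 14 * a * m ^+ 2 + 2 * a * m ^+ 3 +
   4 * a ^+ 2 * m ^+ 4 + 1 / 2 * a ^+ 2 * m ^+ 5 + a ^+ 3 * m ^+ 6) + u ^+ 5 * (2 * m + a * m +
   10 * a * m ^+ 2 + 2 * a * m ^+ 3 + a ^+ 2 * m ^+ 3 + 8 * a ^+ 2 * m ^+ 4 + 1 / 2 * a ^+ 2 * m ^+ 5 +
   a ^+ 3 * m ^+ 6) + u ^+ 6 * (4 * a * m + 8 * a * m ^+ 2 + a * m ^+ 3 + 6 * a ^+ 2 * m ^+ 4 +
   1 / 2 * a ^+ 2 * m ^+ 5 + a ^+ 3 * m ^+ 6) + u ^+ 7 * (8 * a * m ^+ 2 + 5 * a ^+ 2 * m ^+ 4 +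
   1 / 2 * a ^+ 2 * m ^+ 5 + a ^+ 3 * m ^+ 6) + u ^+ 8 * (4 * a ^+ 2 * m ^+ 4)) * n1 +
  (2 + 1 / 2 * m + a * m + a * m ^+ 2 + u * (4 + 2 * m + a * m + 6 * a * m ^+ 2 + a ^+ 2 * m ^+ 3) +
   u ^+ 2 * (8 + 5 / 2 * m + 2 * a * m + 11 / 2 * a * m ^+ 2 + a * m ^+ 3 + 2 * a ^+ 2 * m ^+ 4) +
   u ^+ 3 * (8 + 2 * m + 13 * a * m ^+ 2 + 5 / 2 * a * m ^+ 3 + 2 * a ^+ 2 * m ^+ 3 +
   4 * a ^+ 2 * m ^+ 4) + u ^+ 4 * (1 + 2 * m + 9 * a * m + 14 * a * m ^+ 2 + 2 * a * m ^+ 3 +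
   4 * a ^+ 2 * m ^+ 4 + 1 / 2 * a ^+ 2 * m ^+ 5 + a ^+ 3 * m ^+ 6) + u ^+ 5 * (2 * m + a * m +
   10 * a * m ^+ 2 + 2 * a * m ^+ 3 + a ^+ 2 * m ^+ 3 + 8 * a ^+ 2 * m ^+ 4 + 1 / 2 * a ^+ 2 * m ^+ 5 +
   a ^+ 3 * m ^+ 6) + u ^+ 6 * (4 * a * m + 8 * a * m ^+ 2 + a * m ^+ 3 + 6 * a ^+ 2 * m ^+ 4 +
   1 / 2 * a ^+ 2 * m ^+ 5 + a ^+ 3 * m ^+ 6) + u ^+ 7 * (8 * a * m ^+ 2 + 5 * a ^+ 2 * m ^+ 4 +
   1 / 2 * a ^+ 2 * m ^+ 5 + a ^+ 3 * m ^+ 6) + u ^+ 8 * (4 * a ^+ 2 * m ^+ 4)) * n2 +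
  (2 + 1 / 2 * m + a * m + a * m ^+ 2 + u * (3 + 2 * m + 3 * a * m + 6 * a * m ^+ 2 + a ^+ 2 * m ^+ 3) +
   u ^+ 2 * (6 + 3 / 2 * m + 4 * a * m + 9 / 2 * a * m ^+ 2 + a * m ^+ 3 + 2 * a ^+ 2 * m ^+ 3 +
   2 * a ^+ 2 * m ^+ 4) + u ^+ 3 * (8 * a * m + 11 * a * m ^+ 2 + 5 / 2 * a * m ^+ 3 +
   2 * a ^+ 2 * m ^+ 3 + 4 * a ^+ 2 * m ^+ 4) + u ^+ 4 * (1 + m + 9 * a * m + 10 * a * m ^+ 2 +
   a * m ^+ 3 + 2 * a ^+ 2 * m ^+ 4 + 1 / 2 * a ^+ 2 * m ^+ 5 + a ^+ 3 * m ^+ 6) + u ^+ 5 * (a * m +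
   2 * a * m ^+ 3 + a ^+ 2 * m ^+ 3 + 8 * a ^+ 2 * m ^+ 4 + 1 / 2 * a ^+ 2 * m ^+ 5 + a ^+ 3 * m ^+ 6) +
   u ^+ 6 * (4 * a * m + 6 * a * m ^+ 2 + 4 * a ^+ 2 * m ^+ 4 + 1 / 2 * a ^+ 2 * m ^+ 5 +
   a ^+ 3 * m ^+ 6) + u ^+ 7 * (5 * a ^+ 2 * m ^+ 4 + 1 / 2 * a ^+ 2 * m ^+ 5 + a ^+ 3 * m ^+ 6) +
   u ^+ 8 * (4 * a ^+ 2 * m ^+ 4)) * n3 +
  (2 + 1 / 2 * m + a * m + a * m ^+ 2 + u * (5 + 2 * m + 6 * a * m ^+ 2 + a ^+ 2 * m ^+ 3) +
   u ^+ 2 * (6 + 5 / 2 * m + 2 * a * m + 13 / 2 * a * m ^+ 2 + a * m ^+ 3 + 2 * a ^+ 2 * m ^+ 3 +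
   2 * a ^+ 2 * m ^+ 4) + u ^+ 3 * (15 / 2 + 2 * m + 5 * a * m + 12 * a * m ^+ 2 + 5 / 2 * a * m ^+ 3 +
   4 * a ^+ 2 * m ^+ 4) + u ^+ 4 * (2 * m + 14 * a * m ^+ 2 + 2 * a * m ^+ 3 + 4 * a ^+ 2 * m ^+ 4 +
   1 / 2 * a ^+ 2 * m ^+ 5 + a ^+ 3 * m ^+ 6) + u ^+ 5 * (2 * m + 19 / 2 * a * m ^+ 2 + 2 * a * m ^+ 3 +
   8 * a ^+ 2 * m ^+ 4 + 1 / 2 * a ^+ 2 * m ^+ 5 + a ^+ 3 * m ^+ 6) + u ^+ 6 * (8 * a * m ^+ 2 +
   a * m ^+ 3 + 6 * a ^+ 2 * m ^+ 4 + 1 / 2 * a ^+ 2 * m ^+ 5 + a ^+ 3 * m ^+ 6) +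
   u ^+ 7 * (8 * a * m ^+ 2 + 5 * a ^+ 2 * m ^+ 4 + 1 / 2 * a ^+ 2 * m ^+ 5 + a ^+ 3 * m ^+ 6) +
   u ^+ 8 * (4 * a ^+ 2 * m ^+ 4)) * n4 +
  (1 / 2 + a * m + u * (3 * a * m + a ^+ 2 * m ^+ 3) + u ^+ 2 * (4 * a * m + 2 * a ^+ 2 * m ^+ 3) +
   u ^+ 3 * (8 + 1 / 2 * m + 8 * a * m + 2 * a ^+ 2 * m ^+ 3) + u ^+ 4 * (1 + m + 9 * a * m) +
   u ^+ 5 * (2 * m + a * m + 5 * a * m ^+ 2 + a ^+ 2 * m ^+ 3) + u ^+ 6 * (4 * a * m + 4 * a * m ^+ 2) +
   u ^+ 7 * (8 * a * m ^+ 2)) * n5 +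
  (2 + 1 / 2 * m + a * m + a * m ^+ 2 + u * (5 + 3 / 2 * m + 3 * a * m + 5 * a * m ^+ 2 +
   a ^+ 2 * m ^+ 3) + u ^+ 2 * (4 + 3 / 2 * m + 4 * a * m + 11 / 2 * a * m ^+ 2 + a * m ^+ 3 +
   2 * a ^+ 2 * m ^+ 3 + 2 * a ^+ 2 * m ^+ 4) + u ^+ 3 * (8 + 3 / 2 * m + 8 * a * m + 11 * a * m ^+ 2 +
   2 * a * m ^+ 3 + 2 * a ^+ 2 * m ^+ 3 + 3 * a ^+ 2 * m ^+ 4) + u ^+ 4 * (1 + m + 9 * a * m +
   9 * a * m ^+ 2 + 2 * a * m ^+ 3 + 4 * a ^+ 2 * m ^+ 4 + 1 / 2 * a ^+ 2 * m ^+ 5 + a ^+ 3 * m ^+ 6) +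
   u ^+ 5 * (2 * m + a * m + 9 * a * m ^+ 2 + 3 / 2 * a * m ^+ 3 + a ^+ 2 * m ^+ 3 +
   7 * a ^+ 2 * m ^+ 4 + 1 / 2 * a ^+ 2 * m ^+ 5 + a ^+ 3 * m ^+ 6) + u ^+ 6 * (4 * a * m +
   4 * a * m ^+ 2 + a * m ^+ 3 + 6 * a ^+ 2 * m ^+ 4 + 1 / 2 * a ^+ 2 * m ^+ 5 + a ^+ 3 * m ^+ 6) +
   u ^+ 7 * (8 * a * m ^+ 2 + 5 * a ^+ 2 * m ^+ 4 + 1 / 2 * a ^+ 2 * m ^+ 5 + a ^+ 3 * m ^+ 6) +
   u ^+ 8 * (4 * a ^+ 2 * m ^+ 4)) * n6 +
  (2 + 1 / 2 * m + a * m + a * m ^+ 2 + u * (5 + 2 * m + 3 * a * m + 6 * a * m ^+ 2 + a ^+ 2 * m ^+ 3) +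
   u ^+ 2 * (15 / 2 + 9 / 4 * m + 4 * a * m + 6 * a * m ^+ 2 + a * m ^+ 3 + 2 * a ^+ 2 * m ^+ 3 +
   2 * a ^+ 2 * m ^+ 4) + u ^+ 3 * (6 + 3 / 2 * m + 8 * a * m + 25 / 2 * a * m ^+ 2 +
   5 / 2 * a * m ^+ 3 + 2 * a ^+ 2 * m ^+ 3 + 4 * a ^+ 2 * m ^+ 4) + u ^+ 4 * (1 + 7 / 4 * m +
   9 * a * m + 13 * a * m ^+ 2 + 7 / 4 * a * m ^+ 3 + 7 / 2 * a ^+ 2 * m ^+ 4 +
   1 / 2 * a ^+ 2 * m ^+ 5 + a ^+ 3 * m ^+ 6) + u ^+ 5 * (3 / 2 * m + a * m + 15 / 2 * a * m ^+ 2 +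
   2 * a * m ^+ 3 + a ^+ 2 * m ^+ 3 + 8 * a ^+ 2 * m ^+ 4 + 1 / 2 * a ^+ 2 * m ^+ 5 + a ^+ 3 * m ^+ 6) +
   u ^+ 6 * (4 * a * m + 15 / 2 * a * m ^+ 2 + 3 / 4 * a * m ^+ 3 + 11 / 2 * a ^+ 2 * m ^+ 4 +
   1 / 2 * a ^+ 2 * m ^+ 5 + a ^+ 3 * m ^+ 6) + u ^+ 7 * (6 * a * m ^+ 2 + 5 * a ^+ 2 * m ^+ 4 +
   1 / 2 * a ^+ 2 * m ^+ 5 + a ^+ 3 * m ^+ 6) + u ^+ 8 * (4 * a ^+ 2 * m ^+ 4)) * n7 +
  (1 / 2 * m + a * m + a * m ^+ 2 + u * (4 + m + 3 * a * m + 4 * a * m ^+ 2 + a ^+ 2 * m ^+ 3) +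
   u ^+ 2 * (1 / 2 * m + 4 * a * m + 9 / 2 * a * m ^+ 2 + a * m ^+ 3 + 2 * a ^+ 2 * m ^+ 3 +
   2 * a ^+ 2 * m ^+ 4) + u ^+ 3 * (8 + m + 8 * a * m + 9 * a * m ^+ 2 + 3 / 2 * a * m ^+ 3 +
   2 * a ^+ 2 * m ^+ 3 + 2 * a ^+ 2 * m ^+ 4) + u ^+ 4 * (1 + 9 * a * m + 4 * a * m ^+ 2 +
   2 * a * m ^+ 3 + 4 * a ^+ 2 * m ^+ 4 + 1 / 2 * a ^+ 2 * m ^+ 5 + a ^+ 3 * m ^+ 6) + u ^+ 5 * (2 * m +
   a * m + 8 * a * m ^+ 2 + a * m ^+ 3 + a ^+ 2 * m ^+ 3 + 6 * a ^+ 2 * m ^+ 4 +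
   1 / 2 * a ^+ 2 * m ^+ 5 + a ^+ 3 * m ^+ 6) + u ^+ 6 * (4 * a * m + a * m ^+ 3 + 6 * a ^+ 2 * m ^+ 4 +
   1 / 2 * a ^+ 2 * m ^+ 5 + a ^+ 3 * m ^+ 6) + u ^+ 7 * (8 * a * m ^+ 2 + 5 * a ^+ 2 * m ^+ 4 +
   1 / 2 * a ^+ 2 * m ^+ 5 + a ^+ 3 * m ^+ 6) + u ^+ 8 * (4 * a ^+ 2 * m ^+ 4)) * n8); last first.
  by rewrite /envelope; field.
by syntactic_nneg.
Qed.

End growth_polynomial.

(** * Lebesgue norms and almost everywhere bounds *)

Definition rmeas (R : realType) (f : R -> R) : Prop :=
  measurable_fun (T := measurableTypeR R) (U := measurableTypeR R) setT f.
Definition aeL (R : realType) (P : R -> Prop) : Prop :=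
  {ae (@lebesgue_measure R), forall x, P x}.
Definition LpN (R : realType) (p : R) (f : R -> R) : \bar R :=
  Lnorm (@lebesgue_measure R) p%:E (EFin \o f).
Definition LooN (R : realType) (f : R -> R) : \bar R :=
  Lnorm (@lebesgue_measure R) +oo%E (EFin \o f).

Section measurability.
Context {R : realType}.
Implicit Types (f g : R -> R) (P Q : R -> Prop).
Local Notation mu := (@lebesgue_measure R).

Lemma rmeasD f g : rmeas f -> rmeas g -> rmeas (fun x => f x + g x).
Proof. by move=> mf mg; exact: measurable_funD. Qed.
Lemma rmeasB f g : rmeas f -> rmeas g -> rmeas (fun x => f x - g x).
Proof. by move=> mf mg; exact: measurable_funB. Qed.
Lemma rmeasM f g : rmeas f -> rmeas g -> rmeas (fun x => f x * g x).
Proof. by move=> mf mg; exact: measurable_funM. Qed.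
Lemma rmeasX n f : rmeas f -> rmeas (fun x => f x ^+ n).
Proof. by move=> mf; exact: measurable_funX. Qed.
Lemma rmeas_cst c : rmeas (fun _ : R => c).
Proof. exact: measurable_cst. Qed.
Lemma rmeasZ c f : rmeas f -> rmeas (fun x => c * f x).
Proof. by move=> mf; apply: rmeasM => //; exact: rmeas_cst. Qed.
Lemma rmeas_comp f g : rmeas f -> rmeas g -> rmeas (fun x => f (g x)).
Proof. by move=> mf mg; exact: (measurableT_comp mf mg). Qed.
Lemma rmeas_norm f : rmeas f -> rmeas (fun x => `|f x|).
Proof. exact: (rmeas_comp (@normr_measurable R setT)). Qed.
Lemma rmeas_cont f : continuous f -> rmeas f.
Proof. by move=> cf; exact: continuous_measurable_fun. Qed.
Lemma rmeas_powR (p : R) f : rmeas f -> rmeas (fun x => `|f x| `^ p).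
Proof.
by move=> mf; apply: (measurableT_comp (measurable_powR p)); exact: rmeas_norm.
Qed.
Lemma rmeasV f : rmeas f -> rmeas (fun x => (f x)^-1).
Proof.
move=> mf.
(* Inversion is discontinuous at 0, so it is written through a power of [|f|]. Where [f] vanishes
   both sides are 0, by the convention for [0^-1] on the left and the factor [f x] on the right. *)
have -> : (fun x => (f x)^-1) = (fun x => f x * (`|f x| `^ (-1)) ^+ 2).
  apply/funext => x; rewrite powR_inv1//.
  have [->|f0] := eqVneq (f x) 0; first by rewrite invr0 mul0r.
  by rewrite exprVn real_normK ?num_real// expr2 invfM mulrA mulfV// mul1r.
by apply: rmeasM => //; apply: rmeasX; exact: rmeas_powR.
Qed.
Lemma rmeas_if (b : R -> bool) f g : measurable_fun (T := measurableTypeR R) setT b ->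
  rmeas f -> rmeas g -> rmeas (fun x => if b x then f x else g x).
Proof. exact: measurable_fun_ifT. Qed.

Lemma aeLT P : (forall x, P x) -> aeL P.
Proof. by move=> h; apply: aeW. Qed.
Lemma aeL_mp P Q : (forall x, P x -> Q x) -> aeL P -> aeL Q.
Proof. by move=> h; apply: (@filterS _ _ (ae_filter_ringOfSetsType mu)) => x; exact: h. Qed.
Lemma aeL_and P Q : aeL P -> aeL Q -> aeL (fun x => P x /\ Q x).
Proof. by move=> hP hQ; apply: (@filterI _ _ (ae_filter_ringOfSetsType mu)). Qed.
Lemma aeL_mp2 P Q (S : R -> Prop) : (forall x, P x -> Q x -> S x) -> aeL P -> aeL Q -> aeL S.
Proof. by move=> h p q; apply: aeL_mp (aeL_and p q) => x [/h]; apply. Qed.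
Lemma aeL_all (P : nat -> R -> Prop) : (forall n, aeL (P n)) -> aeL (fun x => forall n, P n x).
Proof. by move=> h; exact/ae_foralln. Qed.

End measurability.

Section norms.
Context {R : realType}.
Implicit Types (f g : R -> R) (p c : R).
Local Notation mu := (@lebesgue_measure R).
Local Open Scope ereal_scope.

Lemma LooN_le f (c : R) : LooN f <= c%:E <-> aeL (fun x => `|f x|%R <= c)%R.
Proof.
rewrite /LooN unlock.
(* The norm with exponent infinity is defined by cases on whether the whole space has positive
   measure. *)
have -> : 0 < mu [set: measurableTypeR R].
  by rewrite -(set_itv_infty_infty R) lebesgue_measure_itv/= lt0y.
split => [/ess_supP|h]; first by apply: aeL_mp => x; rewrite /= lee_fin.
by apply/ess_supP; apply: aeL_mp h => x /=; rewrite lee_fin.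
Qed.

Lemma LpNE p f : LpN p f = (\int[mu]_x (`|f x| `^ p)%R%:E) `^ p^-1.
Proof. by rewrite /LpN unlock. Qed.

Lemma int_powR_ge0 p f : 0 <= \int[mu]_x (`|f x| `^ p)%R%:E.
Proof. by apply: integral_ge0 => x _; rewrite lee_fin powR_ge0. Qed.

Lemma LpN_le p f g : (0 < p)%R -> rmeas f -> rmeas g ->
  aeL (fun x => `|f x| <= `|g x|)%R -> LpN p f <= LpN p g.
Proof.
move=> p0 mf mg fg; rewrite !LpNE.
have ip : (0 <= p^-1)%R by rewrite invr_ge0 ltW.
apply: gt0_ler_poweR => //; try by rewrite in_itv/= leey int_powR_ge0.
apply: ae_ge0_le_integral; first exact: measurableT.
- by move=> x _; rewrite lee_fin powR_ge0.
- by apply/measurable_EFinP; exact: rmeas_powR.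
- by move=> x _; rewrite lee_fin powR_ge0.
- by apply/measurable_EFinP; exact: rmeas_powR.
apply: aeL_mp fg => x h _; rewrite lee_fin; apply: ge0_ler_powR => //.
exact: ltW.
Qed.

Lemma LpN_ae_eq p f g : (0 < p)%R -> rmeas f -> rmeas g ->
  aeL (fun x => f x = g x) -> LpN p f = LpN p g.
Proof.
move=> p0 mf mg h; apply/eqP; rewrite eq_le; apply/andP; split; apply: LpN_le => //;
  by apply: aeL_mp h => x ->.
Qed.

Lemma LooN_ae_eq f g : aeL (fun x => f x = g x) -> LooN f = LooN g.
Proof.
move=> h; rewrite /LooN unlock; case: ifP => // _; apply: eq_ess_sup.
by apply: aeL_mp h => x /= ->.
Qed.

Lemma LpN_ge0 p f : 0 <= LpN p f. Proof. exact: Lnorm_ge0. Qed.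
Lemma LooN_ge0 f : 0 <= LooN f. Proof. exact: Lnorm_ge0. Qed.

Lemma LpND p f g (a b : R) : (1 <= p)%R -> rmeas f -> rmeas g ->
  LpN p f <= a%:E -> LpN p g <= b%:E -> LpN p (fun x => f x + g x)%R <= (a + b)%:E.
Proof.
move=> p1 mf mg fa gb; rewrite EFinD; apply: le_trans; last by apply: leeD; [exact: fa|exact: gb].
exact: minkowski_EFin.
Qed.

Lemma LpNZ p c f : (0 < p)%R -> rmeas f -> LpN p (fun x => c * f x)%R = `|c|%:E * LpN p f.
Proof.
move=> p0 mf; rewrite !LpNE.
under eq_integral do rewrite normrM powRM// EFinM.
rewrite ge0_integralZl//.
- rewrite poweRM; [|by rewrite lee_fin powR_ge0|exact: int_powR_ge0].
  by rewrite poweR_EFin -powRrM mulfV ?gt_eqF// powRr1.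
- by apply/measurable_EFinP; exact: rmeas_powR.
Qed.

Lemma L1NE f : LpN 1 f = \int[mu]_x `|f x|%:E.
Proof. by rewrite /LpN Lnorm1. Qed.

Lemma L1N_mul f g (a b : R) : rmeas f -> rmeas g ->
  LpN 2 f <= a%:E -> LpN 2 g <= b%:E -> LpN 1 (fun x => f x * g x)%R <= (a * b)%:E.
Proof.
move=> mf mg fa gb.
apply: (@le_trans _ _ (LpN 2 f * LpN 2 g)).
  by apply: hoelder => //; field.
by rewrite EFinM; apply: lee_pmul => //; exact: LpN_ge0.
Qed.

Lemma L2N_sqr f (c : R) : (0 <= c)%R ->
  LpN 2 f <= c%:E <-> \int[mu]_x (f x ^+ 2)%:E <= (c ^+ 2)%:E.
Proof.
move=> c0; rewrite LpNE.
have -> : \int[mu]_x (`|f x| `^ 2)%R%:E = \int[mu]_x (f x ^+ 2)%:E.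
  by apply: eq_integral => x _; rewrite powR_mulrn// real_normK ?num_real.
set I := integral _ _ _.
have I0 : 0 <= I by apply: integral_ge0 => x _; rewrite lee_fin sqr_ge0.
split => h.
  have -> : I = (I `^ 2^-1) `^ 2 by rewrite -poweRrM mulVf// poweRe1.
  have -> : (c ^+ 2)%:E = c%:E `^ 2 by rewrite poweR_EFin powR_mulrn.
  by apply: gt0_ler_poweR => //; rewrite in_itv/= ?poweR_ge0 ?lee_fin ?leey ?c0.
have -> : c%:E = (c ^+ 2)%:E `^ 2^-1.
  by rewrite poweR_EFin -powR_mulrn// -powRrM mulfV// powRr1.
by apply: gt0_ler_poweR => //; rewrite in_itv/= ?I0 ?lee_fin ?leey ?sqr_ge0.
Qed.

End norms.

(** * Primitives and changes of variables *)

Section density_measure.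
Context d (T : measurableType d) (R : realType).
Local Open Scope ereal_scope.

(** The hypotheses on [w] are arguments so that the measure structure declared below attaches to
    this term. *)
Definition density_measure (mu : {measure set T -> \bar R}) (w : T -> R)
  (mw : measurable_fun setT w) (w0 : forall x, (0 <= w x)%R) (A : set T) : \bar R :=
  \int[mu]_(x in A) (w x)%:E.

Variables (mu : {measure set T -> \bar R}) (w : T -> R).
Hypotheses (mw : measurable_fun setT w) (w0 : forall x, (0 <= w x)%R).

Let density0 : density_measure mu mw w0 set0 = 0.
Proof. by rewrite /density_measure integral_set0. Qed.

Let density_ge0 A : 0 <= density_measure mu mw w0 A.
Proof. by apply: integral_ge0 => x _; rewrite lee_fin. Qed.

Let density_sigma_additive : semi_sigma_additive (density_measure mu mw w0).
Proof.
move=> F mF tF mUF; rewrite /density_measure.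
rewrite [X in _ --> X](_ : _ = \sum_(i <oo) \int[mu]_(x in F i) (w x)%:E); last first.
  apply: ge0_integral_bigcup => //.
  - by apply/measurable_EFinP; exact: measurable_funS mw.
  - by move=> x _; rewrite lee_fin.
by apply: is_cvg_nneseries => n _ _; apply: integral_ge0 => x _; rewrite lee_fin.
Qed.

HB.instance Definition _ := isMeasure.Build _ _ _
  (density_measure mu mw w0) density0 density_ge0 density_sigma_additive.

Import HBNNSimple.

(** By monotone convergence along increasing simple functions, it suffices to treat indicators of
    level sets, where the formula is the definition of the measure. *)
Lemma ge0_integral_density (f : T -> \bar R) : (forall x, 0 <= f x) ->
  measurable_fun setT f ->
  \int[density_measure mu mw w0]_x f x = \int[mu]_x (f x * (w x)%:E).
Proof.
move=> f0 mf; pose h := nnsfun_approx measurableT mf.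
have cvh x : (EFin \o h n) x @[n --> \oo] --> f x.
  by apply: cvg_nnsfun_approx.
have ndh x : {homo (fun n => (EFin \o h n) x) : m n / (m <= n)%N >-> m <= n}.
  by move=> m n mn; rewrite lee_fin; exact/lefP/nd_nnsfun_approx.
have -> : \int[density_measure mu mw w0]_x f x =
    limn (fun n => \int[density_measure mu mw w0]_x (EFin \o h n) x).
  rewrite -monotone_convergence//.
  - by apply: eq_integral => x _; apply/esym/cvg_lim => //; exact: cvh.
  - by move=> n; apply/measurable_EFinP.
  - by move=> n x _; rewrite lee_fin.
have cvw x : (EFin \o h n) x * (w x)%:E @[n --> \oo] --> f x * (w x)%:E.
  by apply: cvgeZr => //; exact: cvh.
have -> : \int[mu]_x (f x * (w x)%:E) =
    limn (fun n => \int[mu]_x ((EFin \o h n) x * (w x)%:E)).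
  rewrite -monotone_convergence//.
  - by apply: eq_integral => x _; apply/esym/cvg_lim => //; exact: cvw.
  - by move=> n; apply: emeasurable_funM => //; exact/measurable_EFinP.
  - by move=> n x _; apply: mule_ge0 => //; rewrite lee_fin.
  - by move=> x _ m n mn; apply: lee_wpmul2r; rewrite ?lee_fin//; exact/lefP/nd_nnsfun_approx.
congr (limn _); apply/funext => n.
transitivity (\int[density_measure mu mw w0]_x
   (\sum_(y \in range (h n)) (y * \1_(h n @^-1` [set y]) x)%:E)).
  by apply: eq_integral => t tE; rewrite /= fimfunE -fsumEFin.
rewrite ge0_integral_fsum//; last 2 first.
  - by move=> y; apply/measurable_EFinP; exact: measurable_funM.
  - by move=> y x _; exact: nnfun_muleindic_ge0.
transitivity (\int[mu]_x (\sum_(y \in range (h n))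
    (y * \1_(h n @^-1` [set y]) x)%:E * (w x)%:E)); last first.
  apply: eq_integral => x _; rewrite -ge0_mule_fsuml => [|y]; last exact: nnfun_muleindic_ge0.
  by rewrite /= fimfunE -fsumEFin.
rewrite ge0_integral_fsum//; last 2 first.
  - move=> y; apply: emeasurable_funM; apply/measurable_EFinP => //.
    exact: measurable_funM.
  - by move=> y x _; apply: mule_ge0; rewrite ?lee_fin//; exact: nnfun_muleindic_ge0.
apply: eq_fsbigr => r; rewrite inE => -[z _ rz].
rewrite integralZl_indic_nnsfun// integral_indic// setIT.
under [RHS]eq_integral do rewrite EFinM -muleA.
rewrite ge0_integralZl//.
- congr (_ * _); transitivity (\int[mu]_(x in h n @^-1` [set r]) (w x)%:E) => //.
  rewrite integral_mkcond.
  by apply: eq_integral => x _; rewrite epatch_indic muleC.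
- by apply: emeasurable_funM => //; apply/measurable_EFinP.
- by move=> x _; apply: mule_ge0; rewrite lee_fin.
- by rewrite lee_fin -rz.
Qed.

End density_measure.

(** The notion [is_wderiv] over an arbitrary [realType]; at the reals the two are convertible. *)
Definition wder (R : realType) (f g : R -> R) : Prop :=
  forall a b : R, a <= b ->
    (@lebesgue_measure R).-integrable `[a, b] (EFin \o g) /\
    (\int[@lebesgue_measure R]_(x in `[a, b]) (g x)%:E = (f b - f a)%:E)%E.

(** * Weak derivatives on the line *)

Section weak_derivative.
Context {R : realType}.
Implicit Types (f g F : R -> R).
Local Notation mu := (@lebesgue_measure R).

Lemma wder_integrable f g a b : wder f g -> mu.-integrable `[a, b] (EFin \o g).
Proof.
move=> fg; have [ab|ba] := leP a b; first by case: (fg a b ab).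
by rewrite set_itv_ge ?bnd_simp -?ltNge//; exact: integrable_set0.
Qed.

Lemma wderB f g a b : wder f g -> a <= b ->
  \int[mu]_(x in `[a, b]) g x = f b - f a.
Proof. by move=> fg /fg[_ h]; rewrite /Rintegral h. Qed.

Lemma set_itv_cover : \bigcup_n `[- n%:R, n%:R]%classic = [set: R].
Proof.
rewrite -subTset => x _; exists (Num.bound `|x|) => //=.
by rewrite in_itv/= -ler_norml ltW// archi_boundP.
Qed.

Lemma rmeas_locally g : (forall a b, mu.-integrable `[a, b] (EFin \o g)) -> rmeas g.
Proof.
move=> h; rewrite /rmeas -set_itv_cover; apply/measurable_fun_bigcup => //= n.
by apply/measurable_EFinP; exact: measurable_int (h _ _).
Qed.

Lemma wder_meas f g : wder f g -> rmeas g.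
Proof. by move=> fg; apply: rmeas_locally => a b; exact: wder_integrable fg. Qed.

Lemma wder_locally_integrable f g : wder f g -> locally_integrable setT g.
Proof.
move=> fg; split; [exact: wder_meas fg|exact: openT|move=> K _ cK].
have [M [Mr KM]] := compact_bounded cK.
pose m := `|M| + 1.
have Km : K `<=` `[- m, m].
  move=> x Kx; rewrite /= in_itv/= -ler_norml; apply: (KM m) => //.
  by rewrite /m (le_lt_trans (ler_norm _))// ltrDl.
have /integrableP[mg] := wder_integrable (- m) m fg.
apply: le_lt_trans; apply: ge0_subset_integral => //.
  exact: compact_measurable.
by apply/measurable_EFinP; apply: measurableT_comp => //; exact/measurable_EFinP.
Qed.

(** Lebesgue differentiation is applied on each half-line starting at [- n], and a countable
    intersection covers the whole line. The result makes weak derivatives unique almost everywhere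
    and gives them the sign of the difference quotients. *)
Lemma wder_derive f g : wder f g -> aeL (fun x => derivable f x 1 /\ derive1 f x = g x).
Proof.
move=> fg; have := @aeL_all R (fun n x => - n%:R < x -> derivable f x 1 /\ derive1 f x = g x).
move=> h; apply: aeL_mp (h _) => [x /(_ (Num.bound `|x|))|n].
  by apply; rewrite ltrNl (le_lt_trans (ler_norm _))// normrN archi_boundP.
have := @FTC1 R g (BLeft (- n%:R)) _ (wder_locally_integrable fg).
move=> /(_ (fun y => wder_integrable _ _ fg)); apply: aeL_mp => x /=.
rewrite lte_fin => + nx => /(_ nx); set F := (fun z : R => \int[mu]_(t in `[_, z]) _) => -[dF F'].
have E : {near x, f =1 (fun z => F z + f (- n%:R))}.
  near=> z; rewrite /F (wderB fg) ?subrK//.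
  by apply: ltW; near: z; exact: lt_nbhsr.
have dF1 : derivable (fun z => F z + f (- n%:R)) x 1.
  by apply: (derivableD dF); exact: derivable_cst.
have E' : {near x, (fun z => F z + f (- n%:R)) =1 f} by apply: filterS E => z ->.
split; first by apply: near_eq_derivable E' dF1; exact: oner_neq0.
rewrite derive1E -(near_eq_derive _ E')//.
have -> : (fun z => F z + f (- n%:R)) = F + cst (f (- n%:R)) by [].
rewrite (deriveD dF); last exact: derivable_cst.
by rewrite (derive_cst (f (- n%:R)) x 1) addr0 -derive1E.
Unshelve. all: by end_near. Qed.

Lemma wder_uniq f g1 g2 : wder f g1 -> wder f g2 -> aeL (fun x => g1 x = g2 x).
Proof.
by move=> /wder_derive h1 /wder_derive h2; apply: aeL_mp2 h1 h2 => x [_ <-] [_ <-].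
Qed.

Lemma wder_nondecreasing f g : {homo f : x y / x <= y} -> wder f g -> aeL (fun x => 0 <= g x).
Proof.
move=> fh /wder_derive; apply: aeL_mp => x [df <-].
rewrite derive1E; apply: limr_ge; first exact: df.
near=> h; have h0 : h != 0 by near: h; exact: nbhs_dnbhs_neq.
rewrite /GRing.scale/= mulr1.
have [h1|h1|h1] := ltgtP h 0; last by rewrite h1 eqxx in h0.
  by apply: mulr_le0; rewrite ?invr_le0 ?subr_le0 ?(ltW h1)//; apply: fh; lra.
by apply: mulr_ge0; rewrite ?invr_ge0 ?subr_ge0 ?(ltW h1)//; apply: fh; lra.
Unshelve. all: by end_near. Qed.

Lemma wder_ae f g1 g2 : wder f g1 -> rmeas g2 -> aeL (fun x => g1 x = g2 x) -> wder f g2.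
Proof.
move=> fg m2 E a b ab; have [i1 <-] := fg a b ab.
have m (g : R -> R) : rmeas g -> measurable_fun `[a, b] (EFin \o g).
  by move=> mg; apply/measurable_EFinP; apply: measurable_funS mg.
have m1 := wder_meas fg.
split; last first.
  apply: ae_eq_integral => //; [exact: m|exact: m|].
  by apply: aeL_mp E => x /= ->.
apply/integrableP; split; first exact: m.
have /integrableP[_] := i1.
have mn (g : R -> R) : rmeas g -> measurable_fun `[a, b] (fun x => `|(EFin \o g) x|)%E.
  move=> mg; apply/measurable_EFinP; apply: measurable_funS (rmeas_norm mg) => //.
move=> h; apply: le_lt_trans h; rewrite le_eqVlt; apply/orP; left; apply/eqP.
apply: ae_eq_integral => //; [exact: mn|exact: mn|].
by apply: aeL_mp E => x /= ->.
Qed.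

Lemma wderD f1 f2 g1 g2 : wder f1 g1 -> wder f2 g2 ->
  wder (fun x => f1 x + f2 x) (fun x => g1 x + g2 x).
Proof.
move=> h1 h2 a b ab; have [i1 e1] := h1 a b ab; have [i2 e2] := h2 a b ab; split.
  exact: (integrableD _ i1 i2).
rewrite (integralD_EFin _ i1 i2)//= e1 e2 -EFinD; congr EFin; ring.
Qed.

Lemma wderZ c f g : wder f g -> wder (fun x => c * f x) (fun x => c * g x).
Proof.
move=> h a b ab; have [i e] := h a b ab; split; first exact: (integrableZl _ c i).
rewrite (integralZl _ i)// e -EFinM; congr EFin; ring.
Qed.

Lemma wder_sub f1 f2 g1 g2 : wder f1 g1 -> wder f2 g2 ->
  wder (fun x => f1 x - f2 x) (fun x => g1 x - g2 x).
Proof.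
move=> h1 /(wderZ (-1)) h2; have := wderD h1 h2.
by under eq_fun do rewrite mulN1r; under [X in wder _ X]eq_fun do rewrite mulN1r.
Qed.

Lemma wder_cst (c : R) : wder (fun=> c) (fun=> 0).
Proof.
move=> a b ab; split; first exact: integrable0.
by rewrite integral0 subrr.
Qed.

Lemma lebesgue_itvcc (a b : R) : a <= b -> mu `[a, b]%classic = (b - a)%:E.
Proof.
rewrite lebesgue_measure_itv/= lte_fin -EFinB; case: ltgtP => // -> _.
by rewrite subrr.
Qed.

Lemma wder_id : wder (fun x : R => x) (fun=> 1).
Proof.
move=> a b ab; split.
  apply: continuous_compact_integrable; first exact: segment_compact.
  by apply: continuous_subspaceT => x; exact: cvg_cst.
have -> : (fun x : R => 1%:E) = @cst R _ 1%E by [].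
by rewrite integral_cst// mul1e; exact: lebesgue_itvcc.
Qed.

Lemma wder_continuous f g : wder f g -> continuous f.
Proof.
move=> fg x.
have ab : x - 1 < x + 1 by lra.
have := parameterized_integral_continuous (ltW ab) (wder_integrable _ _ fg).
move/continuous_within_itvP => /(_ ab)[+ _ _] => /(_ x).
rewrite in_itv/= => /(_ ltac:(apply/andP; split; lra)) cx.
have E : {near x, (fun z => parameterized_integral mu (x - 1) z g + f (x - 1)) =1 f}.
  near=> z; rewrite /parameterized_integral (wderB fg) ?subrK//.
  by apply: ltW; near: z; apply: lt_nbhsr; lra.
have c2 : (fun z => parameterized_integral mu (x - 1) z g + f (x - 1)) z @[z --> x] --> f x.
  have -> : f x = parameterized_integral mu (x - 1) x g + f (x - 1).
    by rewrite /parameterized_integral (wderB fg) ?subrK//; lra.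
  by apply: cvgD; [exact: cx|exact: cvg_cst].
by apply: cvg_trans c2; apply: near_eq_cvg; apply: filterS E => z ->.
Unshelve. all: by end_near. Qed.

Lemma null_rmeas (g : R -> R) : rmeas g -> measurable_fun setT (EFin \o g).
Proof. by move=> ?; exact/measurable_EFinP. Qed.

End weak_derivative.

(** * Change of variables along increasing bijections *)

Definition chart (R : realType) (f df h : R -> R) : Prop :=
  [/\ cancel f h, cancel h f, {homo f : x y / x < y} & wder f df].

Section change_of_variables.
Context {R : realType}.
Implicit Types (f df h F dF : R -> R).
Local Notation mu := (@lebesgue_measure R).

Lemma chart_lt f df h : chart f df h -> {mono f : x y / x < y}.
Proof.
move=> [_ _ hf _] x y; have [xy|yx|->] := ltgtP x y; last by rewrite ltxx.
  exact: hf.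
by apply/negbTE; rewrite -leNgt ltW// hf.
Qed.

Lemma chart_inv_lt f df h : chart f df h -> {mono h : x y / x < y}.
Proof.
by move=> cf x y; rewrite -(chart_lt cf); have [_ -> _ _] := cf; have [_ -> _ _] := cf.
Qed.

Lemma chart_le f df h : chart f df h -> {mono f : x y / x <= y}.
Proof. by move=> cf x y; rewrite !leNgt (chart_lt cf). Qed.

Lemma chart_inv_le f df h : chart f df h -> {mono h : x y / x <= y}.
Proof. by move=> cf x y; rewrite !leNgt (chart_inv_lt cf). Qed.

Lemma chart_meas f df h : chart f df h -> rmeas f.
Proof. by move=> [_ _ _ /wder_continuous]; exact: rmeas_cont. Qed.

Lemma mono_meas f : {homo f : x y / x <= y} -> rmeas f.
Proof. by move=> fh; apply: nondecreasing_measurable => //; move=> x y _ _; exact: fh. Qed.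

Lemma chart_inv_meas f df h : chart f df h -> rmeas h.
Proof. by move=> cf; apply: mono_meas => x y; rewrite (chart_inv_le cf). Qed.

Lemma chart_ge0 f df h : chart f df h -> aeL (fun x => 0 <= df x).
Proof.
by move=> cf; have [_ _ _ fd] := cf; apply: wder_nondecreasing fd => x y; rewrite (chart_le cf).
Qed.

Local Open Scope ereal_scope.

(** The measure with density [|df|], pushed forward by [f], gives []a, b]] the mass [b - a], hence
    is Lebesgue measure. The absolute value is there because a density must be nonnegative
    everywhere, while [df] is so only almost everywhere. *)
Lemma chart_integral f df h (phi : R -> \bar R) : chart f df h ->
  measurable_fun (T := measurableTypeR R) setT phi -> (forall x, 0 <= phi x) ->
  \int[mu]_x phi x = \int[mu]_x (phi (f x) * (df x)%:E).
Proof.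
move=> cf mphi phi0; have [fK hK fh fd] := cf; have d0 := chart_ge0 cf.
have mf := chart_meas cf; have md := wder_meas fd.
pose w x := `|df x|%R.
have mw : measurable_fun (T := measurableTypeR R) setT w by exact: rmeas_norm.
have w0 x : (0 <= w x)%R by rewrite /w.
pose nu : {measure set (measurableTypeR R) -> \bar R} := density_measure mu mw w0.
pose nuf : {measure set (measurableTypeR R) -> \bar R} :=
  measure_function_pushforward__canonical__measure_function_Measure nu
    (mf : measurable_fun (T := measurableTypeR R) (U := measurableTypeR R) setT f).
have E (X : set (measurableTypeR R)) : measurable X -> mu X = nuf X.
  move=> mX; apply: (lebesgue_measure_unique (mu := nuf)) mX => /= Y [[a b]] _ <- /=.
  transitivity (\int[mu]_(x in `]h a, h b]) (w x)%:E); last first.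
    rewrite /pushforward /density_measure; congr (integral _ _ _).
    by apply/seteqP; split => x /=; rewrite !in_itv/= -(chart_lt cf (h a)) -(chart_le cf x) !hK.
  rewrite lebesgue_measure_itv/= lte_fin.
  have [ab|ba] := ltP a b; last first.
    by rewrite set_itv_ge ?integral_set0// bnd_simp -leNgt (chart_inv_le cf).
  rewrite integral_itv_obnd_cbnd; last first.
    by apply/measurable_EFinP; apply: measurable_funS (mw) => //.
  have hab : (h a <= h b)%R by rewrite (chart_inv_le cf) ltW.
  have [_ e] := fd _ _ hab.
  rewrite !hK in e; rewrite -EFinB -e; apply: ae_eq_integral => //.
  - by apply/measurable_EFinP; apply: measurable_funS md.
  - by apply/measurable_EFinP; apply: measurable_funS (mw) => //.
  - by apply: aeL_mp d0 => x d0x _; rewrite /w ger0_norm.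
rewrite (eq_measure_integral nuf); last by move=> A mA _; exact: E.
rewrite ge0_integral_pushforward// preimage_setT.
have mphif : measurable_fun (T := measurableTypeR R) setT (phi \o f) by exact: measurableT_comp.
rewrite ge0_integral_density//; last by move=> x; exact: phi0.
apply: ae_eq_integral => //.
- by apply: emeasurable_funM => //; exact/measurable_EFinP.
- by apply: emeasurable_funM => //; exact/measurable_EFinP.
- by apply: aeL_mp d0 => x d0x _; rewrite /w ger0_norm.
Qed.

Lemma chart_integral_in f df h (D : set R) (phi : R -> \bar R) : chart f df h ->
  measurable D -> measurable_fun (T := measurableTypeR R) setT phi -> (forall x, 0 <= phi x) ->
  \int[mu]_(x in D) phi x = \int[mu]_(x in f @^-1` D) (phi (f x) * (df x)%:E).
Proof.
move=> cf mD mphi phi0; rewrite integral_mkcond (chart_integral cf).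
- rewrite [RHS]integral_mkcond; apply: eq_integral => x _; rewrite /patch.
  have -> : (x \in f @^-1` D) = (f x \in D) by apply/idP/idP; rewrite !inE.
  by case: ifP => // _; rewrite mul0e.
- by apply/(measurable_restrictT _ mD); exact: measurable_funTS.
- by move=> x; rewrite /patch; case: ifP.
Qed.

Lemma chart_preimage_itv f df h a b : chart f df h ->
  f @^-1` `[f a, f b]%classic = `[a, b]%classic.
Proof.
by move=> cf; apply/seteqP; split => x /=; rewrite !in_itv/= !(chart_le cf).
Qed.

(** [f] sends null sets to null sets, since the measure of an image is an integral of [df]. To
    transport a property along [f] instead of [h], the statement is applied to [chart_inv], which
    asks for [df > 0]. *)
Lemma chart_ae f df h (P : R -> Prop) : chart f df h -> aeL P -> aeL (fun x => P (h x)).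
Proof.
move=> cf [N [mN N0 PN]]; have mh := chart_inv_meas cf.
have mhN : measurable (h @^-1` N) by rewrite -(setTI (_ @^-1` _)); exact: mh.
exists (h @^-1` N); split => //; last by move=> x Px; apply: PN => Phx; exact: Px.
have := chart_integral_in cf mhN (@measurable_cst _ _ (measurableTypeR R) (\bar R) setT 1) (fun=> lee01).
rewrite integral_cst// mul1e => ->.
have -> : f @^-1` (h @^-1` N) = N.
  by have [fK _ _ _] := cf; apply/seteqP; split => x /=; rewrite fK.
apply: null_set_integral => //; under eq_fun do rewrite mul1e.
by apply/measurable_EFinP; apply: measurable_funTS; have [_ _ _ /wder_meas] := cf.
Qed.

Lemma chart_integrable_ge0 f df h (D : set R) (phi : R -> R) : chart f df h ->
  measurable D -> rmeas phi -> (forall x, (0 <= phi x)%R) ->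
  mu.-integrable D (EFin \o phi) ->
  mu.-integrable (f @^-1` D) (EFin \o (fun x => phi (f x) * df x)%R) /\
  \int[mu]_(x in D) (phi x)%:E = \int[mu]_(x in f @^-1` D) (phi (f x) * df x)%:E.
Proof.
move=> cf mD mphi phi0 iphi; have mf := chart_meas cf.
have E := chart_integral_in cf mD (null_rmeas mphi) (fun x => phi0 x).
have md : rmeas df by have [_ _ _ /wder_meas] := cf.
have mpf : rmeas (fun x => phi (f x) * df x)%R by apply: rmeasM => //; exact: rmeas_comp.
split; last by rewrite [LHS]E; apply: eq_integral.
have /integrableP[_ lt] := iphi.
apply/integrableP; split; first by apply/measurable_EFinP; exact: measurable_funTS.
apply: le_lt_trans lt; rewrite le_eqVlt; apply/orP; left; apply/eqP.
transitivity (\int[mu]_(x in f @^-1` D) (phi (f x) * df x)%:E).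
  apply: ae_eq_integral => //.
  - by rewrite -(setTI (_ @^-1` _)); exact: mf.
  - by apply/measurable_EFinP; apply: measurable_funTS; exact: rmeas_norm.
  - by apply/measurable_EFinP; exact: measurable_funTS.
  - apply: aeL_mp (chart_ge0 cf) => x dx _.
    by rewrite /= ger0_norm// mulr_ge0.
transitivity (\int[mu]_(x in D) (phi x)%:E); first by rewrite [RHS]E; apply: eq_integral.
by apply: eq_integral => x _; rewrite /= ger0_norm.
Qed.

Lemma chart_integrable f df h (D : set R) (phi : R -> R) : chart f df h ->
  measurable D -> rmeas phi -> mu.-integrable D (EFin \o phi) ->
  mu.-integrable (f @^-1` D) (EFin \o (fun x => phi (f x) * df x)%R) /\
  \int[mu]_(x in D) (phi x)%:E = \int[mu]_(x in f @^-1` D) (phi (f x) * df x)%:E.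
Proof.
move=> cf mD mphi iphi.
pose p x := Num.max (phi x) 0%R; pose q x := Num.max (- phi x)%R 0%R.
have mp : rmeas p by apply: measurable_maxr => //; exact: rmeas_cst.
have mq : rmeas q.
  apply: measurable_maxr; last exact: rmeas_cst.
  by apply: measurableT_comp.
have pq x : (phi x = p x - q x)%R by rewrite /p /q !maxEle; case: ifP; case: ifP; lra.
have ile (g : R -> R) : rmeas g -> (forall x, (0 <= g x <= `|phi x|)%R) -> mu.-integrable D (EFin \o g).
  move=> mg gp; apply: le_integrable iphi => //.
    by apply/measurable_EFinP; exact: measurable_funTS.
  by move=> x _; rewrite /= lee_fin ger0_norm; have /andP[]:= gp x.
have ip : mu.-integrable D (EFin \o p).
  by apply: ile => // x; rewrite /p le_max lexx orbT/= ge_max normr_ge0 ler_norm.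
have iq : mu.-integrable D (EFin \o q).
  by apply: ile => // x; rewrite /q le_max lexx orbT/= ge_max normr_ge0 -normrN ler_norm.
have p0 x : (0 <= p x)%R by rewrite /p le_max lexx orbT.
have q0 x : (0 <= q x)%R by rewrite /q le_max lexx orbT.
have [ip' ep] := chart_integrable_ge0 cf mD mp p0 ip.
have [iq' eq] := chart_integrable_ge0 cf mD mq q0 iq.
have mfD : measurable (f @^-1` D) by rewrite -(setTI (_ @^-1` _)); exact: (chart_meas cf).
have E x : (phi (f x) * df x = p (f x) * df x - q (f x) * df x)%R by rewrite pq; ring.
split.
  rewrite (_ : EFin \o _ = (EFin \o (fun x => p (f x) * df x)%R) \-
    (EFin \o (fun x => q (f x) * df x)%R)); first exact: integrableB.
  by apply/funext => x /=; rewrite E.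
under eq_integral do rewrite pq EFinB.
under [RHS]eq_integral do rewrite E EFinB.
by rewrite (integralB_EFin _ ip iq)// (integralB_EFin _ ip' iq')// ep eq.
Qed.

Local Close Scope ereal_scope.

Lemma wder_comp f df h F dF : chart f df h -> wder F dF ->
  wder (fun x => F (f x)) (fun x => dF (f x) * df x).
Proof.
move=> cf Fd a b ab; have fab : f a <= f b by rewrite (chart_le cf).
have [i e] := Fd _ _ fab.
have [] := chart_integrable cf _ (wder_meas Fd) i => //.
by rewrite (chart_preimage_itv _ _ cf) e => i' <-.
Qed.

(** A change of variables turns the integral of [1 / df \o h] over [[a, b]] into that of [1] over
    [[h a, h b]]; the factors cancel because [df] is positive almost everywhere. *)
Lemma chart_inv_wder f df h : chart f df h -> aeL (fun x => 0 < df x) ->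
  wder h (fun x => (df (h x))^-1).
Proof.
move=> cf d0; have [fK hK _ fd] := cf.
have md := wder_meas fd; have mh := chart_inv_meas cf.
pose phi x := `|(df (h x))^-1|.
have mphi : rmeas phi by apply: rmeas_norm; apply: rmeasV; exact: rmeas_comp.
have ephi : aeL (fun x => phi x = (df (h x))^-1).
  by apply: aeL_mp (chart_ae cf d0) => x dx; rewrite /phi ger0_norm// invr_ge0 ltW.
apply: wder_ae ephi; last by apply: rmeasV; exact: rmeas_comp.
move=> a b ab.
have hab : h a <= h b by rewrite (chart_inv_le cf).
have E := chart_integral_in cf (measurable_itv `[a, b]) (null_rmeas mphi) (fun x => normr_ge0 _).
have E2 : (\int[mu]_(x in `[a, b]) (phi x)%:E = (h b - h a)%:E)%E.
  rewrite [LHS]E -{1}(hK a) -{1}(hK b) (chart_preimage_itv _ _ cf) -(lebesgue_itvcc hab).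
  rewrite -[RHS]mul1e -integral_cst//; apply: ae_eq_integral => //.
  - apply: emeasurable_funM; apply/measurable_EFinP; apply: measurable_funTS => //.
    exact: (rmeas_comp mphi (chart_meas cf)).
  - apply: aeL_mp d0 => x dx _; rewrite /= /phi fK -EFinM ger0_norm ?invr_ge0 ?(ltW dx)//.
    by rewrite mulVf// gt_eqF.
split => //; apply/integrableP; split.
  by apply/measurable_EFinP; exact: measurable_funTS.
rewrite [X in (X < _)%E](_ : _ = (h b - h a)%:E) ?ltry// -E2.
by apply: eq_integral => x _; rewrite /= normr_id.
Qed.

Lemma chart_inv f df h : chart f df h -> aeL (fun x => 0 < df x) ->
  chart h (fun x => (df (h x))^-1) f.
Proof.
move=> cf d0; have [fK hK _ fd] := cf; split => //; last exact: chart_inv_wder cf d0.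
by move=> x y; rewrite (chart_inv_lt cf).
Qed.

Lemma chart_LooN f df h F : chart f df h -> aeL (fun x => 0 < df x) ->
  (LooN (fun x => F (f x)) <= LooN F)%E.
Proof.
move=> cf d0; have := LooN_ge0 F.
case: (LooN F) (@LooN_le R F) => [c||] h0 // _; last by rewrite leey.
apply/LooN_le; have /h0 := lexx c%:E.
exact: (chart_ae (chart_inv cf d0)).
Qed.

Lemma chart_L1N f df h F : chart f df h -> rmeas F ->
  LpN 1 (fun x => F (f x) * df x) = LpN 1 F.
Proof.
move=> cf mF; rewrite !L1NE [RHS](chart_integral cf (null_rmeas (rmeas_norm mF)) (fun x => normr_ge0 _)).
have md : rmeas df by have [_ _ _ /wder_meas] := cf.
have mFf := rmeas_comp mF (chart_meas cf).
apply: ae_eq_integral => //.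
- by apply/measurable_EFinP; apply: rmeas_norm; exact: rmeasM.
- by apply: emeasurable_funM; apply/measurable_EFinP => //; exact: rmeas_norm.
- by apply: aeL_mp (chart_ge0 cf) => x dx _; rewrite normrM (ger0_norm dx) EFinM.
Qed.

(** In the square of a density, one factor [df] is spent on the change of variables and the other is
    bounded by [c ^ 2], so the norm grows by [c] only. *)
Lemma chart_L2N f df h F (c : R) : chart f df h -> rmeas F -> 0 < c ->
  aeL (fun x => df x <= c ^+ 2) ->
  (LpN 2 (fun x => F (f x) * df x)%R <= c%:E * LpN 2 F)%E.
Proof.
move=> cf mF c0 dc; have := LpN_ge0 2 F.
have md : rmeas df by have [_ _ _ /wder_meas] := cf.
have mFf := rmeas_comp mF (chart_meas cf).
have mFd := rmeasM mFf md.
case E : (LpN 2 F) => [l||] // l0; last first.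
  by rewrite gt0_muley ?leey.
rewrite -EFinM; apply/L2N_sqr; first by rewrite mulr_ge0// ltW.
have /L2N_sqr h2 : (LpN 2 F <= l%:E)%E by rewrite E.
move: (h2 l0); rewrite (chart_integral cf (null_rmeas (rmeasX 2 mF)) (fun x => sqr_ge0 _)) => {}h2.
have mdn := rmeas_norm md.
apply: (@le_trans _ _ (\int[mu]_x ((c ^+ 2)%:E * (F (f x) ^+ 2 * `|df x|)%:E))%E).
  apply: ae_ge0_le_integral => //.
  - by move=> x _; rewrite lee_fin sqr_ge0.
  - by apply/measurable_EFinP; exact: rmeasX.
  - by move=> x _; rewrite -EFinM lee_fin mulr_ge0// ?sqr_ge0// mulr_ge0// sqr_ge0.
  - apply: emeasurable_funM => //; apply/measurable_EFinP => //.
    by apply: rmeasM => //; exact: rmeasX.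
  apply: aeL_mp2 dc (chart_ge0 cf) => x d1 d0 _.
  rewrite -EFinM lee_fin exprMn ger0_norm//.
  have -> : c ^+ 2 * (F (f x) ^+ 2 * df x) = F (f x) ^+ 2 * (c ^+ 2 * df x) by ring.
  by apply: ler_wpM2l; rewrite ?sqr_ge0// expr2; apply: ler_wpM2r.
rewrite ge0_integralZl//; last 3 first.
- by apply/measurable_EFinP; apply: rmeasM => //; exact: rmeasX.
- by move=> x _; rewrite lee_fin mulr_ge0// sqr_ge0.
- by rewrite lee_fin sqr_ge0.
rewrite (_ : ((c * l) ^+ 2)%:E = (c ^+ 2)%:E * (l ^+ 2)%:E)%E; last by rewrite exprMn EFinM.
apply: lee_wpmul2l; first by rewrite lee_fin sqr_ge0.
apply: le_trans h2; rewrite le_eqVlt; apply/orP; left; apply/eqP.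
apply: ae_eq_integral => //.
- by apply/measurable_EFinP; apply: rmeasM => //; exact: rmeasX.
- by apply: emeasurable_funM; apply/measurable_EFinP => //; exact: rmeasX.
- by apply: aeL_mp (chart_ge0 cf) => x dx _; rewrite /= ger0_norm// EFinM.
Qed.

End change_of_variables.

(** * Integral inequalities *)

Section analysis.
Context {R : realType}.
Implicit Types (f g h : R -> R) (a b c t : R).
Local Notation mu := (@lebesgue_measure R).

(** Weighted sums are encoded as lists, so that Minkowski's inequality is iterated once and for all
    in [LpN_wsum]. In [wbounds] each entry holds a coefficient, a function and a bound on its
    norm. *)
Fixpoint wsum (s : seq (R * R)) : R :=
  if s is (c, x) :: s' then c * x + wsum s' else 0.

Fixpoint wbounds (p : R) (s : seq (R * (R -> R) * R)) : Prop :=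
  if s is ((c, f), n) :: s' then
    [/\ 0 <= c, rmeas f, (LpN p f <= n%:E)%E & wbounds p s'] else True.

Lemma LpN_wsum p f (s : seq (R * (R -> R) * R)) : 1 <= p -> rmeas f -> wbounds p s ->
  aeL (fun x => `|f x| <= wsum [seq (z.1.1, `|z.1.2 x|) | z <- s]) ->
  (LpN p f <= (wsum [seq (z.1.1, z.2) | z <- s])%:E)%E.
Proof.
move=> p1 mf ws; have p0 : 0 < p by lra.
pose g x := wsum [seq (z.1.1, `|z.1.2 x|) | z <- s].
suff [mg g0 hg] : [/\ rmeas g, forall x, 0 <= g x & (LpN p g <= (wsum [seq (z.1.1, z.2) | z <- s])%:E)%E].
  move=> h; apply: le_trans hg; apply: LpN_le => //.
  by apply: aeL_mp h => x hx; rewrite (ger0_norm (g0 x)).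
rewrite {}/g; elim: s ws {f mf} => [_|[[c f] n] s IH /= [c0 mf fn ws]].
  split=> //; first exact: rmeas_cst.
  by rewrite /LpN; have := @Lnorm0 _ _ _ mu p%:E => ->//; rewrite eqe gt_eqF.
have {IH} [mg g0 hg] := IH ws; split.
- by apply: rmeasD => //; apply: rmeasZ; exact: rmeas_norm.
- by move=> x; rewrite addr_ge0// mulr_ge0.
apply: LpND => //; first by apply: rmeasZ; exact: rmeas_norm.
rewrite LpNZ//; last exact: rmeas_norm.
rewrite (ger0_norm c0) EFinM; apply: lee_wpmul2l; first by rewrite lee_fin.
apply: le_trans fn; apply: LpN_le => //; first exact: rmeas_norm.
by apply: aeLT => x; rewrite normr_id.
Qed.

Lemma half_diff_le (I1 I2 J1 J2 c : R) : `|I1| <= J1 -> `|I2| <= J2 -> J1 + J2 <= c ->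
  `|2^-1 * I1 - 4^-1 * (I1 + I2)| <= c / 4.
Proof.
move=> i1 i2 j; rewrite (_ : _ - _ = 4^-1 * (I1 - I2)); last by field.
rewrite normrM [`|4^-1|]ger0_norm; last by rewrite invr_ge0 ler0n.
by have := ler_normB I1 I2; lra.
Qed.

Lemma Rint_split f x : mu.-integrable setT (EFin \o f) ->
  \int[mu]_z f z = \int[mu]_(z in `]-oo, x]) f z + \int[mu]_(z in `]x, +oo[) f z.
Proof.
move=> fi; rewrite -Rintegral_setU//.
- by congr (Rintegral _ _ _); rewrite -itv_bndbnd_setU ?bnd_simp// set_itvE.
- by rewrite -itv_bndbnd_setU ?bnd_simp// set_itvE.
- by apply/disj_setPS => z [/=]; rewrite !in_itv/= andbT => h1 h2; lra.
Qed.

(** The expression is a quarter of the integral over the left half-line minus that over the right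
    one, hence at most a quarter of the [L1] norm. Bounding its two terms separately would lose a
    factor 3. *)
Lemma half_int f x (c : R) : mu.-integrable setT (EFin \o f) -> (LpN 1 f <= c%:E)%E ->
  `|2^-1 * \int[mu]_(z in `]-oo, x]) f z - 4^-1 * \int[mu]_z f z| <= c / 4.
Proof.
move=> fi; rewrite L1NE => fc.
have fa : mu.-integrable setT (EFin \o (fun z => `|f z|)) by exact: (integrable_norm fi).
have fS (g : R -> R) (D : set R) : measurable D -> mu.-integrable setT (EFin \o g) -> mu.-integrable D (EFin \o g).
  by move=> mD; apply: integrableS.
have h1 : `|\int[mu]_(z in `]-oo, x]) f z| <= \int[mu]_(z in `]-oo, x]) `|f z|.
  by apply: le_normr_Rintegral => //; exact: fS.
have h2 : `|\int[mu]_(z in `]x, +oo[) f z| <= \int[mu]_(z in `]x, +oo[) `|f z|.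
  by apply: le_normr_Rintegral => //; exact: fS.
have h3 : \int[mu]_z `|f z| <= c.
  by rewrite -lee_fin /Rintegral fineK//; exact: integrable_fin_num.
rewrite (Rint_split x fi); rewrite (Rint_split x fa) in h3.
exact: half_diff_le h1 h2 h3.
Qed.

Lemma Rint_itv_bound g t c : 0 <= t -> mu.-integrable `[0, t] (EFin \o g) ->
  (forall s, 0 <= s <= t -> `|g s| <= c) -> `|\int[mu]_(s in `[0, t]) g s| <= t * c.
Proof.
move=> t0 ig gc; apply: le_trans (le_normr_Rintegral _ ig) _ => //.
have mt : mu `[0, t]%classic = t%:E by rewrite lebesgue_itvcc// subr0.
apply: (@le_trans _ _ (\int[mu]_(s in `[0, t]) c)).
  apply: le_Rintegral => //; first exact: integrable_norm.
  - apply: continuous_compact_integrable; first exact: segment_compact.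
    by apply: continuous_subspaceT => x; exact: cvg_cst.
by rewrite Rintegral_cst// [X in fine X](_ : _ = t%:E)//= mulrC.
Qed.

(** The kernel of the Gronwall step, used with [c = a * M / 4]. *)
Lemma int_exp_sq (c s : R) : 0 <= s ->
  \int[mu]_(r in `[0, s]) (c * r * expR (c * r ^+ 2 / 2)) = expR (c * s ^+ 2 / 2) - 1.
Proof.
rewrite le_eqVlt => /predU1P[<-|s0].
  by rewrite set_itv1 Rintegral_set1 expr0n/= mulr0 mul0r exp.expR0 subrr.
pose F r : R := expR (c * r ^+ 2 / 2).
have dF (r : R) : is_derive r (1 : R) F (c * r * expR (c * r ^+ 2 / 2)).
  by apply: is_derive_eq; rewrite /GRing.scale/=; field.
have cf : continuous (fun r => c * r * expR (c * r ^+ 2 / 2)).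
  move=> r; apply: cvgM.
    by apply: cvgM; [exact: cvg_cst|exact: cvg_id].
  apply: continuous_comp; last exact: continuous_expR.
  apply: cvgM; last exact: cvg_cst.
  apply: cvgM; first exact: cvg_cst.
  by apply: exprn_continuous.
rewrite /Rintegral (continuous_FTC2 s0 (F := F)).
- by rewrite -EFinB/= /F expr0n/= mulr0 mul0r exp.expR0.
- exact: continuous_subspaceT.
- have cF : continuous F by move=> r; apply: differentiable_continuous; apply/derivable1_diffP; case: (dF r).
  split; first by move=> r _; case: (dF r).
  + by apply: cvg_at_right_filter; exact: cF.
  + by apply: cvg_at_left_filter; exact: cF.
- by move=> r _; rewrite derive1E; have [_ ->] := dF r.
Qed.

(* Iterating the improvement [K -> c0 + (K - c0) * q], [q = 1 - 1 / E T < 1], drives the constant to [c0]. *)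
Lemma gronwall (D : R -> R -> R) (E : R -> R) (c0 K0 T : R) : 0 <= T -> c0 <= K0 ->
  (forall s, 0 <= s <= T -> 1 <= E s <= E T) ->
  (forall K, c0 <= K -> aeL (fun x => forall s, 0 <= s <= T -> `|D x s| <= K * E s) ->
     aeL (fun x => forall s, 0 <= s <= T -> `|D x s| <= c0 + K * (E s - 1))) ->
  aeL (fun x => forall s, 0 <= s <= T -> `|D x s| <= K0 * E s) ->
  aeL (fun x => forall s, 0 <= s <= T -> `|D x s| <= c0 * E s).
Proof.
move=> T0 cK0 E1 step base.
have /andP[ET1 _] := E1 T ltac:(by rewrite T0 lexx).
have ET0 : 0 < E T by lra.
pose q := 1 - (E T)^-1.
have iE0 : 0 < (E T)^-1 by rewrite invr_gt0.
have iE1 : (E T)^-1 <= 1 by rewrite invf_le1.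
have q0 : 0 <= q by rewrite /q; lra.
have q1 : q < 1 by rewrite /q; lra.
have P n : aeL (fun x => forall s, 0 <= s <= T -> `|D x s| <= (c0 + q ^+ n * (K0 - c0)) * E s).
  elim: n => [|n IH]; first by apply: aeL_mp base => x h s /h; rewrite expr0 mul1r addrC subrK.
  have Kc : c0 <= c0 + q ^+ n * (K0 - c0) by rewrite lerDl mulr_ge0 ?exprn_ge0//; lra.
  have := step _ Kc IH; apply: aeL_mp => x h s sT; apply: le_trans (h s sT) _.
  have /andP[Es1 EsT] := E1 s sT.
  set d := q ^+ n * (K0 - c0); have d0 : 0 <= d by rewrite /d mulr_ge0 ?exprn_ge0//; lra.
  rewrite (_ : q ^+ n.+1 * (K0 - c0) = d - d * (E T)^-1); last by rewrite /d /q exprS; ring.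
  have : d * ((E T)^-1 * E s) <= d * 1.
    by apply: ler_wpM2l => //; rewrite mulrC ler_pdivrMr// mul1r.
  by move=> ?; lra.
have := aeL_all P; apply: aeL_mp => x h s sT.
have /andP[Es1 EsT] := E1 s sT.
have cv : (c0 + q ^+ n * (K0 - c0)) * E s @[n --> \oo] --> (c0 + 0 * (K0 - c0)) * E s.
  apply: cvgM; last exact: cvg_cst.
  apply: cvgD; first exact: cvg_cst.
  apply: cvgM; last exact: cvg_cst.
  by apply: cvg_expr; rewrite ger0_norm.
rewrite mul0r addr0 in cv; rewrite -(cvg_lim (@Rhausdorff R) cv).
apply: limr_ge; first by apply/cvg_ex; exists (c0 * E s).
by apply: nearW => n; exact: h.
Qed.

Lemma integrable_dom (D : set R) f h : measurable D -> rmeas f ->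
  mu.-integrable D (EFin \o h) -> (forall x, D x -> `|f x| <= `|h x|) ->
  mu.-integrable D (EFin \o f).
Proof.
move=> mD mf ih fh; apply: le_integrable ih => //.
by apply/measurable_EFinP; exact: measurable_funTS.
Qed.

(** * Exchange of the integrals in time and in the label *)

Section half_fubini.
Variables (P : R -> R -> R) (h : R -> R) (t : R) (X : set R).
Hypotheses (mX : measurable X) (t0 : 0 <= t).
Hypothesis mP : measurable_fun (T := (measurableTypeR R * measurableTypeR R)%type)
  (U := measurableTypeR R) setT (fun z => P z.1 z.2).
Hypothesis ih : mu.-integrable setT (EFin \o h).
Hypothesis Ph : forall x s, 0 <= s <= t -> `|P x s| <= `|h x|.

Let mPx x : rmeas (P x).
Proof. exact: (measurableT_comp mP (pair1_measurable x)). Qed.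

Let mPs s : rmeas (P^~ s).
Proof. exact: (measurableT_comp mP (pair2_measurable s)). Qed.

Lemma section_integrable x : mu.-integrable `[0, t] (EFin \o P x).
Proof.
apply: (@integrable_dom _ _ (fun=> h x)) => //.
  apply: continuous_compact_integrable; first exact: segment_compact.
  by apply: continuous_subspaceT => y; exact: cvg_cst.
by move=> s /=; rewrite in_itv/=; exact: Ph.
Qed.

(** Indicators extend the integrand to the whole product, where Fubini's theorem applies to total
    integrals. *)
Let f z : \bar R := (\1_X z.1 * (\1_(`[0, t]%classic : set R) z.2 * P z.1 z.2))%:E.

Let mf : measurable_fun (T := (measurableTypeR R * measurableTypeR R)%type) setT f.
Proof.
apply/measurable_EFinP; apply: measurable_funM.
  by apply: (measurableT_comp (@measurable_indic _ (measurableTypeR R) R setT X mX)); exact: measurable_fst.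
apply: measurable_funM => //.
apply: (measurableT_comp (@measurable_indic _ (measurableTypeR R) R setT (`[0, t]%classic : set R) _)) => //.
Qed.

Let FE x : (\int[mu]_s f (x, s))%E = (\1_X x * \int[mu]_(s in `[0, t]) P x s)%:E.
Proof.
rewrite /f/=; under eq_integral do rewrite EFinM.
have i2 : mu.-integrable setT (fun s => (\1_(`[0, t]%classic : set R) s * P x s)%:E).
  have := section_integrable x => /(integrable_mkcond _ _) -/(_ ltac:(exact: measurable_itv)).
  by apply: eq_integrable => // s _; rewrite /patch indicE; case: ifP; rewrite ?mul1r ?mul0r.
rewrite integralZl// EFinM; congr (_ * _)%E.
rewrite /Rintegral fineK; last exact: integrable_fin_num (section_integrable x).
rewrite [RHS]integral_mkcond; apply: eq_integral => s _.
by rewrite /patch indicE; case: ifP; rewrite ?mul1r ?mul0r.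
Qed.

Let GE s : (\int[mu]_x f (x, s))%E =
  (\1_(`[0, t]%classic : set R) s * \int[mu]_(x in X) P x s)%:E.
Proof.
rewrite indicE /f/=; case: (boolP (s \in (`[0, t]%classic : set R))) => st; last first.
  rewrite mul0r; apply: integral0_eq => x _; by rewrite !indicE (negbTE st) mul0r mulr0.
have is_ : mu.-integrable X (EFin \o P^~ s).
  apply: (@integrable_dom _ _ h) => //; first exact: integrableS ih.
  by move=> x _; apply: Ph; move: st; rewrite inE/= in_itv.
rewrite mul1r /Rintegral fineK; last exact: integrable_fin_num is_.
rewrite [RHS]integral_mkcond; apply: eq_integral => x _.
by rewrite /patch !indicE st mul1r; case: ifP; rewrite ?mul1r ?mul0r.
Qed.

Let fint : (mu \x mu)%E.-integrable setT f.
Proof.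
apply/integrable12ltyP; first exact: mf.
apply: (@le_lt_trans _ _ (\int[mu]_x (t * `|h x|)%:E)%E); last first.
  under eq_integral do rewrite EFinM.
  have /integrableP[_ hlt] := ih.
  rewrite ge0_integralZl ?lte_mul_pinfty//.
  by apply/measurable_EFinP; apply: measurableT_comp => //; apply/measurable_EFinP; exact: measurable_int ih.
apply: ge0_le_integral => //.
- by move=> x _; exact: integral_ge0.
- have ma : measurable_fun (T := (measurableTypeR R * measurableTypeR R)%type) setT (abse \o f).
    exact: measurableT_comp.
  exact: (measurable_fun_fubini_tonelli_F (m2 := mu) (abse \o f) ma (fun z => abse_ge0 _)).
- apply/measurable_EFinP; apply: measurable_funM => //; apply: measurableT_comp => //.
  by apply/measurable_EFinP; exact: measurable_int ih.
move=> x _.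
have le1 : (\int[mu]_s `|f (x, s)| <= \int[mu]_(s in `[0%R, t]) (`|h x|)%:E)%E.
  rewrite [leRHS]integral_mkcond; apply: ge0_le_integral => //.
  - apply: measurableT_comp => //; exact: (measurableT_comp mf (pair1_measurable x)).
  - have mt : measurable (`[0, t]%classic : set (measurableTypeR R)) by exact: measurable_itv.
    by apply/(measurable_restrictT _ mt); exact: measurable_cst.
  move=> s _; rewrite /f /patch /= !indicE.
  case: (boolP (s \in (`[0, t]%classic : set R))) => st; rewrite ?lee_fin; last first.
    by rewrite mul0r mulr0 normr0.
  rewrite mul1r normrM; have hP : `|P x s| <= `|h x| by apply: Ph; move: st; rewrite inE/= in_itv.
  by case: (x \in X); rewrite ?normr1 ?normr0 ?mul1r ?mul0r.
apply: (le_trans le1).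
by rewrite integral_cst// [X in (_ * X)%E](_ : _ = t%:E) -?EFinM 1?mulrC// [LHS]lebesgue_itvcc// subr0.
Qed.

Lemma half_fubini_integrable_t : mu.-integrable `[0, t] (EFin \o (fun s => \int[mu]_(x in X) P x s)).
Proof.
have mG : rmeas (fun s => \1_(`[0, t]%classic : set R) s * \int[mu]_(x in X) P x s).
  apply/measurable_EFinP; rewrite (_ : EFin \o _ = fubini_G mu f); first exact: (measurable_fubini_G fint).
  by apply/funext => s; rewrite /= /fubini_G GE.
pose c := \int[mu]_(x in X) `|h x|.
have ih' : mu.-integrable X (EFin \o (fun x => `|h x|)).
  have iX : mu.-integrable X (EFin \o h) by exact: integrableS ih.
  exact: (integrable_norm iX).
suff : mu.-integrable `[0, t] (EFin \o (fun s => \1_(`[0, t]%classic : set R) s * \int[mu]_(x in X) P x s)).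
  by apply: eq_integrable => // s st; rewrite /= indicE st mul1r.
apply: (@integrable_dom _ _ (fun=> c)) => //.
  apply: continuous_compact_integrable; first exact: segment_compact.
  by apply: continuous_subspaceT => y; exact: cvg_cst.
move=> s st; rewrite indicE mem_set// mul1r.
have is_ : mu.-integrable X (EFin \o P^~ s).
  apply: (@integrable_dom _ _ h) => //; first exact: integrableS ih.
  by move=> x _; apply: Ph; move: st; rewrite /= in_itv.
apply: le_trans (le_normr_Rintegral _ is_) _ => //; apply: le_trans (ler_norm _).
apply: le_Rintegral => //; first exact: integrable_norm.
by move=> x _; apply: Ph; move: st; rewrite /= in_itv.
Qed.


Lemma half_fubini : \int[mu]_(s in `[0, t]) (\int[mu]_(x in X) P x s) =
  \int[mu]_(x in X) (\int[mu]_(s in `[0, t]) P x s).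
Proof.
rewrite /Rintegral; congr fine.
rewrite [LHS]integral_mkcond [RHS]integral_mkcond.
transitivity (\int[mu]_s \int[mu]_x f (x, s))%E.
  by apply: eq_integral => s _; rewrite GE /patch indicE; case: ifP; rewrite ?mul1r ?mul0r.
rewrite -Fubini//.
by apply: eq_integral => x _; rewrite FE /patch indicE; case: ifP; rewrite ?mul1r ?mul0r.
Qed.

End half_fubini.

End analysis.

(** * Comparison of two flows *)

(* [flD] marks the breaking characteristics, [fltau] is their breaking time, and [flK] is the
   energy density lost there. *)
Record flow (R : realType) := Flow { fly : R -> R -> R; flU : R -> R -> R;
  flyx : R -> R; flUx : R -> R; flHx : R -> R; flr : R -> R; flK : R -> R;
  flD : R -> bool; fltau : R -> R; flHinf : R }.

Definition lagof (R : realType) (F : flow R) (x : R) : @lag R :=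
  Lag (flyx F x) (flUx F x) (flHx F x) (flU F x 0) (flHinf F) (fltau F x) (flD F x) (fly F x).

(** The time integral of [V_xi]: what the initial density would accumulate, minus what is missing
    since the breaking time. *)
Definition gain (R : realType) (F : flow R) (x s : R) : R :=
  s * flHx F x - flK F x * posp (s - fltau F x).

(** The equation for [U] is stated with the time integral of [V_xi] already carried out, which frees
    the comparison from Fubini's theorem. The pointwise relations between derivatives are gathered
    in the last field and hold almost everywhere. *)
Record flow_ok (R : realType) (alpha : R -> R) (M : R) (F : flow R) : Prop := FlowOk {
  ok_meas : [/\ rmeas (flyx F), rmeas (flUx F), rmeas (flHx F), rmeas (flr F) & rmeas (flK F)];
  ok_measD : measurable_fun (T := measurableTypeR R) setT (flD F);
  ok_meastau : rmeas (fltau F);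
  ok_measyU : forall s, 0 <= s -> rmeas ((fly F)^~ s) /\ rmeas ((flU F)^~ s);
  ok_tau : forall x, 0 <= fltau F x;
  ok_int : (@lebesgue_measure R).-integrable setT (EFin \o flHx F);
  ok_Hinf : \int[@lebesgue_measure R]_x flHx F x = flHinf F;
  ok_HinfM : 0 <= flHinf F <= M;
  ok_U : forall x s, 0 <= s -> flU F x s = flU F x 0 +
    (2^-1 * \int[@lebesgue_measure R]_(z in `]-oo, x]) gain F z s -
     4^-1 * \int[@lebesgue_measure R]_z gain F z s);
  ok_y : forall x s, 0 <= s -> (@lebesgue_measure R).-integrable `[0, s] (EFin \o flU F x) /\
    fly F x s = fly F x 0 + \int[@lebesgue_measure R]_(r in `[0, s]) flU F x r;
  ok_ae : aeL (fun x => [/\ 0 <= flyx F x, 0 <= flHx F x, 0 <= flK F x <= flHx F x,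
    flUx F x ^+ 2 <= flyx F x * flHx F x &
    [/\ flD F x -> flHx F x * fltau F x = - 2 * flUx F x,
        flD F x -> flyx F x = flHx F x * fltau F x ^+ 2 / 4 &
        flK F x = if flD F x then flHx F x * alpha (fly F x (fltau F x)) else 0]]) }.

Section flow_facts.
Context {R : realType}.
Variables (alpha : R -> R) (M : R) (F : flow R).
Hypothesis okF : flow_ok alpha M F.
Local Notation mu := (@lebesgue_measure R).

Lemma int_lin (c s : R) : 0 <= s -> \int[mu]_(r in `[0, s]) (c * r) = c * s ^+ 2 / 2.
Proof.
rewrite le_eqVlt => /predU1P[<-|s0].
  by rewrite set_itv1 Rintegral_set1 expr0n/= mulr0 mul0r.
pose G r : R := c * r ^+ 2 / 2.
have dG (r : R) : is_derive r (1 : R) G (c * r).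
  by apply: is_derive_eq; rewrite /GRing.scale/=; field.
have cG : continuous G by move=> r; apply: differentiable_continuous; apply/derivable1_diffP; case: (dG r).
rewrite /Rintegral (continuous_FTC2 s0 (F := G)).
- by rewrite -EFinB/= /G expr0n/= mulr0 mul0r subr0.
- apply: continuous_subspaceT => r.
  by apply: cvgM; [exact: cvg_cst|exact: cvg_id].
- split; first by move=> r _; case: (dG r).
  + by apply: cvg_at_right_filter; exact: cG.
  + by apply: cvg_at_left_filter; exact: cG.
- by move=> r _; rewrite derive1E; have [_ ->] := dG r.
Qed.

Lemma rmeas_posp (f : R -> R) : rmeas f -> rmeas (fun x => posp (f x)).
Proof. by move=> mf; apply: measurable_maxr => //; exact: rmeas_cst. Qed.

Lemma rmeas_gain s : rmeas (fun x => gain F x s).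
Proof.
have [_ _ mH _ mK] := ok_meas okF.
apply: rmeasB; first exact: rmeasZ.
apply: rmeasM => //; apply: rmeas_posp; apply: rmeasB; first exact: rmeas_cst.
exact: ok_meastau okF.
Qed.

Lemma gain_bound : aeL (fun x => forall s, 0 <= s -> 0 <= gain F x s <= s * flHx F x).
Proof.
apply: aeL_mp (ok_ae okF) => x [_ H0 /andP[K0 KH] _ _] s s0.
have t0 := ok_tau okF x.
have p0 := posp_ge0 (s - fltau F x).
have p1 : posp (s - fltau F x) <= s by apply: posp_le => //; lra.
rewrite /gain; apply/andP; split; last by rewrite gerBl mulr_ge0.
rewrite subr_ge0 [s * _]mulrC; exact: ler_pM.
Qed.

Lemma Hx_L1 : (LpN 1 (flHx F) <= (flHinf F)%:E)%E.
Proof.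
have [_ _ mH _ _] := ok_meas okF.
rewrite L1NE -(ok_Hinf okF) /Rintegral fineK; last exact: integrable_fin_num (ok_int okF).
rewrite le_eqVlt; apply/orP; left; apply/eqP; apply: ae_eq_integral => //.
- by apply/measurable_EFinP; exact: rmeas_norm.
- by apply/measurable_EFinP.
- by apply: aeL_mp (ok_ae okF) => x [_ H0 _ _ _] _; rewrite /= ger0_norm.
Qed.

Lemma gain_L1 s : 0 <= s -> (LpN 1 (fun x => gain F x s) <= (s * flHinf F)%:E)%E.
Proof.
move=> s0; have [_ _ mH _ _] := ok_meas okF.
have hH := Hx_L1.
have := @LpN_wsum R 1 (fun x => gain F x s) [:: ((s, flHx F), flHinf F)].
rewrite /= addr0; apply => //; first exact: rmeas_gain.
apply: aeL_mp2 gain_bound (ok_ae okF) => x /(_ s s0)/andP[g0 g1] [_ H0 _ _ _].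
by rewrite addr0 !ger0_norm.
Qed.

Lemma gain_integrable s : 0 <= s -> mu.-integrable setT (EFin \o (fun x => gain F x s)).
Proof.
move=> s0; apply/integrableP; split; first by apply/measurable_EFinP; exact: rmeas_gain.
have := gain_L1 s0; rewrite L1NE => /le_lt_trans; apply; exact: ltry.
Qed.

Lemma flU_diff x s : 0 <= s -> `|flU F x s - flU F x 0| <= s * flHinf F / 4.
Proof.
move=> s0; rewrite (ok_U okF)// addrAC subrr add0r.
exact: half_int (gain_integrable s0) (gain_L1 s0).
Qed.

Lemma fly_diff x s s' t : 0 <= s <= t -> 0 <= s' <= t ->
  `|fly F x s - fly F x s'| <= `|s - s'| * (`|flU F x 0| + t * M / 4).
Proof.
have [i0 iM] := andP (ok_HinfM okF).
wlog ss : s s' / s' <= s.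
  move=> h h1 h2; have [c|c] := leP s' s; first exact: h.
  by rewrite distrC [`|s - s'|]distrC; apply: h => //; exact: ltW.
move=> /andP[s0 st] /andP[s0' st'].
have [ii ->] := ok_y okF x s0; have [ii' ->] := ok_y okF x s0'.
rewrite (_ : _ - _ = \int[mu]_(r in `[0, s]) flU F x r - \int[mu]_(r in `[0, s']) flU F x r); last by ring.
rewrite (Rintegral_itvB ii) ?bnd_simp//.
rewrite Rintegral_itv_obnd_cbnd; last first.
  by apply: integrableS ii => //; apply: subset_itvr; rewrite bnd_simp.
have iS : mu.-integrable `[s', s] (EFin \o flU F x).
  by apply: integrableS ii => //; apply: subset_itvr; rewrite bnd_simp.
apply: le_trans (le_normr_Rintegral _ iS) _ => //.
apply: (@le_trans _ _ (\int[mu]_(r in `[s', s]) (`|flU F x 0| + t * M / 4))).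
  apply: le_Rintegral => //; first exact: integrable_norm.
    apply: continuous_compact_integrable; first exact: segment_compact.
    by apply: continuous_subspaceT => y; exact: cvg_cst.
  move=> r; rewrite /= in_itv/= => /andP[r1 r2].
  have r0 : 0 <= r by lra.
  have := flU_diff x r0; have := ler_normD (flU F x 0) (flU F x r - flU F x 0).
  rewrite addrC subrK => h1 h2.
  have : r * flHinf F <= t * M by apply: ler_pM => //; lra.
  lra.
rewrite Rintegral_cst// [X in fine X](_ : _ = (s - s')%:E); last exact: lebesgue_itvcc.
by rewrite /= (ger0_norm (_ : 0 <= s - s')) ?subr_ge0// mulrC.
Qed.

Lemma fly_diff0 x s : 0 <= s ->
  `|fly F x s - fly F x 0| <= s * `|flU F x 0| + s ^+ 2 * flHinf F / 8.
Proof.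
move=> s0; have [ii ->] := ok_y okF x s0; rewrite addrAC subrr add0r.
have ci (g : R -> R) : continuous g -> mu.-integrable `[0, s] (EFin \o g).
  move=> cg; apply: continuous_compact_integrable; first exact: segment_compact.
  exact: continuous_subspaceT.
have cc (c : R) : continuous (fun _ : R => c) by move=> y; exact: cvg_cst.
have cl : continuous (fun r => flHinf F / 4 * r).
  by move=> r; apply: cvgM; [exact: cvg_cst|exact: cvg_id].
apply: le_trans (le_normr_Rintegral _ ii) _ => //.
apply: (@le_trans _ _ (\int[mu]_(r in `[0, s]) (`|flU F x 0| + flHinf F / 4 * r))).
  apply: le_Rintegral => //; first exact: integrable_norm.
    by apply: ci => y; apply: cvgD; [exact: cc|exact: cl].
  move=> r; rewrite /= in_itv/= => /andP[r0 r2].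
  have := flU_diff x r0; have := ler_normD (flU F x 0) (flU F x r - flU F x 0).
  rewrite addrC subrK; lra.
have -> : \int[mu]_(r in `[0, s]) (`|flU F x 0| + flHinf F / 4 * r) =
    \int[mu]_(r in `[0, s]) `|flU F x 0| + \int[mu]_(r in `[0, s]) (flHinf F / 4 * r).
  by apply: RintegralD => //; [exact: ci (cc _)|exact: ci cl].
rewrite int_lin// Rintegral_cst// [X in fine X](_ : _ = s%:E).
  by rewrite /=; lra.
by rewrite [LHS]lebesgue_itvcc// subr0.
Qed.

Lemma lagof_ok : aeL (fun x => forall t, 0 <= t -> lag_ok M t (lagof F x)).
Proof.
apply: aeL_mp (ok_ae okF) => x [y0 H0 _ _ [h1 h2 _]] t t0; split => //=.
- exact: ok_HinfM okF.
- exact: ok_tau okF x.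
split => //; first by move=> s /andP[s0 st]; exact: fly_diff0.
by move=> s s' h h'; exact: fly_diff.
Qed.

(** Before breaking both positive parts vanish. Afterwards the free slope is [H_xi * (s - tau) / 2]
    and [alpha] is frozen at the breaking position, as in [flK]. *)
Lemma gain_energy : aeL (fun x => forall s, 0 <= s -> gain F x s = energy_gain alpha (lagof F x) s).
Proof.
apply: aeL_mp (ok_ae okF) => x [_ H0 _ _ [h1 _ hK]] s s0.
rewrite /gain /energy_gain /loss /= hK; case: ifP h1 => D; last by rewrite !mul0r mulr0.
move=> /(_ isT) e; congr (_ - _).
have -> : free_slope (lagof F x) s = flHx F x / 2 * (s - fltau F x).
  by rewrite /free_slope /=; lra.
have [c|c] := leP (fltau F x) s.
  rewrite /posp !max_l; [by field|nra|lra].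
by rewrite /posp !max_r ?mulr0//; [nra|lra].
Qed.

Lemma gain_mono : aeL (fun x => forall s, 0 <= s ->
  slope alpha (lagof F x) s = flUx F x + gain F x s / 2).
Proof. by apply: aeL_mp gain_energy => x h s s0; rewrite slope_energy h. Qed.

End flow_facts.

(** * Two flows in a common label *)

Definition g10 (R : realType) (alpha : R -> R) (F : flow R) (x : R) : R :=
  flyx F x + (1 - (if flD F x then alpha (fly F x 0) else 0)) * flHx F x.
Definition g20 (R : realType) (a : R) (F : flow R) (x : R) : R :=
  if flD F x then a * flHinf F * negp (flUx F x) else 0.
Definition g30 (R : realType) (a : R) (F : flow R) (x : R) : R :=
  if flD F x then a * flU F x 0 * negp (flUx F x) else 0.
Definition Z0 (R : realType) (F Fb : flow R) (x : R) : R :=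
  Num.sqrt ((flyx F x - flyx Fb x) ^+ 2 + (flUx F x - flUx Fb x) ^+ 2 +
    (flHx F x - flHx Fb x) ^+ 2 + (flr F x - flr Fb x) ^+ 2).

Section core.
Context {R : realType}.
Variables (alpha : R -> R) (a M : R) (F Fb : flow R).
Local Notation mu := (@lebesgue_measure R).
Hypotheses (a0 : 0 <= a) (M0 : 0 <= M).
Hypothesis alpha01 : forall z, 0 <= alpha z <= 1.
Hypothesis alphaL : forall z z', `|alpha z - alpha z'| <= a * `|z - z'|.
Hypotheses (okF : flow_ok alpha M F) (okFb : flow_ok alpha M Fb).
Hypothesis one : aeL (fun x => flyx Fb x + flHx Fb x = 1).
Variables n1 n2 n3 n4 n5 n6 n7 n8 : R.
Hypothesis hn1 : aeL (fun x => `|fly F x 0 - fly Fb x 0| <= n1).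
Hypothesis hn2 : aeL (fun x => `|flU F x 0 - flU Fb x 0| <= n2).
Hypothesis hn3 : (LpN 2 (fun x => a * (flU F x 0 * flHx F x - flU Fb x 0 * flHx Fb x))%R <= n3%:E)%E.
Hypothesis hn4 : (LpN 1 (fun x => flHx F x - flHx Fb x)%R <= n4%:E)%E.
Hypothesis hn5 : (LpN 2 (Z0 F Fb) <= n5%:E)%E.
Hypothesis hn6 : (LpN 2 (fun x => g10 alpha F x - g10 alpha Fb x)%R <= n6%:E)%E.
Hypothesis hn7 : (LpN 2 (fun x => g20 a F x - g20 a Fb x)%R <= n7%:E)%E.
Hypothesis hn8 : (LpN 2 (fun x => g30 a F x - g30 a Fb x)%R <= n8%:E)%E.

Local Notation m := (Num.sqrt M).

Lemma alpha_cont : continuous alpha.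
Proof.
move=> z; apply/cvgrPdist_le => e e0; have a1 : 0 < a + 1 by rewrite ltr_wpDl.
have ea : 0 < e / (a + 1) by rewrite divr_gt0.
near=> y; apply: le_trans (alphaL _ _) _.
have : `|z - y| <= e / (a + 1) by near: y; apply: cvgr_dist_le.
rewrite ler_pdivlMr// => h; apply: le_trans h; rewrite mulrC.
by apply: ler_wpM2l => //; rewrite lerDl.
Unshelve. all: by end_near. Qed.

Lemma rmeas_negp (f : R -> R) : rmeas f -> rmeas (fun x => negp (f x)).
Proof. by move=> mf; apply: measurable_minr => //; exact: rmeas_cst. Qed.

Lemma rmeas_g10 G : flow_ok alpha M G -> rmeas (g10 alpha G).
Proof.
move=> ok; have [my mU mH _ _] := ok_meas ok; have [m0 _] := ok_measyU ok (lexx 0).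
apply: rmeasD => //; apply: rmeasM => //; apply: rmeasB; first exact: rmeas_cst.
apply: rmeas_if; [exact: ok_measD ok| |exact: rmeas_cst].
exact: rmeas_comp (rmeas_cont alpha_cont) m0.
Qed.

Lemma rmeas_g20 G : flow_ok alpha M G -> rmeas (g20 a G).
Proof.
move=> ok; have [my mU mH _ _] := ok_meas ok.
apply: rmeas_if; [exact: ok_measD ok| |exact: rmeas_cst].
by apply: rmeasZ; exact: rmeas_negp.
Qed.

Lemma rmeas_g30 G : flow_ok alpha M G -> rmeas (g30 a G).
Proof.
move=> ok; have [my mU mH _ _] := ok_meas ok; have [_ m0] := ok_measyU ok (lexx 0).
apply: rmeas_if; [exact: ok_measD ok| |exact: rmeas_cst].
by apply: rmeasM; [exact: rmeasZ|exact: rmeas_negp].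
Qed.

Lemma rmeas_Z0 : rmeas (Z0 F Fb).
Proof.
have [my mU mH mr _] := ok_meas okF; have [myb mUb mHb mrb _] := ok_meas okFb.
apply: (rmeas_comp (rmeas_cont (@sqrt_continuous R))).
by do 3![apply: rmeasD; last by apply: rmeasX; exact: rmeasB]; apply: rmeasX; exact: rmeasB.
Qed.

Lemma Z0_ge0 x : 0 <= Z0 F Fb x. Proof. exact: sqrtr_ge0. Qed.

(** In the last bound [3 / 2] is a rational substitute for the square root of 2. *)
Lemma Z0_parts x : [/\ `|flyx F x - flyx Fb x| <= Z0 F Fb x,
  `|flUx F x - flUx Fb x| <= Z0 F Fb x, `|flHx F x - flHx Fb x| <= Z0 F Fb x &
  `|flyx F x - flyx Fb x| + `|flHx F x - flHx Fb x| <= 3 / 2 * Z0 F Fb x].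
Proof.
have key (p z : R) : 0 <= z -> p ^+ 2 <= z -> `|p| <= Num.sqrt z.
  by move=> z0 pz; rewrite -sqrtr_sqr ler_sqrt.
have s0 := sqr_ge0 (flyx F x - flyx Fb x); have s1 := sqr_ge0 (flUx F x - flUx Fb x).
have s2 := sqr_ge0 (flHx F x - flHx Fb x); have s3 := sqr_ge0 (flr F x - flr Fb x).
rewrite /Z0; split; [apply: key; lra|apply: key; lra|apply: key; lra|].
set z := (X in Num.sqrt X); set p := flyx F x - _; set q := flHx F x - _.
have z0 : 0 <= z by rewrite /z; lra.
have zz : Num.sqrt z ^+ 2 = z by rewrite sqr_sqrtr.
have sz := sqrtr_ge0 z.
have pq : p ^+ 2 + q ^+ 2 <= z by rewrite /z /p /q; lra.
have e1 : `|p| ^+ 2 = p ^+ 2 by rewrite real_normK ?num_real.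
have e2 : `|q| ^+ 2 = q ^+ 2 by rewrite real_normK ?num_real.
have p0 := normr_ge0 p; have q0 := normr_ge0 q.
rewrite -(ler_pXn2r (n := 2))// ?nnegrE ?addr_ge0 ?mulr_ge0//.
have := sqr_ge0 (`|p| - `|q|); rewrite exprMn zz; nra.
Qed.

Lemma flHx_L1 G : flow_ok alpha M G -> (LpN 1 (flHx G) <= M%:E)%E.
Proof.
move=> ok; apply: le_trans (Hx_L1 ok) _.
by have /andP[_ h] := ok_HinfM ok; rewrite lee_fin.
Qed.

Lemma Hb_le1 : aeL (fun x => 0 <= flHx Fb x <= 1).
Proof. by apply: aeL_mp2 one (ok_ae okFb) => x e [y0 H0 _ _ _]; lra. Qed.

(** The total energy is at most [M], so a function whose square is dominated by [H_xi] has norm at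
    most [sqrt M]. The factors [sqrt M] in the bounds below arise in this way. *)
Lemma L2_of_sq (f : R -> R) : rmeas f -> aeL (fun x => f x ^+ 2 <= flHx Fb x) ->
  (LpN 2 f <= m%:E)%E.
Proof.
move=> mf fH; have [_ _ mH _ _] := ok_meas okFb.
apply/L2N_sqr; first exact: sqrtr_ge0.
rewrite sqr_sqrtr//; have := flHx_L1 okFb; rewrite L1NE; apply: le_trans.
apply: ae_ge0_le_integral => //.
- by move=> x _; rewrite lee_fin sqr_ge0.
- by apply/measurable_EFinP; exact: rmeasX.
- by apply/measurable_EFinP; exact: rmeas_norm.
by apply: aeL_mp fH => x h _; rewrite lee_fin (le_trans h)// ler_norm.
Qed.

Lemma Hb_L2 : (LpN 2 (flHx Fb) <= m%:E)%E.
Proof.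
have [_ _ mH _ _] := ok_meas okFb; apply: L2_of_sq => //.
by apply: aeL_mp Hb_le1 => x /andP[h0 h1]; rewrite expr2 ler_piMl.
Qed.

(** [U_xi ^ 2 <= y_xi * H_xi], and the normalisation of the second state bounds [y_xi] by 1. *)
Lemma Ub_L2 : (LpN 2 (flUx Fb) <= m%:E)%E.
Proof.
have [_ mU _ _ _] := ok_meas okFb; apply: L2_of_sq => //.
apply: aeL_mp2 one (ok_ae okFb) => x e [y0 H0 _ uu _].
by apply: le_trans uu _; rewrite ler_piMl//; lra.
Qed.

(** A pointwise majorant of [err'] plus the difference of [y_xi], in which the differences of
    [y_xi], [U_xi] and [H_xi] are replaced by [Z0]. It does not involve the unknown distance of the
    positions; [rho'] bounds its norm. *)
Definition err0 (s x : R) : R := `|g10 alpha F x - g10 alpha Fb x| +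
  (s / 4 * `|g20 a F x - g20 a Fb x| + (2 * `|g30 a F x - g30 a Fb x| +
  (s * `|a * (flU F x 0 * flHx F x - flU Fb x 0 * flHx Fb x)| +
   (a * s * M / 4 * (2 + s) + 1) * Z0 F Fb x))).

Definition rho' (s : R) : R :=
  n6 + (s / 4 * n7 + (2 * n8 + (s * n3 + (a * s * M / 4 * (2 + s) + 1) * n5))).

Lemma lag_v0 G x : flow_ok alpha M G -> flyx G x + lag_v alpha (lagof G x) 0 = g10 alpha G x.
Proof.
move=> ok; rewrite /lag_v /loss /g10 /=; congr (_ + (1 - _) * _).
by rewrite (min_idPl _)//; exact: ok_tau ok x.
Qed.

Lemma lag_g20 G x : lag_g2 a (lagof G x) 0 = g20 a G x.
Proof. by rewrite /lag_g2 free0. Qed.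

Lemma lag_g30 G x : lag_g3 a (lagof G x) 0 (flU G x 0) = g30 a G x.
Proof. by rewrite /lag_g3 free0. Qed.

Lemma err'_le s x : 0 <= s ->
  err' alpha a M s (lagof F x) (lagof Fb x) + `|flyx F x - flyx Fb x| <= err0 s x.
Proof.
move=> s0; have [z1 z2 z3 _] := Z0_parts x; have z0 := Z0_ge0 x.
rewrite /err' /err0 (lag_v0 _ okF) (lag_v0 _ okFb) !lag_g20 !lag_g30 /=.
have : a * s * M / 4 * (2 * `|flUx F x - flUx Fb x| + s * `|flHx F x - flHx Fb x|) <=
  a * s * M / 4 * ((2 + s) * Z0 F Fb x).
  apply: ler_wpM2l; first by nneg.
  have := ler_wpM2l s0 z3; lra.
by lra.
Qed.

Lemma rmeas_k : rmeas (fun x => a * (flU F x 0 * flHx F x - flU Fb x 0 * flHx Fb x)).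
Proof.
have [_ _ mH _ _] := ok_meas okF; have [_ _ mHb _ _] := ok_meas okFb.
have [_ mu0] := ok_measyU okF (lexx 0); have [_ mub0] := ok_measyU okFb (lexx 0).
by apply: rmeasZ; apply: rmeasB; exact: rmeasM.
Qed.

Lemma err0_bounds s : 0 <= s -> wbounds 2 [:: ((1, fun x => g10 alpha F x - g10 alpha Fb x), n6);
  ((s / 4, fun x => g20 a F x - g20 a Fb x), n7); ((2, fun x => g30 a F x - g30 a Fb x), n8);
  ((s, fun x => a * (flU F x 0 * flHx F x - flU Fb x 0 * flHx Fb x)), n3);
  ((a * s * M / 4 * (2 + s) + 1, Z0 F Fb), n5)].
Proof.
move=> s0; split => //; first by apply: rmeasB; exact: rmeas_g10.
split => //; [by nneg|by apply: rmeasB; exact: rmeas_g20|].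
split => //; first by apply: rmeasB; exact: rmeas_g30.
split => //; first exact: rmeas_k.
split => //; [by nneg|exact: rmeas_Z0].
Qed.

Lemma rmeas_err0 s : rmeas (err0 s).
Proof.
have nm := @rmeas_norm R.
apply: rmeasD; first by apply: nm; apply: rmeasB; exact: rmeas_g10.
apply: rmeasD; first by apply: rmeasZ; apply: nm; apply: rmeasB; exact: rmeas_g20.
apply: rmeasD; first by apply: rmeasZ; apply: nm; apply: rmeasB; exact: rmeas_g30.
apply: rmeasD; first by apply: rmeasZ; apply: nm; exact: rmeas_k.
by apply: rmeasZ; exact: rmeas_Z0.
Qed.

Lemma err0_ge0 s x : 0 <= s -> 0 <= err0 s x.
Proof. by move=> s0; have := Z0_ge0 x => ?; rewrite /err0; nneg. Qed.

Lemma err0_L2 s : 0 <= s -> (LpN 2 (err0 s) <= (rho' s)%:E)%E.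
Proof.
move=> s0; have := @LpN_wsum R 2 (err0 s) _ ltac:(by rewrite ler1n) (rmeas_err0 s) (err0_bounds s0).
rewrite /= mul1r addr0 => -> //.
apply: aeLT => x; rewrite addr0 ger0_norm ?err0_ge0//.
by rewrite mul1r (ger0_norm (Z0_ge0 x)).
Qed.


Hypotheses (n10 : 0 <= n1) (n20 : 0 <= n2).

Lemma n4_ge0 : 0 <= n4.
Proof. by rewrite -lee_fin; apply: le_trans (LpN_ge0 _ _) hn4. Qed.

Lemma n5_ge0 : 0 <= n5.
Proof. by rewrite -lee_fin; apply: le_trans (LpN_ge0 _ _) hn5. Qed.

Lemma n3_ge0 : 0 <= n3.
Proof. by rewrite -lee_fin; apply: le_trans (LpN_ge0 _ _) hn3. Qed.

Lemma n6_ge0 : 0 <= n6.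
Proof. by rewrite -lee_fin; apply: le_trans (LpN_ge0 _ _) hn6. Qed.

Lemma n7_ge0 : 0 <= n7.
Proof. by rewrite -lee_fin; apply: le_trans (LpN_ge0 _ _) hn7. Qed.

Lemma n8_ge0 : 0 <= n8.
Proof. by rewrite -lee_fin; apply: le_trans (LpN_ge0 _ _) hn8. Qed.

Lemma integrableBr (D : set R) (f g : R -> R) : measurable D ->
  mu.-integrable D (EFin \o f) -> mu.-integrable D (EFin \o g) ->
  mu.-integrable D (EFin \o (fun x => f x - g x)).
Proof. by move=> mD fi gi; exact: (integrableB _ fi gi). Qed.

Lemma Hinf_diff : `|flHinf F - flHinf Fb| <= n4.
Proof.
have [_ _ mH _ _] := ok_meas okF; have [_ _ mHb _ _] := ok_meas okFb.
rewrite -(ok_Hinf okF) -(ok_Hinf okFb) -RintegralB//; [|exact: ok_int okF|exact: ok_int okFb].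
have iB : mu.-integrable setT (EFin \o (fun x => flHx F x - flHx Fb x)).
  by apply: integrableBr => //; [exact: ok_int okF|exact: ok_int okFb].
apply: le_trans (le_normr_Rintegral _ iB) _ => //.
have := hn4; rewrite L1NE /Rintegral => h.
by rewrite -lee_fin fineK//; exact: integrable_fin_num (integrable_norm iB).
Qed.

(** Bound for the difference of the two changes of [U], without the contribution of the distance
    [Ay] of the positions, which [w_bound] adds. *)
Definition w0 (s : R) : R := 2^-1 * ((s + s ^+ 3 / 8) * n4 + s / 2 * (m * n5) +
  (1 + s ^+ 2 / 4) * (m * (n5 + s / 2 * rho' s))).

Definition growth (s : R) : R := n5 + s / 2 * rho' s.

Lemma growth_L2 s : 0 <= s ->
  (LpN 2 (fun x => Z0 F Fb x + s / 2 * err0 s x)%R <= (growth s)%:E)%E.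
Proof.
move=> s0; have := @LpN_wsum R 2 (fun x => Z0 F Fb x + s / 2 * err0 s x)
  [:: ((1, Z0 F Fb), n5); ((s / 2, err0 s), rho' s)].
rewrite /= mul1r addr0; apply.
- by rewrite ler1n.
- by apply: rmeasD; [exact: rmeas_Z0|apply: rmeasZ; exact: rmeas_err0].
- split => //; first exact: rmeas_Z0.
  by split => //; [nneg|exact: rmeas_err0|exact: err0_L2].
apply: aeLT => x; have z0 := Z0_ge0 x; have e0 := err0_ge0 x s0.
by rewrite addr0 !ger0_norm//; [lra|nneg].
Qed.

(** The factors [Hb] produced by [energy_diff] make each product integrable by the Cauchy-Schwarz
    inequality. The factor 4 anticipates the quarter in [half_int]. *)
Lemma gain_diff_L1 s Ay : 0 <= s -> 0 <= Ay ->
  aeL (fun x => forall r, 0 <= r <= s -> `|fly F x r - fly Fb x r| <= Ay) ->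
  (LpN 1 (fun x => gain F x s - gain Fb x s)%R <= (4 * (w0 s + s / 4 * (a * M * Ay)))%:E)%E.
Proof.
move=> s0 A0 hA; have [my mU mH _ _] := ok_meas okF; have [myb mUb mHb _ _] := ok_meas okFb.
have m0 : 0 <= m by exact: sqrtr_ge0.
have mB : rmeas (fun x => gain F x s - gain Fb x s).
  by apply: rmeasB; [exact: rmeas_gain okF s|exact: rmeas_gain okFb s].
have mdy : rmeas (fun x => flyx F x - flyx Fb x) by exact: rmeasB.
have mg : rmeas (fun x => Z0 F Fb x + s / 2 * err0 s x).
  by apply: rmeasD; [exact: rmeas_Z0|apply: rmeasZ; exact: rmeas_err0].
have hdy : (LpN 2 (fun x => flyx F x - flyx Fb x)%R <= n5%:E)%E.
  have := @LpN_wsum R 2 _ [:: ((1, Z0 F Fb), n5)] ltac:(by rewrite ler1n) mdy.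
  rewrite /= mul1r addr0; apply; first by split => //; exact: rmeas_Z0.
  apply: aeLT => x; have [h _ _ _] := Z0_parts x.
  by rewrite addr0 mul1r (ger0_norm (Z0_ge0 x)).
have := @LpN_wsum R 1 _ [:: ((2 * (s + s ^+ 3 / 8), fun x => flHx F x - flHx Fb x), n4);
  ((s * (a * Ay), flHx Fb), M); ((s, fun x => flHx Fb x * (flyx F x - flyx Fb x)), m * n5);
  ((2 * (1 + s ^+ 2 / 4), fun x => flHx Fb x * (Z0 F Fb x + s / 2 * err0 s x)), m * growth s)]
  (lexx 1) mB.
move=> h; apply: le_trans (h _ _) _; last by rewrite lee_fin /= /w0 /growth; lra.
  split => //; [by nneg|exact: rmeasB|]; split => //; [by nneg|exact: flHx_L1|].
  split => //; [exact: rmeasM|apply: L1N_mul => //; [exact: Hb_L2]|].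
  split => //; [by nneg|exact: rmeasM|apply: L1N_mul => //; [exact: Hb_L2|exact: growth_L2]].
apply: aeL_mp2 (aeL_and hA (lagof_ok okF)) (aeL_and (aeL_and one (lagof_ok okFb))
  (aeL_and (gain_energy okF) (gain_energy okFb))) => x [close /(_ s s0) ok]
  [[e1 /(_ s s0) okb] [/(_ s s0)-> /(_ s s0)->]].
have {}Hb0 : 0 <= flHx Fb x by case: okb.
have /= := energy_diff s0 a0 M0 A0 alpha01 alphaL ok okb close e1.
have z0 := Z0_ge0 x; have r0 := err0_ge0 x s0; have [_ z2 _ _] := Z0_parts x.
have e' := err'_le x s0.
rewrite !normrM (ger0_norm Hb0) [`|Z0 _ _ _ + _|]ger0_norm; last by nneg.
have : (1 + s ^+ 2 / 4) * flHx Fb x * (`|flUx F x - flUx Fb x| +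
    s / 2 * (err' alpha a M s (lagof F x) (lagof Fb x) + `|flyx F x - flyx Fb x|)) <=
  (1 + s ^+ 2 / 4) * flHx Fb x * (Z0 F Fb x + s / 2 * err0 s x).
  apply: ler_wpM2l; first by nneg.
  by apply: lerD => //; apply: ler_wpM2l => //; nneg.
move=> k1 k2; have := ler_wpM2r (ler0n R 2) (le_trans k2 (lerD (lexx _) k1)).
rewrite mulfVK ?pnatr_eq0// => /le_trans; apply.
by rewrite le_eqVlt; apply/orP; left; apply/eqP; field.
Qed.

Definition w_bound (s Ay : R) : R := w0 s + s / 4 * (a * M * Ay).

Lemma w_diff s Ay x : 0 <= s -> 0 <= Ay ->
  aeL (fun x => forall r, 0 <= r <= s -> `|fly F x r - fly Fb x r| <= Ay) ->
  `|(flU F x s - flU F x 0) - (flU Fb x s - flU Fb x 0)| <= w_bound s Ay.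
Proof.
move=> s0 A0 hA; rewrite (ok_U okF)// (ok_U okFb)//.
have i1 := gain_integrable okF s0; have i2 := gain_integrable okFb s0.
have iB := integrableBr measurableT i1 i2.
have iS (f : R -> R) : mu.-integrable setT (EFin \o f) -> mu.-integrable `]-oo, x] (EFin \o f).
  by apply: integrableS.
have := half_int x iB (gain_diff_L1 s0 A0 hA).
rewrite RintegralB//; [|exact: iS i1|exact: iS i2].
rewrite [\int[_]_z (_ - _)]RintegralB// [4 * _]mulrC mulfK; last by rewrite pnatr_eq0.
rewrite /w_bound; apply: le_trans; rewrite le_eqVlt; apply/orP; left; apply/eqP.
congr `|_|; ring.
Qed.

Lemma w0_mono s t : 0 <= s <= t -> w0 s <= w0 t.
Proof.
move=> /andP[s0 st]; have m0 : 0 <= m by exact: sqrtr_ge0.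
have h4 := n4_ge0; have h5 := n5_ge0; have h3 := n3_ge0; have h7 := n7_ge0.
have h6 := n6_ge0; have h8 := n8_ge0.
have t0 : 0 <= t by apply: le_trans st.
have s2 : s ^+ 2 <= t ^+ 2 by rewrite lerXn2r.
have s3 : s ^+ 3 <= t ^+ 3 by rewrite lerXn2r.
have r0 : 0 <= rho' s by rewrite /rho'; nneg.
have rr : rho' s <= rho' t.
  rewrite /rho' lerD2l; apply: lerD; first by apply: ler_wpM2r => //; lra.
  rewrite lerD2l; apply: lerD; first exact: ler_wpM2r.
  apply: ler_wpM2r => //; rewrite lerD2r; apply: ler_pM; [nneg|nneg| |lra].
  by apply: ler_wpM2r => //; apply: ler_wpM2r => //; exact: ler_wpM2l.
have gg : growth s <= growth t by rewrite /growth lerD2l; apply: ler_pM => //; [nneg|lra].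
have g0 : 0 <= growth s by rewrite /growth; nneg.
rewrite /w0 -/(growth s) -/(growth t); apply: ler_wpM2l; first by rewrite invr_ge0.
apply: lerD; first apply: lerD.
- by apply: ler_wpM2r => //; lra.
- by apply: ler_wpM2r; [nneg|lra].
apply: ler_pM; [nneg|nneg|lra|exact: ler_wpM2l].
Qed.

(** The change of [U] feels the distance [D] of the positions with weight [a * M * s / 4], so [D(s)]
    is at most [c0] plus the integral of [a * M / 4 * r * D(r)] over [[0, s]]. The extremal case of
    this inequality is [c0 * expo]. *)
Definition expo (s : R) : R := expR (a * M / 4 * s ^+ 2 / 2).

Lemma expo_ge1 s : 1 <= expo s.
Proof. by rewrite -exp.expR0 ler_expR; have := sqr_ge0 s => ?; nneg. Qed.

Lemma expo_mono s t : 0 <= s <= t -> expo s <= expo t.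
Proof.
move=> /andP[s0 st]; rewrite ler_expR; apply: ler_wpM2r => //.
by apply: ler_wpM2l; [nneg|rewrite lerXn2r// ?nnegrE; lra].
Qed.

Definition c0 (T : R) : R := n1 + T * (n2 + w0 T).

Lemma w0_ge0 s : 0 <= s -> 0 <= w0 s.
Proof.
move=> s0; have m0 : 0 <= m by exact: sqrtr_ge0.
have h4 := n4_ge0; have h5 := n5_ge0; have h3 := n3_ge0; have h7 := n7_ge0.
have h6 := n6_ge0; have h8 := n8_ge0.
by rewrite /w0 /rho'; nneg.
Qed.

Lemma fly_flow_diff x s : 0 <= s -> mu.-integrable `[0, s] (EFin \o (fun r => flU F x r - flU Fb x r)) /\
  fly F x s - fly Fb x s = (fly F x 0 - fly Fb x 0) + \int[mu]_(r in `[0, s]) (flU F x r - flU Fb x r).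
Proof.
move=> s0; have [i1 ->] := ok_y okF x s0; have [i2 ->] := ok_y okFb x s0.
split; first exact: integrableBr i1 i2.
by rewrite RintegralB//; ring.
Qed.

(** The supremum of the distance over labels is never integrated in time. A bound [K * expo], valid
    for almost every label and all times, is assumed and improved; [w_diff] turns it into a bound
    for the changes of [U] at every label, so one null set serves all times. *)
Lemma y_diff (T : R) : 0 <= T ->
  aeL (fun x => forall s : R, 0 <= s <= T -> `|fly F x s - fly Fb x s| <= c0 T * expo s).
Proof.
move=> T0; have w00 := w0_ge0 T0.
have c00 : 0 <= c0 T by rewrite /c0; nneg.
have start (b : R -> R) : (forall x s, 0 <= s <= T ->
    `|(flU F x s - flU F x 0) - (flU Fb x s - flU Fb x 0)| <= b s) ->
    aeL (fun x => forall s, 0 <= s <= T -> `|flU F x s - flU Fb x s| <= n2 + b s).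
  move=> hb; apply: aeL_mp hn2 => x h s sT.
  rewrite (_ : _ - _ = (flU F x 0 - flU Fb x 0) +
    ((flU F x s - flU F x 0) - (flU Fb x s - flU Fb x 0))); last by ring.
  by apply: le_trans (ler_normD _ _) _; apply: lerD => //; exact: hb.
(* The starting constant comes from the a priori bound [T * M / 4] on the change of each [U]. *)
apply: (@gronwall R _ expo (c0 T) (c0 T + T * (n2 + T * M / 2))) => //.
- by rewrite lerDl; nneg.
- by move=> s sT; rewrite expo_ge1/=; exact: expo_mono.
- move=> K cK hK; have K0 : 0 <= K by apply: le_trans cK.
  have /start : forall x s, 0 <= s <= T ->
      `|(flU F x s - flU F x 0) - (flU Fb x s - flU Fb x 0)| <= w0 T + K * (a * M / 4 * s * expo s).
    move=> x s /andP[s0 sT].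
    have Es : 0 <= expo s by apply: le_trans (expo_ge1 s).
    (* [expo] is increasing, so its value at [s] bounds the distance at all earlier times, as
       [w_diff] requires. *)
    apply: le_trans (w_diff x s0 (Ay := K * expo s) _ _) _.
    - by rewrite mulr_ge0.
    - apply: aeL_mp hK => z h r /andP[r0 rs].
      apply: le_trans (h r _) _; first by rewrite r0 (le_trans rs).
      by apply: ler_wpM2l => //; apply: expo_mono; rewrite r0.
    rewrite /w_bound; apply: lerD; first by apply: w0_mono; rewrite s0.
    by rewrite le_eqVlt; apply/orP; left; apply/eqP; field.
  move=> hU; apply: aeL_mp2 hn1 hU => x h1 hU s /andP[s0 sT].
  have [iB ->] := fly_flow_diff x s0.
  apply: le_trans (ler_normD _ _) _.
  have ci (g : R -> R) : continuous g -> mu.-integrable `[0, s] (EFin \o g).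
    move=> cg; apply: continuous_compact_integrable; first exact: segment_compact.
    exact: continuous_subspaceT.
  have ig : mu.-integrable `[0, s] (EFin \o (fun r => a * M / 4 * r * expo r)).
    apply: ci => r; apply: cvgM; first by apply: cvgM; [exact: cvg_cst|exact: cvg_id].
    apply: continuous_comp; last exact: continuous_expR.
    apply: cvgM; last exact: cvg_cst.
    by apply: cvgM; [exact: cvg_cst|apply: cvgM; exact: cvg_id].
  have icst (c : R) : mu.-integrable `[0, s] (EFin \o (fun=> c)) by apply: ci => r; exact: cvg_cst.
  have iK : mu.-integrable `[0, s] (EFin \o (fun r => K * (a * M / 4 * r * expo r))).
    exact: (integrableZl _ K ig).
  have : `|\int[mu]_(r in `[0, s]) (flU F x r - flU Fb x r)| <=
      \int[mu]_(r in `[0, s]) ((n2 + w0 T) + K * (a * M / 4 * r * expo r)).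
    apply: le_trans (le_normr_Rintegral _ iB) _ => //.
    apply: le_Rintegral => //; first exact: integrable_norm.
      exact: (integrableD _ (icst _) iK).
    move=> r /=; rewrite in_itv/= => /andP[r0 rs]; rewrite -addrA; apply: hU.
    by rewrite r0 (le_trans rs).
  have -> : \int[mu]_(r in `[0, s]) ((n2 + w0 T) + K * (a * M / 4 * r * expo r)) =
      \int[mu]_(r in `[0, s]) (n2 + w0 T) + \int[mu]_(r in `[0, s]) (K * (a * M / 4 * r * expo r)).
    exact: (RintegralD _ (icst _) iK).
  have -> : \int[mu]_(r in `[0, s]) (K * (a * M / 4 * r * expo r)) =
      K * \int[mu]_(r in `[0, s]) (a * M / 4 * r * expo r) by apply: RintegralZl.
  rewrite int_exp_sq// Rintegral_cst//.
  rewrite [X in fine X](_ : _ = s%:E) /=; last by rewrite [LHS]lebesgue_itvcc// subr0.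
  rewrite -/(expo s) => hI.
  have : s * (n2 + w0 T) <= T * (n2 + w0 T) by apply: ler_wpM2r => //; nneg.
  move=> h2; rewrite /c0 -addrA; apply: lerD => //; apply: le_trans hI _.
  by rewrite lerD2r mulrC.
have /start : forall x s, 0 <= s <= T ->
    `|(flU F x s - flU F x 0) - (flU Fb x s - flU Fb x 0)| <= T * M / 2.
  move=> x s /andP[s0 sT]; apply: le_trans (ler_normB _ _) _.
  have := flU_diff okF x s0; have := flU_diff okFb x s0.
  have /andP[i0 iM] := ok_HinfM okF; have /andP[j0 jM] := ok_HinfM okFb.
  have : s * flHinf F <= T * M by exact: ler_pM.
  have : s * flHinf Fb <= T * M by exact: ler_pM.
  by lra.
move=> hU; apply: aeL_mp2 hn1 hU => x h1 hU s /andP[s0 sT].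
have [iB ->] := fly_flow_diff x s0.
apply: le_trans (ler_normD _ _) _.
have : `|\int[mu]_(r in `[0, s]) (flU F x r - flU Fb x r)| <= s * (n2 + T * M / 2).
  by apply: Rint_itv_bound => // r /andP[r0 rs]; apply: hU; rewrite r0 (le_trans rs).
have q0 : 0 <= n2 + T * M / 2 by nneg.
have : s * (n2 + T * M / 2) <= T * (n2 + T * M / 2) by apply: ler_wpM2r.
move=> h2 h3; apply: (@le_trans _ _ (c0 T + T * (n2 + T * M / 2))); last first.
  by rewrite ler_peMr ?expo_ge1//; nneg.
apply: lerD; first by apply: le_trans h1 _; rewrite /c0 lerDl; nneg.
exact: le_trans h3 h2.
Qed.

(** * The eight terms of the distance at time [T] *)

Section final.
Variable T : R.
Hypothesis T0 : 0 <= T.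

Definition y_bound : R := c0 T * expo T.
Definition W_bound : R := w_bound T y_bound.
Definition rho : R := a * m * y_bound + rho' T.
Definition errT (x : R) : R := a * y_bound * flHx Fb x + err0 T x.

Lemma c0_ge0 : 0 <= c0 T.
Proof. by have w00 := w0_ge0 T0; rewrite /c0; nneg. Qed.

Lemma y_bound_ge0 : 0 <= y_bound.
Proof. by rewrite mulr_ge0 ?c0_ge0// (le_trans ler01 (expo_ge1 T)). Qed.

Lemma W_bound_ge0 : 0 <= W_bound.
Proof. by have := w0_ge0 T0; have := y_bound_ge0 => ? ?; rewrite /W_bound /w_bound; nneg. Qed.

Lemma close_T : aeL (fun x => forall s : R, 0 <= s <= T -> `|fly F x s - fly Fb x s| <= y_bound).
Proof.
apply: aeL_mp (y_diff T0) => x h s sT; apply: le_trans (h s sT) _.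
by apply: ler_wpM2l; [exact: c0_ge0|exact: expo_mono].
Qed.

Lemma final_y : aeL (fun x => `|fly F x T - fly Fb x T| <= y_bound).
Proof. by apply: aeL_mp close_T => x; apply; rewrite T0 lexx. Qed.

Lemma wT_diff x : `|(flU F x T - flU F x 0) - (flU Fb x T - flU Fb x 0)| <= W_bound.
Proof. by apply: w_diff => //; [exact: y_bound_ge0|exact: close_T]. Qed.

Lemma final_U : aeL (fun x => `|flU F x T - flU Fb x T| <= n2 + W_bound).
Proof.
apply: aeL_mp hn2 => x h.
rewrite (_ : _ - _ = (flU F x 0 - flU Fb x 0) +
    ((flU F x T - flU F x 0) - (flU Fb x T - flU Fb x 0))); last by ring.
by apply: le_trans (ler_normD _ _) _; apply: lerD => //; exact: wT_diff.
Qed.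

Lemma rmeas_errT : rmeas errT.
Proof.
have [_ _ mHb _ _] := ok_meas okFb.
by apply: rmeasD; [exact: rmeasZ|exact: rmeas_err0].
Qed.

Lemma errT_L2 : (LpN 2 errT <= rho%:E)%E.
Proof.
have A0 := y_bound_ge0; have [_ _ mHb _ _] := ok_meas okFb.
have := @LpN_wsum R 2 errT [:: ((a * y_bound, flHx Fb), m); ((1, err0 T), rho' T)]
  ltac:(by rewrite ler1n) rmeas_errT.
rewrite /= mul1r addr0 => h; apply: le_trans (h _ _) _.
- split => //; [nneg|exact: Hb_L2|split => //; [exact: rmeas_err0|exact: err0_L2]].
- apply: aeL_mp Hb_le1 => x /andP[h0 _]; have e0 := err0_ge0 x T0.
  by rewrite addr0 mul1r /errT (ger0_norm h0) [`|err0 T x|]ger0_norm// ger0_norm//; nneg.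
by rewrite lee_fin /rho lerD2r mulrAC.
Qed.

Lemma err0_mono s x : 0 <= s <= T -> err0 s x <= err0 T x.
Proof.
move=> /andP[s0 sT]; have z0 := Z0_ge0 x; rewrite /err0 lerD2l; apply: lerD.
  by apply: ler_wpM2r => //; lra.
rewrite lerD2l; apply: lerD; first exact: ler_wpM2r.
apply: ler_wpM2r => //; rewrite lerD2r; apply: ler_pM; [nneg|nneg| |lra].
by apply: ler_wpM2r => //; apply: ler_wpM2r => //; exact: ler_wpM2l.
Qed.

Definition slopeF (G : flow R) (x s : R) : R := flUx G x + gain G x s / 2.
Definition yxT (G : flow R) (x : R) : R := flyx G x + \int[mu]_(r in `[0, T]) slopeF G x r.
(** The density that [g] adds to [y_xi]: on a breaking characteristic it is [(1 - alpha(y)) * H_xi]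
    before breaking and [V_xi] afterwards. *)
Definition vT (G : flow R) (x : R) : R := flHx G x - (if flD G x then
  (if fltau G x <= T then flK G x else flHx G x * alpha (fly G x T)) else 0).
Definition g1T (G : flow R) (x : R) : R := yxT G x + vT G x.
Definition g2T (G : flow R) (x : R) : R :=
  if flD G x then a * flHinf G * negp (flUx G x + T / 2 * flHx G x) else 0.
Definition g3T (G : flow R) (x : R) : R :=
  if flD G x then a * flU G x T * negp (flUx G x + T / 2 * flHx G x) else 0.
Definition ZT (x : R) : R :=
  Num.sqrt ((yxT F x - yxT Fb x) ^+ 2 + (slopeF F x T - slopeF Fb x T) ^+ 2 +
    (flHx F x - flHx Fb x) ^+ 2 + (flr F x - flr Fb x) ^+ 2).

Lemma vTE G : flow_ok alpha M G -> aeL (fun x => vT G x = lag_v alpha (lagof G x) T).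
Proof.
move=> ok; apply: aeL_mp (ok_ae ok) => x [_ _ _ _ [_ _ hK]].
rewrite /vT /lag_v /loss /= mulrBl mul1r; case: ifP hK => D hK; last by rewrite mul0r.
have [c|c] := leP (fltau G x) T; first by rewrite hK mulrC.
by rewrite mulrC.
Qed.

Lemma slope_T : aeL (fun x => forall s : R, 0 <= s <= T ->
  `|slopeF F x s - slopeF Fb x s| <=
  `|flUx F x - flUx Fb x| + T / 2 * Z0 F Fb x + T / 2 * errT x).
Proof.
apply: aeL_mp2 (aeL_and close_T (aeL_and (gain_mono okF) (gain_mono okFb)))
  (aeL_and Hb_le1 (aeL_and (lagof_ok okF) (lagof_ok okFb)))
  => x [close [e1 e2]] [/andP[hb0 _] [ok okb]] s /andP[s0 sT].
have A0 := y_bound_ge0.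
rewrite /slopeF -(e1 s s0) -(e2 s s0).
have cl (r : R) : 0 <= r <= s -> `|lp (lagof F x) r - lp (lagof Fb x) r| <= y_bound.
  by move=> /andP[r0 rs]; apply: close; rewrite r0 (le_trans rs).
apply: le_trans (slope_diff s0 a0 M0 A0 alpha01 alphaL (ok s s0) (okb s s0) cl) _.
have [_ _ z3 _] := Z0_parts x; have := err'_le x s0; have := @err0_mono s x; rewrite s0 sT => /(_ isT) h1 h2.
have e'0 := err'_ge0 alpha (lagof F x) (lagof Fb x) s0 a0 M0.
move: h2 e'0; rewrite /err /errT; set e' := err' _ _ _ _ _ _ => h2 e'0.
apply: lerD; first by rewrite lerD2l; apply: ler_pM => //; [nneg|lra].
apply: ler_pM; [nneg|rewrite /=; nneg|lra|].
by rewrite /= -addrA; apply: lerD; [rewrite mulrAC|exact: le_trans h2 h1].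
Qed.

Lemma slopeF_integrable G x : mu.-integrable `[0, T] (EFin \o slopeF G x).
Proof.
apply: continuous_compact_integrable; first exact: segment_compact.
apply: continuous_subspaceT => s; apply: cvgD; first exact: cvg_cst.
apply: cvgM; last exact: cvg_cst.
apply: cvgB; first by apply: cvgM; [exact: cvg_id|exact: cvg_cst].
apply: cvgM; first exact: cvg_cst.
apply: (@continuous_comp R R R (fun s => s - fltau G x) posp).
  by apply: cvgB; [exact: cvg_id|exact: cvg_cst].
by apply: continuous_max; [exact: cvg_id|exact: cvg_cst].
Qed.

Lemma Dy_T : aeL (fun x => `|(yxT F x - flyx F x) - (yxT Fb x - flyx Fb x)| <=
  T * (`|flUx F x - flUx Fb x| + T / 2 * Z0 F Fb x + T / 2 * errT x)).
Proof.
apply: aeL_mp slope_T => x h; rewrite /yxT.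
rewrite (_ : _ - _ = \int[mu]_(r in `[0, T]) slopeF F x r - \int[mu]_(r in `[0, T]) slopeF Fb x r); last by ring.
have i1 := slopeF_integrable F x; have i2 := slopeF_integrable Fb x.
rewrite -RintegralB//; apply: Rint_itv_bound => //; exact: integrableBr i1 i2.
Qed.

Lemma int_posp (b s : R) : 0 <= b -> 0 <= s ->
  \int[mu]_(r in `[0, s]) posp (r - b) = posp (s - b) ^+ 2 / 2.
Proof.
move=> b0 s0.
have ci (c d : R) (g : R -> R) : continuous g -> mu.-integrable `[c, d] (EFin \o g).
  move=> cg; apply: continuous_compact_integrable; first exact: segment_compact.
  exact: continuous_subspaceT.
have cp : continuous (fun r => posp (r - b)).
  move=> r; apply: (@continuous_comp R R R (fun s => s - b) posp).
    by apply: cvgB; [exact: cvg_id|exact: cvg_cst].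
  by apply: continuous_max; [exact: cvg_id|exact: cvg_cst].
have cl : continuous (fun r : R => r - b) by move=> r; apply: cvgB; [exact: cvg_id|exact: cvg_cst].
have zero (c : R) : c <= b -> \int[mu]_(r in `[0, c]) posp (r - b) = 0.
  move=> cb; have -> : \int[mu]_(r in `[0, c]) posp (r - b) = \int[mu]_(r in `[0, c]) 0.
    apply: eq_Rintegral => r; rewrite inE/= in_itv/= => /andP[_ rc].
    by rewrite /posp max_r// subr_le0 (le_trans rc).
  by rewrite Rintegral_cst// mul0r.
have [sb|bs] := leP s b.
  by rewrite zero// /posp max_r ?expr0n/= ?mul0r// subr_le0.
have split (g : R -> R) : continuous g -> \int[mu]_(r in `[0, s]) g r =
    \int[mu]_(r in `[0, b]) g r + \int[mu]_(r in `]b, s]) g r.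
  by move=> cg; rewrite -(Rintegral_itvB (ci 0 s g cg)) ?bnd_simp// 1?ltW//; ring.
have lin (c : R) : 0 <= c -> \int[mu]_(r in `[0, c]) (r - b) = c ^+ 2 / 2 - b * c.
  move=> c0'; have i1 : mu.-integrable `[0, c] (EFin \o (fun r : R => r)).
    by apply: ci => r; exact: cvg_id.
  have i2 : mu.-integrable `[0, c] (EFin \o (fun=> b)) by apply: ci => r; exact: cvg_cst.
  have -> : \int[mu]_(r in `[0, c]) (r - b) =
      \int[mu]_(r in `[0, c]) r - \int[mu]_(r in `[0, c]) b by exact: (RintegralB _ i1 i2).
  rewrite Rintegral_cst// [X in fine X](_ : _ = c%:E); last by rewrite [LHS]lebesgue_itvcc// subr0.
  have := @int_lin R 1 c c0'; rewrite mul1r => <-; congr (_ - _).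
  by apply: eq_Rintegral => r _; rewrite mul1r.
rewrite split// zero// add0r.
have -> : \int[mu]_(r in `]b, s]) posp (r - b) = \int[mu]_(r in `]b, s]) (r - b).
  apply: eq_Rintegral => r; rewrite inE/= in_itv/= => /andP[br _].
  by rewrite /posp max_l// subr_ge0 ltW.
have := split _ cl; rewrite !lin// /posp max_l ?subr_ge0 1?ltW//.
by move=> e; lra.
Qed.

Lemma yxTE G x : flow_ok alpha M G -> yxT G x =
  flyx G x + T * flUx G x + T ^+ 2 / 4 * flHx G x - flK G x * posp (T - fltau G x) ^+ 2 / 4.
Proof.
move=> ok; rewrite /yxT -!addrA; congr (_ + _).
have ci (g : R -> R) : continuous g -> mu.-integrable `[0, T] (EFin \o g).
  move=> cg; apply: continuous_compact_integrable; first exact: segment_compact.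
  exact: continuous_subspaceT.
have i1 : mu.-integrable `[0, T] (EFin \o (fun=> flUx G x)) by apply: ci => r; exact: cvg_cst.
have i2 : mu.-integrable `[0, T] (EFin \o (fun r => flHx G x / 2 * r)).
  by apply: ci => r; apply: cvgM; [exact: cvg_cst|exact: cvg_id].
have i3 : mu.-integrable `[0, T] (EFin \o (fun r => posp (r - fltau G x))).
  apply: ci => r; apply: (@continuous_comp R R R (fun s => s - fltau G x) posp).
    by apply: cvgB; [exact: cvg_id|exact: cvg_cst].
  by apply: continuous_max; [exact: cvg_id|exact: cvg_cst].
have i4 : mu.-integrable `[0, T] (EFin \o (fun r => flK G x / 2 * posp (r - fltau G x))).
  exact: (integrableZl _ _ i3).
have i12 : mu.-integrable `[0, T] (EFin \o (fun r => flUx G x + flHx G x / 2 * r)).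
  exact: (integrableD _ i1 i2).
transitivity (\int[mu]_(r in `[0, T]) ((flUx G x + flHx G x / 2 * r) - flK G x / 2 * posp (r - fltau G x))).
  by apply: eq_Rintegral => r _; rewrite /slopeF /gain; field.
have -> : \int[mu]_(r in `[0, T]) ((flUx G x + flHx G x / 2 * r) - flK G x / 2 * posp (r - fltau G x)) =
  \int[mu]_(r in `[0, T]) (flUx G x + flHx G x / 2 * r) -
  \int[mu]_(r in `[0, T]) (flK G x / 2 * posp (r - fltau G x)) by exact: (RintegralB _ i12 i4).
have -> : \int[mu]_(r in `[0, T]) (flUx G x + flHx G x / 2 * r) =
  \int[mu]_(r in `[0, T]) flUx G x + \int[mu]_(r in `[0, T]) (flHx G x / 2 * r) by exact: (RintegralD _ i1 i2).
have -> : \int[mu]_(r in `[0, T]) (flK G x / 2 * posp (r - fltau G x)) =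
  flK G x / 2 * \int[mu]_(r in `[0, T]) posp (r - fltau G x) by apply: RintegralZl.
rewrite int_posp//; last exact: ok_tau ok x.
rewrite int_lin// Rintegral_cst// [X in fine X](_ : _ = T%:E); last by rewrite [LHS]lebesgue_itvcc// subr0.
by rewrite /=; field.
Qed.

Lemma rmeas_yxT G : flow_ok alpha M G -> rmeas (yxT G).
Proof.
move=> ok; have [my mU mH _ mK] := ok_meas ok.
rewrite (_ : yxT G = fun x => flyx G x + T * flUx G x + T ^+ 2 / 4 * flHx G x -
  4^-1 * (flK G x * posp (T - fltau G x) ^+ 2)); last first.
  by apply/funext => x; rewrite yxTE//; congr (_ - _); rewrite mulrC.
apply: rmeasB.
  by apply: rmeasD; [apply: rmeasD => //; exact: rmeasZ|exact: rmeasZ].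
apply: rmeasZ; apply: rmeasM => //; apply: rmeasX; apply: rmeas_posp.
by apply: rmeasB; [exact: rmeas_cst|exact: ok_meastau ok].
Qed.

Lemma rmeas_slopeF G s : flow_ok alpha M G -> rmeas (slopeF G ^~ s).
Proof.
move=> ok; have [my mU mH _ mK] := ok_meas ok.
rewrite (_ : slopeF G ^~ s = fun x => flUx G x + 2^-1 * gain G x s); last first.
  by apply/funext => x; rewrite /slopeF mulrC.
by apply: rmeasD => //; apply: rmeasZ; exact: rmeas_gain ok s.
Qed.

Lemma rmeas_vT G : flow_ok alpha M G -> rmeas (vT G).
Proof.
move=> ok; have [_ _ mH _ mK] := ok_meas ok; have [mY _] := ok_measyU ok T0.
apply: rmeasB => //; apply: rmeas_if; [exact: ok_measD ok| |exact: rmeas_cst].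
apply: rmeas_if => //.
  by apply: measurable_fun_ler; [exact: ok_meastau ok|exact: rmeas_cst].
by apply: rmeasM => //; exact: rmeas_comp (rmeas_cont alpha_cont) mY.
Qed.

Lemma rmeas_g1T G : flow_ok alpha M G -> rmeas (g1T G).
Proof. by move=> ok; apply: rmeasD; [exact: rmeas_yxT|exact: rmeas_vT]. Qed.

Lemma rmeas_free G : flow_ok alpha M G -> rmeas (fun x => negp (flUx G x + T / 2 * flHx G x)).
Proof.
move=> ok; have [_ mU mH _ mK] := ok_meas ok.
by apply: rmeas_negp; apply: rmeasD => //; exact: rmeasZ.
Qed.

Lemma rmeas_g2T G : flow_ok alpha M G -> rmeas (g2T G).
Proof.
move=> ok; apply: rmeas_if; [exact: ok_measD ok| |exact: rmeas_cst].
by apply: rmeasZ; exact: rmeas_free.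
Qed.

Lemma rmeas_g3T G : flow_ok alpha M G -> rmeas (g3T G).
Proof.
move=> ok; have [_ mU0] := ok_measyU ok T0.
apply: rmeas_if; [exact: ok_measD ok| |exact: rmeas_cst].
by apply: rmeasM; [exact: rmeasZ|exact: rmeas_free].
Qed.

Lemma rmeas_ZT : rmeas ZT.
Proof.
have [my mU mH mr _] := ok_meas okF; have [myb mUb mHb mrb _] := ok_meas okFb.
have h := rmeas_yxT okF; have hb := rmeas_yxT okFb.
have k := rmeas_slopeF T okF; have kb := rmeas_slopeF T okFb.
apply: (rmeas_comp (rmeas_cont (@sqrt_continuous R))).
by do 3![apply: rmeasD; last by apply: rmeasX; exact: rmeasB]; apply: rmeasX; exact: rmeasB.
Qed.

(** The triangle inequality for the Euclidean norm in [ZT], of which only the components of [y_xi]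
    and [U_xi] evolve in time. *)
Lemma sqrt_perturb (p q p' q' e1 e2 c : R) : 0 <= c -> 0 <= e1 -> 0 <= e2 ->
  `|p'| <= `|p| + e1 -> `|q'| <= `|q| + e2 ->
  Num.sqrt (p' ^+ 2 + q' ^+ 2 + c) <= Num.sqrt (p ^+ 2 + q ^+ 2 + c) + e1 + e2.
Proof.
move=> cp e10 e20 hp hq; have p2 := sqr_ge0 p; have q2 := sqr_ge0 q.
set S := Num.sqrt (p ^+ 2 + _ + c).
have S0 : 0 <= S by exact: sqrtr_ge0.
have SS : S ^+ 2 = p ^+ 2 + q ^+ 2 + c by rewrite sqr_sqrtr// !addr_ge0.
have pS : `|p| <= S by rewrite -sqrtr_sqr ler_sqrt ?addr_ge0//; lra.
have qS : `|q| <= S by rewrite -sqrtr_sqr ler_sqrt ?addr_ge0//; lra.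
have r0 : 0 <= S + e1 + e2 by lra.
rewrite -(ger0_norm r0) -sqrtr_sqr ler_sqrt ?sqr_ge0//.
have sq (v w e : R) : 0 <= e -> `|v| <= `|w| + e -> `|w| <= S -> v ^+ 2 <= w ^+ 2 + 2 * S * e + e ^+ 2.
  move=> e0 hv hw; have w0' := normr_ge0 w.
  rewrite -[v ^+ 2]real_normK ?num_real// -[w ^+ 2]real_normK ?num_real//.
  apply: (@le_trans _ _ ((`|w| + e) ^+ 2)); first by rewrite lerXn2r// nnegrE; lra.
  by have := ler_wpM2r e0 hw; rewrite sqrrD mulr2n; lra.
have := sq _ _ _ e10 hp pS; have := sq _ _ _ e20 hq qS.
have := mulr_ge0 e10 e20.
rewrite (_ : (S + e1 + e2) ^+ 2 = S ^+ 2 + 2 * S * e1 + 2 * S * e2 + e1 ^+ 2 + e2 ^+ 2 + 2 * (e1 * e2)); last by ring.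
by rewrite SS; lra.
Qed.

Lemma errT_ge0 : aeL (fun x => 0 <= errT x).
Proof.
apply: aeL_mp Hb_le1 => x /andP[h0 _]; have e0 := err0_ge0 x T0; have A0 := y_bound_ge0.
by rewrite /errT; nneg.
Qed.

Lemma final_Z : (LpN 2 ZT <= ((1 + (T + T ^+ 2 / 2) + T / 2) * n5 + (T ^+ 2 / 2 + T / 2) * rho)%:E)%E.
Proof.
have := @LpN_wsum R 2 ZT [:: ((1 + (T + T ^+ 2 / 2) + T / 2, Z0 F Fb), n5);
  ((T ^+ 2 / 2 + T / 2, errT), rho)] ltac:(by rewrite ler1n) rmeas_ZT.
rewrite /= addr0; apply.
  split => //; [nneg|exact: rmeas_Z0|split => //; [nneg|exact: rmeas_errT|exact: errT_L2]].
apply: aeL_mp2 Dy_T (aeL_and errT_ge0 slope_T) => x hy [e0 /(_ T)]; rewrite T0 lexx => /(_ isT) hs.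
have z0 := Z0_ge0 x; have [_ z2 _ _] := Z0_parts x.
rewrite addr0 !ger0_norm// ?sqrtr_ge0//.
rewrite /ZT -(addrA (_ + _)).
have c0' : 0 <= (flHx F x - flHx Fb x) ^+ 2 + (flr F x - flr Fb x) ^+ 2 by rewrite addr_ge0// sqr_ge0.
have q1 : 0 <= T * (Z0 F Fb x + T / 2 * Z0 F Fb x + T / 2 * errT x) by nneg.
have q2 : 0 <= T / 2 * Z0 F Fb x + T / 2 * errT x by nneg.
have p1 : `|yxT F x - yxT Fb x| <= `|flyx F x - flyx Fb x| +
    T * (Z0 F Fb x + T / 2 * Z0 F Fb x + T / 2 * errT x).
  rewrite (_ : yxT F x - _ = (flyx F x - flyx Fb x) + ((yxT F x - flyx F x) - (yxT Fb x - flyx Fb x))); last by ring.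
  apply: le_trans (ler_normD _ _) _; rewrite lerD2l; apply: le_trans hy _.
  by apply: ler_wpM2l => //; rewrite !lerD2r.
have p2 : `|slopeF F x T - slopeF Fb x T| <= `|flUx F x - flUx Fb x| +
    (T / 2 * Z0 F Fb x + T / 2 * errT x) by rewrite addrA.
apply: le_trans (sqrt_perturb c0' q1 q2 p1 p2) _.
rewrite [X in X + _ + _ <= _](_ : _ = Z0 F Fb x); last by rewrite /Z0 addrA.
by rewrite le_eqVlt; apply/orP; left; apply/eqP; field.
Qed.

(** The arithmetic of [final_g1], separated so that absolute values and norms become plain
    variables. *)
Lemma g1_collect (Z e b D u1 u3 u4 G1 G2 G3 G4 A : R) :
  u4 + u3 <= 3 / 2 * Z -> D <= T * (u1 + T / 2 * Z + T / 2 * e) ->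
  T * (u1 + T / 2 * Z + T / 2 * e) <= T * (Z + T / 2 * Z + T / 2 * e) ->
  a * T * M / 4 * (2 * u1 + T * u3) <= a * T * M / 4 * ((2 + T) * Z) ->
  u4 + u3 + D + (a * b * A + (G1 + T / 4 * G2 + 2 * G3 + T * G4 + a * T * M / 4 * (2 * u1 + T * u3))) <=
  (3 / 2 + (T + T ^+ 2 / 2) + a * T * M / 4 * (2 + T)) * Z + (T ^+ 2 / 2 * e + (a * A * b +
    (1 * G1 + (T / 4 * G2 + (2 * G3 + (T * G4 + 0)))))).
Proof. by move=> h1 h2 h3 h4; lra. Qed.

Lemma final_g1 : (LpN 2 (fun x => g1T F x - g1T Fb x)%R <=
  ((3 / 2 + (T + T ^+ 2 / 2) + a * T * M / 4 * (2 + T)) * n5 + T ^+ 2 / 2 * rho +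
   (a * y_bound * m + (n6 + T / 4 * n7 + 2 * n8 + T * n3)))%:E)%E.
Proof.
have A0 := y_bound_ge0; have [_ _ mHb _ _] := ok_meas okFb.
have mB : rmeas (fun x => g1T F x - g1T Fb x) by apply: rmeasB; exact: rmeas_g1T.
have := @LpN_wsum R 2 _ [:: ((3 / 2 + (T + T ^+ 2 / 2) + a * T * M / 4 * (2 + T), Z0 F Fb), n5);
  ((T ^+ 2 / 2, errT), rho); ((a * y_bound, flHx Fb), m);
  ((1, fun x => g10 alpha F x - g10 alpha Fb x), n6);
  ((T / 4, fun x => g20 a F x - g20 a Fb x), n7); ((2, fun x => g30 a F x - g30 a Fb x), n8);
  ((T, fun x => a * (flU F x 0 * flHx F x - flU Fb x 0 * flHx Fb x)), n3)]
  ltac:(by rewrite ler1n) mB.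
move=> h; apply: le_trans (h _ _) _; last by rewrite /= lee_fin; lra.
  split => //; [nneg|exact: rmeas_Z0|split => //; [nneg|exact: rmeas_errT|exact: errT_L2|]].
  split => //; [nneg|exact: Hb_L2|].
  split => //; first by apply: rmeasB; exact: rmeas_g10.
  split => //; [by nneg|by apply: rmeasB; exact: rmeas_g20|].
  split => //; first by apply: rmeasB; exact: rmeas_g30.
  split => //; exact: rmeas_k.
apply: aeL_mp2 (aeL_and (aeL_and Dy_T errT_ge0) (aeL_and Hb_le1 close_T))
  (aeL_and (aeL_and (vTE okF) (vTE okFb)) (aeL_and (lagof_ok okF) (lagof_ok okFb)))
  => x [[hy e0] [/andP[hb0 _] close]] [[v1 v2] [/(_ T T0) ok /(_ T T0) okb]].
have z0 := Z0_ge0 x; have [_ z2 z3 z4] := Z0_parts x.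
rewrite /g1T v1 v2.
apply: le_trans (g1_diff T0 a0 M0 A0 alpha01 alphaL ok okb close _ _) _.
rewrite /= /err /err' (lag_v0 _ okF) (lag_v0 _ okFb) !lag_g20 !lag_g30 /=.
rewrite (ger0_norm e0) (ger0_norm z0) (ger0_norm hb0).
have : a * T * M / 4 * (2 * `|flUx F x - flUx Fb x| + T * `|flHx F x - flHx Fb x|) <=
  a * T * M / 4 * ((2 + T) * Z0 F Fb x).
  apply: ler_wpM2l; first by nneg.
  have := ler_wpM2l T0 z3; lra.
have : T * (`|flUx F x - flUx Fb x| + T / 2 * Z0 F Fb x + T / 2 * errT x) <=
  T * (Z0 F Fb x + T / 2 * Z0 F Fb x + T / 2 * errT x) by apply: ler_wpM2l => //; rewrite !lerD2r.
by move=> h1 h2; exact: g1_collect z4 hy h1 h2.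
Qed.

Lemma final_g2 : (LpN 2 (fun x => g2T F x - g2T Fb x)%R <=
  (n7 + T / 2 * a * M * n5 + T / 2 * a * n4 * m)%:E)%E.
Proof.
have h4 := n4_ge0; have [_ _ mHb _ _] := ok_meas okFb.
have mB : rmeas (fun x => g2T F x - g2T Fb x) by apply: rmeasB; exact: rmeas_g2T.
have := @LpN_wsum R 2 _ [:: ((1, fun x => g20 a F x - g20 a Fb x), n7);
  ((T / 2 * a * M, Z0 F Fb), n5); ((T / 2 * a * n4, flHx Fb), m)]
  ltac:(by rewrite ler1n) mB.
move=> h; apply: le_trans (h _ _) _; last by rewrite /= lee_fin; lra.
  split => //; first by apply: rmeasB; exact: rmeas_g20.
  split => //; [nneg|exact: rmeas_Z0|split => //; [nneg|exact: Hb_L2]].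
apply: aeL_mp2 Hb_le1 (aeL_and (lagof_ok okF) (lagof_ok okFb))
  => x /andP[hb0 _] [/(_ T T0) ok /(_ T T0) okb].
have z0 := Z0_ge0 x; have [_ z2 z3 z4] := Z0_parts x.
have := g2_diff T0 a0 M0 ok okb Hinf_diff; rewrite !lag_g20 /lag_g2 /free_slope /= -/(g2T F x) -/(g2T Fb x).
rewrite (ger0_norm z0) (ger0_norm hb0) mul1r addr0 => /le_trans; apply.
rewrite -[leLHS]addrA lerD2l; apply: lerD; first by apply: ler_wpM2l => //; nneg.
by rewrite mulrAC.
Qed.

Lemma final_g3 : (LpN 2 (fun x => g3T F x - g3T Fb x)%R <=
  (n8 + T / 2 * n3 + T / 4 * n7 + a * W_bound * m + a * T * M / 8 * (2 + T) * n5)%:E)%E.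
Proof.
have W0 := W_bound_ge0; have [_ mUb mHb _ _] := ok_meas okFb.
have mB : rmeas (fun x => g3T F x - g3T Fb x) by apply: rmeasB; exact: rmeas_g3T.
have := @LpN_wsum R 2 _ [:: ((1, fun x => g30 a F x - g30 a Fb x), n8);
  ((T / 2, fun x => a * (flU F x 0 * flHx F x - flU Fb x 0 * flHx Fb x)), n3);
  ((T / 4, fun x => g20 a F x - g20 a Fb x), n7); ((a * W_bound, flUx Fb), m);
  ((a * T * M / 8 * (2 + T), Z0 F Fb), n5)]
  ltac:(by rewrite ler1n) mB.
move=> h; apply: le_trans (h _ _) _; last by rewrite /= lee_fin; lra.
  split => //; first by apply: rmeasB; exact: rmeas_g30.
  split => //; [nneg|exact: rmeas_k|].
  split => //; [by nneg|by apply: rmeasB; exact: rmeas_g20|].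
  split => //; [nneg|exact: Ub_L2|].
  split => //; [nneg|exact: rmeas_Z0].
apply: aeL_mp (aeL_and (lagof_ok okF) (lagof_ok okFb))
  => x [/(_ T T0) ok /(_ T T0) okb].
have z0 := Z0_ge0 x; have [_ z2 z3 z4] := Z0_parts x.
have := g3_diff T0 a0 M0 ok okb (flU_diff okF x T0) (flU_diff okFb x T0) (wT_diff x).
rewrite !lag_g20 !lag_g30 /lag_g3 /free_slope /= -/(g3T F x) -/(g3T Fb x).
rewrite (ger0_norm z0) mul1r addr0 => /le_trans; apply.
rewrite -!addrA !lerD2l -[X in _ <= X]mulrA; apply: ler_wpM2l; first by nneg.
by have := ler_wpM2l T0 z3; lra.
Qed.

Lemma final_UH : (LpN 2 (fun x => a * (flU F x T * flHx F x - flU Fb x T * flHx Fb x))%R <=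
  (n3 + a * W_bound * m + a * T * M / 4 * n5)%:E)%E.
Proof.
have W0 := W_bound_ge0; have [_ _ mH _ _] := ok_meas okF; have [_ _ mHb _ _] := ok_meas okFb.
have [_ mu0] := ok_measyU okF T0; have [_ mub0] := ok_measyU okFb T0.
have mB : rmeas (fun x => a * (flU F x T * flHx F x - flU Fb x T * flHx Fb x)).
  by apply: rmeasZ; apply: rmeasB; exact: rmeasM.
have := @LpN_wsum R 2 _ [:: ((1, fun x => a * (flU F x 0 * flHx F x - flU Fb x 0 * flHx Fb x)), n3);
  ((a * W_bound, flHx Fb), m); ((a * T * M / 4, Z0 F Fb), n5)]
  ltac:(by rewrite ler1n) mB.
move=> h; apply: le_trans (h _ _) _; last by rewrite /= lee_fin; lra.
  split => //; [exact: rmeas_k|].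
  split => //; [nneg|exact: Hb_L2|].
  split => //; [nneg|exact: rmeas_Z0].
apply: aeL_mp2 Hb_le1 (aeL_and (lagof_ok okF) (lagof_ok okFb))
  => x /andP[hb0 _] [/(_ T T0) ok /(_ T T0) okb].
have z0 := Z0_ge0 x; have [_ z2 z3 z4] := Z0_parts x.
have := n3_diff T0 a0 ok okb (flU_diff okF x T0) (wT_diff x).
rewrite /= (ger0_norm z0) (ger0_norm hb0) mul1r addr0 => /le_trans; apply.
by rewrite -!addrA !lerD2l; apply: ler_wpM2l => //; nneg.
Qed.

Lemma expR_ge_cube (x : R) : 0 <= x -> (1 + x / 3) ^+ 3 <= expR x.
Proof.
move=> x0; have -> : expR x = expR (x / 3) ^+ 3.
  by rewrite -expRM_natl; congr expR; rewrite mulrC mulrnAr mulr1; field.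
have y0 : 0 <= x / 3 by rewrite mulr_ge0// invr_ge0.
by rewrite lerXn2r ?nnegrE ?expR_ge0 ?expR_ge1Dx// addr_ge0.
Qed.

Definition growth_const : R :=
  (3 + 3/2 * T + 1/2 * T^+2 + 3/16 * T^+3
  + m * (1 + 1/4 * T + 1/4 * T^+2 + 1/16 * T^+3)
  + a * m * (5 + 2 * T + T^+2 + 3/8 * T^+3)
  + a * M * (3 + 5/4 * T + 1/2 * T^+2 + 1/8 * T^+3)) *
  expR (T * (2 + a * m + m * (1/2 + 1/8 * T + 1/16 * T^+2)
  + a * M * (1 + 1/4 * T + 1/8 * T^+2))).

Lemma growth_const_ge : expo T * (cpoly_part (T / 2) a m * (1 + xpoly_part (T / 2) a m / 3) ^+ 3) <=
  growth_const.
Proof.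
have m0 : 0 <= m by exact: sqrtr_ge0.
have mM : M = m ^+ 2 by rewrite sqr_sqrtr.
have x0 : 0 <= xpoly_part (T / 2) a m by rewrite /xpoly_part; syntactic_nneg.
have c0' : 0 <= cpoly_part (T / 2) a m by rewrite /cpoly_part; syntactic_nneg.
apply: (@le_trans _ _ (expo T * (cpoly_part (T / 2) a m * expR (xpoly_part (T / 2) a m)))).
  apply: ler_wpM2l; first exact: expR_ge0.
  apply: ler_wpM2l => //.
  exact: expR_ge_cube.
rewrite mulrCA /growth_const; apply: ler_pM => //.
- by rewrite mulr_ge0// expR_ge0.
- rewrite -subr_ge0 /cpoly_part; move: m mM m0 => q qM q0; rewrite qM.
  rewrite (_ : _ - _ = 3/2 * T + q * (1/4 * T + 1/16 * T ^+ 3) + a * q * (2 * T + T ^+ 2) +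
    a * q ^+ 2 * (5/4 * T + 1/2 * T ^+ 2 + 1/8 * T ^+ 3)); first by syntactic_nneg.
  by field.
rewrite /expo -exp.expRD ler_expR -subr_ge0 /xpoly_part; move: m mM m0 => q qM q0; rewrite qM.
rewrite (_ : _ - _ = T * (a * q + q * (1/2 + 1/8 * T + 1/16 * T^+2))); first by syntactic_nneg.
by field.
Qed.

Lemma final_sum : y_bound + (n2 + W_bound) + (n3 + a * W_bound * m + a * T * M / 4 * n5) + n4 +
  ((1 + (T + T ^+ 2 / 2) + T / 2) * n5 + (T ^+ 2 / 2 + T / 2) * rho) +
  ((3 / 2 + (T + T ^+ 2 / 2) + a * T * M / 4 * (2 + T)) * n5 + T ^+ 2 / 2 * rho +
   (a * y_bound * m + (n6 + T / 4 * n7 + 2 * n8 + T * n3))) +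
  (n7 + T / 2 * a * M * n5 + T / 2 * a * n4 * m) +
  (n8 + T / 2 * n3 + T / 4 * n7 + a * W_bound * m + a * T * M / 8 * (2 + T) * n5) <=
  growth_const * (n1 + n2 + n3 + n4 + n5 + n6 + n7 + n8).
Proof.
have m0 : 0 <= m by exact: sqrtr_ge0.
have mM : M = m ^+ 2 by rewrite sqr_sqrtr.
have h3 := n3_ge0; have h4 := n4_ge0; have h5 := n5_ge0.
have h6 := n6_ge0; have h7 := n7_ge0; have h8 := n8_ge0.
have u0 : 0 <= T / 2 by rewrite mulr_ge0// invr_ge0.
have s0 : 0 <= n1 + n2 + n3 + n4 + n5 + n6 + n7 + n8 by rewrite !addr_ge0.
have := envelope_sum u0 a0 m0 n10 n20 h3 h4 h5 h6 h7 h8.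
rewrite (_ : 2 * (T / 2) = T); last by rewrite mulrC divfK ?pnatr_eq0.
rewrite -mM -/(rho' T) -/(w0 T) -/(c0 T).
set P0 := (X in X + _ <= _); set P1 := (X in _ + _ * X <= _) => key.
have P00 : 0 <= P0.
  have w00 := w0_ge0 T0; have r0 : 0 <= rho' T by rewrite /rho'; syntactic_nneg.
  by rewrite /P0; syntactic_nneg.
(* Only the bound for [y] carries the Gronwall factor. As [expo T >= 1], it may multiply the
   remaining part [P0] as well, and the whole sum then has this single factor. *)
apply: (@le_trans _ _ (expo T * (P0 + c0 T * P1))).
  apply: (@le_trans _ _ (P0 + expo T * (c0 T * P1))); last first.
    by rewrite [X in _ <= X]mulrDr lerD2r ler_peMl// expo_ge1.
  rewrite le_eqVlt; apply/orP; left; apply/eqP.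
  by rewrite /rho /W_bound /w_bound /y_bound /P0 /P1; field.
have E0 : 0 <= expo T by exact: expR_ge0.
apply: le_trans (ler_wpM2l E0 key) _; rewrite mulrA; apply: ler_wpM2r => //.
apply: le_trans growth_const_ge; apply: ler_wpM2l => //; exact: envelope_le.
Qed.

End final.

End core.

(** * Lower bound for [y_xi + H_xi] at a later time *)

Section energy_density.
Context {R : realType}.

(** Nonnegativity of a binary quadratic form, with [A] and [B] its diagonal terms and [C] its mixed
    term. *)
Lemma psd_form (A B C : R) : 0 <= A -> 0 <= B -> C ^+ 2 <= 4 * (A * B) -> 0 <= A + C + B.
Proof.
move=> A0 B0 h; have s0 : 0 <= A + B by rewrite addr_ge0.
have : `|C| <= A + B.
  rewrite -(ger0_norm s0) -!sqrtr_sqr ler_sqrt ?sqr_ge0//; apply: le_trans h _.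
  have := sqr_ge0 (A - B); rewrite (_ : (A - B) ^+ 2 = (A + B) ^+ 2 - 4 * (A * B)); last by ring.
  by rewrite subr_ge0.
by move=> /ler_normlP[h1 h2]; lra.
Qed.

(** Here [p], [z], [q] are [y_xi], [U_xi], [H_xi] at time 0, and [D] is [y_xi] at time [T]. Without
    loss, subtracting [c * (p + q)] from [D + q] leaves a quadratic form that is nonnegative for
    [c = (1 + T / 2) ^ -2]. After breaking, [p = q * tau ^ 2 / 4] with [tau <= T] makes [q] alone
    large enough. *)
Lemma energy_density_lb (T p q z K tau : R) : 0 <= T -> 0 <= p -> 0 <= q -> p + q = 1 ->
  z ^+ 2 <= p * q -> 0 <= K <= q -> 0 <= tau ->
  K = 0 \/ (q * tau = - 2 * z /\ p = q * tau ^+ 2 / 4) ->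
  let D := p + T * z + T ^+ 2 / 4 * q - K * posp (T - tau) ^+ 2 / 4 in
  0 <= D /\ ((1 + T / 2) ^+ 2)^-1 <= D + q.
Proof.
move=> T0 p0 q0 pq zz /andP[K0 Kq] tau0 hK; rewrite /=.
have s0 : 0 < (1 + T / 2) ^+ 2 by rewrite exprn_gt0//; lra.
have T2 : 0 <= T ^+ 2 by exact: sqr_ge0.
have s1 : 1 + T ^+ 2 / 4 <= (1 + T / 2) ^+ 2 by lra.
have s2 : 1 <= (1 + T / 2) ^+ 2 by lra.
have free : 0 <= p + T * z + T ^+ 2 / 4 * q /\
    ((1 + T / 2) ^+ 2)^-1 <= p + T * z + T ^+ 2 / 4 * q + q.
  split.
    apply: psd_form => //; first by rewrite mulr_ge0// mulr_ge0// invr_ge0.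
    have := ler_wpM2l T2 zz; rewrite exprMn; lra.
  set S := (1 + T / 2) ^+ 2; set c := S^-1.
  have cS : c * S = 1 by rewrite mulVf// gt_eqF.
  have c0 : 0 <= c by rewrite invr_ge0 ltW.
  have c1 : c <= 1 by rewrite invf_le1.
  (* The discriminant condition of that form. It reduces to [1 - T <= c], which follows by expanding
     [c * S = 1]. *)
  have key : T ^+ 2 / 4 <= (1 - c) * (1 + T ^+ 2 / 4 - c).
    rewrite (_ : (1 - c) * _ = T ^+ 2 / 4 + c * (S + c - 2 - T ^+ 2 / 4)); last first.
      transitivity (T ^+ 2 / 4 + (1 - c * S) + c * (S + c - 2 - T ^+ 2 / 4)); first by field.
    by rewrite cS subrr addr0.
    have cT : c = 1 - T + c * (3 / 4 * T ^+ 2 + T ^+ 3 / 4).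
      transitivity (1 - T + c * (3 / 4 * T ^+ 2 + T ^+ 3 / 4) + (c * S - 1) * (1 - T)).
        by rewrite /S; field.
      by rewrite cS subrr mul0r addr0.
    have : 0 <= c * (3 / 4 * T ^+ 2 + T ^+ 3 / 4) by syntactic_nneg.
    have SE : S = 1 + T + T ^+ 2 / 4 by rewrite /S; field.
    move: cT; set v := c * (_ + _) => cT v0; rewrite lerDl mulr_ge0// SE.
    by move: v v0 cT => v v0 cT; lra.
  suff : 0 <= (1 - c) * p + T * z + (1 + T ^+ 2 / 4 - c) * q by nra.
  apply: psd_form; [by rewrite mulr_ge0// subr_ge0|by rewrite mulr_ge0//; lra|].
  have pq0 : 0 <= p * q by rewrite mulr_ge0.
  have := ler_wpM2r pq0 key; have := ler_wpM2l T2 zz; rewrite exprMn; lra.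
have [h|[h1 h2]] := hK.
  by rewrite h !mul0r subr0.
have [c|c] := leP T tau.
  by rewrite /posp max_r ?subr_le0// expr0n/= mulr0 mul0r subr0.
rewrite /posp max_l; last by rewrite subr_ge0 ltW.
have z2 : z = - (q * tau) / 2 by rewrite h1; field.
have KK : K * (T - tau) ^+ 2 <= q * (T - tau) ^+ 2 by apply: ler_wpM2r => //; exact: sqr_ge0.
have D0 : 0 <= p + T * z + T ^+ 2 / 4 * q - K * (T - tau) ^+ 2 / 4.
  rewrite (_ : p + T * z + T ^+ 2 / 4 * q = q * (T - tau) ^+ 2 / 4); first by lra.
  by rewrite h2 z2; field.
split => //; apply: (@le_trans _ _ q); last by lra.
rewrite -div1r ler_pdivrMr//.
have t2 : tau ^+ 2 <= T ^+ 2 by rewrite lerXn2r// ?nnegrE// ltW.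
have := ler_wpM2l q0 s1; have := ler_wpM2l q0 t2; lra.
Qed.

Lemma yxT_bounds (alpha : R -> R) (M T : R) (F : flow R) : 0 <= T -> flow_ok alpha M F ->
  aeL (fun x => flyx F x + flHx F x = 1) ->
  aeL (fun x => [/\ 0 <= yxT T F x, ((1 + T / 2) ^+ 2)^-1 <= yxT T F x + flHx F x &
    yxT T F x + flHx F x <= 1 + T + T ^+ 2 / 4]).
Proof.
move=> T0 ok one; apply: aeL_mp2 one (ok_ae ok) => x e [y0 H0 K0 uu [h1 h2 hK]].
rewrite (yxTE T0 _ ok).
have hD : flK F x = 0 \/ (flHx F x * fltau F x = - 2 * flUx F x /\
    flyx F x = flHx F x * fltau F x ^+ 2 / 4).
  by case: (flD F x) hK h1 h2 => hK h1 h2; [right; split; [exact: h1|exact: h2]|left].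
have [d1 d2] := energy_density_lb T0 y0 H0 e uu K0 (ok_tau ok x) hD.
split => //.
have : 0 <= flK F x * posp (T - fltau F x) ^+ 2 / 4.
  by case/andP: K0 => K0 _; rewrite mulr_ge0 ?invr_ge0// mulr_ge0// sqr_ge0.
have Hx1 : flHx F x <= 1 by lra.
have U1 : flUx F x <= 1 by have := sqr_ge0 (flUx F x - 1); nra.
have := ler_wpM2l T0 U1; have := ler_wpM2l (sqr_ge0 T) Hx1; lra.
Qed.

End energy_density.

(** * Existence of solutions *)

Section geometric.
Context {R : realType}.

Lemma geometric_limit (u : nat -> R) (c : R) :
  (forall n, `|u n.+1 - u n| <= c * 2^-1 ^+ n) ->
  u @ \oo --> limn u /\ forall n, `|limn u - u n| <= 2 * c * 2^-1 ^+ n.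
Proof.
move=> h; have c0 : 0 <= c by have := h 0%N; rewrite expr0 mulr1; apply: le_trans.
have pn (n : nat) : (0 : R) <= 2^-1 ^+ n by rewrite exprn_ge0// invr_ge0.
have cu : cvgn u.
  suff : cvgn (series (telescope u)).
    rewrite telescopeK => /(is_cvgD (f := fun=> u 0%N) (is_cvg_cst _)) k.
    rewrite (_ : u = (fun=> u 0%N) + [sequence u n - u 0%N]_n)//.
    by apply/funext => n; rewrite [RHS]addrC/= subrK.
  apply: normed_cvg; apply: (series_le_cvg (v_ := geometric c 2^-1)) => //.
  - by move=> n; exact: normr_ge0.
  - by move=> n; rewrite /= mulr_ge0.
  - apply: is_cvg_geometric_series; rewrite ger0_norm ?invr_ge0//; lra.
split => // n.
have step k : `|u (n + k)%N - u n| <= 2 * c * 2^-1 ^+ n * (1 - 2^-1 ^+ k).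
  elim: k => [|k IH]; first by rewrite addn0 subrr normr0 expr0 subrr mulr0.
  rewrite addnS; apply: le_trans (ler_distD (u (n + k)%N) _ _) _.
  apply: le_trans (lerD (h _) IH) _.
  by rewrite le_eqVlt; apply/orP; left; apply/eqP; rewrite exprD exprS; field.
have cv : (fun k => `|u k - u n|) @ \oo --> `|limn u - u n|.
  by apply: cvg_norm; apply: cvgB => //; exact: cvg_cst.
rewrite -(cvg_lim _ cv)//; apply: limr_le; first by apply/cvg_ex; eexists; exact: cv.
near=> k; have nk : (n <= k)%N by near: k; exact: nbhs_infty_ge.
rewrite -(subnKC nk); apply: le_trans (step _) _; rewrite ler_piMr//.
  by rewrite mulr_ge0// mulr_ge0.
Unshelve. all: by end_near. Qed.

(** From [exp x >= (x / 2) ^ 2]. The factor [lam ^ -2] is what makes the fixed point map a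
    contraction when [lam] is large. *)
Lemma sqr_le_expR (s lam : R) : 0 <= s -> 0 < lam -> s ^+ 2 / 2 <= 2 / lam ^+ 2 * expR (lam * s).
Proof.
move=> s0 l0; have l2 : 0 < lam ^+ 2 by rewrite exprn_gt0.
have h0 : 0 <= lam * s / 2 by rewrite mulr_ge0 ?invr_ge0// mulr_ge0// ltW.
have : (lam * s / 2) ^+ 2 <= expR (lam * s).
  have -> : expR (lam * s) = expR (lam * s / 2) ^+ 2.
    by rewrite -expRM_natl; congr expR; field.
  rewrite lerXn2r ?nnegrE ?expR_ge0//.
  by apply: le_trans (expR_ge1Dx _); rewrite lerDr.
move=> h; rewrite [X in _ <= X]mulrAC ler_pdivlMr//; have := ler_wpM2l (ler0n R 2) h; lra.
Qed.

End geometric.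

Section half_operator.
Context {R : realType}.
Local Notation mu := (@lebesgue_measure R).

(** The right-hand side of the equation for [U_t], as an operator on the density [V_xi]. *)
Definition half (f : R -> R) (x : R) : R :=
  2^-1 * \int[mu]_(z in `]-oo, x]) f z - 4^-1 * \int[mu]_z f z.

Lemma half_dist (f g h : R -> R) (c x : R) :
  mu.-integrable setT (EFin \o f) -> mu.-integrable setT (EFin \o g) ->
  mu.-integrable setT (EFin \o h) -> (forall z, `|f z - g z| <= h z) ->
  \int[mu]_z h z <= c -> `|half f x - half g x| <= c / 4.
Proof.
move=> i1 i2 ih fg hc; have iB := integrableBr measurableT i1 i2.
have iS (q : R -> R) : mu.-integrable setT (EFin \o q) -> mu.-integrable `]-oo, x] (EFin \o q).
  by apply: integrableS.
have e1 : \int[mu]_(z in `]-oo, x]) (f z - g z) =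
    \int[mu]_(z in `]-oo, x]) f z - \int[mu]_(z in `]-oo, x]) g z.
  exact: (RintegralB _ (iS _ i1) (iS _ i2)).
have e2 : \int[mu]_z (f z - g z) = \int[mu]_z f z - \int[mu]_z g z.
  exact: (RintegralB _ i1 i2).
have n1 : (LpN 1 (fun z => f z - g z)%R <= c%:E)%E.
  rewrite L1NE; apply: (@le_trans _ _ (\int[mu]_z h z)%:E); last by rewrite lee_fin.
  rewrite /Rintegral fineK; last exact: integrable_fin_num ih.
  apply: ge0_le_integral => //.
  - by have := measurable_int _ (integrable_norm iB).
  - by have := measurable_int _ ih.
  - by move=> z _; rewrite lee_fin.
have := half_int x iB n1; rewrite e1 e2; apply: le_trans.
by rewrite le_eqVlt; apply/orP; left; apply/eqP; congr `|_|; rewrite /half; ring.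
Qed.

Lemma wder_cumulative (f : R -> R) : mu.-integrable setT (EFin \o f) ->
  wder (fun x => \int[mu]_(z in `]-oo, x]) f z) f.
Proof.
move=> fi b c bc; have iS (D : set R) : measurable D -> mu.-integrable D (EFin \o f).
  by move=> mD; apply: integrableS fi.
split; first exact: iS.
have i1 : mu.-integrable `]-oo, c] (EFin \o f) by exact: iS.
rewrite (Rintegral_itvB i1) ?bnd_simp// Rintegral_itv_obnd_cbnd; last exact: iS.
by rewrite /Rintegral fineK//; apply: integrable_fin_num (iS _ _) => //.
Qed.

Lemma wder_half (f : R -> R) : mu.-integrable setT (EFin \o f) ->
  wder (half f) (fun x => 2^-1 * f x).
Proof.
move=> fi; have := wderD (wderZ 2^-1 (wder_cumulative fi)) (wder_cst (- (4^-1 * \int[mu]_z f z))).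
by rewrite (_ : (fun x => 2^-1 * f x + 0) = (fun x => 2^-1 * f x))//; apply/funext => x; rewrite addr0.
Qed.

Lemma rmeas_half (f : R -> R) : mu.-integrable setT (EFin \o f) -> rmeas (half f).
Proof. by move=> /wder_half/wder_continuous; exact: rmeas_cont. Qed.

End half_operator.

Lemma posp_lip (R : realFieldType) (x y : R) : `|posp x - posp y| <= `|x - y|.
Proof.
have [h1 h2] := norm_ge (x - y); have h := normr_ge0 (x - y).
by apply: norm_le; rewrite /posp /Order.max; case: ltP => ?; case: ltP => ?; lra.
Qed.

(** * The fixed point equation for the lost energy density *)

Section delayed.
Context {R : realType}.
Local Notation mu := (@lebesgue_measure R).
Local Notation RR2 := (measurableTypeR R * measurableTypeR R)%type.

Lemma rmeas_paramint (q : R -> R -> R) :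
  measurable_fun (T := RR2) (U := measurableTypeR R) setT (fun z => q z.1 z.2) ->
  (forall x z, 0 <= q x z) -> rmeas (fun x => \int[mu]_z q x z).
Proof.
move=> mq q0; apply: (measurableT_comp (fine_measurable measurableT)).
have mf : measurable_fun (T := RR2) setT (fun z => (q z.1 z.2)%:E) by exact/measurable_EFinP.
apply: (measurable_fun_fubini_tonelli_F (m2 := mu) (fun z : RR2 => (q z.1 z.2)%:E) mf) => z.
by rewrite lee_fin.
Qed.

Variables (alpha : R -> R) (a M : R) (y0 U0 Hx tau : R -> R) (D : R -> bool).
Hypotheses (a0 : 0 <= a) (M0 : 0 <= M).
Hypothesis alpha01 : forall z, 0 <= alpha z <= 1.
Hypothesis alphaL : forall z z', `|alpha z - alpha z'| <= a * `|z - z'|.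
Hypotheses (my : rmeas y0) (mU : rmeas U0) (mH : rmeas Hx) (mtau : rmeas tau).
Hypothesis mD : measurable_fun (T := measurableTypeR R) setT D.
Hypotheses (H0 : forall x, 0 <= Hx x) (tau0 : forall x, 0 <= tau x).
Hypotheses (iH : mu.-integrable setT (EFin \o Hx)) (HM : \int[mu]_x Hx x <= M).
Implicit Types (Phi : R -> R).

(** For a given density [Phi] of lost energy the flow is explicit: [dlP] is [V_xi], [dlG1] and
    [dlG2] are its first and second time integrals, and [half] turns these into the velocity and the
    position. The only equation left is the one for [Phi]. *)
Definition dlP Phi x s : R := Hx x - (if tau x <= s then Phi x else 0).
Definition dlG1 Phi s x : R := s * Hx x - Phi x * posp (s - tau x).
Definition dlG2 Phi s x : R := s ^+ 2 / 2 * Hx x - Phi x * (posp (s - tau x) ^+ 2 / 2).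
Definition dlU Phi x s : R := U0 x + half (dlG1 Phi s) x.
Definition dlY Phi x s : R := y0 x + s * U0 x + half (dlG2 Phi s) x.

Definition dlok Phi : Prop := rmeas Phi /\ forall x, 0 <= Phi x <= Hx x.

Lemma posp_tau s x : 0 <= posp (s - tau x) <= `|s|.
Proof.
rewrite posp_ge0/=; apply: posp_le => //; have := ler_norm s; have := tau0 x; lra.
Qed.

Lemma rmeas_dlG1 Phi s : dlok Phi -> rmeas (dlG1 Phi s).
Proof.
move=> ok; apply: rmeasB; first exact: rmeasZ.
apply: rmeasM; first by case: ok.
by apply: rmeas_posp; apply: rmeasB => //; exact: rmeas_cst.
Qed.

Lemma rmeas_dlG2 Phi s : dlok Phi -> rmeas (dlG2 Phi s).
Proof.
move=> ok; apply: rmeasB; first exact: rmeasZ.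
apply: rmeasM; first by case: ok.
under [X in rmeas X]funext do rewrite mulrC.
apply: rmeasZ; apply: rmeasX.
by apply: rmeas_posp; apply: rmeasB => //; exact: rmeas_cst.
Qed.

Lemma dl_int (c : R) (f : R -> R) : rmeas f -> (forall x, `|f x| <= c * Hx x) ->
  mu.-integrable setT (EFin \o f).
Proof.
move=> mf fc; apply: (@integrable_dom _ _ _ (fun x => c * Hx x)) => //.
  exact: (integrableZl _ c iH).
by move=> x _; apply: le_trans (fc x) (ler_norm _).
Qed.

Lemma dlG1_lip Phi s s' x : dlok Phi ->
  `|dlG1 Phi s x - dlG1 Phi s' x| <= 2 * `|s - s'| * Hx x.
Proof.
move=> ok; have [mK /(_ x)/andP[k0 k1]] := ok.
rewrite (_ : _ - _ = (s - s') * Hx x - Phi x * (posp (s - tau x) - posp (s' - tau x))); last first.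
  by rewrite /dlG1; ring.
apply: le_trans (ler_normB _ _) _; rewrite !normrM (ger0_norm (H0 x)) (ger0_norm k0).
have p : `|posp (s - tau x) - posp (s' - tau x)| <= `|s - s'|.
  apply: le_trans (posp_lip _ _) _; rewrite le_eqVlt; apply/orP; left; apply/eqP.
  by congr `|_|; ring.
have := ler_pM k0 (normr_ge0 _) k1 p; lra.
Qed.

Lemma posp_tau0 x : posp (0 - tau x) = 0.
Proof. by rewrite /posp sub0r max_r// oppr_le0. Qed.

Lemma dlG10 Phi x : dlG1 Phi 0 x = 0.
Proof. by rewrite /dlG1 posp_tau0 mul0r mulr0 subr0. Qed.

Lemma dlG20 Phi x : dlG2 Phi 0 x = 0.
Proof. by rewrite /dlG2 posp_tau0 expr0n/= !mul0r mulr0 subr0. Qed.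

Lemma dlG2_lip Phi s s' x : dlok Phi ->
  `|dlG2 Phi s x - dlG2 Phi s' x| <= `|s - s'| * (`|s| + `|s'|) * Hx x.
Proof.
move=> ok; have [mK /(_ x)/andP[k0 k1]] := ok.
rewrite (_ : _ - _ = (s - s') * ((s + s') / 2) * Hx x - Phi x *
  ((posp (s - tau x) - posp (s' - tau x)) * ((posp (s - tau x) + posp (s' - tau x)) / 2))); last first.
  by rewrite /dlG2; field.
apply: le_trans (ler_normB _ _) _; rewrite !normrM (ger0_norm (H0 x)) (ger0_norm k0).
have p : `|posp (s - tau x) - posp (s' - tau x)| <= `|s - s'|.
  apply: le_trans (posp_lip _ _) _; rewrite le_eqVlt; apply/orP; left; apply/eqP.
  by congr `|_|; ring.
have h2 : `|2^-1 : R| = 2^-1 by rewrite ger0_norm ?invr_ge0.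
have /andP[q0 q1] := posp_tau s x; have /andP[r0 r1] := posp_tau s' x.
have z : `|posp (s - tau x) + posp (s' - tau x)| * `|2^-1| <= (`|s| + `|s'|) / 2.
  by rewrite h2 ger0_norm ?addr_ge0//; lra.
have w : `|s + s'| * `|2^-1| <= (`|s| + `|s'|) / 2 by rewrite h2; have := ler_normD s s'; lra.
have n0 := normr_ge0 (s - s').
have z' := ler_pM (normr_ge0 _) (mulr_ge0 (normr_ge0 _) (normr_ge0 _)) p z.
have z'' := ler_pM k0 (mulr_ge0 (normr_ge0 _) (mulr_ge0 (normr_ge0 _) (normr_ge0 _))) k1 z'.
have w' := ler_wpM2r (H0 x) (ler_wpM2l n0 w).
apply: le_trans (lerD w' z'') _.
by rewrite le_eqVlt; apply/orP; left; apply/eqP; field.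
Qed.

Lemma dlG1_int Phi s : dlok Phi -> mu.-integrable setT (EFin \o dlG1 Phi s).
Proof.
move=> ok; apply: (@dl_int (2 * `|s - 0|)); first exact: rmeas_dlG1.
by move=> x; have := dlG1_lip s 0 x ok; rewrite dlG10 subr0.
Qed.

Lemma dlG2_int Phi s : dlok Phi -> mu.-integrable setT (EFin \o dlG2 Phi s).
Proof.
move=> ok; apply: (@dl_int (`|s - 0| * (`|s| + `|0 : R|))); first exact: rmeas_dlG2.
by move=> x; rewrite -[X in `|X|]subr0 -[X in `|_ - X|](dlG20 Phi x); exact: dlG2_lip.
Qed.

Lemma int_cHx (c : R) : 0 <= c -> mu.-integrable setT (EFin \o (fun x => c * Hx x)) /\
  \int[mu]_x (c * Hx x) <= c * M.
Proof.
move=> c0; split; first exact: (integrableZl _ c iH).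
have -> : \int[mu]_x (c * Hx x) = c * \int[mu]_x Hx x by apply: RintegralZl.
exact: ler_wpM2l.
Qed.

Lemma half_G1_lip Phi s s' x : dlok Phi ->
  `|half (dlG1 Phi s) x - half (dlG1 Phi s') x| <= `|s - s'| * (M / 2).
Proof.
move=> ok; have c0 : 0 <= 2 * `|s - s'| by rewrite mulr_ge0.
have [i1 i2] := int_cHx c0.
have := half_dist x (dlG1_int s ok) (dlG1_int s' ok) i1 (fun z => dlG1_lip s s' z ok) i2; lra.
Qed.

Lemma half_G2_lip Phi s s' x : dlok Phi ->
  `|half (dlG2 Phi s) x - half (dlG2 Phi s') x| <= `|s - s'| * ((`|s| + `|s'|) * M / 4).
Proof.
move=> ok; have c0 : 0 <= `|s - s'| * (`|s| + `|s'|) by rewrite mulr_ge0// addr_ge0.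
have [i1 i2] := int_cHx c0.
have := half_dist x (dlG2_int s ok) (dlG2_int s' ok) i1 (fun z => dlG2_lip s s' z ok) i2; lra.
Qed.

Lemma lip_continuous (f : R -> R) (c : R -> R) : (forall s s', `|s - s'| <= 1 -> `|f s - f s'| <= `|s - s'| * c s) ->
  continuous f.
Proof.
move=> h s; apply/cvgrPdist_le => e e0; pose k := `|c s| + 1.
have k0 : 0 < k by rewrite ltr_wpDl.
near=> s'; have d1 : `|s - s'| <= 1 by near: s'; apply: cvgr_dist_le.
have d2 : `|s - s'| <= e / k by near: s'; apply: cvgr_dist_le => //; rewrite divr_gt0.
apply: le_trans (h _ _ d1) _; apply: le_trans (_ : `|s - s'| * k <= _); last by rewrite -ler_pdivlMr.
by apply: ler_wpM2l => //; rewrite /k; have := ler_norm (c s); lra.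
Unshelve. all: by end_near. Qed.

Lemma dlU_continuous Phi x : dlok Phi -> continuous (dlU Phi x).
Proof.
move=> ok; apply: (@lip_continuous _ (fun=> M / 2)) => s s' _.
by rewrite /dlU opprD addrACA subrr add0r; exact: half_G1_lip.
Qed.

Lemma dlY_continuous Phi x : dlok Phi -> continuous (dlY Phi x).
Proof.
move=> ok; apply: (@lip_continuous _ (fun s => `|U0 x| + (2 * `|s| + 1) * M / 4)) => s s' d.
rewrite (_ : _ - _ = (s - s') * U0 x + (half (dlG2 Phi s) x - half (dlG2 Phi s') x)); last first.
  by rewrite /dlY; ring.
apply: le_trans (ler_normD _ _) _; rewrite normrM mulrDr lerD2l.
apply: le_trans (half_G2_lip _ _ _ ok) _; apply: ler_wpM2l => //.
rewrite ler_pM2r ?invr_gt0//; apply: ler_wpM2r => //.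
have := ler_distD s s' 0; rewrite !subr0 (distrC s'); lra.
Qed.

Lemma joint1 (f : R -> R) : rmeas f ->
  measurable_fun (T := RR2) (U := measurableTypeR R) setT (fun z => f z.1).
Proof. by move=> mf; apply: (measurableT_comp mf); exact: measurable_fst. Qed.

Lemma joint2 (f : R -> R) : rmeas f ->
  measurable_fun (T := RR2) (U := measurableTypeR R) setT (fun z => f z.2).
Proof. by move=> mf; apply: (measurableT_comp mf); exact: measurable_snd. Qed.

(** The breaking time varies with the label, so measurability at fixed times is not enough. The
    value is written through parametrised integrals of nonnegative, jointly measurable functions,
    the constraint [z <= x] becoming part of the integrand. *)
Lemma rmeas_dlY_tau Phi : dlok Phi -> rmeas (fun x => dlY Phi x (tau x)).
Proof.
move=> ok; have [mK _] := ok.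
pose q (x z : R) := dlG2 Phi (tau x) z.
have q0 x z : 0 <= q x z.
  have [_ /(_ z)/andP[k0 k1]] := ok; have /andP[p0 p1] := posp_tau (tau x) z.
  rewrite /q /dlG2 subr_ge0 [X in _ <= X]mulrC; apply: ler_pM => //; first by rewrite mulr_ge0 ?invr_ge0// sqr_ge0.
  rewrite (ger0_norm (tau0 x)) in p1.
  by rewrite ler_pM2r ?invr_gt0// lerXn2r// nnegrE.
have mq : measurable_fun (T := RR2) (U := measurableTypeR R) setT (fun z => q z.1 z.2).
  apply: measurable_funB.
    apply: measurable_funM; last exact: joint2.
    by apply: measurable_funM; [apply: measurable_funX; exact: joint1|exact: measurable_cst].
  apply: measurable_funM; first exact: joint2.
  apply: measurable_funM; last exact: measurable_cst.
  apply: measurable_funX; apply: measurable_maxr; last exact: measurable_cst.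
  by apply: measurable_funB; [exact: joint1|exact: joint2].
pose qx (x z : R) := if z <= x then q x z else 0.
have mqx : measurable_fun (T := RR2) (U := measurableTypeR R) setT (fun z => qx z.1 z.2).
  apply: measurable_fun_ifT => //.
  by apply: measurable_fun_ler; [exact: measurable_snd|exact: measurable_fst].
have e x : half (q x) x = 2^-1 * \int[mu]_z qx x z - 4^-1 * \int[mu]_z q x z.
  rewrite /half; congr (_ * _ - _); rewrite Rintegral_mkcond; apply: eq_Rintegral => z _.
  rewrite /qx /patch; case: ifPn; rewrite ?inE ?notin_setE/= in_itv/=; first by move=> ->.
  by move=> /negP/negbTE->.
under [X in rmeas X]funext do rewrite /dlY -/(q _) e.
apply: rmeasD; first by apply: rmeasD => //; exact: rmeasM.
by apply: rmeasB; apply: rmeasZ; apply: rmeas_paramint => // x z; rewrite /qx; case: ifP.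
Qed.

Definition picard Phi x : R := if D x then Hx x * alpha (dlY Phi x (tau x)) else 0.

Lemma picard_ok Phi : dlok Phi -> dlok (picard Phi).
Proof.
move=> ok; split; last first.
  move=> x; have /andP[p0 p1] := alpha01 (dlY Phi x (tau x)).
  by rewrite /picard; case: ifP => _; rewrite ?lexx ?H0// mulr_ge0//= ler_piMr.
apply: rmeas_if => //; last exact: rmeas_cst.
by apply: rmeasM => //; exact: rmeas_comp (rmeas_cont (alpha_cont a0 alphaL)) (rmeas_dlY_tau ok).
Qed.

Local Notation lam := (a * M + 1).

(** The position at time [tau x] involves [Phi z] only through [posp (tau x - tau z) ^ 2], hence
    only for labels that broke earlier. Against the weight [exp (lam * tau)] this square costs
    [2 / lam ^ 2], and [lam = a * M + 1] gives [a * M <= lam ^ 2]. No restriction to short times is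
    involved. *)
Lemma picard_contract Phi Psi (c : R) : dlok Phi -> dlok Psi -> 0 <= c ->
  (forall x, `|Phi x - Psi x| <= c * (Hx x * expR (lam * tau x))) ->
  forall x, `|picard Phi x - picard Psi x| <= c / 2 * (Hx x * expR (lam * tau x)).
Proof.
move=> ok ok' c0 h x; set t := tau x; have t0 : 0 <= t by exact: tau0.
have l1 : 1 <= lam by rewrite lerDr mulr_ge0.
have l0 : 0 < lam by lra.
have l2 : 0 < lam ^+ 2 by rewrite exprn_gt0.
pose d : R := c * (2 / lam ^+ 2) * expR (lam * t).
have d0 : 0 <= d by rewrite !mulr_ge0 ?expR_ge0// invr_ge0 ltW.
have g z : `|dlG2 Phi t z - dlG2 Psi t z| <= d * Hx z.
  have z0 := H0 z; have p0 := posp_ge0 (t - tau z).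
  rewrite (_ : _ - _ = - ((Phi z - Psi z) * (posp (t - tau z) ^+ 2 / 2))); last first.
    by rewrite /dlG2; ring.
  rewrite normrN normrM [`|_ / 2|]ger0_norm; last by rewrite mulr_ge0 ?invr_ge0// exprn_ge0.
  have k := h z.
  have [tz|tz] := leP t (tau z).
    by rewrite /posp max_r ?subr_le0// expr0n/= mul0r mulr0 mulr_ge0.
  have s0 : 0 <= t - tau z by rewrite subr_ge0 ltW.
  have := sqr_le_expR s0 l0; rewrite /posp max_l// => e.
  apply: le_trans (ler_pM _ _ k e) _ => //.
    by rewrite mulr_ge0 ?invr_ge0// exprn_ge0.
  rewrite /d (_ : lam * t = lam * tau z + lam * (t - tau z)); last by ring.
  by rewrite exp.expRD le_eqVlt; apply/orP; left; apply/eqP; ring.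
have [i1 i2] := int_cHx d0.
have := half_dist x (dlG2_int t ok) (dlG2_int t ok') i1 g i2 => hd.
have x0 := H0 x; rewrite /picard; case: ifP => _; last by rewrite subrr normr0 !mulr_ge0 ?expR_ge0// invr_ge0.
rewrite -mulrBr normrM (ger0_norm x0) mulrCA; apply: ler_wpM2l => //.
apply: le_trans (alphaL _ _) _.
rewrite (_ : dlY _ _ _ - _ = half (dlG2 Phi t) x - half (dlG2 Psi t) x); last first.
  by rewrite /dlY -/t; ring.
apply: le_trans (ler_wpM2l a0 hd) _.
rewrite (_ : a * (d * M / 4) = (a * M / lam ^+ 2) * (c / 2 * expR (lam * t))); last first.
  by rewrite /d; field; rewrite gt_eqF.
rewrite ler_piMl//; first by rewrite !mulr_ge0 ?expR_ge0// invr_ge0.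
have aM : 0 <= a * M by rewrite mulr_ge0.
by rewrite ler_pdivrMr// mul1r; have := sqr_ge0 (a * M); nra.
Qed.

(** The iterates converge at each label with rate [2 ^ -n] relative to [Hx * exp (lam * tau)]. This
    weight may be unbounded in the label, so the limit is taken pointwise and inherits measurability
    from the iterates. *)
Lemma picard_fixpoint : exists Phi, dlok Phi /\ forall x, Phi x = picard Phi x.
Proof.
pose u n := iter n picard (fun=> 0).
have ok0 : dlok (fun=> 0) by split; [exact: rmeas_cst|move=> x; rewrite lexx H0].
have uok n : dlok (u n) by elim: n => [//|n IH]; exact: picard_ok.
have l0 : 0 <= lam by rewrite addr_ge0// mulr_ge0.
have e1 x : 1 <= expR (lam * tau x) by rewrite -[X in X <= _]exp.expR0 ler_expR mulr_ge0.
have step n x : `|u n.+1 x - u n x| <= 2^-1 ^+ n * (Hx x * expR (lam * tau x)).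
  elim: n x => [|n IH] x.
    have [_ /(_ x)/andP[p0 p1]] := uok 1%N.
    by rewrite expr0 mul1r subr0 ger0_norm// (le_trans p1)// ler_peMr.
  have pn : (0 : R) <= 2^-1 ^+ n by rewrite exprn_ge0// invr_ge0.
  have := picard_contract (uok n.+1) (uok n) pn IH x.
  by rewrite exprS [X in _ <= X * _ -> _]mulrC.
pose Phi x := limn (u ^~ x).
have lim x : u ^~ x @ \oo --> Phi x /\ forall n, `|Phi x - u n x| <= 2 * (Hx x * expR (lam * tau x)) * 2^-1 ^+ n.
  by apply: geometric_limit => n; rewrite mulrC; exact: step.
have okP : dlok Phi.
  split; first by apply: (measurable_fun_cvg (h := u)) => [n|x _]; [case: (uok n)|case: (lim x)].
  move=> x; have [cu _] := lim x.
  have cu' : cvgn (u ^~ x) by apply/cvg_ex; exists (Phi x).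
  apply/andP; split; [apply: limr_ge => //|apply: limr_le => //];
    by apply: nearW => n; have [_ /(_ x)/andP[]] := uok n.
exists Phi; split => // x; apply/eqP; rewrite -subr_eq0 -normr_le0.
apply/ler_addgt0Pl => e e0; rewrite addr0.
set E := Hx x * expR (lam * tau x).
have [n hn] : exists n : nat, 2 * E * 2^-1 ^+ n <= e.
  have : (fun n : nat => 2 * E * 2^-1 ^+ n) @ \oo --> (0 : R).
    by apply: cvg_geometric; rewrite ger0_norm ?invr_ge0//; lra.
  move=> /cvgrPdist_le/(_ _ e0)[n _ /(_ n (leqnn n))]; rewrite sub0r normrN => h.
  by exists n; apply: le_trans (ler_norm _) h.
have pn : (0 : R) <= 2 * 2^-1 ^+ n by rewrite mulr_ge0// exprn_ge0// invr_ge0.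
have h1 : `|picard Phi x - u n.+1 x| <= 2 * 2^-1 ^+ n / 2 * E.
  apply: (picard_contract okP (uok n) pn _ x) => z.
  by have [_ /(_ n)] := lim z; rewrite mulrAC.
have h2 : `|Phi x - u n.+1 x| <= 2 * E * 2^-1 ^+ n.+1 by have [_] := lim x; apply.
apply: le_trans hn; apply: le_trans (ler_distD (u n.+1 x) _ _) _; rewrite [`|u _ _ - _|]distrC.
by apply: le_trans (lerD h2 h1) _; rewrite exprS le_eqVlt; apply/orP; left; apply/eqP; field.
Qed.

Lemma int_step (b c s : R) : 0 <= b -> 0 <= s ->
  \int[mu]_(r in `[0, s]) (if b <= r then c else 0) = c * posp (s - b).
Proof.
move=> b0 s0; rewrite Rintegral_mkcond.
transitivity (\int[mu]_(r in `[b, s]) c).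
  rewrite [RHS]Rintegral_mkcond; apply: eq_Rintegral => r _; rewrite /patch !mem_setE !in_itv/=.
  by have [br|rb] := leP b r; rewrite ?if_same// (le_trans b0 br).
rewrite Rintegral_cst//; have [bs|sb] := leP b s.
  rewrite [X in fine X](_ : _ = (s - b)%:E); last exact: lebesgue_itvcc.
  by rewrite /posp max_l// subr_ge0.
rewrite set_itv_ge ?bnd_simp -?ltNge// measure0/= mulr0 /posp max_r ?mulr0// subr_le0 ltW//.
Qed.

Lemma half_int_swap (P : R -> R -> R) (h : R -> R) (t x : R) : 0 <= t ->
  measurable_fun (T := RR2) (U := measurableTypeR R) setT (fun z => P z.1 z.2) ->
  mu.-integrable setT (EFin \o h) -> (forall z s, 0 <= s <= t -> `|P z s| <= `|h z|) ->
  mu.-integrable `[0, t] (EFin \o (fun s => half (P^~ s) x)) /\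
  \int[mu]_(s in `[0, t]) half (P^~ s) x = half (fun z => \int[mu]_(s in `[0, t]) P z s) x.
Proof.
move=> t0 mP ih Ph.
have i1 := half_fubini_integrable_t (X := `]-oo, x]) (measurable_itv _) t0 mP ih Ph.
have i2 := half_fubini_integrable_t measurableT t0 mP ih Ph.
have j1 : mu.-integrable `[0, t] (EFin \o (fun s => 2^-1 * \int[mu]_(z in `]-oo, x]) P z s)).
  exact: (integrableZl _ _ i1).
have j2 : mu.-integrable `[0, t] (EFin \o (fun s => 4^-1 * \int[mu]_z P z s)).
  exact: (integrableZl _ _ i2).
split; first exact: integrableBr j1 j2.
rewrite /half.
have -> : \int[mu]_(s in `[0, t]) (2^-1 * \int[mu]_(z in `]-oo, x]) P z s - 4^-1 * \int[mu]_z P z s) =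
    \int[mu]_(s in `[0, t]) (2^-1 * \int[mu]_(z in `]-oo, x]) P z s) -
    \int[mu]_(s in `[0, t]) (4^-1 * \int[mu]_z P z s) by exact: (RintegralB _ j1 j2).
have -> : \int[mu]_(s in `[0, t]) (2^-1 * \int[mu]_(z in `]-oo, x]) P z s) =
    2^-1 * \int[mu]_(s in `[0, t]) \int[mu]_(z in `]-oo, x]) P z s by apply: RintegralZl.
have -> : \int[mu]_(s in `[0, t]) (4^-1 * \int[mu]_z P z s) =
    4^-1 * \int[mu]_(s in `[0, t]) \int[mu]_z P z s by apply: RintegralZl.
rewrite (half_fubini (X := `]-oo, x]) (measurable_itv _) t0 mP ih Ph).
by rewrite (half_fubini measurableT t0 mP ih Ph).
Qed.

Lemma int_dlP Phi x t : 0 <= t -> \int[mu]_(s in `[0, t]) dlP Phi x s = dlG1 Phi t x.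
Proof.
move=> t0; rewrite /dlP.
have i1 : mu.-integrable `[0, t] (EFin \o (fun=> Hx x)).
  apply: continuous_compact_integrable; first exact: segment_compact.
  by apply: continuous_subspaceT => y; exact: cvg_cst.
have i2 : mu.-integrable `[0, t] (EFin \o (fun s => if tau x <= s then Phi x else 0)).
  apply: (@integrable_dom _ _ _ (fun=> Phi x)) => //.
  - apply: rmeas_if; [|exact: rmeas_cst|exact: rmeas_cst].
    by apply: measurable_fun_ler => //; exact: rmeas_cst.
  - apply: continuous_compact_integrable; first exact: segment_compact.
    by apply: continuous_subspaceT => y; exact: cvg_cst.
  - by move=> s _; case: ifP => _ //; rewrite normr0.
have -> : \int[mu]_(s in `[0, t]) (Hx x - (if tau x <= s then Phi x else 0)) =
  \int[mu]_(s in `[0, t]) Hx x - \int[mu]_(s in `[0, t]) (if tau x <= s then Phi x else 0).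
  exact: (RintegralB _ i1 i2).
rewrite int_step// Rintegral_cst// [X in fine X](_ : _ = t%:E); last by rewrite [LHS]lebesgue_itvcc// subr0.
by rewrite /dlG1 mulrC.
Qed.

Lemma int_dlG1 Phi x t : 0 <= t -> \int[mu]_(s in `[0, t]) dlG1 Phi s x = dlG2 Phi t x.
Proof.
move=> t0.
have ci (g : R -> R) : continuous g -> mu.-integrable `[0, t] (EFin \o g).
  move=> cg; apply: continuous_compact_integrable; first exact: segment_compact.
  exact: continuous_subspaceT.
have i1 : mu.-integrable `[0, t] (EFin \o (fun s => Hx x * s)).
  by apply: ci => s; apply: cvgM; [exact: cvg_cst|exact: cvg_id].
have i3 : mu.-integrable `[0, t] (EFin \o (fun s => posp (s - tau x))).
  apply: ci => s; apply: (@continuous_comp R R R (fun s => s - tau x) posp).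
    by apply: cvgB; [exact: cvg_id|exact: cvg_cst].
  by apply: continuous_max; [exact: cvg_id|exact: cvg_cst].
have i2 : mu.-integrable `[0, t] (EFin \o (fun s => Phi x * posp (s - tau x))).
  exact: (integrableZl _ _ i3).
transitivity (\int[mu]_(s in `[0, t]) (Hx x * s - Phi x * posp (s - tau x))).
  by apply: eq_Rintegral => s _; rewrite /dlG1 mulrC.
have -> : \int[mu]_(s in `[0, t]) (Hx x * s - Phi x * posp (s - tau x)) =
  \int[mu]_(s in `[0, t]) (Hx x * s) - \int[mu]_(s in `[0, t]) (Phi x * posp (s - tau x)).
  exact: (RintegralB _ i1 i2).
have -> : \int[mu]_(s in `[0, t]) (Phi x * posp (s - tau x)) =
  Phi x * \int[mu]_(s in `[0, t]) posp (s - tau x) by apply: RintegralZl.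
by rewrite int_lin// int_posp// /dlG2; field.
Qed.

Lemma dlU_eq Phi x t : dlok Phi -> 0 <= t ->
  mu.-integrable `[0, t] (EFin \o (fun s => half (dlP Phi ^~ s) x)) /\
  dlU Phi x t = U0 x + \int[mu]_(s in `[0, t]) half (dlP Phi ^~ s) x.
Proof.
move=> ok t0.
have mP : measurable_fun (T := RR2) (U := measurableTypeR R) setT (fun z => dlP Phi z.1 z.2).
  apply: measurable_funB; first exact: joint1.
  apply: measurable_fun_ifT => //.
    by apply: measurable_fun_ler; [exact: joint1|exact: measurable_snd].
  by apply: joint1; case: ok.
have Ph z s : 0 <= s <= t -> `|dlP Phi z s| <= `|Hx z|.
  move=> _; have [_ /(_ z)/andP[k0 k1]] := ok; have h := H0 z.
  by rewrite /dlP (ger0_norm h); case: ifP => _; rewrite ?subr0 ger0_norm//; lra.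
have [i ->] := half_int_swap x t0 mP iH Ph; split => //.
suff -> : (fun z => \int[mu]_(s in `[0, t]) dlP Phi z s) = dlG1 Phi t by reflexivity.
by apply/funext => z; exact: int_dlP.
Qed.

Lemma dlY_eq Phi x t : dlok Phi -> 0 <= t ->
  dlY Phi x t = y0 x + \int[mu]_(s in `[0, t]) dlU Phi x s.
Proof.
move=> ok t0.
have mP : measurable_fun (T := RR2) (U := measurableTypeR R) setT (fun z => dlG1 Phi z.2 z.1).
  apply: measurable_funB.
    by apply: measurable_funM; [exact: measurable_snd|exact: joint1].
  apply: measurable_funM; first by apply: joint1; case: ok.
  apply: measurable_maxr; last exact: measurable_cst.
  by apply: measurable_funB; [exact: measurable_snd|exact: joint1].
have it : mu.-integrable setT (EFin \o (fun z => 2 * t * Hx z)) by exact: (integrableZl _ _ iH).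
have Ph z s : 0 <= s <= t -> `|dlG1 Phi s z| <= `|2 * t * Hx z|.
  move=> /andP[s0 st]; have := dlG1_lip s 0 z ok; rewrite dlG10 subr0 subr0 (ger0_norm s0) => h.
  have h0 := H0 z; rewrite [`|2 * t * _|]ger0_norm ?mulr_ge0//; apply: le_trans h _.
  by rewrite ler_wpM2r// ler_wpM2l.
have [i e] := half_int_swap x t0 mP it Ph.
have ic : mu.-integrable `[0, t] (EFin \o (fun=> U0 x)).
  apply: continuous_compact_integrable; first exact: segment_compact.
  by apply: continuous_subspaceT => y; exact: cvg_cst.
have -> : \int[mu]_(s in `[0, t]) dlU Phi x s = \int[mu]_(s in `[0, t]) U0 x +
  \int[mu]_(s in `[0, t]) half (dlG1 Phi s) x by exact: (RintegralD _ ic i).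
rewrite e Rintegral_cst// [X in fine X](_ : _ = t%:E); last by rewrite [LHS]lebesgue_itvcc// subr0.
rewrite /dlY -addrA; congr (_ + (_ + half _ _)); first by rewrite mulrC.
by apply/funext => z; rewrite int_dlG1.
Qed.

Lemma rmeas_dlU Phi s : dlok Phi -> rmeas (dlU Phi ^~ s).
Proof. by move=> ok; apply: rmeasD => //; apply: rmeas_half; exact: dlG1_int. Qed.

Lemma rmeas_dlY Phi s : dlok Phi -> rmeas (dlY Phi ^~ s).
Proof.
move=> ok; apply: rmeasD; first by apply: rmeasD => //; exact: rmeasZ.
by apply: rmeas_half; exact: dlG2_int.
Qed.

End delayed.

(** * Solutions of the flow equations *)

Section solution.
Context {R : realType}.
Local Notation mu := (@lebesgue_measure R).
Variables (alpha : R -> R) (a M : R) (y0 yx U0 Ux Hx r : R -> R).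
Hypotheses (a0 : 0 <= a) (M0 : 0 <= M).
Hypothesis alpha01 : forall z, 0 <= alpha z <= 1.
Hypothesis alphaL : forall z z', `|alpha z - alpha z'| <= a * `|z - z'|.
Hypotheses (dy : wder y0 yx) (dU : wder U0 Ux) (mr : rmeas r) (mH : rmeas Hx).
Hypotheses (iH : mu.-integrable setT (EFin \o Hx)) (HM : \int[mu]_x Hx x <= M).
Hypothesis data : aeL (fun x => [/\ 0 <= yx x, 0 <= Hx x, yx x * Hx x = Ux x ^+ 2 + r x ^+ 2 &
  yx x + Hx x = 1]).

(** The breaking time without the value infinity: [brk] tells whether it is finite, and [btime] has
    the default value 0 when it is not. *)
Definition brk x : bool := (yx x == 0) || ((r x == 0) && (Ux x < 0)).
Definition btime x : R := if yx x == 0 then 0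
  else if (r x == 0) && (Ux x < 0) then - 2 * Ux x / Hx x else 0.
Definition Vi (Y : R -> R -> R) t x : R :=
  Hx x * (1 - (if brk x && (btime x <= t) then alpha (Y x (btime x)) else 0)).

Definition solves (Y U : R -> R -> R) : Prop :=
  (forall t, 0 <= t -> rmeas (Vi Y t)) /\
  (forall x t, 0 <= t ->
     Y x t = y0 x + \int[mu]_(s in `[0, t]) U x s /\
     U x t = U0 x + \int[mu]_(s in `[0, t])
       ((\int[mu]_(z in `]-oo, x]) Vi Y s z) / 2 - (\int[mu]_z Vi Y s z) / 4)) /\
  (forall x, {within `[0, +oo[, continuous (Y x)} /\ {within `[0, +oo[, continuous (U x)}).

Let my : rmeas y0. Proof. exact: rmeas_cont (wder_continuous dy). Qed.
Let mU : rmeas U0. Proof. exact: rmeas_cont (wder_continuous dU). Qed.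
Let myx : rmeas yx. Proof. exact: wder_meas dy. Qed.
Let mUx : rmeas Ux. Proof. exact: wder_meas dU. Qed.

(** [Hp] and [tp] are nonnegative at every label, as the fixed point construction requires, and
    agree with [Hx] and [btime] almost everywhere. *)
Let Hp x : R := `|Hx x|.
Let tp x : R := posp (btime x).

Lemma rmeas_eq0 (f : R -> R) : rmeas f ->
  measurable_fun (T := measurableTypeR R) setT (fun x => f x == 0).
Proof. by move=> mf; apply: measurable_fun_eqr => //; exact: rmeas_cst. Qed.

Lemma meas_late : measurable_fun (T := measurableTypeR R) setT (fun x => (r x == 0) && (Ux x < 0)).
Proof.
apply: measurable_and; first exact: rmeas_eq0.
by apply: measurable_fun_ltr => //; exact: rmeas_cst.
Qed.

Lemma meas_brk : measurable_fun (T := measurableTypeR R) setT brk.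
Proof. by apply: measurable_or; [exact: rmeas_eq0|exact: meas_late]. Qed.

Lemma rmeas_btime : rmeas btime.
Proof.
apply: rmeas_if; [exact: rmeas_eq0|exact: rmeas_cst|].
apply: rmeas_if; [exact: meas_late| |exact: rmeas_cst].
apply: rmeasM; first exact: rmeasZ.
exact: rmeasV.
Qed.

(** If [y_xi = 0] then [U_xi = 0], and both relations hold with breaking time 0. Otherwise [r = 0],
    and they follow from [y_xi * H_xi = U_xi ^ 2]. *)
Lemma brk_data : aeL (fun x => [/\ 0 <= btime x,
  brk x -> Hx x * btime x = - 2 * Ux x & brk x -> yx x = Hx x * btime x ^+ 2 / 4]).
Proof.
apply: aeL_mp data => x [y0' H0' e one]; rewrite /brk /btime.
have [z|z] := eqVneq (yx x) 0.
  have U2 : Ux x ^+ 2 = 0.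
    have h1 := sqr_ge0 (Ux x); have h2 := sqr_ge0 (r x); move: e; rewrite z mul0r => e.
    by apply/eqP; rewrite eq_le h1 andbT; lra.
  have -> : Ux x = 0 by apply/eqP; rewrite -sqrf_eq0 U2.
  by split => //= _; rewrite ?mulr0// expr0n/= mulr0 mul0r.
case: ifPn => [|_] /=; last by split.
case/andP => /eqP r0 U0'; rewrite r0 expr0n/= addr0 in e.
have yp : 0 < yx x by rewrite lt_neqAle eq_sym z.
have Hp' : 0 < Hx x.
  rewrite lt_neqAle eq_sym H0' andbT; apply/eqP => h; move: e; rewrite h mulr0 => /esym/eqP.
  by rewrite sqrf_eq0 lt_eqF.
have H1 : Hx x != 0 by rewrite gt_eqF.
split; first by rewrite mulr_ge0 ?invr_ge0//; lra.
- by move=> _; field; exact: H1.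
- move=> _; apply: (mulIf H1); rewrite e; field; exact: H1.
Qed.

Let Hp0 x : 0 <= Hp x. Proof. exact: normr_ge0. Qed.
Let tp0 x : 0 <= tp x. Proof. exact: posp_ge0. Qed.
Let mHp : rmeas Hp. Proof. exact: rmeas_norm. Qed.
Let mtp : rmeas tp. Proof. by apply: rmeas_posp; exact: rmeas_btime. Qed.
Let iHp : mu.-integrable setT (EFin \o Hp). Proof. exact: (integrable_norm iH). Qed.

Let HpE : aeL (fun x => Hp x = Hx x).
Proof. by apply: aeL_mp data => x [_ h _ _]; rewrite /Hp ger0_norm. Qed.

Lemma aeL_Rint (D : set R) (f g : R -> R) : measurable D -> rmeas f -> rmeas g ->
  aeL (fun x => f x = g x) -> \int[mu]_(x in D) f x = \int[mu]_(x in D) g x.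
Proof.
move=> mD mf mg fg; rewrite /Rintegral; congr fine; apply: ae_eq_integral => //.
- by apply/measurable_EFinP; exact: measurable_funTS.
- by apply/measurable_EFinP; exact: measurable_funTS.
by apply: aeL_mp fg => x -> _.
Qed.

Let HMp : \int[mu]_x Hp x <= M.
Proof. by rewrite (aeL_Rint measurableT mHp mH HpE). Qed.

Lemma tp_le s x : 0 <= s -> (tp x <= s) = (btime x <= s).
Proof. by move=> s0; rewrite /tp /posp ge_max s0 andbT. Qed.

Lemma solution_exists : exists Y U, solves Y U.
Proof.
have [K [ok Kfix]] := picard_fixpoint a0 M0 alpha01 alphaL my mU mHp mtp meas_brk Hp0 tp0 iHp HMp.
(* The positive part of [t] makes the position at [btime x] equal to the one at [tp x] for every
   label, also on the null set where [btime] may be negative. *)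
pose Y x t := dlY y0 U0 Hp tp K x (posp t); pose U x t := dlU U0 Hp tp K x t.
have Yt x : Y x (btime x) = dlY y0 U0 Hp tp K x (tp x) by [].
have mYt : rmeas (fun x => dlY y0 U0 Hp tp K x (tp x)) by exact: rmeas_dlY_tau.
have mV t : rmeas (Vi Y t).
  apply: rmeasM => //; apply: rmeasB; first exact: rmeas_cst.
  apply: rmeas_if; last exact: rmeas_cst.
    by apply: measurable_and; [exact: meas_brk|apply: measurable_fun_ler; [exact: rmeas_btime|exact: rmeas_cst]].
  by under [X in rmeas X]funext do rewrite Yt; exact: rmeas_comp (rmeas_cont (alpha_cont a0 alphaL)) mYt.
have mP t : rmeas (dlP Hp tp K ^~ t).
  apply: rmeasB => //; apply: rmeas_if; [|by case: ok|exact: rmeas_cst].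
  by apply: measurable_fun_ler => //; exact: rmeas_cst.
have VP t : 0 <= t -> aeL (fun x => Vi Y t x = dlP Hp tp K x t).
  move=> t0; apply: aeL_mp HpE => x e; rewrite /Vi /dlP (tp_le _ t0) e Kfix /picard -Yt e.
  by case: (brk x); rewrite ?if_same ?subr0 ?mulr1//=; case: ifP; rewrite ?mulrBr ?mulr1// ?mulr0.
have Ueq x t : 0 <= t -> U x t = U0 x + \int[mu]_(s in `[0, t])
       ((\int[mu]_(z in `]-oo, x]) Vi Y s z) / 2 - (\int[mu]_z Vi Y s z) / 4).
  move=> t0; have [_ e] := dlU_eq U0 mHp mtp Hp0 tp0 iHp x ok t0; rewrite /U e.
  congr (_ + _); apply: eq_Rintegral => s; rewrite inE/= in_itv/= => /andP[s0 _].
  rewrite /half mulrC [4^-1 * _]mulrC; congr (_ / _ - _ / _).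
    by apply: aeL_Rint => //; apply: aeL_mp (VP s s0) => z ->.
  by apply: aeL_Rint => //; apply: aeL_mp (VP s s0) => z ->.
have cY x : continuous (dlY y0 U0 Hp tp K x) by exact: (dlY_continuous M0 mHp mtp Hp0 tp0 iHp HMp ok).
have cU x : continuous (dlU U0 Hp tp K x) by exact: (dlU_continuous mHp mtp Hp0 tp0 iHp HMp ok).
exists Y, U; split; first by move=> t _; exact: mV.
split => [x t t0|x].
  split; last exact: Ueq.
  rewrite /Y /posp max_l//; exact: dlY_eq.
split; apply: continuous_subspaceT => s.
  apply: (@continuous_comp R R R posp (dlY y0 U0 Hp tp K x)).
    by apply: continuous_max; [exact: cvg_id|exact: cvg_cst].
  exact: cY.
exact: cU.
Qed.

Variable Hinf : R.
Hypotheses (HinfE : \int[mu]_x Hx x = Hinf) (Hinf0 : 0 <= Hinf).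

Section extraction.
Variables (Y U : R -> R -> R).
Hypothesis sol : solves Y U.

Let K x : R := if brk x then Hx x * alpha (Y x (btime x)) else 0.

Definition sol_flow : flow R := Flow Y U yx Ux Hx r K brk tp Hinf.

Lemma Vi_K t x : Vi Y t x = Hx x - (if btime x <= t then K x else 0).
Proof.
rewrite /Vi /K; case: (brk x) => /=; last by rewrite if_same subr0 mulr1 subr0.
by case: ifP; rewrite mulrBr mulr1// mulr0.
Qed.

(** The measurability of [Y] at the breaking time, which depends on the label, is recovered from
    that of [Vi] at fixed times: at integer times beyond the breaking time [Vi] equals [Hx - K]. *)
Let mK : rmeas K.
Proof.
have [mV _] := sol.
apply: (measurable_fun_cvg (h := fun (n : nat) x => Hx x - Vi Y n%:R x)) => [n|x _].
  by apply: rmeasB => //; exact: mV.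
apply: cvg_near_cst; near=> n; rewrite Vi_K opprB addrC subrK.
have -> // : btime x <= n%:R.
by near: n; apply: nbhs_infty_ger.
Unshelve. all: by end_near. Qed.

Let Kp x : R := posp (K x).

Let Kbound x : `|K x| <= Hp x.
Proof.
rewrite /K /Hp; case: ifP => _; last by rewrite normr0.
have /andP[h1 h2] := alpha01 (Y x (btime x)).
by rewrite normrM ler_piMr// ger0_norm.
Qed.

Let okKp : dlok Hp Kp.
Proof.
split; first exact: rmeas_posp.
move=> x; rewrite /Kp posp_ge0/=; apply: posp_le => //.
exact: le_trans (ler_norm _) (Kbound x).
Qed.

Let KpE : aeL (fun x => Kp x = K x).
Proof.
apply: aeL_mp data => x [_ h _ _]; rewrite /Kp /posp max_l// /K; case: ifP => // _.
by have /andP[h1 h2] := alpha01 (Y x (btime x)); rewrite mulr_ge0.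
Qed.

Let gainE s : aeL (fun x => dlG1 Hp tp Kp s x = gain sol_flow x s).
Proof. by apply: aeL_mp2 KpE HpE => x e1 e2; rewrite /dlG1 /gain /= e1 e2. Qed.

(** An arbitrary solution has the explicit form, with its own lost density in the place of the fixed
    point. This is what carries the estimates over to the solution selected by [epsilon]. *)
Let UE x t : 0 <= t -> U x t = dlU U0 Hp tp Kp x t.
Proof.
move=> t0; have [mV [/(_ x t t0)[_ ->] _]] := sol.
have [_ ->] := dlU_eq U0 mHp mtp Hp0 tp0 iHp x okKp t0.
have VP s : 0 <= s -> aeL (fun x => Vi Y s x = dlP Hp tp Kp x s).
  move=> s0; apply: aeL_mp2 KpE HpE => z e1 e2.
  by rewrite Vi_K /dlP e1 e2 (tp_le _ s0).
have mP s : rmeas (dlP Hp tp Kp ^~ s).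
  apply: rmeasB => //; apply: rmeas_if; [|by case: okKp|exact: rmeas_cst].
  by apply: measurable_fun_ler => //; exact: rmeas_cst.
congr (_ + _); apply: eq_Rintegral => s; rewrite inE/= in_itv/= => /andP[s0 _].
rewrite /half [2^-1 * _]mulrC [4^-1 * _]mulrC; congr (_ / _ - _ / _).
  by apply: aeL_Rint => //; [exact: mV|exact: VP].
by apply: aeL_Rint => //; [exact: mV|exact: VP].
Qed.

Let YE x t : 0 <= t -> Y x t = dlY y0 U0 Hp tp Kp x t.
Proof.
move=> t0; have [_ [/(_ x t t0)[-> _] _]] := sol.
rewrite (dlY_eq y0 U0 mHp mtp Hp0 tp0 iHp x okKp t0); congr (_ + _).
by apply: eq_Rintegral => s; rewrite inE/= in_itv/= => /andP[s0 _]; exact: UE.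
Qed.

Let U0E x : U x 0 = U0 x.
Proof.
by have [_ [/(_ x 0 (lexx 0))[_ ->] _]] := sol; rewrite set_itv1 Rintegral_set1 addr0.
Qed.

Let Y0E x : Y x 0 = y0 x.
Proof.
by have [_ [/(_ x 0 (lexx 0))[-> _] _]] := sol; rewrite set_itv1 Rintegral_set1 addr0.
Qed.

Lemma sol_flow_ok : flow_ok alpha M sol_flow.
Proof.
split => //=.
- exact: meas_brk.
- move=> s s0; split; [under [X in rmeas X]funext do rewrite YE//|under [X in rmeas X]funext do rewrite UE//].
    exact: (rmeas_dlY my mU mHp mtp Hp0 tp0 iHp s okKp).
  exact: (rmeas_dlU mU mHp mtp Hp0 tp0 iHp s okKp).
- by rewrite Hinf0 -HinfE HM.
- move=> x s s0; rewrite UE// U0E /dlU /half.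
  have m1 : rmeas (dlG1 Hp tp Kp s) by exact: rmeas_dlG1.
  have m2 : rmeas (fun z => gain sol_flow z s).
    apply: rmeasB; first exact: rmeasZ.
    by apply: rmeasM => //; apply: rmeas_posp; apply: rmeasB => //; exact: rmeas_cst.
  by rewrite (aeL_Rint (measurable_itv _) m1 m2 (gainE s)) (aeL_Rint measurableT m1 m2 (gainE s)).
- move=> x s s0; split; last first.
    by have [_ [/(_ x s s0)[-> _] _]] := sol; rewrite Y0E.
  have : mu.-integrable `[0, s] (EFin \o dlU U0 Hp tp Kp x).
    apply: continuous_compact_integrable; first exact: segment_compact.
    apply: continuous_subspaceT; exact: (dlU_continuous mHp mtp Hp0 tp0 iHp HMp okKp).
  apply: eq_integrable => // t; rewrite inE/= in_itv/= => /andP[t0 _].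
  by rewrite /= UE.
apply: aeL_mp2 data brk_data => x [h1 h2 h3 h4] [b0 b1 b2].
have tE : tp x = btime x by rewrite /tp /posp max_l.
split => //.
- rewrite /K; case: ifP => _; last by rewrite lexx.
  by have /andP[k1 k2] := alpha01 (Y x (btime x)); rewrite mulr_ge0//= ler_piMr.
- by rewrite h3 lerDl sqr_ge0.
- by rewrite tE; split.
Qed.

Lemma sol_wder_U s : 0 <= s -> wder (U^~ s) (slopeF sol_flow ^~ s).
Proof.
move=> s0; have i1 := dlG1_int mHp mtp Hp0 tp0 iHp s okKp.
have := wderD dU (wder_half i1).
rewrite (_ : (fun x => U0 x + half (dlG1 Hp tp Kp s) x) = U^~ s); last first.
  by apply/funext => x; rewrite UE.
move/wder_ae; apply; first exact: rmeas_slopeF sol_flow_ok.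
by apply: aeL_mp (gainE s) => x ->; rewrite /slopeF /= mulrC.
Qed.

Lemma sol_wder_Y s : 0 <= s -> wder (Y^~ s) (yxT s sol_flow).
Proof.
move=> s0; have i1 := dlG2_int mHp mtp Hp0 tp0 iHp s okKp.
have := wderD (wderD dy (wderZ s dU)) (wder_half i1).
rewrite (_ : (fun x => y0 x + s * U0 x + half (dlG2 Hp tp Kp s) x) = Y^~ s); last first.
  by apply/funext => x; rewrite YE.
move/wder_ae; apply; first exact: (rmeas_yxT s0 sol_flow_ok).
by apply: aeL_mp2 KpE HpE => x e1 e2; rewrite (yxTE s0 _ sol_flow_ok) /dlG2 e1 e2 /=; field.
Qed.

Lemma sol_Vi_integrable s : 0 <= s -> mu.-integrable setT (EFin \o Vi Y s).
Proof.
move=> s0; have [mV _] := sol.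
apply: (@integrable_dom _ _ _ (fun x => Hp x)) => //; first exact: mV.
move=> x _; rewrite /Vi /Hp normrM normr_id ler_piMr//.
by case: ifP => _; rewrite ?subr0 ?normr1//; have /andP[h1 h2] := alpha01 (Y x (btime x));
  rewrite ger0_norm; lra.
Qed.

End extraction.

End solution.

(** * The distance between flows under relabelling *)

Section flow_distance.
Context {R : realType}.
Implicit Types (F Fb G : flow R) (alpha f df h : R -> R) (a M T c : R).
Local Notation mu := (@lebesgue_measure R).

(** The distance [dtilde] at time [T], with the chosen weak derivatives replaced by the explicit
    formulas of the flow and the factor [a] moved inside the norm. *)
Definition dflow alpha a T F Fb : \bar R :=
  (LooN (fun x => fly F x T - fly Fb x T)%R + LooN (fun x => flU F x T - flU Fb x T)%R +
   LpN 2 (fun x => a * (flU F x T * flHx F x - flU Fb x T * flHx Fb x))%R +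
   LpN 1 (fun x => flHx F x - flHx Fb x)%R + LpN 2 (ZT F Fb T) +
   LpN 2 (fun x => g1T alpha T F x - g1T alpha T Fb x)%R +
   LpN 2 (fun x => g2T a T F x - g2T a T Fb x)%R +
   LpN 2 (fun x => g3T a T F x - g3T a T Fb x)%R)%E.

Lemma dflow_ge0 alpha a T F Fb : (0 <= dflow alpha a T F Fb)%E.
Proof. by rewrite !adde_ge0 ?LooN_ge0 ?LpN_ge0. Qed.

Lemma gain0 alpha M F x : flow_ok alpha M F -> gain F x 0 = 0.
Proof.
move=> ok; have t0 := ok_tau ok x.
by rewrite /gain sub0r /posp max_r ?oppr_le0// mul0r mulr0 subr0.
Qed.

Lemma yxT0 alpha M F x : flow_ok alpha M F -> yxT 0 F x = flyx F x.
Proof. by move=> ok; rewrite /yxT set_itv1 Rintegral_set1 addr0. Qed.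

Lemma slopeF0 alpha M F x : flow_ok alpha M F -> slopeF F x 0 = flUx F x.
Proof. by move=> ok; rewrite /slopeF (gain0 x ok) mul0r addr0. Qed.

Lemma g1T0 alpha M F : flow_ok alpha M F -> aeL (fun x => g1T alpha 0 F x = g10 alpha F x).
Proof.
move=> ok; apply: aeL_mp (ok_ae ok) => x [_ _ _ _ [_ _ hK]].
rewrite /g1T (yxT0 x ok) /vT /g10 hK mulrBl mul1r.
case: (flD F x); last by rewrite mul0r.
case: ifP => [t0|_]; last by rewrite [_ * flHx F x]mulrC.
have -> : fltau F x = 0 by apply/eqP; rewrite eq_le t0 (ok_tau ok).
by rewrite [_ * flHx F x]mulrC.
Qed.

Lemma dflow0 alpha a M F Fb : 0 <= a ->
  (forall z z', `|alpha z - alpha z'| <= a * `|z - z'|) ->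
  flow_ok alpha M F -> flow_ok alpha M Fb ->
  dflow alpha a 0 F Fb =
  (LooN (fun x => fly F x 0 - fly Fb x 0)%R + LooN (fun x => flU F x 0 - flU Fb x 0)%R +
   LpN 2 (fun x => a * (flU F x 0 * flHx F x - flU Fb x 0 * flHx Fb x))%R +
   LpN 1 (fun x => flHx F x - flHx Fb x)%R + LpN 2 (Z0 F Fb) +
   LpN 2 (fun x => g10 alpha F x - g10 alpha Fb x)%R +
   LpN 2 (fun x => g20 a F x - g20 a Fb x)%R +
   LpN 2 (fun x => g30 a F x - g30 a Fb x)%R)%E.
Proof.
move=> a0 alphaL ok okb; rewrite /dflow.
have -> : ZT F Fb 0 = Z0 F Fb.
  by apply/funext => x; rewrite /ZT !(yxT0 x ok) !(yxT0 x okb) (slopeF0 x ok) (slopeF0 x okb).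
have e2 G : g2T a 0 G = g20 a G by apply/funext => x; rewrite /g2T /g20 !mul0r addr0.
have e3 G : g3T a 0 G = g30 a G by apply/funext => x; rewrite /g3T /g30 !mul0r addr0.
rewrite !e2 !e3; congr (_ + _ + _ + _)%E; apply: LpN_ae_eq => //.
- by apply: rmeasB; [exact: (rmeas_g1T a0 alphaL (lexx 0) ok)|exact: (rmeas_g1T a0 alphaL (lexx 0) okb)].
- by apply: rmeasB; [exact: (rmeas_g10 a0 alphaL ok)|exact: (rmeas_g10 a0 alphaL okb)].
by apply: aeL_mp2 (g1T0 ok) (g1T0 okb) => x -> ->.
Qed.

Lemma growth_const_gt0 a M T : 0 <= a -> 0 <= M -> 0 <= T -> 0 < growth_const a M T.
Proof.
move=> a0 M0 T0; have m0 : 0 <= Num.sqrt M by exact: sqrtr_ge0.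
rewrite /growth_const mulr_gt0 ?expR_gt0// -!addrA ltr_pwDl ?ltr0n//.
by syntactic_nneg.
Qed.

Lemma core_flow alpha a M T F Fb : 0 <= a -> 0 <= M -> 0 <= T ->
  (forall z, 0 <= alpha z <= 1) ->
  (forall z z', `|alpha z - alpha z'| <= a * `|z - z'|) ->
  flow_ok alpha M F -> flow_ok alpha M Fb ->
  aeL (fun x => flyx Fb x + flHx Fb x = 1) ->
  (dflow alpha a T F Fb <= (growth_const a M T)%:E * dflow alpha a 0 F Fb)%E.
Proof.
move=> a0 M0 T0 alpha01 alphaL ok okb one; have gc := growth_const_gt0 a0 M0 T0.
have := dflow_ge0 alpha a 0 F Fb; rewrite le_eqVlt (dflow0 a0 alphaL ok okb).
set n1 := LooN (fun x => fly F x 0 - _)%R; set n2 := LooN (fun x => flU F x 0 - _)%R.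
set n3 := LpN 2 (fun x => a * _)%R; set n4 := LpN 1 _; set n5 := LpN 2 (Z0 _ _).
set n6 := LpN 2 (fun x => g10 _ _ _ - _)%R; set n7 := LpN 2 (fun x => g20 _ _ _ - _)%R.
set n8 := LpN 2 (fun x => g30 _ _ _ - _)%R => _.
have p1 : (0 <= n1)%E := LooN_ge0 _. have p2 : (0 <= n2)%E := LooN_ge0 _.
have p3 : (0 <= n3)%E := LpN_ge0 _ _. have p4 : (0 <= n4)%E := LpN_ge0 _ _.
have p5 : (0 <= n5)%E := LpN_ge0 _ _. have p6 : (0 <= n6)%E := LpN_ge0 _ _.
have p7 : (0 <= n7)%E := LpN_ge0 _ _. have p8 : (0 <= n8)%E := LpN_ge0 _ _.
(* An infinite distance at time 0 is immediate because the constant is positive. Otherwise all eight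
   terms are finite. *)
have [|fin] := boolP ((n1 + n2 + n3 + n4 + n5 + n6 + n7 + n8)%E == +oo%E).
  by move=> /eqP->; rewrite gt0_muley ?lte_fin// leey.
have ft (z w : \bar R) : (0 <= z)%E -> (0 <= w)%E -> (z + w)%E != +oo%E -> z != +oo%E /\ w != +oo%E.
  by case: z => [z| |] // _; case: w => [w| |].
have s2 := adde_ge0 p1 p2; have s3 := adde_ge0 s2 p3; have s4 := adde_ge0 s3 p4.
have s5 := adde_ge0 s4 p5; have s6 := adde_ge0 s5 p6; have s7 := adde_ge0 s6 p7.
have [f1 q8] := ft _ _ s7 p8 fin.
have [f2 q7] := ft _ _ s6 p7 f1.
have [f3 q6] := ft _ _ s5 p6 f2.
have [f4 q5] := ft _ _ s4 p5 f3.
have [f5 q4] := ft _ _ s3 p4 f4.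
have [f6 q3] := ft _ _ s2 p3 f5.
have [q1 q2] := ft _ _ p1 p2 f6.
have fk (z : \bar R) : (0 <= z)%E -> z != +oo%E -> z = (fine z)%:E /\ 0 <= fine z by case: z.
have [e1 k1] := fk _ p1 q1; have [e2 k2] := fk _ p2 q2; have [e3 k3] := fk _ p3 q3.
have [e4 k4] := fk _ p4 q4; have [e5 k5] := fk _ p5 q5; have [e6 k6] := fk _ p6 q6.
have [e7 k7] := fk _ p7 q7; have [e8 k8] := fk _ p8 q8.
have l1 : aeL (fun x => `|fly F x 0 - fly Fb x 0| <= fine n1) by apply/LooN_le; rewrite -e1.
have l2 : aeL (fun x => `|flU F x 0 - flU Fb x 0| <= fine n2) by apply/LooN_le; rewrite -e2.
have l3 : (n3 <= (fine n3)%:E)%E by rewrite -e3.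
have l4 : (n4 <= (fine n4)%:E)%E by rewrite -e4.
have l5 : (n5 <= (fine n5)%:E)%E by rewrite -e5.
have l6 : (n6 <= (fine n6)%:E)%E by rewrite -e6.
have l7 : (n7 <= (fine n7)%:E)%E by rewrite -e7.
have l8 : (n8 <= (fine n8)%:E)%E by rewrite -e8.
rewrite e1 e2 e3 e4 e5 e6 e7 e8 -!EFinD -EFinM.
have := final_sum (alpha := alpha) a0 M0 l3 l4 l5 l6 l7 l8 k1 k2 T0.
rewrite -lee_fin => h; apply: le_trans h; rewrite !EFinD /dflow.
have r1 := final_y a0 M0 alpha01 alphaL ok okb one l1 l2 l3 l4 l5 l6 l7 l8 k1 k2 T0.
have r2 := final_U a0 M0 alpha01 alphaL ok okb one l1 l2 l3 l4 l5 l6 l7 l8 k1 k2 T0.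
apply: leeD; last exact: (final_g3 a0 M0 alpha01 alphaL ok okb one l1 l2 l3 l4 l5 l6 l7 l8 k1 k2 T0).
apply: leeD; last exact: (final_g2 a0 M0 ok okb one l4 l5 l7 T0).
apply: leeD; last first.
  by have := final_g1 a0 M0 alpha01 alphaL ok okb one l1 l2 l3 l4 l5 l6 l7 l8 k1 k2 T0; rewrite !EFinD.
apply: leeD; last first.
  by have := final_Z a0 M0 alpha01 alphaL ok okb one l1 l2 l3 l4 l5 l6 l7 l8 k1 k2 T0; rewrite !EFinD.
apply: leeD; last exact: l4.
apply: leeD; last first.
  by have := final_UH a0 M0 alpha01 alphaL ok okb one l1 l2 l3 l4 l5 l6 l7 l8 k1 k2 T0; rewrite !EFinD.
apply: leeD; first by apply/LooN_le.
by rewrite -EFinD; apply/LooN_le.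
Qed.

(** Derivatives are densities and acquire the factor [df]. Breaking times keep their values because
    the relations for them are homogeneous in the derivatives, and the total energy is preserved by
    the change of variables. *)
Definition flow_comp F f df : flow R := Flow (fun x => fly F (f x)) (fun x => flU F (f x))
  (fun x => flyx F (f x) * df x) (fun x => flUx F (f x) * df x) (fun x => flHx F (f x) * df x)
  (fun x => flr F (f x) * df x) (fun x => flK F (f x) * df x) (fun x => flD F (f x))
  (fun x => fltau F (f x)) (flHinf F).

Lemma gain_comp F f df x s : gain (flow_comp F f df) x s = gain F (f x) s * df x.
Proof. by rewrite /gain /=; ring. Qed.

Lemma Rint_chart f df h (D : set R) (phi : R -> R) : chart f df h -> measurable D -> rmeas phi ->
  mu.-integrable D (EFin \o phi) ->
  \int[mu]_(x in D) phi x = \int[mu]_(x in f @^-1` D) (phi (f x) * df x).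
Proof. by move=> cf mD mp ip; have [_ e] := chart_integrable cf mD mp ip; rewrite /Rintegral e. Qed.

Lemma flow_comp_ok alpha M F f df h : chart f df h -> aeL (fun x => 0 < df x) ->
  flow_ok alpha M F -> flow_ok alpha M (flow_comp F f df).
Proof.
move=> cf d0 ok; have mf := chart_meas cf; have [fK hK fh fd] := cf.
have md := wder_meas fd; have [my mU mH mr mK] := ok_meas ok.
have cmp g : rmeas g -> rmeas (fun x => g (f x) * df x).
  by move=> mg; apply: rmeasM => //; exact: rmeas_comp mg mf.
split => /=.
- by split; exact: cmp.
- exact: (measurableT_comp (ok_measD ok) mf).
- exact: rmeas_comp (ok_meastau ok) mf.
- by move=> s /(ok_measyU ok)[h1 h2]; split; [exact: rmeas_comp h1 mf|exact: rmeas_comp h2 mf].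
- by move=> x; exact: ok_tau ok _.
- by have [] := chart_integrable cf measurableT mH (ok_int ok); rewrite preimage_setT.
- by rewrite -(ok_Hinf ok) (Rint_chart cf measurableT mH (ok_int ok)) preimage_setT.
- exact: ok_HinfM ok.
- move=> x s s0; rewrite (ok_U ok)//; congr (_ + (_ * _ - _ * _)).
    have ig : mu.-integrable `]-oo, f x] (EFin \o (fun z => gain F z s)).
      by apply: integrableS (gain_integrable ok s0).
    rewrite (Rint_chart cf (measurable_itv _) (rmeas_gain ok s) ig).
    have -> : f @^-1` `]-oo, f x]%classic = `]-oo, x]%classic.
      by apply/seteqP; split => y /=; rewrite !in_itv/= (chart_le cf).
    by apply: eq_Rintegral => z _; rewrite gain_comp.
  rewrite (Rint_chart cf measurableT (rmeas_gain ok s) (gain_integrable ok s0)) preimage_setT.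
  by apply: eq_Rintegral => z _; rewrite gain_comp.
- by move=> x s s0; exact: (ok_y ok).
apply: aeL_mp2 d0 (chart_ae (chart_inv cf d0) (ok_ae ok)) => x d [h1 h2 /andP[h3 h3'] h4 [h5 h6 h7]].
have d' := ltW d; split; [exact: mulr_ge0|exact: mulr_ge0| | |split].
- by rewrite mulr_ge0//= ler_wpM2r.
- rewrite exprMn (_ : _ * df x * _ = flyx F (f x) * flHx F (f x) * df x ^+ 2); last by ring.
  by rewrite ler_wpM2r// sqr_ge0.
- by move=> D; rewrite mulrAC h5// mulrA.
- by move=> D; rewrite h6//; ring.
- by rewrite h7; case: ifP => _; rewrite ?mul0r// mulrAC.
Qed.

Section relabel.
Variables (alpha : R -> R) (a M T c : R) (F Fb : flow R) (f df h : R -> R).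
Hypotheses (a0 : 0 <= a) (T0 : 0 <= T) (c1 : 1 <= c).
Hypothesis alphaL : forall z z', `|alpha z - alpha z'| <= a * `|z - z'|.
Hypotheses (cf : chart f df h) (d0 : aeL (fun x => 0 < df x)) (dc : aeL (fun x => df x <= c ^+ 2)).
Hypotheses (ok : flow_ok alpha M F) (okb : flow_ok alpha M Fb).

Lemma yxT_comp G x : flow_ok alpha M G -> yxT T (flow_comp G f df) x = yxT T G (f x) * df x.
Proof.
move=> okG; rewrite (yxTE T0 _ (flow_comp_ok cf d0 okG)) (yxTE T0 _ okG) /=; ring.
Qed.

Lemma slopeF_comp G x s : slopeF (flow_comp G f df) x s = slopeF G (f x) s * df x.
Proof. by rewrite /slopeF gain_comp /=; ring. Qed.

Lemma vT_comp G x : vT alpha T (flow_comp G f df) x = vT alpha T G (f x) * df x.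
Proof. by rewrite /vT /=; case: ifP => _; [case: ifP => _|]; ring. Qed.

Lemma g1T_comp G x : flow_ok alpha M G ->
  g1T alpha T (flow_comp G f df) x = g1T alpha T G (f x) * df x.
Proof. by move=> okG; rewrite /g1T (yxT_comp _ okG) vT_comp; ring. Qed.

Lemma negp_scale (x d : R) : 0 <= d -> negp (x * d) = negp x * d.
Proof. by move=> d1; rewrite /negp -[X in Num.min _ X](mul0r d) -minr_pMl. Qed.

Lemma g2T_comp G : aeL (fun x => g2T a T (flow_comp G f df) x = g2T a T G (f x) * df x).
Proof.
apply: aeL_mp d0 => x /ltW d'; rewrite /g2T /=; case: ifP => _; last by rewrite mul0r.
by rewrite mulrA -mulrDl negp_scale// mulrA.
Qed.

Lemma g3T_comp G : aeL (fun x => g3T a T (flow_comp G f df) x = g3T a T G (f x) * df x).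
Proof.
apply: aeL_mp d0 => x /ltW d'; rewrite /g3T /=; case: ifP => _; last by rewrite mul0r.
by rewrite mulrA -mulrDl negp_scale// mulrA.
Qed.

Let c0 : 0 < c. Proof. exact: lt_le_trans c1. Qed.

Lemma L2_relabel (g q : R -> R) : rmeas g -> rmeas q -> aeL (fun x => q x = g (f x) * df x) ->
  (LpN 2 q <= c%:E * LpN 2 g)%E.
Proof.
move=> mg mq e; apply: le_trans (chart_L2N cf mg c0 dc).
have [_ _ _ /wder_meas md] := cf.
have -> // : LpN 2 q = LpN 2 (fun x => g (f x) * df x).
by apply: LpN_ae_eq => //; apply: rmeasM => //; exact: rmeas_comp mg (chart_meas cf).
Qed.

(** Supremum norms do not increase and the [L1] norm is invariant; only the square integral norms of
    densities pay the factor [c]. *)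
Lemma relabel_le : (dflow alpha a T (flow_comp F f df) (flow_comp Fb f df) <=
  c%:E * dflow alpha a T F Fb)%E.
Proof.
have okc := flow_comp_ok cf d0 ok; have okcb := flow_comp_ok cf d0 okb.
have [_ _ mH mr _] := ok_meas ok; have [_ _ mHb mrb _] := ok_meas okb.
have [_ _ mHc _ _] := ok_meas okc; have [_ _ mHcb _ _] := ok_meas okcb.
have [_ mu] := ok_measyU ok T0; have [_ mub] := ok_measyU okb T0.
have [_ muc] := ok_measyU okc T0; have [_ mucb] := ok_measyU okcb T0.
have le1 (z w : \bar R) : (0 <= w)%E -> (z <= w)%E -> (z <= c%:E * w)%E.
  move=> w0 zw; apply: le_trans zw _; rewrite -[X in (X <= _)%E]mul1e.
  by apply: lee_wpmul2r => //; rewrite lee_fin.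
have cD (z w : \bar R) : (0 <= z)%E -> (0 <= w)%E -> (c%:E * (z + w) = c%:E * z + c%:E * w)%E.
  by move=> z0 w0; rewrite ge0_muleDr.
rewrite [in X in (_ <= X)%E]/dflow !cD ?adde_ge0 ?LooN_ge0 ?LpN_ge0//.
apply: leeD; [apply: leeD; [apply: leeD; [apply: leeD; [apply: leeD; [apply: leeD; [apply: leeD|]|]|]|]|]|].
- by apply: le1; [exact: LooN_ge0|exact: (chart_LooN (fun x => fly F x T - fly Fb x T) cf d0)].
- by apply: le1; [exact: LooN_ge0|exact: (chart_LooN (fun x => flU F x T - flU Fb x T) cf d0)].
- apply: L2_relabel.
  + by apply: rmeasZ; apply: rmeasB; exact: rmeasM.
  + by apply: rmeasZ; apply: rmeasB; exact: rmeasM.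
  + by apply: aeLT => x /=; ring.
- apply: le1; first exact: LpN_ge0.
  rewrite -(chart_L1N cf (F := fun x => flHx F x - flHx Fb x)); last exact: rmeasB.
  by under eq_fun do rewrite -mulrBl.
- apply: L2_relabel; [exact: (rmeas_ZT ok okb T0)|exact: (rmeas_ZT okc okcb T0)|].
  apply: aeL_mp d0 => x /ltW d'.
  rewrite /ZT (yxT_comp _ ok) (yxT_comp _ okb) !slopeF_comp /= -!mulrBl !exprMn -!mulrDl.
  by rewrite sqrtrM ?addr_ge0 ?sqr_ge0// sqrtr_sqr ger0_norm.
- apply: L2_relabel.
  + by apply: rmeasB; [exact: (rmeas_g1T a0 alphaL T0 ok)|exact: (rmeas_g1T a0 alphaL T0 okb)].
  + by apply: rmeasB; [exact: (rmeas_g1T a0 alphaL T0 okc)|exact: (rmeas_g1T a0 alphaL T0 okcb)].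
  + by apply: aeLT => x; rewrite (g1T_comp _ ok) (g1T_comp _ okb) mulrBl.
- apply: L2_relabel.
  + by apply: rmeasB; [exact: (rmeas_g2T a T ok)|exact: (rmeas_g2T a T okb)].
  + by apply: rmeasB; [exact: (rmeas_g2T a T okc)|exact: (rmeas_g2T a T okcb)].
  + by apply: aeL_mp2 (g2T_comp F) (g2T_comp Fb) => x -> ->; rewrite mulrBl.
- apply: L2_relabel.
  + by apply: rmeasB; [exact: (rmeas_g3T a T0 ok)|exact: (rmeas_g3T a T0 okb)].
  + by apply: rmeasB; [exact: (rmeas_g3T a T0 okc)|exact: (rmeas_g3T a T0 okcb)].
  + by apply: aeL_mp2 (g3T_comp F) (g3T_comp Fb) => x -> ->; rewrite mulrBl.
Qed.

End relabel.

Lemma flow_compA F f df g dg : flow_comp (flow_comp F f df) g dg =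
  flow_comp F (fun x => f (g x)) (fun x => df (g x) * dg x).
Proof. by congr Flow; apply/funext => x /=; rewrite mulrA. Qed.

Lemma dflowC alpha a T F Fb : dflow alpha a T F Fb = dflow alpha a T Fb F.
Proof.
have LooC (p q : R -> R) : LooN (fun x => p x - q x) = LooN (fun x => q x - p x).
  have le (p' q' : R -> R) : (LooN (fun x => p' x - q' x)%R <= LooN (fun x => q' x - p' x)%R)%E.
    have := LooN_ge0 (fun x => q' x - p' x); case: (LooN _) (@LooN_le R (fun x => q' x - p' x)) => [c||] k // _; last by rewrite leey.
    by apply/LooN_le; have /k := lexx c%:E; apply: aeL_mp => x; rewrite distrC.
  by apply/eqP; rewrite eq_le !le.
have LpC p (f g : R -> R) : LpN p (fun x => f x - g x) = LpN p (fun x => g x - f x).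
  by rewrite !LpNE; under eq_integral do rewrite distrC.
have -> : dflow alpha a T F Fb = (LooN (fun x => fly Fb x T - fly F x T)%R +
   LooN (fun x => flU Fb x T - flU F x T)%R +
   LpN 2 (fun x => a * (flU F x T * flHx F x) - a * (flU Fb x T * flHx Fb x))%R +
   LpN 1 (fun x => flHx Fb x - flHx F x)%R + LpN 2 (ZT Fb F T) +
   LpN 2 (fun x => g1T alpha T Fb x - g1T alpha T F x)%R +
   LpN 2 (fun x => g2T a T Fb x - g2T a T F x)%R +
   LpN 2 (fun x => g3T a T Fb x - g3T a T F x)%R)%E.
  rewrite /dflow (LooC (fun x => fly F x T)) (LooC (fun x => flU F x T)).
  rewrite (LpC 1 (flHx F)) (LpC 2 (g1T alpha T F)) (LpC 2 (g2T a T F)) (LpC 2 (g3T a T F)).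
  have -> : ZT F Fb T = ZT Fb F T.
    apply/funext => x; rewrite /ZT -[in LHS](opprB (yxT T Fb x)) -[in LHS](opprB (slopeF Fb x T)).
    by rewrite -[in LHS](opprB (flHx Fb x)) -[in LHS](opprB (flr Fb x)) !sqrrN.
  by under [X in (_ + LpN 2 X + _ + _ + _ + _ + _)%E]eq_fun do rewrite mulrBr.
rewrite (LpC 2 (fun x => a * (flU F x T * flHx F x))).
by under [X in (_ + LpN 2 X + _ + _ + _ + _ + _)%E]eq_fun do rewrite -mulrBr.
Qed.

End flow_distance.

(** * The energy relabelling *)

Section breaking_set.
Context {R : realType}.
Implicit Types (F : flow R).

Definition phys F : Prop := aeL (fun x => [/\ flyx F x * flHx F x = flUx F x ^+ 2 + flr F x ^+ 2,
  0 < flyx F x + flHx F x &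
  flD F x = (flyx F x == 0) || ((flr F x == 0) && (flUx F x < 0))]).

Lemma phys_comp F f df h : chart f df h -> aeL (fun x => 0 < df x) -> phys F ->
  phys (flow_comp F f df).
Proof.
move=> cf d0 ph; apply: aeL_mp2 d0 (chart_ae (chart_inv cf d0) ph) => x d [h1 h2 h3].
split => /=.
- by rewrite mulrACA h1; ring.
- by rewrite -mulrDl mulr_gt0.
- by rewrite h3 !mulf_eq0 [df x == 0]gt_eqF// !orbF pmulr_llt0.
Qed.

(** At time [T], up to a null set, [Omega_d] consists of the characteristics that break strictly
    after [T]: before breaking the slope is negative, and afterwards it is nonnegative because no
    more than the available energy is lost. The case distinctions of [g1], [g2], [g3] then match the
    explicit formulas. *)
Lemma phys_g alpha (a M T : R) F : 0 <= T -> flow_ok alpha M F -> phys F ->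
  aeL (fun x => let om := (slopeF F x T < 0) && (flr F x == 0) in
    [/\ (if om then yxT T F x + flHx F x - alpha (fly F x T) * flHx F x else
         yxT T F x + (flHx F x - (if flD F x && (fltau F x <= T) then flK F x else 0))) =
         g1T alpha T F x,
        (if om then a * flHinf F * slopeF F x T else 0) = g2T a T F x &
        (if om then a * flU F x T * slopeF F x T else 0) = g3T a T F x]).
Proof.
move=> T0 ok ph; apply: aeL_mp2 (ok_ae ok) ph => x [y0 H0 /andP[K0 KH] uu [b1 b2 _]] [h1 h2 hD].
have tau0 := ok_tau ok x.
have omE : (slopeF F x T < 0) && (flr F x == 0) = flD F x && (T < fltau F x).
  apply/andP/andP => [[s0 /eqP r0]|[D lt]].
    have g0 : 0 <= gain F x T.
      have p1 : posp (T - fltau F x) <= T by apply: posp_le => //; lra.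
      by rewrite /gain subr_ge0 [T * _]mulrC; apply: ler_pM => //; exact: posp_ge0.
    have U0 : flUx F x < 0 by move: s0; rewrite /slopeF; lra.
    have D : flD F x by rewrite hD r0 eqxx U0 orbT.
    split => //; rewrite ltNge; apply/negP => le.
    move: s0; rewrite /slopeF /gain /posp max_l ?subr_ge0// => s0.
    have := b1 D => e.
    have d0 : 0 <= T - fltau F x by rewrite subr_ge0.
    have : flK F x * (T - fltau F x) <= flHx F x * (T - fltau F x) by exact: ler_wpM2r.
    by lra.
  have e1 := b1 D; have e2 := b2 D.
  have Hp : 0 < flHx F x.
    rewrite lt_neqAle H0 andbT; apply/eqP => h; move: h2; rewrite e2 -h !mul0r addr0.
    by rewrite ltxx.
  split.
    rewrite /slopeF /gain /posp max_r ?subr_le0 1?ltW// mulr0 subr0.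
    have : flHx F x * T < flHx F x * fltau F x by rewrite ltr_pM2l.
    by lra.
  (* A vanishing [y_xi] also forces [r = 0], by the algebraic relation [h1]. *)
  move: D; rewrite hD => /orP[/eqP z|/andP[]//].
  have : flr F x ^+ 2 = 0.
    apply/eqP; rewrite eq_le sqr_ge0 andbT.
    by move: h1; rewrite z mul0r; have := sqr_ge0 (flUx F x); lra.
  by move=> /eqP; rewrite sqrf_eq0.
rewrite /= omE /g1T /vT /g2T /g3T.
case: (flD F x) b1 b2 => b1 b2 /=; last by split; rewrite ?subr0.
have e1 := b1 isT.
have [lt|le] := ltP T (fltau F x).
  have -> : slopeF F x T = flUx F x + T / 2 * flHx F x.
    by rewrite /slopeF /gain /posp max_r ?subr_le0 1?ltW// mulr0 subr0; lra.
  have -> : negp (flUx F x + T / 2 * flHx F x) = flUx F x + T / 2 * flHx F x.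
    rewrite /negp min_l//; have : flHx F x * T <= flHx F x * fltau F x by rewrite ler_wpM2l// ltW.
    by lra.
  by split => //; rewrite -addrA [_ * flHx F x]mulrC.
have -> : negp (flUx F x + T / 2 * flHx F x) = 0.
  rewrite /negp min_r//; have : flHx F x * fltau F x <= flHx F x * T by rewrite ler_wpM2l.
  by lra.
by split => //; rewrite mulr0.
Qed.

End breaking_set.

(** * The group of relabellings *)

Section relabelling_group.
Context {R : realType}.
Implicit Types (f df g dg h k : R -> R).
Local Notation mu := (@lebesgue_measure R).

Lemma aeL_cst (P : Prop) : aeL (fun _ : R => P) -> P.
Proof.
move=> [N [mN N0 sub]]; apply: contrapT => nP.
have : (mu `[0%R, 1%R] <= mu N)%E by apply: le_measure; rewrite ?inE// => x _; exact: sub.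
by rewrite N0 [X in (X <= _)%E](_ : _ = 1%:E) ?lee_fin ?ler10// [LHS]lebesgue_itvcc// subr0.
Qed.

(** The group [G] in quantitative form: increasing, with derivative between positive constants and
    bounded displacement. The agreement with [in_G] is shown by [in_G_relab] and [relab_in_G]. *)
Definition relab f df h : Prop := [/\ chart f df h,
  exists m N, 0 < m /\ aeL (fun x => m <= df x <= N),
  exists B, forall x, `|f x - x| <= B & (LpN 2 (fun x => df x - 1)%R < +oo)%E].

Lemma relab_gt0 f df h : relab f df h -> aeL (fun x => 0 < df x).
Proof. by move=> [_ [m [N [m0 hm]]] _ _]; apply: aeL_mp hm => x /andP[h1 _]; exact: lt_le_trans h1. Qed.

(** [1 / df(h) - 1] equals [- (df(h) - 1) / df(h)], whose norm is controlled by the change of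
    variables along [h]. *)
Lemma relab_inv f df h : relab f df h -> relab h (fun x => (df (h x))^-1) f.
Proof.
move=> rf; have d0 := relab_gt0 rf; have [cf [m [N [m0 hm]]] [B hB] hL] := rf.
have ci := chart_inv cf d0; have [fK hK _ _] := cf.
have md : rmeas df by have [_ _ _ /wder_meas] := cf.
have hm' : aeL (fun x => m <= df (h x) <= N) by exact: chart_ae cf hm.
have N0 : 0 < N.
  have : aeL (fun _ : R => 0 < N).
    by apply: aeL_mp hm => x /andP[h1 h2]; apply: lt_le_trans m0 (le_trans h1 h2).
  exact: aeL_cst.
split => //.
- exists N^-1, m^-1; split; first by rewrite invr_gt0.
  apply: aeL_mp hm' => x /andP[h1 h2]; have p : 0 < df (h x) by exact: lt_le_trans h1.
  by rewrite !lef_pV2 ?posrE// h2 h1.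
- by exists B => x; rewrite -[X in `|_ - X|]hK distrC.
- have le : aeL (fun x => (df (h x))^-1 <= (Num.sqrt m^-1) ^+ 2).
    apply: aeL_mp hm' => x /andP[h1 _]; rewrite sqr_sqrtr; last by rewrite invr_ge0 ltW.
    by rewrite lef_pV2 ?posrE//; exact: lt_le_trans h1.
  have s0 : 0 < Num.sqrt m^-1 by rewrite sqrtr_gt0 invr_gt0.
  have m1 : rmeas (fun x => df x - 1) by apply: rmeasB => //; exact: rmeas_cst.
  have mdh := rmeas_comp md (chart_meas ci).
  have mi : rmeas (fun x => (df (h x))^-1) by exact: rmeasV.
  have le2 : (LpN 2 (fun x => (df (h x))^-1 - 1)%R <= LpN 2 (fun x => (df (h x) - 1) * (df (h x))^-1)%R)%E.
    apply: LpN_le => //.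
    + by apply: rmeasB => //; exact: rmeas_cst.
    + by apply: rmeasM => //; apply: rmeasB => //; exact: rmeas_cst.
    apply: aeL_mp hm' => x /andP[h1 _]; have p : df (h x) != 0 by rewrite gt_eqF//; exact: lt_le_trans h1.
    by rewrite mulrBl mulfV// mul1r distrC.
  apply: le_lt_trans le2 _; apply: le_lt_trans (chart_L2N ci m1 s0 le) _.
  by rewrite lte_mul_pinfty// lee_fin ltW.
Qed.

Lemma relab_comp f df h g dg k : relab f df h -> relab g dg k ->
  relab (fun x => f (g x)) (fun x => df (g x) * dg x) (fun x => k (h x)).
Proof.
move=> rf rg; have d0 := relab_gt0 rf; have e0 := relab_gt0 rg.
have [cf [m [N [m0 hm]]] [B hB] hL] := rf; have [cg [m' [N' [m0' hm']]] [B' hB'] hL'] := rg.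
have [fK hK fh fd] := cf; have [gK kK gh gd] := cg.
have hmg : aeL (fun x => m <= df (g x) <= N) by exact: chart_ae (chart_inv cg e0) hm.
split.
- split; [by move=> x; rewrite fK gK|by move=> x; rewrite kK hK| |exact: wder_comp cg fd].
  by move=> x y xy; apply: fh; exact: gh.
- exists (m * m'), (N * N'); split; first exact: mulr_gt0.
  apply: aeL_mp2 hmg hm' => x /andP[h1 h2] /andP[h3 h4].
  have p1 := ltW m0; have p2 := ltW m0'.
  by rewrite !ler_pM//; [exact: le_trans h1|exact: le_trans h3].
- exists (B + B') => x; rewrite (_ : _ - x = (f (g x) - g x) + (g x - x)); last by ring.
  by apply: le_trans (ler_normD _ _) _; exact: lerD.
have md : rmeas df by exact: wder_meas fd. have mdg : rmeas dg by exact: wder_meas gd.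
have mg := chart_meas cg.
have le : aeL (fun x => dg x <= (Num.sqrt N') ^+ 2).
  apply: aeL_mp hm' => x /andP[h3 h4]; rewrite sqr_sqrtr//.
  by apply: le_trans h4; apply: le_trans (ltW m0') h3.
have N0' : 0 < N'.
  have : aeL (fun _ : R => 0 < N').
    by apply: aeL_mp hm' => x /andP[h1 h2]; apply: lt_le_trans m0' (le_trans h1 h2).
  exact: aeL_cst.
have s0 : 0 < Num.sqrt N' by rewrite sqrtr_gt0.
have m1 : rmeas (fun x => df x - 1) by apply: rmeasB => //; exact: rmeas_cst.
have m2 : rmeas (fun x => dg x - 1) by apply: rmeasB => //; exact: rmeas_cst.
have m3 : rmeas (fun x => (df (g x) - 1) * dg x).
  by apply: rmeasM => //; exact: rmeas_comp m1 mg.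
have hfin : (LpN 2 (fun x => (df (g x) - 1) * dg x)%R < +oo)%E.
  by apply: le_lt_trans (chart_L2N cg m1 s0 le) _; rewrite lte_mul_pinfty// lee_fin ltW.
have fk (z : \bar R) : (0 <= z)%E -> (z < +oo)%E -> (z <= (fine z)%:E)%E by case: z.
have p1 := fk _ (LpN_ge0 _ _) hfin; have p2 := fk _ (LpN_ge0 _ _) hL'.
have := LpND (p := 2) ltac:(by rewrite ler1n) m3 m2 p1 p2.
rewrite (_ : (fun x => (df (g x) - 1) * dg x + (dg x - 1)) = (fun x => df (g x) * dg x - 1)); last first.
  by apply/funext => x; ring.
by move=> /le_lt_trans; apply; exact: ltry.
Qed.

End relabelling_group.

(** * Antiderivatives, monotonicity and inverse functions *)

Section antiderivatives.
Context {R : realType}.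
Implicit Types (f g H k : R -> R).
Local Notation mu := (@lebesgue_measure R).

(** [b] records whether the upper limits eventually exceed every point or eventually stay below it,
    so that one application of dominated convergence covers both ends of the line. *)
Lemma cumulative_cvg g (u : nat -> R) (b : bool) : mu.-integrable setT (EFin \o g) ->
  (forall x, \forall n \near \oo, (x <= u n) = b) ->
  (fun n => \int[mu]_(z in `]-oo, u n]) g z) @ \oo --> (if b then \int[mu]_z g z else 0).
Proof.
move=> ig hu; have mg : rmeas g by apply/measurable_EFinP; exact: measurable_int ig.
have e n : \int[mu]_(z in `]-oo, u n]) g z = \int[mu]_z (if z <= u n then g z else 0).
  rewrite Rintegral_mkcond; apply: eq_Rintegral => z _.
  by rewrite /patch mem_setE in_itv/=; case: ifP.
under eq_fun do rewrite e.
have -> : (if b then \int[mu]_z g z else 0) = \int[mu]_z (if b then g z else 0).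
  by case: b hu => // hu; rewrite Rintegral_cst// mul0r.
have mn n : rmeas (fun z => if z <= u n then g z else 0).
  by apply: rmeas_if; [apply: measurable_fun_ler => //; exact: rmeas_cst| |exact: rmeas_cst].
have mb : rmeas (fun z => if b then g z else 0) by case: (b); [|exact: rmeas_cst].
have [ib _ cv] := @dominated_convergence _ (measurableTypeR R) R mu setT measurableT
  (fun n z => (if z <= u n then g z else 0)%:E) (fun z => (if b then g z else 0)%:E)
  (fun z => `|g z|%:E) (fun n => null_rmeas (mn n)) (null_rmeas mb)
  ltac:(by apply: aeLT => z _; apply: cvg_near_cst; apply: filterS (hu z) => n ->)
  (integrable_norm ig)
  ltac:(by apply: aeLT => z n _; rewrite lee_fin; case: ifP; rewrite ?normr0).
apply: fine_cvg; rewrite /Rintegral fineK//; exact: integrable_fin_num ib.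
Qed.

Lemma cumulative_cvg_pinfty g : mu.-integrable setT (EFin \o g) ->
  (fun x => \int[mu]_(z in `]-oo, x]) g z) @ +oo --> \int[mu]_z g z.
Proof.
move=> ig; apply/cvg_pinftyP => u /cvgryPge uy.
exact: (cumulative_cvg (b := true) ig (fun x => uy x)).
Qed.

Lemma antiderivative_ninfty H g : wder H g -> mu.-integrable setT (EFin \o g) ->
  H x @[x --> -oo] --> (0 : R) -> forall x, H x = \int[mu]_(z in `]-oo, x]) g z.
Proof.
move=> dH ig /cvg_ninftyP H0 x.
pose G x := \int[mu]_(z in `]-oo, x]) g z.
have dG : wder G g := wder_cumulative ig.
have cst y : y <= x -> H x - G x = H y - G y.
  move=> yx; have := wderB dH yx; rewrite (wderB dG yx) => e.
  by have : H x - H y = G x - G y by []; lra.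
have un : (fun n : nat => - n%:R : R) @ \oo --> -oo%R.
  apply/cvgrNyPle => A; near=> n; rewrite lerNl.
  by near: n; exact: nbhs_infty_ger.
have c1 := H0 _ un.
have c2 : (fun n : nat => G (- n%:R)) @ \oo --> (0 : R).
  apply: (cumulative_cvg (b := false) ig) => z; near=> n; apply/negbTE; rewrite -ltNge ltrNl.
  by near: n; exact: nbhs_infty_gtr.
have c3 : (fun n : nat => H (- n%:R) - G (- n%:R)) @ \oo --> (0 : R).
  by rewrite -[X in _ --> X](subr0 0); exact: cvgB c1 c2.
have c4 : (fun n : nat => H (- n%:R) - G (- n%:R)) @ \oo --> H x - G x.
  apply: cvg_near_cst; near=> n; rewrite -cst// lerNl.
  by near: n; exact: nbhs_infty_ger.
by apply/eqP; rewrite -subr_eq0; apply/eqP; exact: cvg_unique c4 c3.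
Unshelve. all: by end_near. Qed.

(** By monotone convergence along [[- n, n]] the total integral is at most the oscillation
    [2 * C]. *)
Lemma wder_bounded_integrable H g (C : R) : wder H g -> aeL (fun x => 0 <= g x) ->
  (forall x, `|H x| <= C) -> mu.-integrable setT (EFin \o g).
Proof.
move=> dH g0 HC; have mg := wder_meas dH.
apply/integrableP; split; first exact: null_rmeas.
have := @ge0_nondecreasing_set_cvg_integral _ (measurableTypeR R) R
  (fun n => `[- n%:R, n%:R]%classic) (fun x => `|g x|%:E) mu
  ltac:(by move=> m n mn; apply/subsetPset => x /=; rewrite !in_itv/= => /andP[h1 h2];
    have := mn; rewrite -(ler_nat R) => mn'; apply/andP; split; lra)
  (fun n => measurable_itv _) ltac:(by move=> n; apply: measurable_funTS; apply: null_rmeas; exact: rmeas_norm)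
  ltac:(by move=> n x _; rewrite lee_fin).
rewrite set_itv_cover => cv.
apply: (@le_lt_trans _ _ (2 * C)%:E); last exact: ltry.
rewrite -(cvg_lim _ cv)//; apply: lime_le; first by apply/cvg_ex; eexists; exact: cv.
apply: nearW => n.
have nn : - n%:R <= n%:R :> R by rewrite lerNl opprK ler0n || (have := ler0n R n; lra).
have [_ e] := dH _ _ nn.
have -> : (\int[mu]_(x in `[(- n%:R)%R, n%:R%R]) `|g x|%:E = \int[mu]_(x in `[(- n%:R)%R, n%:R%R]) (g x)%:E)%E.
  apply: ae_eq_integral => //.
  - by apply: measurable_funTS; apply: null_rmeas; exact: rmeas_norm.
  - by apply: measurable_funTS; exact: null_rmeas.
  - by apply: aeL_mp g0 => x h _; rewrite ger0_norm.
rewrite e lee_fin; have := HC n%:R; have := HC (- n%:R).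
by move=> /ler_normlP[h1 h2] /ler_normlP[h3 h4]; lra.
Qed.

Lemma ae_le_everywhere f (C : R) : continuous f -> aeL (fun x => `|f x| <= C) -> forall x, `|f x| <= C.
Proof.
move=> cf [N [mN N0 sub]] x; rewrite leNgt; apply/negP => h.
have cn : continuous (fun x => `|f x|) by move=> y; apply: cvg_norm; exact: cf.
have : \forall y \near x, C < `|f y| by apply: cvgr_gt (cn x) _ h.
move=> /nbhs_ballP[e /= e0 he].
have : (mu (`[x, (x + e / 2)%R]%classic : set R) <= mu N)%E.
  apply: le_measure; rewrite ?inE//.
  move=> y /=; rewrite in_itv/= => /andP[h1 h2]; apply: sub => /= hy.
  have : C < `|f y|.
    apply: he; rewrite /ball/= ltr_norml; apply/andP; split; lra.
  by rewrite ltNge hy.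
rewrite N0 [X in (X <= _)%E](_ : _ = (e / 2)%:E) ?lee_fin; first lra.
by rewrite [LHS]lebesgue_itvcc; [congr EFin; lra|lra].
Qed.

Lemma wder_ge f g (m x y : R) : wder f g -> aeL (fun x => m <= g x) -> x <= y ->
  m * (y - x) <= f y - f x.
Proof.
move=> df gm xy; rewrite -(wderB df xy).
have mg := wder_meas df; have ig := wder_integrable x y df.
have -> : \int[mu]_(z in `[x, y]) g z = \int[mu]_(z in `[x, y]) Num.max (g z) m.
  apply: aeL_Rint => //; first by apply: measurable_maxr => //; exact: rmeas_cst.
  by apply: aeL_mp gm => z h; rewrite max_l.
have -> : m * (y - x) = \int[mu]_(z in `[x, y]) m.
  by rewrite Rintegral_cst// [X in fine X](_ : _ = (y - x)%:E)//; exact: lebesgue_itvcc.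
have im : mu.-integrable `[x, y] (EFin \o (fun=> m)).
  apply: continuous_compact_integrable; first exact: segment_compact.
  by apply: continuous_subspaceT => z; exact: cvg_cst.
apply: le_Rintegral => //; last by move=> z _; rewrite le_max lexx orbT.
apply: (@integrable_dom _ _ _ (fun z => `|g z| + `|m|)) => //.
- by apply: measurable_maxr => //; exact: rmeas_cst.
- exact: (integrableD _ (integrable_norm ig) (integrable_norm im)).
move=> z _; have n0 : 0 <= `|g z| + `|m| by rewrite addr_ge0.
by rewrite (ger0_norm n0) /Num.max; case: ifP => _; [rewrite lerDr|rewrite lerDl].
Qed.

(** The lower bound on the density gives injectivity, and bounded displacement gives surjectivity by
    the intermediate value theorem. *)
Lemma relab_of_density k dk (m N B : R) : wder k dk -> 0 < m -> aeL (fun x => m <= dk x <= N) ->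
  (forall x, `|k x - x| <= B) -> (LpN 2 (fun x => dk x - 1)%R < +oo)%E -> exists h, relab k dk h.
Proof.
move=> dk' m0 hm hB hL.
have inc : {homo k : x y / x < y}.
  move=> x y xy; have := wder_ge dk' (aeL_mp (fun x h => proj1 (andP h)) hm) (ltW xy).
  have : 0 < m * (y - x) by rewrite mulr_gt0// subr_gt0.
  by lra.
have inj : injective k.
  move=> x y e; have [xy|yx|//] := ltgtP x y; first by have := inc _ _ xy; rewrite e ltxx.
  by have := inc _ _ yx; rewrite e ltxx.
have surj z : exists x, k x = z.
  have B0 : 0 <= B by apply: le_trans (hB 0).
  have ab : z - B <= z + B by lra.
  suff [c _ <-] : exists2 c, c \in `[z - B, z + B] & k c = z by exists c.
  apply: IVT => //; first exact: continuous_subspaceT (wder_continuous dk').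
  have /ler_normlP[h1 h2] := hB (z - B); have /ler_normlP[h3 h4] := hB (z + B).
  by rewrite ge_min le_max; apply/andP; split; apply/orP; [left|right]; lra.
pose h z := projT1 (cid (surj z)).
have hK z : k (h z) = z by rewrite /h; case: cid.
have kK x : h (k x) = x by apply: inj; rewrite hK.
exists h; split => //; [by exists m, N; split|by exists B].
Qed.

(** A continuous injection is monotone, and comparing its values at [0] and [2 * B + 1] excludes the
    decreasing case. *)
Lemma bounded_inj_increasing f (B : R) : continuous f -> injective f ->
  (forall x, `|f x - x| <= B) -> {homo f : x y / x < y}.
Proof.
move=> cf fi hB; have B0 : 0 <= B by apply: le_trans (hB 0).
have mono : {in `]-oo, +oo[ &, {mono f : x y / x <= y}}.
  apply: itv_continuous_inj_le.
  - exists 0, (2 * B + 1); rewrite !in_itv/=; split => //; first lra.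
    have /ler_normlP[h1 h2] := hB 0; have /ler_normlP[h3 h4] := hB (2 * B + 1); lra.
  - exact: continuous_subspaceT.
  - by move=> x y _ _; exact: fi.
by move=> x y; rewrite !ltNge mono ?in_itv.
Qed.

End antiderivatives.

Section energy_relabelling.
Context {R : realType}.
Local Notation mu := (@lebesgue_measure R).

(** The displacement of [y + H] is that of [y] alone, because [y + H] is the identity at time 0. In
    the norm of [y_xi + H_xi - 1] the initial normalisation cancels the constant, leaving terms in
    [U_xi] and [H_xi] that are square integrable. *)
Lemma energy_relab (alpha : R -> R) (a M T B : R) (F : flow R) (H : R -> R) :
  0 <= a -> 0 <= M -> 0 <= T ->
  (forall z z', `|alpha z - alpha z'| <= a * `|z - z'|) ->
  flow_ok alpha M F -> aeL (fun x => flyx F x + flHx F x = 1) ->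
  wder (fly F ^~ T) (yxT T F) -> wder H (flHx F) -> (forall x, fly F x 0 + H x = x) ->
  (forall x, `|flU F x 0| <= B) ->
  exists h, relab (fun x => fly F x T + H x) (fun x => yxT T F x + flHx F x) h /\
    aeL (fun x => (yxT T F (h x) + flHx F (h x))^-1 <= (1 + T / 2) ^+ 2).
Proof.
move=> a0 M0 T0 alphaL ok one dY dH e0 UB.
have dk := wderD dY dH; have bnd := yxT_bounds T0 ok one.
have s0 : 0 < (1 + T / 2) ^+ 2 by rewrite exprn_gt0//; lra.
have /andP[i0 iM] := ok_HinfM ok.
have bd : aeL (fun x => ((1 + T / 2) ^+ 2)^-1 <= yxT T F x + flHx F x <= 1 + T + T ^+ 2 / 4).
  by apply: aeL_mp bnd => x [_ -> ->].
have close x : `|fly F x T + H x - x| <= T * B + T ^+ 2 * M / 8.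
  rewrite -[X in _ - X]e0 (_ : _ - _ = fly F x T - fly F x 0); last by ring.
  apply: le_trans (fly_diff0 ok x T0) _; apply: lerD; first exact: ler_wpM2l.
  by rewrite ler_pM2r ?invr_gt0//; apply: ler_wpM2l => //; exact: sqr_ge0.
have [myx mUx mHx _ mK] := ok_meas ok.
have L2 : (LpN 2 (fun x => yxT T F x + flHx F x - 1)%R < +oo)%E.
  have mq : rmeas (fun x => yxT T F x + flHx F x - 1).
    by apply: rmeasB; [exact: wder_meas dk|exact: rmeas_cst].
  have := @LpN_wsum R 2 _ [:: ((T, flUx F), Num.sqrt M); ((T ^+ 2 / 2, flHx F), Num.sqrt M)]
    ltac:(by rewrite ler1n) mq.
  move=> h; apply: le_lt_trans (h _ _) (ltry _).
    split => //; first exact: Ub_L2 M0 ok one.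
    by split => //; [syntactic_nneg|exact: Hb_L2 M0 ok one].
  apply: aeL_mp2 one (ok_ae ok) => x e [y0 H0 /andP[K0 KH] _ _].
  rewrite /= addr0 (yxTE T0 x ok).
  have p0 := posp_ge0 (T - fltau F x).
  have p1 : posp (T - fltau F x) <= T by apply: posp_le => //; have := ok_tau ok x; lra.
  have p2 : posp (T - fltau F x) ^+ 2 <= T ^+ 2 by rewrite lerXn2r.
  have kp : 0 <= flK F x * posp (T - fltau F x) ^+ 2 <= flHx F x * T ^+ 2.
    by rewrite mulr_ge0 ?exprn_ge0//= ler_pM// exprn_ge0.
  have -> : flyx F x + T * flUx F x + T ^+ 2 / 4 * flHx F x -
      flK F x * posp (T - fltau F x) ^+ 2 / 4 + flHx F x - 1 =
    T * flUx F x + (T ^+ 2 / 4 * flHx F x - flK F x * posp (T - fltau F x) ^+ 2 / 4) by lra.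
  apply: le_trans (ler_normD _ _) _; apply: lerD; first by rewrite normrM (ger0_norm T0).
  rewrite (ger0_norm H0); have t2 : 0 <= T ^+ 2 * flHx F x by rewrite mulr_ge0 ?exprn_ge0.
  by case/andP: kp => k1 k2; rewrite ler_norml; apply/andP; split; lra.
have [h rh] := relab_of_density dk (m := ((1 + T / 2) ^+ 2)^-1) ltac:(by rewrite invr_gt0) bd close L2.
exists h; split => //; have [cf _ _ _] := rh.
apply: aeL_mp (chart_ae cf bd) => x /andP[h1 _].
rewrite -[X in _ <= X]invrK lef_pV2 ?posrE ?invr_gt0//; apply: lt_le_trans h1; by rewrite invr_gt0.
Qed.

End energy_relabelling.

(** * Lagrangian states *)

Import Defs.

Lemma scaled_sum_le {R : realType} (c C : R) (u v v' p q q' : \bar R) :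
  (0 <= p)%E -> (0 <= q)%E -> c <= C -> v = v' -> q = q' ->
  (u <= c%:E * p)%E -> (v' <= c%:E * q')%E -> (u + v <= C%:E * (p + q))%E.
Proof.
move=> p0 q0 cC -> <- up vq; apply: le_trans (leeD up vq) _.
by rewrite -ge0_muleDr // lee_wpmul2r ?adde_ge0 ?lee_fin.
Qed.

Lemma wderivP (f g : RR -> RR) : is_wderiv f g -> is_wderiv f (wderiv f).
Proof.
by move=> fg; apply: (epsilon_spec (inhabits (fun _ => 0)) (is_wderiv f)); exists g.
Qed.

Lemma wderiv_ae (f g : RR -> RR) : wder f g -> aeL (fun x => wderiv f x = g x).
Proof. by move=> fg; exact: wder_uniq (wderivP fg) fg. Qed.

Lemma in_Linf_bound (f : RR -> RR) : in_Linf f -> exists C : RR, aeL (fun x => `|f x| <= C).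
Proof.
move=> [_]; rewrite /Linf_norm -/(LooN f) => fin; exists (fine (LooN f)); apply/LooN_le.
by rewrite fineK// ge0_fin_numE// LooN_ge0.
Qed.

(** Monotonicity comes from bounded displacement. The inverse has Lipschitz constant at most
    [L + 1], so [(L + 1) * f] minus the identity is nondecreasing, which gives the positive lower
    bound on the derivative. *)
Lemma in_G_relab (f : RR -> RR) : in_G f -> exists h, relab f (wderiv f) h.
Proof.
move=> [h [fK [hK [cf [ch [[bf [df' [ddf bdf]]] [[bh [dh' [ddh bdh]]] L2f]]]]]]].
exists h.
have dfid : wder (fun x => f x - x) df' by [].
have dhid : wder (fun x => h x - x) dh' by [].
have dft : wder f (fun x => df' x + 1).
  have := wderD dfid (@wder_id RR); rewrite (_ : (fun x => f x - x + x) = f)//.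
  by apply/funext => x; rewrite subrK.
have dht : wder h (fun x => dh' x + 1).
  have := wderD dhid (@wder_id RR); rewrite (_ : (fun x => h x - x + x) = h)//.
  by apply/funext => x; rewrite subrK.
have dw : wder f (wderiv f) := wderivP dft.
have [B hB] := in_Linf_bound bf.
have {}hB : forall x, `|f x - x| <= B.
  by apply: ae_le_everywhere hB => x; apply: cvgB; [exact: cf|exact: cvg_id].
have fh := bounded_inj_increasing cf (can_inj fK) hB.
have chf : chart f (wderiv f) h by split.
have [C hC] := in_Linf_bound bdf; have [L hL] := in_Linf_bound bdh.
have L0 : 0 <= L.
  apply: (@aeL_cst RR); apply: aeL_mp hL => x; apply: le_trans; exact: normr_ge0.
have L1 : 0 < L + 1 by rewrite ltr_wpDl.
split; [exact: chf| |by exists B|by case: L2f].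
exists ((L + 1)^-1), (C + 1); split; first by rewrite invr_gt0.
have low : aeL (fun x => 0 <= (L + 1) * wderiv f x - 1).
  apply: wder_nondecreasing (wder_sub (wderZ (L + 1) dw) (@wder_id RR)) => x y xy.
  have := wder_ge (wder_sub (wderZ (L + 1) (@wder_id RR)) dht) (m := 0) _ (_ : f x <= f y).
  rewrite mul0r !fK => k.
  have : 0 <= (L + 1) * f y - y - ((L + 1) * f x - x).
    apply: k; last by rewrite (chart_le chf).
    by apply: aeL_mp hL => z /ler_normlP[h1 h2]; lra.
  by lra.
apply: aeL_mp2 low (aeL_and (wderiv_ae dft) hC) => x l [e /ler_normlP[h1 h2]].
rewrite e in l *; apply/andP; split; last by rewrite lerD2r.
by rewrite -div1r ler_pdivrMr// mulrC -subr_ge0.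
Qed.

Lemma in_Linf_of (f : RR -> RR) (C : RR) : rmeas f -> aeL (fun x => `|f x| <= C) -> in_Linf f.
Proof.
move=> mf fC; split; first exact: mf.
have /LooN_le h := fC; exact: (le_lt_trans h (ltry C)).
Qed.

Lemma relab_W1inf (f df h : RR -> RR) : relab f df h -> in_W1inf (fun x => f x - x).
Proof.
move=> [[_ _ _ fd] [m [N [m0 hm]]] [B hB] _].
have dd : wder (fun x => f x - x) (fun x => df x - 1) by apply: wder_sub fd (@wder_id RR).
split.
  apply: (in_Linf_of (C := B)); last exact: aeLT.
  exact: rmeas_cont (wder_continuous dd).
exists (fun x => df x - 1); split; first exact: dd.
apply: (in_Linf_of (C := `|N| + 1)); first exact: wder_meas dd.
apply: aeL_mp hm => x /andP[h1 h2]; rewrite ler_norml; have := ler_norm N.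
by move=> h3; apply/andP; split; lra.
Qed.

Lemma relab_in_G (f df h : RR -> RR) : relab f df h -> in_G f.
Proof.
move=> rf; have [[fK hK _ fd] _ _ L2f] := rf; have [[_ _ _ hd] _ _ _] := relab_inv rf.
exists h; split; first exact: fK.
split; first exact: hK.
split; first exact: wder_continuous fd.
split; first exact: wder_continuous hd.
split; first exact: relab_W1inf rf.
split; first exact: relab_W1inf (relab_inv rf).
have dw : wder f (wderiv f) := wderivP fd.
have m1 : rmeas (fun x => wderiv f x - 1) by apply: rmeasB; [exact: wder_meas dw|exact: rmeas_cst].
have m2 : rmeas (fun x => df x - 1) by apply: rmeasB; [exact: wder_meas fd|exact: rmeas_cst].
split; first exact: m1.
have e : LpN 2 (fun x => wderiv f x - 1) = LpN 2 (fun x => df x - 1).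
  apply: LpN_ae_eq => //; apply: aeL_mp (wderiv_ae fd) => x ->; reflexivity.
by have := L2f; rewrite -e.
Qed.


Section setting.
Variables (alpha : RR -> RR) (M : RR).
Hypothesis alphaW : in_W1inf alpha.
Hypothesis alpha_range : (forall x, 0 <= alpha x < 1) \/ (forall x, alpha x = 1).
Hypothesis M0 : 0 < M.
Local Notation a := (alpha'_norm alpha).

Lemma alpha_01 z : 0 <= alpha z <= 1.
Proof.
have [h|->] := alpha_range; last by rewrite ler01 lexx.
by have /andP[-> /ltW->] := h z.
Qed.

Lemma alpha'_norm_ge0 : 0 <= a.
Proof. by rewrite /alpha'_norm fine_ge0// LooN_ge0. Qed.

Lemma alpha_lip z z' : `|alpha z - alpha z'| <= a * `|z - z'|.
Proof.
have [_ [g [ag [_ gL]]]] := alphaW.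
have dg : wder alpha g := ag.
have dw : wder alpha (wderiv alpha) := wderivP ag.
have fin : (LooN (wderiv alpha) < +oo)%E.
  by rewrite (LooN_ae_eq (wderiv_ae dg)); exact: gL.
have le : aeL (fun x => `|wderiv alpha x| <= a).
  by apply/LooN_le; rewrite /alpha'_norm fineK// ge0_fin_numE// LooN_ge0.
wlog zz : z z' / z' <= z.
  move=> h; have [c|c] := leP z' z; first exact: h.
  by rewrite distrC [`|z - z'|]distrC; apply: h; exact: ltW.
have up := wder_ge (wder_sub (wderZ a (@wder_id RR)) dw) (m := 0) _ zz.
have lo := wder_ge (wderD (wderZ a (@wder_id RR)) dw) (m := 0) _ zz.
rewrite mul0r in up; rewrite mul0r in lo.
rewrite [`|z - z'|]ger0_norm ?subr_ge0// ler_norml; apply/andP; split.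
  have : 0 <= a * z + alpha z - (a * z' + alpha z').
    by apply: lo; apply: aeL_mp le => x /ler_normlP[h1 h2]; lra.
  by lra.
have : 0 <= a * z - alpha z - (a * z' - alpha z').
  by apply: up; apply: aeL_mp le => x /ler_normlP[h1 h2]; lra.
by lra.
Qed.

(** What the estimates use of the initial set: the chosen representatives are weak derivatives, the
    energy relation holds with [V = H], and [y + H = id] is available in integrated and in
    differentiated form. *)
Record lagrangian (X : state) : Prop := {
  lg_y : wder (st_y X) (wderiv (st_y X));
  lg_U : wder (st_U X) (wderiv (st_U X));
  lg_H : wder (st_H X) (wderiv (st_H X));
  lg_r : rmeas (st_r X);
  lg_int : (@lebesgue_measure RR).-integrable setT (EFin \o wderiv (st_H X));
  lg_HE : forall x, st_H X x = \int[leb]_(z in `]-oo, x]) wderiv (st_H X) z;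
  lg_Hinf : 0 <= \int[leb]_z wderiv (st_H X) z <= M;
  lg_Ubd : exists B, forall x, `|st_U X x| <= B;
  lg_id : forall x, st_y X x + st_H X x = x;
  lg_ae : aeL (fun x => [/\ 0 <= wderiv (st_y X) x, 0 <= wderiv (st_H X) x,
    wderiv (st_y X) x * wderiv (st_H X) x = wderiv (st_U X) x ^+ 2 + st_r X x ^+ 2 &
    wderiv (st_y X) x + wderiv (st_H X) x = 1]) }.

Lemma in_Fi0M_lagrangian X : in_Fi0M alpha M X -> lagrangian X.
Proof.
move=> [[FX VH] [[_ yH] [_ HM]]].
have [[[_ [gy [dgy _]]] [[bU [gU [dgU _]]] [[[bH [gH [dgH _]]] H0] [[mr _] _]]]]
  [_ [_ [_ [_ [_ [[c [c0 pos]] [eqn _]]]]]]]] := FX.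
have dyid : wder (fun x => st_y X x - x) gy := dgy.
have dy0 : wder (st_y X) (fun x => gy x + 1).
  have := wderD dyid (@wder_id RR); rewrite (_ : (fun x => st_y X x - x + x) = st_y X)//.
  by apply/funext => x; rewrite subrK.
have dy : wder (st_y X) (wderiv (st_y X)) := wderivP dy0.
have dU : wder (st_U X) (wderiv (st_U X)) := wderivP dgU.
have dH : wder (st_H X) (wderiv (st_H X)) := wderivP dgH.
have pos' : aeL (fun x => 0 <= wderiv (st_H X) x) by apply: aeL_mp pos => x [_ []].
have HbM : forall x, `|st_H X x| <= M.
  apply: ae_le_everywhere; first exact: wder_continuous dH.
  by apply/LooN_le; exact: HM.
have iH := wder_bounded_integrable dH pos' HbM.
have HE := antiderivative_ninfty dH iH H0.
have one : aeL (fun x => wderiv (st_y X) x + wderiv (st_H X) x = 1).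
  apply: wder_uniq (@wder_id RR); have := wderD dy dH.
  by rewrite (_ : (fun x => st_y X x + st_H X x) = (fun x => x))//; apply/funext => x; exact: yH.
have mHx := wder_meas dH.
split => //.
- apply/andP; split.
    rewrite (aeL_Rint measurableT mHx (rmeas_norm mHx)); first exact: Rintegral_ge0.
    by apply: aeL_mp pos' => x h; rewrite ger0_norm.
  have cv := cumulative_cvg_pinfty iH; rewrite -(cvg_lim _ cv)//.
  apply: limr_le; first by apply/cvg_ex; eexists; exact: cv.
  by apply: nearW => x; rewrite -HE; exact: le_trans (ler_norm _) (HbM x).
- have [B hB] := in_Linf_bound bU; exists B.
  by apply: ae_le_everywhere hB; exact: wder_continuous dU.
- apply: aeL_mp2 one (aeL_and pos eqn) => x e [[h1 [h2 _]] h3]; split => //.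
  by rewrite -h3 VH.
Qed.

Lemma V_integrandE X Y t : 0 <= t -> V_integrand alpha X Y t =
  Vi alpha (wderiv (st_y X)) (wderiv (st_U X)) (wderiv (st_H X)) (st_r X) Y t.
Proof.
move=> t0; apply/funext => x; rewrite /V_integrand /Vi /tau /brk /btime.
case: (wderiv (st_y X) x == 0) => /=; first by rewrite lee_fin.
by case: ((st_r X x == 0) && (wderiv (st_U X) x < 0)) => /=; rewrite ?lee_fin.
Qed.

Definition state_solves X := solves alpha (st_y X) (wderiv (st_y X)) (st_U X) (wderiv (st_U X))
  (wderiv (st_H X)) (st_r X).

Lemma is_flow_solves X Y U : is_flow alpha X Y U <-> state_solves X Y U.
Proof.
have e x t : \int[leb]_(s in `[0, t]) (Vflow alpha X Y x s / 2 - Vflow_inf alpha X Y s / 4) =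
  \int[leb]_(s in `[0, t]) ((\int[leb]_(z in `]-oo, x])
    Vi alpha (wderiv (st_y X)) (wderiv (st_U X)) (wderiv (st_H X)) (st_r X) Y s z) / 2 -
    (\int[leb]_z Vi alpha (wderiv (st_y X)) (wderiv (st_U X)) (wderiv (st_H X)) (st_r X) Y s z) / 4).
  apply: eq_Rintegral => s; rewrite inE /= in_itv /= => /andP[s0 _].
  by rewrite /Vflow /Vflow_inf V_integrandE.
split => [[m [eq c]]|[m [eq c]]]; split.
- by move=> t t0; have := m t t0; rewrite V_integrandE.
- split; last exact: c.
  move=> x t t0; have [e1 e2] := eq x t t0; split; first exact: e1.
  rewrite e2 e; reflexivity.
- by move=> t t0; rewrite V_integrandE//; exact: m.
- split; last exact: c.
  move=> x t t0; have [e1 e2] := eq x t t0; split; first exact: e1.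
  rewrite e2 e; reflexivity.
Qed.

Lemma flow_sol_solves X : lagrangian X -> state_solves X (flow_sol alpha X).1 (flow_sol alpha X).2.
Proof.
move=> lg; apply/is_flow_solves.
apply: (epsilon_spec (inhabits (fun _ _ => 0, fun _ _ => 0)) (fun p => is_flow alpha X p.1 p.2)).
have /andP[_ iM] := lg_Hinf lg.
have [Y [U s]] := solution_exists alpha'_norm_ge0 (ltW M0) alpha_01 alpha_lip (lg_y lg) (lg_U lg)
  (lg_r lg) (wder_meas (lg_H lg)) (lg_int lg) iM (lg_ae lg).
by exists (Y, U); apply/is_flow_solves.
Qed.

Definition flow_of X : flow RR := sol_flow alpha (wderiv (st_y X)) (wderiv (st_U X))
  (wderiv (st_H X)) (st_r X) (\int[leb]_z wderiv (st_H X) z) (flow_sol alpha X).1 (flow_sol alpha X).2.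

Section one_state.
Variable X : state.
Hypothesis lg : lagrangian X.
Local Notation F := (flow_of X).

Lemma flow_of_ok : flow_ok alpha M F.
Proof.
have /andP[i0 iM] := lg_Hinf lg.
exact: (sol_flow_ok alpha_01 (lg_y lg) (lg_U lg) (lg_r lg) (wder_meas (lg_H lg)) (lg_int lg) iM
  (lg_ae lg) erefl i0 (flow_sol_solves lg)).
Qed.

Lemma flow_of_wder_Y s : 0 <= s -> wder (fly F ^~ s) (yxT s F).
Proof.
have /andP[i0 iM] := lg_Hinf lg.
exact: (sol_wder_Y alpha_01 (lg_y lg) (lg_U lg) (lg_r lg) (wder_meas (lg_H lg)) (lg_int lg) iM
  (lg_ae lg) erefl i0 (flow_sol_solves lg)).
Qed.

Lemma flow_of_wder_U s : 0 <= s -> wder (flU F ^~ s) (slopeF F ^~ s).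
Proof.
have /andP[i0 iM] := lg_Hinf lg.
exact: (sol_wder_U alpha_01 (lg_y lg) (lg_U lg) (lg_r lg) (wder_meas (lg_H lg)) (lg_int lg) iM
  (lg_ae lg) erefl i0 (flow_sol_solves lg)).
Qed.

Lemma flow_of_phys : phys F.
Proof. by apply: aeL_mp (lg_ae lg) => x [_ _ h1 h2]; split => //=; rewrite h2. Qed.

Lemma flow_of_one : aeL (fun x => flyx F x + flHx F x = 1).
Proof. by apply: aeL_mp (lg_ae lg) => x []. Qed.

Lemma flow_of_y0 x : fly F x 0 = st_y X x.
Proof.
have [_ [/(_ x 0 (lexx 0))[e _] _]] := flow_sol_solves lg.
by rewrite /= e set_itv1 Rintegral_set1 addr0.
Qed.

Lemma flow_of_U0 x : flU F x 0 = st_U X x.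
Proof.
have [_ [/(_ x 0 (lexx 0))[_ e] _]] := flow_sol_solves lg.
by rewrite /= e set_itv1 Rintegral_set1 addr0.
Qed.

Definition V_xi T x : RR := flHx F x - (if flD F x && (fltau F x <= T) then flK F x else 0).

Lemma flow_of_wder_V T : 0 <= T -> wder (st_V (S_t alpha T X)) (V_xi T).
Proof.
move=> T0; have ok := flow_of_ok.
have iV := sol_Vi_integrable alpha_01 (lg_int lg) (flow_sol_solves lg) T0.
have := wder_cumulative iV.
rewrite (_ : (fun x => _) = st_V (S_t alpha T X)); last first.
  by apply/funext => x; rewrite /= /Vflow V_integrandE.
move/wder_ae; apply.
  have [_ _ mH _ mK] := ok_meas ok.
  apply: rmeasB => //; apply: rmeas_if; [|exact: mK|exact: rmeas_cst].
  apply: measurable_and; first exact: ok_measD ok.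
  by apply: measurable_fun_ler; [exact: ok_meastau ok|exact: rmeas_cst].
apply: aeLT => x; rewrite Vi_K /V_xi /=; congr (_ - _).
rewrite (tp_le _ _ _ _ _ T0); case: (brk _ _ _ x); rewrite ?if_same//=.
Qed.

End one_state.

(* [Z] is, up to a null set in its fourth component, [act (S_t alpha T X) phi]. *)
Record rep (X : state) (T : RR) (phi dphi : RR -> RR) (Z : state) : Prop := Rep {
  rep_y : st_y Z = (fun x => fly (flow_of X) (phi x) T);
  rep_U : st_U Z = (fun x => flU (flow_of X) (phi x) T);
  rep_H : st_H Z = (fun x => st_H X (phi x));
  rep_r : aeL (fun x => st_r Z x = st_r X (phi x) * dphi x);
  rep_rm : rmeas (st_r Z);
  rep_V : st_V Z = (fun x => st_V (S_t alpha T X) (phi x)) }.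

Lemma rep_S X T : lagrangian X -> rep X T (fun x => x) (fun=> 1) (S_t alpha T X).
Proof.
move=> lg; split; try reflexivity; last exact: lg_r lg.
by apply: aeLT => x; rewrite mulr1.
Qed.

Lemma rep_act X T phi dphi Z f : in_G f -> rmeas dphi -> rep X T phi dphi Z ->
  rep X T (fun x => phi (f x)) (fun x => dphi (f x) * wderiv f x) (act Z f).
Proof.
move=> /in_G_relab[h rf] md [ey eU eH er mr eV]; have d0 := relab_gt0 rf; have [cf _ _ _] := rf.
split => /=.
- by apply/funext => x; rewrite /= ey.
- by apply/funext => x; rewrite /= eU.
- by apply/funext => x; rewrite /= eH.
- by apply: aeL_mp (chart_ae (chart_inv cf d0) er) => x ->; rewrite mulrA.
- apply: rmeasM; first exact: rmeas_comp mr (chart_meas cf).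
  by have [_ _ _ /wder_meas] := cf.
- by apply/funext => x; rewrite /= eV.
Qed.

Section represented.
Variables (X : state) (T : RR) (phi dphi h : RR -> RR) (Z : state).
Hypotheses (lg : lagrangian X) (T0 : 0 <= T) (rp : relab phi dphi h) (rZ : rep X T phi dphi Z).
Local Notation G := (flow_comp (flow_of X) phi dphi).

Let cphi : chart phi dphi h. Proof. by case: rp. Qed.
Let d0 : aeL (fun x => 0 < dphi x). Proof. exact: relab_gt0 rp. Qed.

Lemma rep_ok : flow_ok alpha M G.
Proof. exact: flow_comp_ok cphi d0 (flow_of_ok lg). Qed.

Lemma rep_wders : [/\ wder (st_y Z) (yxT T G), wder (st_U Z) (slopeF G ^~ T),
  wder (st_H Z) (flHx G) & wder (st_V Z) (fun x => V_xi X T (phi x) * dphi x)].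
Proof.
have [ey eU eH _ _ eV] := rZ; rewrite ey eU eH eV; split.
- have := wder_comp cphi (flow_of_wder_Y lg T0).
  rewrite (_ : (fun x => yxT T (flow_of X) (phi x) * dphi x) = yxT T G)//.
  by apply/funext => x; rewrite (yxT_comp T0 cphi d0 _ (flow_of_ok lg)).
- have := wder_comp cphi (flow_of_wder_U lg T0).
  rewrite (_ : (fun x => slopeF (flow_of X) (phi x) T * dphi x) = (slopeF G ^~ T))//.
  by apply/funext => x; rewrite slopeF_comp.
- exact: wder_comp cphi (lg_H lg).
- exact: wder_comp cphi (flow_of_wder_V lg T0).
Qed.

Lemma rep_wderiv : aeL (fun x => [/\ wderiv (st_y Z) x = yxT T G x,
  wderiv (st_U Z) x = slopeF G x T, wderiv (st_H Z) x = flHx G x,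
  wderiv (st_V Z) x = V_xi X T (phi x) * dphi x & st_r Z x = flr G x]).
Proof.
have [w1 w2 w3 w4] := rep_wders.
apply: aeL_mp2 (aeL_and (wderiv_ae w1) (wderiv_ae w2))
  (aeL_and (aeL_and (wderiv_ae w3) (wderiv_ae w4)) (rep_r rZ)) => x [e1 e2] [[e3 e4] e5].
by split.
Qed.

Lemma rep_meas : [/\ rmeas (wderiv (st_y Z)), rmeas (wderiv (st_U Z)), rmeas (wderiv (st_H Z)) &
  rmeas (wderiv (st_V Z))].
Proof.
have [w1 w2 w3 w4] := rep_wders.
split; [exact: wder_meas (wderivP w1)|exact: wder_meas (wderivP w2)|
  exact: wder_meas (wderivP w3)|exact: wder_meas (wderivP w4)].
Qed.

Lemma rep_Hinf : Hinf Z = flHinf G.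
Proof.
have ok := rep_ok; have iG := ok_int ok.
rewrite /Hinf (rep_H rZ).
have -> : (fun x => st_H X (phi x)) = (fun x => \int[leb]_(z in `]-oo, x]) flHx G z).
  apply/funext => x; rewrite (lg_HE lg).
  have iX : leb.-integrable `]-oo, phi x] (EFin \o wderiv (st_H X)).
    by apply: integrableS (lg_int lg).
  rewrite (Rint_chart cphi (measurable_itv _) (wder_meas (lg_H lg)) iX).
  have -> // : phi @^-1` `]-oo, phi x]%classic = `]-oo, x]%classic.
  by apply/seteqP; split => y /=; rewrite !in_itv/= (chart_le cphi).
rewrite -(ok_Hinf ok); apply: cvg_lim; first exact: Rhausdorff.
exact: cumulative_cvg_pinfty iG.
Qed.

Lemma rep_g : aeL (fun x => [/\ g1 alpha Z x = g1T alpha T G x, g2 alpha Z x = g2T a T G x &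
  g3 alpha Z x = g3T a T G x]).
Proof.
have ph := phys_comp cphi d0 (flow_of_phys lg).
apply: aeL_mp2 rep_wderiv (phys_g a T0 rep_ok ph) => x [e1 e2 e3 e4 e5] /= [k1 k2 k3].
rewrite /g1 /g2 /g3 /in_Omega_d e1 e2 e3 e4 e5 rep_Hinf (rep_y rZ) (rep_U rZ) -k1 -k2 -k3.
split; [|reflexivity|reflexivity].
case: ifP => _; first reflexivity.
congr (_ + _); rewrite /V_xi mulrBl; congr (_ - _) => /=.
by case: ifP => _; rewrite ?mul0r.
Qed.

Lemma rmeas_Omega : measurable_fun (T := measurableTypeR RR) setT (in_Omega_d Z).
Proof.
have [_ mU _ _] := rep_meas; apply: measurable_and.
  by apply: measurable_fun_ltr; [exact: mU|exact: rmeas_cst].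
by apply: rmeas_eq0; exact: rep_rm rZ.
Qed.

Lemma rep_yU_meas : rmeas (st_y Z) /\ rmeas (st_U Z).
Proof.
have [w1 w2 _ _] := rep_wders.
by split; [exact: rmeas_cont (wder_continuous w1)|exact: rmeas_cont (wder_continuous w2)].
Qed.

Lemma rep_g_meas : [/\ rmeas (g1 alpha Z), rmeas (g2 alpha Z) & rmeas (g3 alpha Z)].
Proof.
have [m1 m2 m3 m4] := rep_meas; have [my mU] := rep_yU_meas.
have ac := rmeas_cont (alpha_cont alpha'_norm_ge0 alpha_lip).
split; (apply: rmeas_if; first exact: rmeas_Omega).
- apply: rmeasB; first exact: rmeasD.
  by apply: rmeasM; [exact: rmeas_comp ac my|exact: m3].
- exact: rmeasD.
- exact: rmeasZ.
- exact: rmeas_cst.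
- by apply: rmeasM; [exact: rmeasZ|exact: m2].
- exact: rmeas_cst.
Qed.

End represented.

(** Every term of the distance is a norm and ignores null sets, so the chosen representatives can be
    replaced by the explicit formulas. *)
Lemma dtilde_dflow X Xb T phi dphi h psi dpsi k Z Zb : lagrangian X -> lagrangian Xb -> 0 <= T ->
  relab phi dphi h -> relab psi dpsi k -> rep X T phi dphi Z -> rep Xb T psi dpsi Zb ->
  dtilde alpha Z Zb =
  dflow alpha a T (flow_comp (flow_of X) phi dphi) (flow_comp (flow_of Xb) psi dpsi).
Proof.
move=> lg lgb T0 rp rq rZ rZb.
have ok := rep_ok lg rp; have okb := rep_ok lgb rq.
have [m1 m2 m3 m4] := rep_meas lg T0 rp rZ; have [n1 n2 n3 n4] := rep_meas lgb T0 rq rZb.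
have [my mU] := rep_yU_meas lg T0 rp rZ; have [myb mUb] := rep_yU_meas lgb T0 rq rZb.
have [g1m g2m g3m] := rep_g_meas lg T0 rp rZ; have [h1m h2m h3m] := rep_g_meas lgb T0 rq rZb.
have wd := rep_wderiv lg T0 rp rZ; have wdb := rep_wderiv lgb T0 rq rZb.
have gg := rep_g lg T0 rp rZ; have ggb := rep_g lgb T0 rq rZb.
have a0 := alpha'_norm_ge0.
have [_ _ mH _ _] := ok_meas ok; have [_ _ mHb _ _] := ok_meas okb.
have [_ mUT] := ok_measyU ok T0; have [_ mUTb] := ok_measyU okb T0.
have p2 : (0 < 2 :> RR) by rewrite ltr0n.
have p1 : (0 < 1 :> RR) by rewrite ltr01.
rewrite /dtilde /dflow.
have ey x : st_y Z x - st_y Zb x = fly (flow_of X) (phi x) T - fly (flow_of Xb) (psi x) T.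
  by rewrite (rep_y rZ) (rep_y rZb).
have eU x : st_U Z x = flU (flow_of X) (phi x) T by rewrite (rep_U rZ).
have eUb x : st_U Zb x = flU (flow_of Xb) (psi x) T by rewrite (rep_U rZb).
congr (_ + _ + _ + _ + _ + _ + _ + _)%E.
- by apply: LooN_ae_eq; apply: aeLT => x; rewrite ey; reflexivity.
- by apply: LooN_ae_eq; apply: aeLT => x; rewrite eU eUb; reflexivity.
- rewrite -[X in (X%:E * _)%E](ger0_norm a0) -[LHS](LpNZ a p2); last first.
    by apply: rmeasB; apply: rmeasM; [exact: mU|exact: m3|exact: mUb|exact: n3].
  apply: LpN_ae_eq p2 _ _ _.
  + apply: rmeasZ; apply: rmeasB; apply: rmeasM; [exact: mU|exact: m3|exact: mUb|exact: n3].
  + apply: rmeasZ; apply: rmeasB; apply: rmeasM; [exact: mUT|exact: mH|exact: mUTb|exact: mHb].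
  apply: aeL_mp2 wd wdb => x [_ _ e1 _ _] [_ _ e2 _ _]; rewrite e1 e2 eU eUb; reflexivity.
- apply: LpN_ae_eq p1 _ _ _; [by apply: rmeasB|by apply: rmeasB|].
  apply: aeL_mp2 wd wdb => x [_ _ e1 _ _] [_ _ e2 _ _]; rewrite e1 e2; reflexivity.
- apply: LpN_ae_eq p2 _ _ _.
  + have mr := rep_rm rZ; have mrb := rep_rm rZb.
    apply: (rmeas_comp (rmeas_cont (@sqrt_continuous RR))).
    apply: rmeasD; last by apply: rmeasX; apply: rmeasB; [exact: mr|exact: mrb].
    apply: rmeasD; last by apply: rmeasX; apply: rmeasB; [exact: m3|exact: n3].
    apply: rmeasD; last by apply: rmeasX; apply: rmeasB; [exact: m2|exact: n2].
    by apply: rmeasX; apply: rmeasB; [exact: m1|exact: n1].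
  + exact: (rmeas_ZT ok okb T0).
  apply: aeL_mp2 wd wdb => x [e1 e2 e3 _ e5] [f1 f2 f3 _ f5].
  rewrite /Zdiff /ZT e1 e2 e3 e5 f1 f2 f3 f5; reflexivity.
- apply: LpN_ae_eq p2 _ _ _.
  + by apply: rmeasB; [exact: g1m|exact: h1m].
  + apply: rmeasB; [exact: (rmeas_g1T a0 alpha_lip T0 ok)|exact: (rmeas_g1T a0 alpha_lip T0 okb)].
  apply: aeL_mp2 gg ggb => x [e1 _ _] [f1 _ _]; rewrite e1 f1; reflexivity.
- apply: LpN_ae_eq p2 _ _ _.
  + by apply: rmeasB; [exact: g2m|exact: h2m].
  + apply: rmeasB; [exact: (rmeas_g2T a T ok)|exact: (rmeas_g2T a T okb)].
  apply: aeL_mp2 gg ggb => x [_ e1 _] [_ f1 _]; rewrite e1 f1; reflexivity.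
- apply: LpN_ae_eq p2 _ _ _.
  + by apply: rmeasB; [exact: g3m|exact: h3m].
  + apply: rmeasB; [exact: (rmeas_g3T a T0 ok)|exact: (rmeas_g3T a T0 okb)].
  apply: aeL_mp2 gg ggb => x [_ _ e1] [_ _ f1]; rewrite e1 f1; reflexivity.
Qed.

Lemma dtilde_sym X Xb T phi dphi h psi dpsi k Z Zb : lagrangian X -> lagrangian Xb -> 0 <= T ->
  relab phi dphi h -> relab psi dpsi k -> rep X T phi dphi Z -> rep Xb T psi dpsi Zb ->
  dtilde alpha Z Zb = dtilde alpha Zb Z.
Proof.
move=> lg lgb T0 rp rq rZ rZb.
by rewrite (dtilde_dflow lg lgb T0 rp rq rZ rZb) (dtilde_dflow lgb lg T0 rq rp rZb rZ) dflowC.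
Qed.

(** The same label map can be written as different compositions, each with its own formula for the
    derivative; uniqueness of weak derivatives identifies them almost everywhere. *)
Lemma rep_change X T phi dphi psi dpsi Z : (forall x, phi x = psi x) -> wder phi dphi ->
  wder psi dpsi -> rep X T phi dphi Z -> rep X T psi dpsi Z.
Proof.
move=> /funext e; rewrite e => w1 w2 [ey eU eH er mr eV]; split; try assumption.
by apply: aeL_mp2 (wder_uniq w1 w2) er => x <- ->.
Qed.

Lemma inverse_funE (k h : RR -> RR) : cancel k h -> cancel h k -> inverse_fun k = h.
Proof.
move=> kK hK; apply/funext => x; rewrite /inverse_fun.
have e : k (epsilon (inhabits 0) (fun z => k z = x)) = x.
  by apply: (epsilon_spec (inhabits 0) (fun z => k z = x)); exists (h x); exact: hK.
by rewrite -[LHS]kK e.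
Qed.

(** The last clause, a consequence of [y + H = id] at time 0, allows the distance at time 0 to be
    computed without the relabelling in [Pi]. *)
Lemma Pi_rep X t : lagrangian X -> 0 <= t -> exists k dk h, [/\ relab k dk h,
  aeL (fun x => (dk (h x))^-1 <= (1 + t / 2) ^+ 2),
  rep X t h (fun x => (dk (h x))^-1) (Pi (S_t alpha t X)) & (t = 0 -> forall x, h x = x)].
Proof.
move=> lg t0; have [B hB] := lg_Ubd lg.
have e0 x : fly (flow_of X) x 0 + st_H X x = x by rewrite (flow_of_y0 lg) (lg_id lg).
have B0 x : `|flU (flow_of X) x 0| <= B by rewrite (flow_of_U0 lg).
have [h [rk le]] := energy_relab alpha'_norm_ge0 (ltW M0) t0 alpha_lip (flow_of_ok lg)
  (flow_of_one lg) (flow_of_wder_Y lg t0) (lg_H lg) e0 B0.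
eexists; eexists; exists h; split; [exact: rk|exact: le| |].
- have [[kK hK _ _] _ _ _] := rk; have ri := relab_inv rk.
  rewrite /Pi (_ : inverse_fun _ = h); last exact: inverse_funE.
  have := rep_act (relab_in_G ri) (rmeas_cst 1) (rep_S t lg).
  have [[_ _ _ wh] _ _ _] := ri; apply: rep_change => //.
  rewrite (_ : (fun x => 1 * wderiv h x) = wderiv h); first exact: wderivP wh.
  by apply/funext => x; rewrite mul1r.
- move=> tz x; have [[kK hK _ _] _ _ _] := rk.
  by rewrite -[RHS]hK tz e0.
Qed.

Lemma flow_comp_id (F : flow RR) : flow_comp F (fun x => x) (fun=> 1) = F.
Proof.
have e (f : RR -> RR) : (fun x => f x * 1) = f by apply/funext => x; rewrite mulr1.
by case: F => ? ? ? ? ? ? ? ? ? ?; rewrite /flow_comp /= !e.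
Qed.

Lemma relab_id : relab (fun x : RR => x) (fun=> 1) (fun x => x).
Proof.
split.
- by split; [move=> x|move=> x|move=> x y|exact: wder_id].
- by exists 1, 1; split; [exact: ltr01|apply: aeLT => x; rewrite lexx].
- by exists 0 => x; rewrite subrr normr0.
have p12 : (1 : RR) <= 2 by rewrite ler1n.
have /(_ (aeLT _)) le := @LpN_wsum RR 2 (fun _ => 1 - 1) [::] p12 (rmeas_cst _) I.
by apply: le_lt_trans (ltry 0); apply: le => x; rewrite subrr normr0.
Qed.

Lemma half_J X Xb (t : RR) f : lagrangian X -> lagrangian Xb -> 0 <= t -> in_G f ->
  exists2 f', in_G f' &
  (dtilde alpha (act (Pi (S_t alpha t X)) f') (Pi (S_t alpha t Xb)) <=
   ((1 + t / 2) * growth_const a M t)%R%:E *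
     dtilde alpha (act (Pi (S_t alpha 0%R X)) f) (Pi (S_t alpha 0%R Xb)))%E.
Proof.
move=> lg lgb t0 /in_G_relab[hf rf]; have inGf := relab_in_G rf.
have [k [dk [h [rk _ rX _]]]] := Pi_rep lg t0.
have [kb [dkb [hb [rkb leb rXb _]]]] := Pi_rep lgb t0.
have [k0 [dk0 [h0 [rk0 _ rX0 /(_ erefl) h0E]]]] := Pi_rep lg (lexx 0).
have [kb0 [dkb0 [hb0 [rkb0 _ rXb0 /(_ erefl) hb0E]]]] := Pi_rep lgb (lexx 0).
have rh := relab_inv rk; have rhb := relab_inv rkb.
have rh0 := relab_inv rk0; have rhb0 := relab_inv rkb0.
have rfhb := relab_comp rf rhb.
have inG' := relab_in_G (relab_comp rk rfhb).
exists (fun x => k (f (hb x))); first exact: inG'.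
have [hf' rf'] := in_G_relab inG'.
have [[kK hK _ _] _ _ _] := rk.
have [cf' _ _ _] := rf'; have [cfhb _ _ _] := rfhb; have [cf _ _ _] := rf.
have [[_ _ _ wh] _ _ _] := rh; have [[_ _ _ wh0] _ _ _] := rh0.
have [[_ _ _ whb0] _ _ _] := rhb0; have [_ _ _ wfhb] := cfhb; have [_ _ _ wf] := cf.
(* The outer [k] cancels the [h] of [Pi], so the label is [f \o hb]. Both states are thus taken in
   the common label of [X] along [f] and [Xb], and then relabelled by [hb]. *)
have r1 : rep X t (fun x => f (hb x)) (fun x => wderiv f (hb x) * (dkb (hb x))^-1)
    (act (Pi (S_t alpha t X)) (fun x => k (f (hb x)))).
  apply: (rep_change _ _ wfhb (rep_act inG' (wder_meas wh) rX)); first by move=> x; exact: kK.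
  exact: wder_comp cf' wh.
have r2 : rep X 0 f (wderiv f) (act (Pi (S_t alpha 0 X)) f).
  apply: (rep_change _ _ wf (rep_act inGf (wder_meas wh0) rX0)); first by move=> x; exact: h0E.
  exact: wder_comp cf wh0.
have r3 : rep Xb 0 (fun x => x) (fun=> 1) (Pi (S_t alpha 0 Xb)).
  exact: rep_change hb0E whb0 wder_id rXb0.
rewrite (dtilde_dflow lg lgb t0 rfhb rhb r1 rXb).
rewrite (dtilde_dflow lg lgb (lexx 0) rf relab_id r2 r3) flow_comp_id -flow_compA.
have ok : flow_ok alpha M (flow_comp (flow_of X) f (wderiv f)).
  exact: flow_comp_ok cf (relab_gt0 rf) (flow_of_ok lg).
have [chb _ _ _] := rhb.
have c1 : 1 <= 1 + t / 2 by rewrite lerDl divr_ge0.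
have le := relabel_le alpha'_norm_ge0 t0 c1 alpha_lip chb (relab_gt0 rhb) leb ok (flow_of_ok lgb).
apply: le_trans le _.
rewrite EFinM -muleA; apply: lee_wpmul2l; first by rewrite lee_fin (le_trans ler01).
(* The normalisation is supplied for [Xb], whose label is unchanged at time 0; the first flow has
   already been relabelled by [f]. *)
exact: core_flow alpha'_norm_ge0 (ltW M0) t0 alpha_01 alpha_lip ok (flow_of_ok lgb)
  (flow_of_one lgb).
Qed.

Lemma dtilde_ge0 (X Xb : state) : (0 <= dtilde alpha X Xb)%E.
Proof.
have an : (0 <= a%:E)%E by rewrite lee_fin; exact: alpha'_norm_ge0.
by rewrite /dtilde; repeat apply: adde_ge0; rewrite ?mule_ge0 ?Lnorm_ge0.
Qed.

Lemma Jdist_ge0 (X Xb : state) : (0 <= Jdist alpha X Xb)%E.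
Proof.
apply: le_ereal_inf_tmp => _ [f [g [_ [_ ->]]]].
by apply: adde_ge0; exact: dtilde_ge0.
Qed.

(** Dividing by [c > 0] turns the claim into a lower bound for the infimum of [B], which is checked
    element by element. *)
Lemma scale_ereal_inf (c : RR) (A B : set (\bar RR)) : 0 < c ->
  (forall x, B x -> exists2 y, A y & (y <= c%:E * x)%E) ->
  (ereal_inf A <= c%:E * ereal_inf B)%E.
Proof.
move=> c0 h; rewrite -lee_pdivrMl //; apply: le_ereal_inf_tmp => x /h[y Ay yx].
by rewrite lee_pdivrMl //; apply: le_trans yx; exact: ereal_inf_lbound.
Qed.

Lemma dtilde_act_sym X Xb (t : RR) g : lagrangian X -> lagrangian Xb -> 0 <= t -> in_G g ->
  dtilde alpha (Pi (S_t alpha t X)) (act (Pi (S_t alpha t Xb)) g) =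
  dtilde alpha (act (Pi (S_t alpha t Xb)) g) (Pi (S_t alpha t X)).
Proof.
move=> lg lgb t0 inGg; have [hg rg] := in_G_relab inGg.
have [k [dk [h [/relab_inv rh _ rX _]]]] := Pi_rep lg t0.
have [kb [dkb [hb [/relab_inv rhb _ rXb _]]]] := Pi_rep lgb t0.
have [[_ _ _ /wder_meas mhb] _ _ _] := rhb.
exact: dtilde_sym lg lgb t0 rh (relab_comp rhb rg) rX (rep_act inGg mhb rXb).
Qed.

Local Notation C t := (Chat alpha M t).

Lemma Chat_ge (t : RR) : 0 <= t -> 0 < (1 + t / 2) * growth_const a M t <= C t.
Proof.
move=> t0; have g0 := growth_const_gt0 alpha'_norm_ge0 (ltW M0) t0.
rewrite mulr_gt0 //=; last by rewrite ltr_pwDl // divr_ge0.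
rewrite /Chat -mulrA; apply: ler_pM; [by rewrite addr_ge0 // divr_ge0|exact: ltW g0| |].
  exact: expR_ge1Dx.
exact: lexx.
Qed.

(** By symmetry of [dtilde], the term in which [g] acts on the second state is the other term with
    the states exchanged, so both reduce to [half_J]. *)
Lemma Jdist_le X Xb (t : RR) : lagrangian X -> lagrangian Xb -> 0 <= t ->
  (Jdist alpha (Pi (S_t alpha t X)) (Pi (S_t alpha t Xb)) <=
   (C t)%:E * Jdist alpha (Pi (S_t alpha 0%R X)) (Pi (S_t alpha 0%R Xb)))%E.
Proof.
move=> lg lgb t0; have /andP[c0 cC] := Chat_ge t0.
apply: scale_ereal_inf; first exact: lt_le_trans cC.
move=> _ [f [g [inGf [inGg ->]]]].
have [f' inGf' lef] := half_J lg lgb t0 inGf.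
have [g' inGg' leg] := half_J lgb lg t0 inGg.
eexists; first by exists f', g'; split; [exact: inGf'|split; [exact: inGg'|reflexivity]].
have e1 := dtilde_act_sym lg lgb t0 inGg'.
have e2 := dtilde_act_sym lg lgb (lexx (0 : RR)) inGg.
exact: scaled_sum_le (dtilde_ge0 _ _) (dtilde_ge0 _ _) cC e1 e2 lef leg.
Qed.

Lemma chain_sum_ge0 t X s : (0 <= chain_sum alpha t X s)%E.
Proof.
elim: s X => [X|Y s IH X] /=; first exact: lexx.
by apply: adde_ge0; [exact: Jdist_ge0|exact: IH].
Qed.

Lemma chain_sum_le (t : RR) X s : 0 <= t -> in_Fi0M alpha M X ->
  (forall Z, List.In Z s -> in_Fi0M alpha M Z) ->
  (chain_sum alpha t X s <= (C t)%:E * chain_sum alpha 0%R X s)%E.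
Proof.
move=> t0; elim: s X => [X _ _|Y s IH X FX Fs] /=; first by rewrite mule0.
have FY : in_Fi0M alpha M Y by apply: Fs; left.
rewrite ge0_muleDr; [|exact: Jdist_ge0|exact: chain_sum_ge0].
apply: leeD; first exact: Jdist_le (in_Fi0M_lagrangian FX) (in_Fi0M_lagrangian FY) t0.
by apply: IH FY _ => Z sZ; apply: Fs; right.
Qed.

End setting.

Theorem theorem4p19 (alpha : RR -> RR) (M : RR) (X Xb : state) (t : RR) :
  in_W1inf alpha ->
  ((forall x, 0 <= alpha x < 1) \/ (forall x, alpha x = 1)) ->
  0 < M ->
  in_Fi0M alpha M X -> in_Fi0M alpha M Xb ->
  0 <= t ->
  (d_M alpha M t X Xb <= (Chat alpha M t)%:E * d_M alpha M 0%R X Xb)%E.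
Proof.
move=> aW ar M0 FX _ t0; have /andP[c0 cC] := Chat_ge alpha M0 t0.
apply: scale_ereal_inf; first exact: lt_le_trans cC.
move=> _ [s [Fs [lastE ->]]].
(* The chain is made of initial data, so the same chain is admissible at time 0 and at time [t]. *)
eexists; first by exists s; split; [exact: Fs|split; [exact: lastE|reflexivity]].
exact: (chain_sum_le aW ar M0 t0 FX Fs).
Qed.
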